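(* Let $X$ be a solenoid with normalized Haar measure $\mu$ and let $\Gamma$ be a countable subgroup of ${\rm Aff}(X)$. Let $p_{\rm a}: {\rm Aff}(X)\to {\rm Aut}(X)$ denote the canonical projection. The following properties are equivalent: (i) The action $\Gamma\curvearrowright (X,\mu)$ does not have the spectral gap property. (ii) The action $p_{\rm a}(\Gamma)\curvearrowright (X,\mu)$ does not have the spectral gap property. (iii) There exists a $p_{\rm a}(\Gamma)$-invariant proper subsolenoid $Y$ of $X$ such that the image of $\Gamma$ in ${\rm Aff}(X/Y)$ is an amenable group. (iv) There exists a $p_{\rm a}(\Gamma)$-invariant proper subsolenoid $Y$ of $X$ such that the image of $\Gamma$ in ${\rm Aff}(X/Y)$ is a virtually solvable group.
   Context: A solenoid is a finite-dimensional, connected, compact abelian group. A subsolenoid of a solenoid $X$ is a closed connected subgroup of $X$. ${\rm Aut}(X)$ denotes the group of continuous automorphisms of $X$, and ${\rm Aff}(X)={\rm Aut}(X)\ltimes X$ is the group of affine transformations $x\mapsto x_0\theta(x)$ with $\theta\in{\rm Aut}(X)$, $x_0\in X$; $p_{\rm a}$ sends such a map to $\theta$. Every element of ${\rm Aff}(X)$ preserves the normalized Haar measure $\mu$. If $Y$ is a $p_{\rm a}(\Gamma)$-invariant closed subgroup, $\Gamma$ acts by affine transformations on $X/Y$, giving a map $\Gamma\to{\rm Aff}(X/Y)$. A measure-preserving action of a countable group $\Gamma$ on a probability space $(X,\mu)$ has the spectral gap property if there is no sequence of unit vectors $f_n\in L^2_0(X,\mu)=\{f\in L^2(X,\mu):\int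 f\,d\mu=0\}$ with $\lim_n\|\pi_X(\gamma)f_n-f_n\|=0$ for all $\gamma\in\Gamma$, where $\pi_X$ is the Koopman representation $\pi_X(\gamma)f=f\circ\gamma^{-1}$. A group is virtually $\mathcal P$ if it has a finite index subgroup with property $\mathcal P$. *)

(* Defs.v *)
From HB Require Import structures.
From mathcomp Require Import all_boot all_order all_algebra.
From mathcomp Require Import all_classical all_reals all_analysis.
From mathcomp Require Import complex.

Set Implicit Arguments.
Unset Strict Implicit.
Unset Printing Implicit Defensive.

Import Order.TTheory GRing.Theory Num.Theory.
Import numFieldTopology.Exports numFieldNormedType.Exports.
Local Open Scope classical_set_scope.
Local Open Scope ring_scope.

Definition pointed_at0 (X : topologicalZmodType) : Type := X.
HB.instance Definition _ (X : topologicalZmodType) :=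
  Choice.on (pointed_at0 X).
HB.instance Definition _ (X : topologicalZmodType) :=
  isPointed.Build (pointed_at0 X) (0 : X).
Notation borel X := (g_sigma_algebraType (@open X : set (set (pointed_at0 X)))).

Definition is_character (R : realType) (X : topologicalZmodType)
    (chi : X -> R[i]) : Prop :=
  [/\ continuous (fun x => complex.Re (chi x) : R), continuous (fun x => complex.Im (chi x) : R),
      (forall x, `|chi x| = 1),
      (forall x y, chi (x + y) = chi x * chi y) & chi 0 = 1].

(* dim X < oo  <=>  the dual group of X has finite torsion-free rank:
   any d+1 characters are multiplicatively (Z-linearly) dependent. *)
Definition finite_dimensional (R : realType) (X : topologicalZmodType) : Prop :=
  exists d : nat, forall chi : 'I_d.+1 -> X -> R[i],
    (forall i, is_character (chi i)) ->
    exists n : 'I_d.+1 -> int, (exists i, n i != 0) /\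
      forall x, \prod_(i < d.+1) (chi i x) ^ (n i) = 1.

Definition solenoid (R : realType) (X : topologicalZmodType) : Prop :=
  [/\ hausdorff_space X, compact [set: X], connected [set: X]
    & finite_dimensional R X].

Definition is_subgroup_set (X : zmodType) (Y : set X) : Prop :=
  Y 0 /\ (forall x y, Y x -> Y y -> Y (x - y)).

Definition subsolenoid (X : topologicalZmodType) (Y : set X) : Prop :=
  [/\ is_subgroup_set Y, closed Y & connected Y].

Definition is_automorphism (X : topologicalZmodType) (theta : X -> X) : Prop :=
  [/\ (forall x y, theta (x + y) = theta x + theta y),
      continuous theta &
      exists theta' : X -> X, [/\ cancel theta theta', cancel theta' theta
                                  & continuous theta']].

Definition is_affine (X : topologicalZmodType) (g : X -> X) : Prop :=
  exists (x0 : X) (theta : X -> X),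
    is_automorphism theta /\ g = (fun x => x0 + theta x).

(* p_a(g) : x |-> g x - g 0   (the linear part of g = x0 + theta) *)
Definition p_a (X : zmodType) (g : X -> X) : X -> X := fun x => g x - g 0.

Definition is_group (T : Type) (G : set (T -> T)) : Prop :=
  [/\ G id,
      (forall a b, G a -> G b -> G (a \o b)) &
      (forall a, G a -> (exists2 a', G a' & (a \o a' = id /\ a' \o a = id)))].

Definition is_subgroup (T : Type) (G K : set (T -> T)) : Prop :=
  [/\ K `<=` G, K id,
      (forall a b, K a -> K b -> K (a \o b)) &
      (forall a a', K a -> G a' -> a \o a' = id -> K a')].

Definition commutators (T : Type) (G S : set (T -> T)) : set (T -> T) :=
  [set c | exists a b a' b', [/\ S a /\ S b, G a' /\ G b',
      a \o a' = id, b \o b' = id & c = a' \o b' \o a \o b]].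

Definition derived_subgroup (T : Type) (G S : set (T -> T)) : set (T -> T) :=
  \bigcap_(K in [set K | is_subgroup G K /\ commutators G S `<=` K]) K.

Fixpoint derived_series (T : Type) (G H : set (T -> T)) (n : nat)
    : set (T -> T) :=
  match n with
  | 0 => H
  | n'.+1 => derived_subgroup G (derived_series G H n')
  end.

(* The image of Gamma in Aff(X/Y): it is (isomorphic to) Gamma / N,    *)
(* where N is the kernel of the induced action on X/Y.                 *)
Definition kernel_on_quotient (X : zmodType) (Gamma : set (X -> X)) (Y : set X)
    : set (X -> X) :=
  [set g | Gamma g /\ forall x, Y (g x - x)].

(* Gamma / N is amenable (as a discrete group): there is a left-invariant
   mean on l^oo(Gamma / N), i.e. on the bounded functions on Gamma that are
   constant on the cosets g N. *)
Definition quotient_amenable (R : realType) (T : Type) (G N : set (T -> T))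
    : Prop :=
  let B := fun phi : (T -> T) -> R =>
    (exists M : R, forall g, G g -> `|phi g| <= M) /\
    (forall g e, G g -> N e -> phi (g \o e) = phi g) in
  exists m : ((T -> T) -> R) -> R,
    [/\ (forall (a : R) phi psi, B phi -> B psi ->
           m (fun g => a * phi g + psi g) = a * m phi + m psi),
        (forall phi, B phi -> (forall g, G g -> 0 <= phi g) -> 0 <= m phi),
        m (fun _ => 1) = 1 &
        (forall h phi, G h -> B phi -> m (fun g => phi (h \o g)) = m phi)].

(* Gamma / N is virtually solvable: there is a subgroup H of Gamma with
   N <= H, of finite index in Gamma, such that H / N is solvable. *)
Definition quotient_virtually_solvable (T : Type) (G N : set (T -> T)) : Prop :=
  exists H : set (T -> T),
    [/\ is_subgroup G H, N `<=` H,
        (exists F : set (T -> T), [/\ finite_set F, F `<=` G &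
           forall g, G g -> exists2 k, F k & exists2 h, H h & g = k \o h]) &
        exists n : nat, derived_series G H n `<=` N].

(* No spectral gap for the Koopman representation of G on L^2_0(X, mu)
   (complex valued functions f = u + i v are written via their real and
   imaginary parts):  there are unit vectors f_n in L^2_0 with
   || f_n o g^-1 - f_n ||_2 -> 0 for every g in G. *)
Definition no_spectral_gap (R : realType) (X : topologicalZmodType)
    (mu : {measure set (borel X) -> \bar R}) (G : set (X -> X)) : Prop :=
  exists u v : nat -> borel X -> R,
    [/\ (forall n, measurable_fun setT (u n) /\ measurable_fun setT (v n)),
        (forall n, (\int[mu]_x (((u n x) ^+ 2 + (v n x) ^+ 2)%:E) = 1)%E),
        (forall n, (\int[mu]_x ((u n x)%:E) = 0)%E /\
                   (\int[mu]_x ((v n x)%:E) = 0)%E) &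
        (forall g g', G g -> G g' -> g \o g' = id -> g' \o g = id ->
           (fun n => (\int[mu]_x
              (((u n (g' x) - u n x) ^+ 2 + (v n (g' x) - v n x) ^+ 2)%:E))%E)
             @ \oo --> 0%E)].

(* Main.v *)
(* The dual group of X is torsion-free of finite rank r, so it embeds in Q^r, and
   the linear parts of the elements of Gamma act on Q^r by matrices.  Everything
   is compared with the existence of a finitely additive probability m on Q^r,
   invariant under these matrices, with m {0} = 0.

   Each of (i), (ii), (iii) yields such a mean: almost invariant unit vectors are
   approximated by trigonometric polynomials, whose squared coefficients define
   almost invariant masses on the dual, and an ultralimit is taken (a translation
   only multiplies coefficients by numbers of modulus one, so it is invisible);
   an invariant mean on the quotient is pushed forward along an orbit of a
   character that is trivial on Y.

   A mean yields (iv).  Take a subgroup H of finite index whose matrices span as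
   small an algebra as possible, and a subspace W of minimal dimension with
   m W > 0; W is H-stable.  For every absolute value on an algebraically closed
   field containing Q, if the eigenvalues of g had different sizes, the dynamics
   of g would concentrate m near smaller subspaces; an induction along a flag
   shows that on W all eigenvalues of [H, H] have absolute value 1.  Applying this to
   the p-adic and the complex absolute values, the traces of [H, H] on W are bounded
   integers.  Hence finitely many trace functions occur, the elements with the
   trace function of 1 form a unipotent group of finite index in [H, H], and H is
   virtually solvable on W.  The finitely many translates of W are handled likewise,
   and Y is the identity component of the annihilator of their sum.

   Finally (iv) gives the other three.  A virtually solvable quotient has
   almost invariant finite sequences s, and their averages converge along an
   ultrafilter to an invariant mean.  For a character chi trivial on Y and
   B = {Re chi > 1 - 1/n} of measure small compared with 1/|s|, the square root of the sum
   over g in s of the indicator functions of g B is almost invariant and far from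
   being constant. *)
Require Import Defs.
From mathcomp Require Import spectral.
From HB Require Import structures.
From mathcomp Require Import all_boot all_order all_algebra.
From mathcomp Require Import all_classical all_reals all_analysis.
From mathcomp Require Import measurable_realfun complex all_field.
From mathcomp Require Import ring lra zify.

Set Implicit Arguments.
Unset Strict Implicit.
Unset Printing Implicit Defensive.

Import Order.TTheory GRing.Theory Num.Theory.
Import numFieldTopology.Exports numFieldNormedType.Exports.
Local Open Scope classical_set_scope.
Local Open Scope ring_scope.

(** Q^r carries no compactness, whereas the usual source of invariant subspaces is an invariant
    measure on a projective space over a local field. The substitute is [charged]: a subspace over
    any valued field counts as soon as all the cones [near] it keep a mass bounded below. One mean
    on Q^r thus serves all absolute values. The minimal span of [H] plays the part of Zariski
    connectedness: a linear condition that holds on a subgroup of finite index in [H] holds on [H],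
    even for subspaces over an extension field.

    On the analytic side [mu] is only known to be a translation invariant Borel probability; neither
    regularity nor invariance under automorphisms is given. Both gaps are closed by countability of
    the dual: finite rank leaves countably many characters, so every open set is a countable union
    of finite intersections of half-spaces cut out by characters, and trigonometric polynomials are
    dense in L2 of every finite Borel measure. For the sum of [mu] and its image this density yields
    invariance under automorphisms. That characters separate points rests on Peter-Weyl for [mu],
    obtained from compact convolution operators. *)

Section UltraLimit.
Variables (R : realType) (T : Type) (U : set_system T).
Hypothesis UU : UltraFilter U.

Let PU : ProperFilter U. Proof. exact: ultra_proper. Qed.

Definition bounded_family (u : T -> R) : Prop := exists M, forall n, `|u n| <= M.

Definition ulim (u : T -> R) : R :=
  xget 0 [set l | forall e, 0 < e -> U [set n | `|u n - l| < e]].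

(** The values stay in the compact [[- M, M]], so the image filter clusters at some [p]. An
    ultrafilter contains the set where [u n] is [e]-close to [p] or its complement, and the
    complement contradicts clustering. *)
Lemma ulimP u : bounded_family u ->
  forall e, 0 < e -> U [set n | `|u n - ulim u| < e].
Proof.
move=> [M hM].
have PF : ProperFilter (u @ U) by exact: fmap_proper_filter.
have FM : (u @ U) (`[- M, M]%classic : set R).
  by apply: (@filterS _ U _ setT) => [n _|]; [rewrite /= in_itv/= -ler_norml|exact: filterT].
have [p [_ hp]] := @segment_compact R (- M) M (u @ U) PF FM.
apply: (@xgetPex _ 0 [set l | forall e, 0 < e -> U [set n | `|u n - l| < e]]).
exists p => e e0.
have [//|hc] := in_ultra_setVsetC [set n | `|u n - p| < e] UU.
have hb : nbhs p (ball p e) by exact: nbhsx_ballx.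
have hc' : U (u @^-1` (~` ball p e)).
  by apply: filterS hc => n h1 h2; apply: h1; rewrite /= distrC; exact: h2.
by have [z [z1 z2]] := hp (~` ball p e) _ hc' hb.
Qed.

Lemma ulim_unique u l :
  (forall e, 0 < e -> U [set n | `|u n - l| < e]) -> ulim u = l.
Proof.
move=> hl; have h : forall e, 0 < e -> U [set n | `|u n - ulim u| < e].
  apply: (@xgetPex _ 0 [set l | forall e, 0 < e -> U [set n | `|u n - l| < e]]).
  by exists l.
apply/eqP; rewrite -subr_eq0 -normr_eq0 eq_le normr_ge0 andbT.
apply/ler_addgt0Pl => e e0; rewrite addr0.
have e2 : 0 < e / 2 by rewrite divr_gt0.
have [n [/= h1 h2]] := filter_ex (filterI (h _ e2) (hl _ e2)).
have -> : ulim u - l = (u n - l) - (u n - ulim u) by ring.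
rewrite (le_trans (ler_normB _ _))// ltW//.
by rewrite [X in _ < X](splitr e) ltrD.
Qed.

Lemma ulim_cst c : ulim (fun=> c) = c.
Proof.
apply: ulim_unique => e e0; apply: filterS filterT => n _ /=.
by rewrite subrr normr0.
Qed.

Lemma ulimD u v : bounded_family u -> bounded_family v ->
  ulim (fun n => u n + v n) = ulim u + ulim v.
Proof.
move=> hu hv; apply: ulim_unique => e e0.
have e2 : 0 < e / 2 by rewrite divr_gt0.
apply: filterS (filterI (ulimP hu e2) (ulimP hv e2)) => n [/= h1 h2].
have -> : u n + v n - (ulim u + ulim v) = (u n - ulim u) + (v n - ulim v) by ring.
rewrite (le_lt_trans (ler_normD _ _))//.
by rewrite [X in _ < X](splitr e) ltrD.
Qed.

Lemma ulimZ c u : bounded_family u -> ulim (fun n => c * u n) = c * ulim u.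
Proof.
move=> hu; apply: ulim_unique => e e0.
have e2 : 0 < e / (1 + `|c|) by rewrite divr_gt0// ltr_pwDl.
apply: filterS (ulimP hu e2) => n /=.
rewrite ltr_pdivlMr ?ltr_pwDl// => h; rewrite -mulrBr normrM.
apply: le_lt_trans h; rewrite mulrC ler_wpM2l// lerDr//.
Qed.

Lemma ulim_le u v : bounded_family u -> bounded_family v ->
  U [set n | u n <= v n] -> ulim u <= ulim v.
Proof.
move=> hu hv huv; apply/ler_addgt0Pl => e e0.
have e2 : 0 < e / 2 by rewrite divr_gt0.
have [n [[/= h1 h2] h3]] := filter_ex (filterI (filterI (ulimP hu e2) (ulimP hv e2)) huv).
move: h1 h2; rewrite !ltr_norml => /andP[h1 h1'] /andP[h2 h2']; lra.
Qed.

Lemma ulim_ge0 u : bounded_family u -> (forall n, 0 <= u n) -> 0 <= ulim u.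
Proof.
move=> hu h; rewrite -(ulim_cst 0); apply: ulim_le => //.
  by exists 0 => n; rewrite normr0.
by apply: filterS filterT => n _ /=.
Qed.

End UltraLimit.

Lemma nat_ultrafilter : exists2 U : set_system nat, UltraFilter U & \oo `<=` U.
Proof.
have [U [UU hU]] := @ultraFilterLemma nat \oo _.
by exists U.
Qed.

(** * Finitely additive means and linear groups *)

Section Mean.
Variable R : realType.

Definition is_mean (T : Type) (m : set T -> R) : Prop :=
  [/\ forall A, 0 <= m A, m setT = 1 &
      forall A B, A `&` B = set0 -> m (A `|` B) = m A + m B].

Section MeanTheory.
Variables (T : Type) (m : set T -> R).
Hypothesis hm : is_mean m.

Lemma mean_ge0 A : 0 <= m A. Proof. by case: hm. Qed.

Lemma mean_set0 : m set0 = 0.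
Proof.
case: hm => _ _ /(_ set0 set0); rewrite setI0 setU0 => /(_ erefl) H.
by apply/eqP; rewrite -(inj_eq (addrI (m set0))) addr0 -H.
Qed.

Lemma meanDI A B : m A = m (A `&` B) + m (A `\` B).
Proof.
case: hm => _ _ <-; first by rewrite setUIDK.
by apply/seteqP; split=> x /=; tauto.
Qed.

Lemma mean_le A B : A `<=` B -> m A <= m B.
Proof.
by move=> AB; rewrite (meanDI B A) (setIidr AB) lerDl mean_ge0.
Qed.

Lemma mean_leU A B : m (A `|` B) <= m A + m B.
Proof.
rewrite (meanDI (A `|` B) A); apply: lerD; apply: mean_le => x; first by case.
by move=> [[]].
Qed.

Lemma mean_UI A B : m A + m B = m (A `|` B) + m (A `&` B).
Proof.
rewrite (meanDI (A `|` B) A) (meanDI B A).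
have -> : (A `|` B) `&` A = A by apply/seteqP; split=> x /=; tauto.
have -> : (A `|` B) `\` A = B `\` A by apply/seteqP; split=> x /=; tauto.
rewrite (setIC B A); lra.
Qed.

Lemma mean_le1 A : m A <= 1.
Proof. by case: (hm) => _ <- _; apply: mean_le. Qed.

Lemma mean_pushforward (U : Type) (f : T -> U) : is_mean (fun E => m (f @^-1` E)).
Proof.
case: hm => h0 h1 h2; split=> // A B AB.
by rewrite preimage_setU h2// -preimage_setI AB preimage_set0.
Qed.

Lemma mean_bigU_seq (I : Type) (s : seq I) (A : I -> set T) :
  m (\big[setU/set0]_(i <- s) A i) <= \sum_(i <- s) m (A i).
Proof.
elim: s => [|i s IH]; first by rewrite !big_nil mean_set0.
by rewrite !big_cons (le_trans (mean_leU _ _))// lerD2l.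
Qed.

(** Second order inclusion-exclusion, with [n * n] as a crude count of the pairs. It bounds the
    number of translates of a subspace whose pairwise intersections are light, and so turns
    minimality of a subspace into finiteness of its orbit. *)
Lemma mean_overlap (n : nat) (A : nat -> set T) (c d : R) :
  0 <= d -> (forall i, (i < n)%N -> c <= m (A i)) ->
  (forall i j, (i < j < n)%N -> m (A i `&` A j) <= d) ->
  n%:R * c <= 1 + (n * n)%:R * d.
Proof.
move=> d0 hA hAA.
suff H k : (k <= n)%N ->
    k%:R * c <= m (\big[setU/set0]_(i < k) A i) + (k * k)%:R * d.
  by apply: (le_trans (H _ (leqnn n))); rewrite lerD2r mean_le1.
elim: k => [|k IH] kn; first by rewrite !mul0r addr0 mean_ge0.
rewrite big_ord_recr /=; set U := (\big[_/_]_(_ < _) _).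
have := mean_UI U (A k); have := IH (ltnW kn); have := hA _ kn.
have UA : m (U `&` A k) <= k%:R * d.
  rewrite /U setIC big_distrr /=.
  rewrite -(big_mkord xpredT (fun i => A k `&` A i)).
  apply: (le_trans (mean_bigU_seq _ _)).
  rewrite mulr_natl -[k in leRHS]subn0 -sumr_const_nat.
  rewrite big_nat [leRHS]big_nat ler_sum// => i /andP[_ ik]; rewrite setIC hAA//.
  by rewrite ik.
move: UA; rewrite -/U.
have -> : (k.+1 * k.+1)%:R = (k * k)%:R + k%:R + k.+1%:R :> R.
  by rewrite -!natrD; congr (_%:R); rewrite mulnS mulSn addnAC addnA; lia.
rewrite -[k.+1]addn1 natrD => h1 h2 h3 h4.
have h5 : 0 <= k%:R * d by rewrite mulr_ge0.
by rewrite !mulrDl !mul1r; lra.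
Qed.

Lemma mean_disjoint_eq0 (A : nat -> set T) (c : R) :
  (forall i, c <= m (A i)) -> (forall i j, (i < j)%N -> A i `&` A j = set0) ->
  c <= 0.
Proof.
move=> hc hd; rewrite leNgt; apply/negP => c0.
have [n hn] : exists n : nat, 1 < n%:R * c.
  exists (Num.truncn c^-1).+1; rewrite -ltr_pdivrMr// mul1r.
  exact: truncnS_gt.
have hA i j : (i < j < n)%N -> m (A i `&` A j) <= 0.
  by move=> /andP[ij _]; rewrite hd// mean_set0.
have := @mean_overlap n A c 0 (lexx _) (fun i _ => hc i) hA.
by rewrite mulr0 addr0 leNgt hn.
Qed.

End MeanTheory.
End Mean.

(** * Absolute values on a field and the growth of matrix powers *)

Section AbsVal.
Variables (R : realType) (K : fieldType).

Definition is_absval (a : K -> R) : Prop :=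
  [/\ forall x, 0 <= a x, forall x, (a x == 0) = (x == 0),
      forall x y, a (x * y) = a x * a y &
      forall x y, a (x + y) <= a x + a y].

Variable a : K -> R.
Hypothesis ha : is_absval a.

Lemma absval_ge0 x : 0 <= a x. Proof. by case: ha. Qed.
Lemma absval_eq0 x : (a x == 0) = (x == 0). Proof. by case: ha. Qed.
Lemma absvalM x y : a (x * y) = a x * a y. Proof. by case: ha. Qed.
Lemma absvalD x y : a (x + y) <= a x + a y. Proof. by case: ha. Qed.
Lemma absval0 : a 0 = 0. Proof. by apply/eqP; rewrite absval_eq0. Qed.

Lemma absval1 : a 1 = 1.
Proof.
have h : a 1 != 0 by rewrite absval_eq0 oner_eq0.
by apply: (mulfI h); rewrite -absvalM !mulr1.
Qed.

Lemma absvalV x : a x^-1 = (a x)^-1.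
Proof.
have [->|x0] := eqVneq x 0; first by rewrite !invr0 absval0 invr0.
have ax : a x != 0 by rewrite absval_eq0.
by apply: (mulfI ax); rewrite -absvalM !mulfV// absval1.
Qed.

Lemma absval_sum (I : Type) (s : seq I) (F : I -> K) :
  a (\sum_(i <- s) F i) <= \sum_(i <- s) a (F i).
Proof.
elim: s => [|i s IH]; first by rewrite !big_nil absval0.
by rewrite !big_cons (le_trans (absvalD _ _))// lerD2l.
Qed.

Lemma absval_prod (I : Type) (s : seq I) (F : I -> K) :
  a (\prod_(i <- s) F i) = \prod_(i <- s) a (F i).
Proof. by apply: (big_morph a absvalM absval1). Qed.

(** The entrywise l1 norm: submultiplicative for every absolute value, and additive on [row_mx],
    which suits intersections of kernels. *)
Definition absmx m n (A : 'M[K]_(m, n)) : R := \sum_i \sum_j a (A i j).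

Lemma absmx_ge0 m n (A : 'M[K]_(m, n)) : 0 <= absmx A.
Proof. by do 2 (apply: sumr_ge0 => ? _); exact: absval_ge0. Qed.

Lemma absmx_eq0 m n (A : 'M[K]_(m, n)) : (absmx A == 0) = (A == 0).
Proof.
apply/eqP/eqP => [/eqP|->]; last first.
  by do 2 (apply: big1 => ? _); rewrite mxE absval0.
rewrite psumr_eq0; last by move=> i _; apply: sumr_ge0 => ? _; exact: absval_ge0.
move/allP => h; apply/matrixP => i j; rewrite mxE.
have := h i (mem_index_enum _); rewrite /= psumr_eq0; last by move=> ? _; exact: absval_ge0.
by move/allP/(_ j (mem_index_enum _)) => /=; rewrite absval_eq0 => /eqP.
Qed.

Lemma absmx0 m n : absmx (0 : 'M[K]_(m, n)) = 0.
Proof. by apply/eqP; rewrite absmx_eq0. Qed.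

Lemma absmxD m n (A B : 'M[K]_(m, n)) : absmx (A + B) <= absmx A + absmx B.
Proof.
rewrite /absmx -big_split /=; apply: ler_sum => i _.
by rewrite -big_split /=; apply: ler_sum => j _; rewrite mxE absvalD.
Qed.

Lemma absmxZ m n c (A : 'M[K]_(m, n)) : absmx (c *: A) = a c * absmx A.
Proof.
rewrite /absmx mulr_sumr; apply: eq_bigr => i _.
by rewrite mulr_sumr; apply: eq_bigr => j _; rewrite mxE absvalM.
Qed.

Lemma absmxM m n p (A : 'M[K]_(m, n)) (B : 'M[K]_(n, p)) :
  absmx (A *m B) <= absmx A * absmx B.
Proof.
rewrite /absmx mulr_suml; apply: ler_sum => i _.
rewrite mulr_suml.
have -> : \sum_j a (A i j) * (\sum_i0 \sum_j0 a (B i0 j0)) =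
          \sum_j0 \sum_j a (A i j) * \sum_i0 a (B i0 j0).
  rewrite [RHS]exchange_big /=; apply: eq_bigr => j _; rewrite -mulr_sumr.
  by congr (_ * _); rewrite exchange_big.
apply: ler_sum => k _; rewrite mxE (le_trans (absval_sum _ _))//.
apply: ler_sum => j _; rewrite absvalM ler_wpM2l ?absval_ge0//.
by rewrite (bigD1 j)//= lerDl sumr_ge0// => ? _; exact: absval_ge0.
Qed.

Lemma absmx_row_mx m n p (A : 'M[K]_(m, n)) (B : 'M[K]_(m, p)) :
  absmx (row_mx A B) = absmx A + absmx B.
Proof.
rewrite /absmx -big_split /=; apply: eq_bigr => i _.
rewrite big_split_ord /=; congr (_ + _); apply: eq_bigr => j _.
  by rewrite row_mxEl.
by rewrite row_mxEr.
Qed.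

(* Spectral growth: a factor killed by prod (A - l) with all |l| <= s grows at most like t ^ n for s < t. *)
Lemma absmx_growth q (A : 'M[K]_q.+1) (ls : seq K) (s t : R) :
  0 <= s -> s < t -> (forall l, l \in ls -> a l <= s) ->
  exists2 C : R, 0 < C &
    forall p (M : 'M[K]_(p, q.+1)), M *m \prod_(l <- ls) (A - l%:M) = 0 ->
      forall n, absmx (M *m A ^+ n) <= C * t ^+ n * absmx M.
Proof.
move=> s0 st; elim: ls => [|l ls IH] hls.
  exists 1 => // p M; rewrite big_nil mulmx1 => -> n.
  by rewrite mul0mx !absmx0 mulr0.
have [C1 C10 hC1] : exists2 C : R, 0 < C &
    forall p (M : 'M[K]_(p, q.+1)), M *m \prod_(l <- ls) (A - l%:M) = 0 ->
      forall n, absmx (M *m A ^+ n) <= C * t ^+ n * absmx M.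
  by apply: IH => x xs; apply: hls; rewrite inE xs orbT.
have t0 : 0 < t by exact: le_lt_trans st.
(* [D] closes the recursion x(n+1) <= s x(n) + D (t - s) t^n: from x(n) <= (1 + D) t^n the next term
   is at most (s (1 + D) + D (t - s)) t^n, which is below (1 + D) t^(n+1). *)
set D := C1 * absmx (A - l%:M) / (t - s).
have D0 : 0 <= D.
  by rewrite /D !mulr_ge0 ?invr_ge0 ?subr_ge0 ?absmx_ge0// ltW.
exists (1 + D); first by rewrite ltr_pwDl.
move=> p M; rewrite big_cons -[_ * _]/(_ *m _) mulmxA => hM.
elim=> [|n IHn].
  by rewrite expr0 mulmx1 expr0 mulr1 ler_peMl ?absmx_ge0// lerDl.
have -> : M *m A ^+ n.+1 = l *: (M *m A ^+ n) + (M *m (A - l%:M)) *m A ^+ n.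
  rewrite mulmxBr mul_mx_scalar mulmxBl -scalemxAl addrC subrK exprS.
  by rewrite -mulmxA.
have := hC1 _ _ hM n => h1.
have h2 := absmxM M (A - l%:M).
have al : a l <= s by apply: hls; rewrite inE eqxx.
apply: (le_trans (absmxD _ _)); rewrite absmxZ.
have tn : 0 <= t ^+ n by rewrite exprn_ge0// ltW.
have M0 := absmx_ge0 M.
have h3 : absmx (M *m (A - l%:M) *m A ^+ n) <= D * (t - s) * (t ^+ n * absmx M).
  rewrite (le_trans h1)// /D mulfVK ?subr_eq0 ?gt_eqF// -!mulrA ler_wpM2l ?(ltW C10)//.
  rewrite [leRHS]mulrCA; apply: ler_wpM2l => //; apply: (le_trans h2).
  by rewrite mulrC.
have h4 : a l * absmx (M *m A ^+ n) <= s * ((1 + D) * t ^+ n * absmx M).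
  by rewrite ler_pM ?absval_ge0 ?absmx_ge0.
apply: (le_trans (lerD h4 h3)); clearbody D.
rewrite exprS -!mulrA; set u := t ^+ n * absmx M.
have u0 : 0 <= u by rewrite mulr_ge0.
rewrite -subr_ge0 (_ : _ - _ = (t - s) * u); last by ring.
by rewrite mulr_ge0// subr_ge0 ltW.
Qed.

End AbsVal.

Lemma exprn_ge_linear (R : realDomainType) (x : R) n :
  1 <= x -> 1 + n%:R * (x - 1) <= x ^+ n.
Proof.
move=> x1; elim: n => [|n IH]; first by rewrite mul0r addr0 expr0.
rewrite exprS -[n.+1]addn1 natrD.
have n0 : 0 <= n%:R :> R by [].
have h : x * (1 + n%:R * (x - 1)) <= x * x ^+ n.
  by rewrite ler_wpM2l// (le_trans ler01).
have h2 : 0 <= n%:R * ((x - 1) * (x - 1)).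
  by rewrite mulr_ge0// -expr2 sqr_ge0.
by lra.
Qed.

Lemma exprn_unbounded (R : realType) (x M : R) :
  1 < x -> exists n0 : nat, forall n, (n0 <= n)%N -> M < x ^+ n.
Proof.
move=> x1; exists (Num.truncn (`|M| / (x - 1))).+1 => n hn.
have h := @exprn_ge_linear R x n (ltW x1).
have h1 : `|M| / (x - 1) < n%:R.
  by apply: (lt_le_trans (truncnS_gt _)); rewrite ler_nat.
rewrite ltr_pdivrMr ?subr_gt0// in h1.
by have := ler_norm M; lra.
Qed.

(** * Splitting a matrix by the size of its eigenvalues *)

Section Split.
Variables (R : realType) (K : closedFieldType) (a : K -> R).
Hypothesis ha : is_absval a.
Variables (q : nat) (A : 'M[K]_q.+1).

Lemma horner_mx_prod (ls : seq K) (B : 'M[K]_q.+1) :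
  horner_mx B (\prod_(l <- ls) ('X - l%:P)) = \prod_(l <- ls) (B - l%:M).
Proof.
rewrite rmorph_prod; apply: eq_bigr => l _.
by rewrite rmorphB /= horner_mx_X horner_mx_C.
Qed.

(** From A^-1 - l^-1 = - l^-1 (A - l) A^-1, all factors commuting with A^-1. It lets the growth
    bound be applied to the inverse, where an upper bound becomes a lower bound for the powers of
    [A]. *)
Lemma mulmx_prod_inv p (M : 'M[K]_(p, q.+1)) (ls : seq K) :
  A \in unitmx -> 0 \notin ls -> M *m \prod_(l <- ls) (A - l%:M) = 0 ->
  M *m \prod_(l <- [seq l^-1 | l <- ls]) (invmx A - l%:M) = 0.
Proof.
move=> uA; elim: ls M => [|l ls IH] M; first by rewrite !big_nil.
rewrite inE negb_or /= => /andP[l0 ls0].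
rewrite !big_cons -[_ * _]/(_ *m _) mulmxA => /(IH _ ls0) h.
rewrite -[_ * _]/(_ *m _) mulmxA.
have -> : M *m (invmx A - l^-1%:M) = - l^-1 *: ((M *m (A - l%:M)) *m invmx A).
  rewrite mulmxBr mulmxBr mulmxBl -mulmxA mulmxV// mulmx1 !mul_mx_scalar.
  rewrite -scalemxAl scalerBr scalerA mulNr mulVf 1?eq_sym//.
  by rewrite !scaleNr scale1r opprK addrC.
rewrite -scalemxAl -mulmxA.
have -> : invmx A *m \prod_(l <- [seq l^-1 | l <- ls]) (invmx A - l%:M) =
          \prod_(l <- [seq l^-1 | l <- ls]) (invmx A - l%:M) *m invmx A.
  by rewrite -horner_mx_prod; apply: comm_mx_horner.
by rewrite mulmxA h mul0mx scaler0.
Qed.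

Lemma eigen_horner (w : 'rV[K]_q.+1) l (p : {poly K}) :
  w *m A = l *: w -> w *m horner_mx A p = p.[l] *: w.
Proof.
move=> wA; elim/poly_ind: p => [|p c IH].
  by rewrite rmorph0 mulmx0 horner0 scale0r.
rewrite rmorphD rmorphM /= horner_mx_X horner_mx_C mulmxDr mul_mx_scalar.
by rewrite -[_ * _]/(_ *m _) mulmxA IH -scalemxAl wA scalerA hornerMXaddC scalerDl.
Qed.

(** A finite spectrum leaves room above [s]; the two growth rates of the splitting are placed in
    this gap. *)
Lemma list_gap (rs : seq K) (s : R) :
  exists2 t, s < t & forall z, z \in rs -> s < a z -> t <= a z.
Proof.
elim: rs => [|z rs [t st ht]]; first by exists (s + 1); rewrite ?ltrDl.
have [sz|zs] := ltP s (a z).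
  exists (Num.min t (a z)); first by rewrite lt_min st.
  move=> y; rewrite inE => /orP[/eqP -> _|/ht h /h ty]; first by rewrite ge_min lexx orbT.
  by rewrite ge_min ty.
exists t => // y; rewrite inE => /orP[/eqP ->|/ht//]; by rewrite ltNge zs.
Qed.

(** [P1] and [P2] are the spectral projections for the eigenvalues of size at most [s] and larger
    than [s]. A Bezout relation between the two factors of the characteristic polynomial makes them
    polynomials in [A], so they commute with [A]. The lower bound on the second part is the growth
    bound for the inverse of [A]. *)
Lemma spectral_split (s : R) : A \in unitmx -> 0 <= s ->
  exists P1 P2 : 'M[K]_q.+1, exists C t1 t2 : R,
  [/\ P1 + P2 = 1%:M, [/\ 0 < C, 0 < t1 & t1 < t2],
      forall p (w : 'M[K]_(p, q.+1)) n,
        absmx a (w *m A ^+ n *m P1) <= C * t1 ^+ n * absmx a (w *m P1),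
      forall p (w : 'M[K]_(p, q.+1)) n,
        absmx a (w *m P2) * t2 ^+ n <= C * absmx a (w *m A ^+ n *m P2) &
      forall (w : 'rV[K]_q.+1) l, w *m A = l *: w ->
        if a l <= s then w *m P2 = 0 else w *m P1 = 0].
Proof.
move=> uA s0.
have [rs hrs] := closed_field_poly_normal (char_poly A).
rewrite (monicP (char_poly_monic A)) scale1r in hrs.
have [t st ht] := list_gap rs s.
pose r1 := [seq z <- rs | a z <= s]; pose r2 := [seq z <- rs | ~~ (a z <= s)].
pose p1 := \prod_(z <- r1) ('X - z%:P); pose p2 := \prod_(z <- r2) ('X - z%:P).
have p12 : p1 * p2 = char_poly A.
  by rewrite hrs /p1 /p2 !big_filter [RHS](bigID (fun z => a z <= s)).
have cop : coprimep p1 p2.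
  apply: Pdiv.ClosedField.root_coprimep => x; rewrite root_prod_XsubC => xr1.
  apply/negP => /eqP/rootP; rewrite root_prod_XsubC.
  by move: xr1; rewrite !mem_filter => /andP[->].
have /Bezout_eq1_coprimepP[[u v] /= uv] := cop.
pose P1 := horner_mx A (v * p2); pose P2 := horner_mx A (u * p1).
have CH : horner_mx A (p1 * p2) = 0 by rewrite p12 Cayley_Hamilton.
have P1A n : A ^+ n *m P1 = P1 *m A ^+ n.
  by rewrite -{1 2}[A]horner_mx_X -!rmorphXn; apply: comm_horner_mx2.
have P2A n : A ^+ n *m P2 = P2 *m A ^+ n.
  by rewrite -{1 2}[A]horner_mx_X -!rmorphXn; apply: comm_horner_mx2.
(* No eigenvalue has its size strictly between [s] and [t]; rates at one third and two thirds of
   this interval leave a margin on both sides, as [absmx_growth] needs. *)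
pose t1 := s + (t - s) / 3%:R; pose t2 := s + (t - s) * 2%:R / 3%:R.
have st1 : s < t1 by rewrite /t1; lra.
have t12 : t1 < t2 by rewrite /t1 /t2; lra.
have t2t : t2 < t by rewrite /t2; lra.
have t20 : 0 < t2 by apply: le_lt_trans (lt_trans st1 t12).
have t0 : 0 < t by exact: lt_trans t2t.
have hr1 l : l \in r1 -> a l <= s by rewrite mem_filter => /andP[].
have [C1 C10 hC1] := @absmx_growth R K a ha q A r1 s t1 s0 st1 hr1.
have ti0 : 0 <= t^-1 by rewrite invr_ge0 ltW.
have r20 : 0 \notin r2 by rewrite mem_filter (absval0 ha) s0.
have ti : t^-1 < t2^-1 by rewrite ltf_pV2.
have hr2 l : l \in [seq l^-1 | l <- r2] -> a l <= t^-1.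
  case/mapP => z; rewrite mem_filter -ltNge => /andP[sz zrs] ->.
  have tz := ht _ zrs sz.
  by rewrite (absvalV ha) lef_pV2// posrE (lt_le_trans t0 tz).
have [C2 C20 hC2] := @absmx_growth R K a ha q (invmx A) _ _ _ ti0 ti hr2.
have [h1 h2] : P1 *m \prod_(l <- r1) (A - l%:M) = 0 /\ P2 *m \prod_(l <- r2) (A - l%:M) = 0.
  have hmul (f g : {poly K}) : horner_mx A f *m horner_mx A g = horner_mx A (f * g).
    by rewrite rmorphM.
  rewrite -!horner_mx_prod /P1 /P2 !hmul -/p1 -/p2.
  have h0 (f : {poly K}) : horner_mx A (f * (p1 * p2)) = 0.
    by rewrite -hmul CH mulmx0.
  by split; rewrite -mulrA ?(mulrC p2 p1) h0.
exists P1, P2, (C1 + C2), t1, t2; split => //.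
- by rewrite addrC -rmorphD uv rmorph1.
- by split=> //; [rewrite addr_gt0|exact: le_lt_trans st1].
- move=> p w n; rewrite -mulmxA P1A mulmxA.
  apply: (le_trans (hC1 _ _ _ n)); first by rewrite -mulmxA h1 mulmx0.
  rewrite ler_wpM2r ?absmx_ge0// ler_wpM2r ?lerDl ?exprn_ge0 ?(ltW C20)//.
  by rewrite ltW// (le_lt_trans s0).
- move=> p w n; rewrite -mulmxA P2A mulmxA.
  have hz : w *m P2 *m A ^+ n *m \prod_(l <- [seq l^-1 | l <- r2]) (invmx A - l%:M) = 0.
    apply: mulmx_prod_inv => //.
    by rewrite -(mulmxA w) -P2A -!mulmxA h2 !mulmx0.
  have := hC2 _ _ hz n.
  have An k : A ^+ k *m invmx A ^+ k = 1%:M.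
    rewrite -[_ *m _]/(_ * _) -exprMn_comm ?expr1n//.
      by rewrite -[A * _]/(A *m _) mulmxV// expr1n.
    by rewrite /GRing.comm -[A * _]/(A *m _) -[_ * A]/(_ *m A) mulmxV ?mulVmx.
  rewrite -(mulmxA (w *m P2)) An mulmx1 => h.
  have t2n : 0 < t2 ^+ n by rewrite exprn_gt0.
  rewrite exprVn in h; rewrite -ler_pdivlMr//; apply: (le_trans h).
  rewrite -mulrA [_^-1 * _]mulrC mulrA ler_wpM2r ?invr_ge0 ?(ltW t2n)//.
  by rewrite ler_wpM2r ?absmx_ge0// lerDr (ltW C10).
- move=> w l wA; have [->|w0] := eqVneq w 0; first by rewrite !mul0mx; case: ifP.
  have lrs : l \in rs.
    rewrite -root_prod_XsubC -hrs -eigenvalue_root_char.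
    by apply/eigenvalueP; exists w.
  case: ifPn => ls; rewrite (eigen_horner _ wA) hornerM.
    have /rootP -> : root p1 l by rewrite root_prod_XsubC mem_filter ls.
    by rewrite mulr0 scale0r.
  have /rootP -> : root p2 l by rewrite root_prod_XsubC mem_filter ls.
  by rewrite mulr0 scale0r.
Qed.

End Split.

(** * Subgroups, finite index and finiteness of orbits *)

Section Subgroups.
Variable G : groupType.
Local Open Scope group_scope.

Definition subgrp (H : set G) : Prop :=
  [/\ H 1, forall x y, H x -> H y -> H (x * y) & forall x, H x -> H x^-1].

(** Finitely many right cosets of [S] cover [H]. [S] is an arbitrary set, so that a stabiliser
    condition can be put there directly. *)
Definition finidx (H S : set G) : Prop :=
  exists s : seq G, (forall h, h \in s -> H h) /\
    forall g, H g -> exists2 h, h \in s & S (g * h^-1).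

End Subgroups.

(** A list in [H] with distinct images and of maximal length hits every value. This is how a bound
    on the number of distinct translates of a subspace becomes finite index of its stabiliser. *)
Lemma finite_range (G : eqType) (T : eqType) (H : set G) (f : G -> T) (N : nat) :
  (forall s : seq G, (forall g, g \in s -> H g) -> uniq (map f s) ->
     (size s <= N)%N) ->
  exists s : seq G, (forall h, h \in s -> H h) /\
    forall g, H g -> exists2 h, h \in s & f h = f g.
Proof.
move=> hN.
pose P n := `[< exists s : seq G, [/\ forall g, g \in s -> H g, uniq (map f s) & size s = n] >].
have P0 : exists n, P n by exists 0%N; apply/asboolP; exists [::].
have Pm n : P n -> (n <= N)%N by move/asboolP => [s [h1 h2 <-]]; apply: hN.
case: (ex_maxnP P0 Pm) => n /asboolP[s [h1 h2 h3]] hmax.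
exists s; split => // g Hg; apply: contrapT => hn.
have : (n.+1 <= n)%N; last by rewrite ltnn.
apply: hmax; apply/asboolP; exists (g :: s); split.
- by move=> h; rewrite inE => /orP[/eqP ->|/h1].
- rewrite /= h2 andbT; apply/negP => /mapP[h hs e]; apply: hn; by exists h.
- by rewrite /= h3.
Qed.

Lemma small_all (R : realType) (I : eqType) (s : seq I) (P : I -> R -> Prop) :
  (forall i, i \in s -> exists2 e, 0 < e & P i e) ->
  (forall i (e d : R), 0 < d -> d <= e -> P i e -> P i d) ->
  exists2 e, 0 < e & forall i, i \in s -> P i e.
Proof.
move=> + hmon; elim: s => [|i s IH] h; first by exists 1.
case: IH => [|e e0 he]; first by move=> j js; apply: h; rewrite inE js orbT.
have [d d0 hd] := h i (mem_head _ _).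
exists (Num.min e d); first by rewrite lt_min e0.
move=> j; rewrite inE => /orP[/eqP ->|js].
  by apply: hmon hd; rewrite ?lt_min ?e0 // ge_min lexx orbT.
by apply: hmon (he _ js); rewrite ?lt_min ?e0 // ge_min lexx.
Qed.

(** * Conical neighbourhoods of subspaces over a valued field *)

Section Near.
Variables (R : realType) (K : fieldType) (a : K -> R).
Hypothesis ha : is_absval a.

(* The vectors whose direction is [e]-close to the kernel of [P]. *)
Definition near q p (P : 'M[K]_(q, p)) (e : R) : set 'rV[K]_q :=
  [set w | absmx a (w *m P) <= e * absmx a w].

Lemma near_le q p (P : 'M[K]_(q, p)) d e : d <= e -> near P d `<=` near P e.
Proof. by move=> de w /= h; apply: (le_trans h); rewrite ler_wpM2r ?absmx_ge0. Qed.

(** The inclusion of kernels makes [P'] factor as [P *m S], so closeness to the first kernel gives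
    closeness to the second up to the norm of [S]. *)
Lemma near_ker q p p' (P : 'M[K]_(q, p)) (P' : 'M[K]_(q, p')) e :
  (kermx P <= kermx P')%MS -> 0 < e ->
  exists2 d, 0 < d & forall c, 0 < c -> c <= d -> near P c `<=` near P' e.
Proof.
move=> sub e0; pose S := pinvmx P *m P'.
have hS : P *m S = P'.
  have : (1%:M - P *m pinvmx P <= kermx P')%MS.
    apply: submx_trans sub; apply/sub_kermxP.
    by rewrite mulmxBl mul1mx mulmxKpV// subrr.
  by move/sub_kermxP; rewrite mulmxBl mul1mx => /subr0_eq ->; rewrite /S mulmxA.
have S0 : 0 < 1 + absmx a S by rewrite ltr_pwDl// absmx_ge0.
exists (e / (1 + absmx a S)); first by rewrite divr_gt0.
move=> c c0 ce w; rewrite /near /= => h.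
rewrite -hS mulmxA (le_trans (absmxM ha _ _))//.
apply: (le_trans (ler_wpM2r (absmx_ge0 ha _) h)).
rewrite mulrAC ler_wpM2r ?absmx_ge0//.
rewrite ler_pdivlMr// in ce; apply: le_trans ce.
by rewrite ler_wpM2l ?ltW// ltrDr.
Qed.

Lemma near_cap q p p' (P : 'M[K]_(q, p)) (P' : 'M[K]_(q, p')) e :
  near P e `&` near P' e `<=` near (row_mx P P') (2%:R * e).
Proof.
move=> w [/= h1 h2]; rewrite /near /= mul_mx_row absmx_row_mx.
by rewrite -mulrA mulr_natl mulr2n lerD.
Qed.

(** [m] is only finitely additive, so the kernel of [P] may be null although all its conical
    neighbourhoods keep a mass at least [c]. This is the counterpart of a subspace of positive
    measure for an invariant measure on a projective space. *)
Definition charged q (m : set 'rV[K]_q -> R) p (P : 'M[K]_(q, p)) : Prop :=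
  exists2 c, 0 < c & forall e, 0 < e -> c <= m (near P e).

Lemma not_charged q (m : set 'rV[K]_q -> R) p (P : 'M[K]_(q, p)) c :
  ~ charged m P -> 0 < c -> exists2 e, 0 < e & m (near P e) < c.
Proof.
move=> h c0; apply: contrapT => hn; apply: h; exists c => // e e0.
by rewrite leNgt; apply/negP => h; apply: hn; exists e.
Qed.

End Near.

(** * Dynamics of a matrix that preserves a mean *)

Section OneStep.
Variables (R : realType) (K : closedFieldType) (a : K -> R).
Hypothesis ha : is_absval a.
Variables (q : nat) (m : set 'rV[K]_q.+1 -> R).
Hypothesis hm : is_mean m.

Lemma mean_mulmx_exp (A : 'M[K]_q.+1) :
  (forall E, m ((fun w => w *m A) @^-1` E) = m E) ->
  forall n E, m ((fun w => w *m A ^+ n) @^-1` E) = m E.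
Proof.
move=> hA; elim=> [|n IH] E.
  by congr m; apply/seteqP; split=> w /=; rewrite expr0 mulmx1.
rewrite -[RHS](IH E) -[RHS]hA; congr m.
by apply/seteqP; split=> w /=; rewrite exprS mulmxA.
Qed.

(** Poincare recurrence: no point of [D] returns after [n0] steps, so the preimages of [D] under the
    powers of exponent [n0 * i] are disjoint, and all have the mass of [D]. *)
Lemma mean_transient (A : 'M[K]_q.+1) (D : set 'rV[K]_q.+1) (n0 : nat) :
  (forall E, m ((fun w => w *m A) @^-1` E) = m E) ->
  (forall w n, (n0 <= n)%N -> D w -> ~ D (w *m A ^+ n)) -> m D = 0.
Proof.
move=> hA hD; apply/eqP; rewrite eq_le (mean_ge0 hm) andbT.
pose F i := (fun w => w *m A ^+ (n0 * i)) @^-1` D.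
apply: (@mean_disjoint_eq0 R _ m hm F) => [i|i j ij].
  by rewrite /F (mean_mulmx_exp hA).
apply/seteqP; split => // w [/= h1 h2].
apply: (hD _ (n0 * (j - i))%N _ h1); first by rewrite leq_pmulr// subn_gt0.
by rewrite -mulmxA -[_ *m A ^+ _]/(_ * _) -exprD -mulnDr subnKC// ltnW.
Qed.

(** For a vector bounded away from both spectral subspaces the ratio of the two components lies
    between [k] and [1 / k], while [n] iterations multiply it by at least a constant times
    [(t2 / t1) ^+ n]. Hence the set is transient. *)
Lemma mean_split0 (A P1 P2 : 'M[K]_q.+1) (C t1 t2 e : R) :
  (forall E, m ((fun w => w *m A) @^-1` E) = m E) ->
  0 < C -> 0 < t1 -> t1 < t2 -> 0 < e ->
  (forall p (w : 'M[K]_(p, q.+1)) n,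
        absmx a (w *m A ^+ n *m P1) <= C * t1 ^+ n * absmx a (w *m P1)) ->
  (forall p (w : 'M[K]_(p, q.+1)) n,
        absmx a (w *m P2) * t2 ^+ n <= C * absmx a (w *m A ^+ n *m P2)) ->
  m [set w | e * absmx a w < absmx a (w *m P1) /\
             e * absmx a w < absmx a (w *m P2)] = 0.
Proof.
move=> hA C0 t10 t12 e0 h1 h2.
set N := 1 + absmx a P1 + absmx a P2.
have P10 := absmx_ge0 ha P1; have P20 := absmx_ge0 ha P2.
have N0 : 0 < N by rewrite /N; lra.
pose k := e / N.
have k0 : 0 < k by rewrite divr_gt0.
have hk (P P' : 'M[K]_q.+1) w : absmx a P <= N -> e * absmx a w < absmx a (w *m P') ->
    k * absmx a (w *m P) < absmx a (w *m P').
  move=> PN; apply: le_lt_trans; rewrite /k -mulrA ler_wpM2l ?(ltW e0)//.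
  rewrite ler_pdivrMl// (le_trans (absmxM ha _ _))// mulrC ler_wpM2r//.
  exact: absmx_ge0.
have t20 := lt_trans t10 t12.
have t21 : 1 < t2 / t1 by rewrite ltr_pdivlMr// mul1r.
(* If a vector and its [n]th image both lie in the set, the inequalities below give
   [k * k * t2 ^+ n < C * C * t1 ^+ n], impossible beyond [n0]. *)
have [n0 hn0] := exprn_unbounded (C * C / (k * k)) t21.
apply: (mean_transient (n0 := n0) hA) => w n /hn0 hn [_ hw2] [hw1 _].
have PN1 : absmx a P1 <= N by rewrite /N; lra.
have PN2 : absmx a P2 <= N by rewrite /N; lra.
have i1 := hk _ P1 P2 _ PN1 hw2.
have i2 := hk _ P2 P1 _ PN2 hw1.
have i3 := h1 _ w n; have i4 := h2 _ w n.
have x0 := absmx_ge0 ha (w *m P1).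
move: i1 i2 i3 i4 x0; clear h1 h2 hk hw1 hw2.
set x := absmx a (w *m P1); set y := absmx a (w *m P2).
set x' := absmx a (_ *m P1); set y' := absmx a (_ *m P2) => i1 i2 i3 i4 x0; clearbody k.
have tn : 0 < t2 ^+ n by rewrite exprn_gt0.
have j1 : k * (k * x * t2 ^+ n) <= k * (y * t2 ^+ n).
  by rewrite ler_wpM2l ?(ltW k0)// ler_wpM2r ?(ltW tn)// ltW.
have j2 : k * (y * t2 ^+ n) <= C * (k * y').
  by rewrite [leRHS]mulrCA ler_wpM2l// ltW.
have j3 : C * (k * y') < C * x' by rewrite ltr_pM2l.
have j4 : C * x' <= C * (C * t1 ^+ n * x) by rewrite ler_wpM2l// ltW.
have j5 : k * k * t2 ^+ n * x < C * C * t1 ^+ n * x.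
  have -> : k * k * t2 ^+ n * x = k * (k * x * t2 ^+ n) by ring.
  have -> : C * C * t1 ^+ n * x = C * (C * t1 ^+ n * x) by ring.
  exact: (le_lt_trans j1 (le_lt_trans j2 (lt_le_trans j3 j4))).
have xp : 0 < x.
  rewrite lt_neqAle x0 andbT; apply/eqP => x00.
  by rewrite -x00 !mulr0 ltxx in j5.
rewrite ltr_pM2r// in j5.
move: hn; rewrite ltNge => /negP; apply.
rewrite expr_div_n ler_pdivrMr ?exprn_gt0// mulrAC ler_pdivlMr ?mulr_gt0//.
by rewrite mulrC ltW.
Qed.

(* If the eigenvalues of an [m]-preserving matrix have different absolute
   values, then under iteration almost every vector drifts towards one of the two
   spectral subspaces, so that one of them already carries a positive mass in all
   its neighbourhoods. *)
Lemma charged_split (A : 'M[K]_q.+1) p (P : 'M[K]_(q.+1, p)) (s : R) :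
  A \in unitmx -> 0 <= s ->
  (forall E, m ((fun w => w *m A) @^-1` E) = m E) -> charged a m P ->
  exists Q : 'M[K]_q.+1, charged a m (row_mx P Q) /\
    ((forall (w : 'rV[K]_q.+1) l, w *m A = l *: w -> a l <= s -> w *m Q = 0 -> w = 0)
    \/ (forall (w : 'rV[K]_q.+1) l, w *m A = l *: w -> s < a l -> w *m Q = 0 -> w = 0)).
Proof.
move=> uA s0 hA [c c0 hc].
have [P1 [P2 [C [t1 [t2 [P12 [C0 t10 t12] h1 h2 h3]]]]]] := spectral_split ha uA s0.
have [ch1|n1] := pselect (charged a m (row_mx P P1)).
  exists P1; split => //; left => w l wA ls wP1.
  have := h3 _ _ wA; rewrite ls => wP2.
  by rewrite -[w]mulmx1 -P12 mulmxDr wP1 wP2 addr0.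
have [ch2|n2] := pselect (charged a m (row_mx P P2)).
  exists P2; split => //; right => w l wA ls wP2.
  have := h3 _ _ wA; rewrite leNgt ls /= => wP1.
  by rewrite -[w]mulmx1 -P12 mulmxDr wP1 wP2 addr0.
exfalso.
have c2 : 0 < c / 2%:R by rewrite divr_gt0.
have [e1 e10 he1] := not_charged n1 c2.
have [e2 e20 he2] := not_charged n2 c2.
(* [near_cap] doubles the radius, hence the half. Off a null set, a vector near the kernel of [P] is
   near one of its two intersections with a spectral subspace, and each of these neighbourhoods has
   mass less than [c / 2]. *)
pose e := Num.min e1 e2 / 2%:R.
have e0 : 0 < e by rewrite divr_gt0// lt_min e10.
have := hc _ e0; apply/negP; rewrite -ltNge.
have := mean_split0 hA C0 t10 t12 e0 h1 h2; set D := [set w | _ /\ _] => D0.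
have sub : near a P e `<=` (near a (row_mx P P1) e1 `|` near a (row_mx P P2) e2) `|` D.
  move=> w hw.
  have [hP1|hP1] := leP (absmx a (w *m P1)) (e * absmx a w).
    left; left; apply: (@near_le _ _ _ ha _ _ _ (2%:R * e)).
      by rewrite /e mulrCA divff// mulr1 ge_min lexx.
    exact: near_cap.
  have [hP2|hP2] := leP (absmx a (w *m P2)) (e * absmx a w); last by right.
  left; right; apply: (@near_le _ _ _ ha _ _ _ (2%:R * e)).
    by rewrite /e mulrCA divff// mulr1 ge_min lexx orbT.
  exact: near_cap.
apply: (le_lt_trans (mean_le hm sub)).
apply: (le_lt_trans (mean_leU hm _ _)); rewrite D0 addr0.
by apply: (le_lt_trans (mean_leU hm _ _)); lra.
Qed.

Lemma charged_min : exists p (P : 'M[K]_(q.+1, p)), charged a m P /\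
  forall p' (P' : 'M[K]_(q.+1, p')), charged a m P' ->
    (\rank (kermx P) <= \rank (kermx P'))%N.
Proof.
pose Pr k := `[< exists p (P : 'M[K]_(q.+1, p)), charged a m P /\ \rank (kermx P) = k >].
have Pr0 : exists k, Pr k.
  exists (\rank (kermx (0 : 'M[K]_(q.+1, 1)))); apply/asboolP; exists 1%N, 0; split=> //.
  exists 1 => // e e0; case: hm => _ <- _; apply: (mean_le hm) => w _.
  by rewrite /near /= mulmx0 absmx0// mulr_ge0 ?(absmx_ge0 ha) ?(ltW e0).
case: (ex_minnP Pr0) => k /asboolP[p [P [ch <-]]] hmin.
exists p, P; split => // p' P' ch'; apply: hmin; apply/asboolP.
by exists p', P'.
Qed.

(** With zero kernel, the cone of [P] for a small radius would lie in the cone of the identity of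
    radius 1/2, where the norm of [w] is at most half of itself: this is the origin, which is
    null. *)
Lemma charged_ker_neq0 p (P : 'M[K]_(q.+1, p)) : m [set 0] = 0 -> charged a m P ->
  kermx P != 0.
Proof.
move=> m0 [c c0 hc]; apply/negP => /eqP k0.
have [||d d0 hd] := @near_ker _ _ a ha _ _ _ P (1%:M : 'M[K]_q.+1) (2%:R^-1).
- by rewrite k0 sub0mx.
- by rewrite invr_gt0.
have := hc _ d0; apply/negP; rewrite -ltNge; apply: le_lt_trans c0.
rewrite -m0; apply: (mean_le hm) => w /(hd _ d0 (lexx _)).
rewrite /near /= mulmx1 => h; apply/eqP; rewrite -(absmx_eq0 ha).
by have := absmx_ge0 ha w; rewrite eq_le => -> /=; rewrite andbT; lra.
Qed.

Section Group.
Variables (G : groupType) (H : set G) (sg : G -> 'M[K]_q.+1).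
Hypothesis hH : subgrp H.
Hypothesis sg1 : sg 1%g = 1%:M.
Hypothesis sgM : forall x y, H x -> H y -> sg (x * y)%g = sg x *m sg y.
Hypothesis minv : forall g, H g -> forall E, m ((fun w => w *m sg g) @^-1` E) = m E.

Lemma sgV g : H g -> sg g *m sg g^-1%g = 1%:M.
Proof. by case: hH => _ _ hV Hg; rewrite -sgM ?mulgV//; exact: hV. Qed.

Lemma sgVr g : H g -> sg g^-1%g *m sg g = 1%:M.
Proof. by case: hH => _ _ hV Hg; rewrite -sgM ?mulVg//; exact: hV. Qed.

Lemma sg_unit g : H g -> sg g \in unitmx.
Proof. by move=> Hg; have [] := mulmx1_unit (sgV Hg). Qed.

(** The kernel of [sg g^-1 *m P] is the image under [sg g] of the kernel of [P]; the factor
    [1 + absmx a (sg g^-1)] accounts for the distortion of cones. *)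
Lemma charged_translate p (P : 'M[K]_(q.+1, p)) c g : H g -> 
  (forall e, 0 < e -> c <= m (near a P e)) ->
  forall e, 0 < e -> c <= m (near a (sg g^-1%g *m P) e).
Proof.
move=> Hg hc e e0; rewrite -(minv Hg).
have N0 : 0 < 1 + absmx a (sg g^-1%g) by rewrite ltr_pwDl// (absmx_ge0 ha).
apply: (le_trans (hc (e / (1 + absmx a (sg g^-1%g))) _)); first by rewrite divr_gt0.
apply: (mean_le hm) => w; rewrite /near /= => h.
rewrite mulmxA -(mulmxA w) sgV// mulmx1 (le_trans h)//.
rewrite -mulrA ler_wpM2l ?(ltW e0)// ler_pdivrMl//.
rewrite -{1}[w]mulmx1 -(sgV Hg) mulmxA (le_trans (absmxM ha _ _))// mulrC.
by rewrite ler_wpM2r ?(absmx_ge0 ha)// lerDr.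
Qed.

(** [Z] is a charged kernel of minimal rank. Two distinct translates meet in a smaller kernel, which
    is not charged and so has a light neighbourhood; the overlap bound leaves finitely many
    translates. If two eigenvectors of [sg g] in [Z] had eigenvalues of different sizes,
    [charged_split] with the smaller size as threshold would produce a smaller charged kernel. *)
Lemma charged_orbit : m [set 0] = 0 -> exists Z : 'M[K]_q.+1,
  [/\ Z != 0, finidx H (fun g => (Z *m sg g <= Z)%MS) &
      forall g, H g -> forall (w w' : 'rV[K]_q.+1) l l',
        (w <= Z)%MS -> (w' <= Z)%MS -> w != 0 -> w' != 0 ->
        w *m sg g = l *: w -> w' *m sg g = l' *: w' -> a l = a l'].
Proof.
move=> m0; have [p [P [ch hmin]]] := charged_min.
have hproper p' (Q : 'M[K]_(q.+1, p')) : charged a m (row_mx P Q) ->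
    (kermx P <= kermx Q)%MS.
  move=> chQ; have := hmin _ _ chQ => hr.
  have sub : (kermx (row_mx P Q) <= kermx P)%MS.
    apply/sub_kermxP; have := mulmx_ker (row_mx P Q).
    by rewrite mul_mx_row => /eqP; rewrite row_mx_eq0 => /andP[/eqP].
  have sub2 : (kermx P <= kermx (row_mx P Q))%MS.
    by rewrite -(geq_leqif (mxrank_leqif_sup sub)).
  apply: (submx_trans sub2); apply/sub_kermxP; have := mulmx_ker (row_mx P Q).
  by rewrite mul_mx_row => /eqP; rewrite row_mx_eq0 => /andP[_ /eqP].
exists (kermx P); split.
- exact: charged_ker_neq0.
- have [c c0 hc] := ch.
  pose f g := (<<kermx P *m sg g>>)%MS.
  have [|s [sH hs]] := @finite_range G _ H f (Num.truncn (2%:R / c)); last first.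
    exists s; split => // g Hg; have [h hsx /genmxP/andP[_ e]] := hs _ Hg.
    exists h => //; have Hh := sH _ hsx.
    have HV : H h^-1%g by case: hH => _ _; apply.
    rewrite sgM// mulmxA (submx_trans (submxMr _ e))//.
    by rewrite -mulmxA sgV// mulmx1.
  move=> s sH us; set n := size s.
  pose g_ i := nth 1%g s i.
  have Hg i : (i < n)%N -> H (g_ i) by move=> h; apply: sH; exact: mem_nth.
  pose A i e := near a (sg (g_ i)^-1%g *m P) e.
  (* Overlaps of at most [d] contribute at most 1 in the overlap bound, so [n * c <= 2]: this is the
     origin of [2 / c] above. *)
  pose d : R := ((n * n).+1)%:R^-1.
  have d0 : 0 < d by rewrite invr_gt0.
  have ker_tr L i : (i < n)%N -> (L : 'M[K]_q.+1) *m (sg (g_ i)^-1%g *m P) = 0 ->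
      (L <= kermx P *m sg (g_ i))%MS.
    move=> ltn; rewrite mulmxA => /sub_kermxP/(submxMr (sg (g_ i))).
    by rewrite -mulmxA sgVr ?mulmx1//; exact: Hg.
  have rk i : (i < n)%N -> \rank (kermx P *m sg (g_ i)) = \rank (kermx P).
    by move=> lin; rewrite mxrankMfree// row_free_unit sg_unit//; exact: Hg.
  have [||e e0 he] := @small_all R _ [seq (i, j) | i <- iota 0 n, j <- iota 0 n]
      (fun ij e => (ij.1 < ij.2)%N -> m (A ij.1 e `&` A ij.2 e) <= d).
  + case=> i j /allpairsP[[i' j'] /= []]; rewrite !mem_iota !add0n /= => i'n j'n [-> ->] {i j}.
    have [ij|ij] := ltnP i' j'; last by exists 1.
    have nch : ~ charged a m (row_mx (sg (g_ i')^-1%g *m P) (sg (g_ j')^-1%g *m P)).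
      move=> chQ; have hr := hmin _ _ chQ.
      set Q := row_mx _ _ in hr.
      have := mulmx_ker Q; rewrite mul_mx_row => /eqP; rewrite row_mx_eq0 => /andP[/eqP q1 /eqP q2].
      have {}q1 := ker_tr _ _ i'n q1; have {}q2 := ker_tr _ _ j'n q2.
      have e1 : (kermx P *m sg (g_ i') <= kermx Q)%MS.
        by rewrite -(geq_leqif (mxrank_leqif_sup q1)) rk.
      have e2 : (kermx P *m sg (g_ j') <= kermx Q)%MS.
        by rewrite -(geq_leqif (mxrank_leqif_sup q2)) rk.
      have ff : f (g_ i') = f (g_ j').
        by apply/genmxP; rewrite (submx_trans e1 q2) (submx_trans e2 q1).
      have := @nth_uniq _ (f 1%g) (map f s) i' j'.
      rewrite size_map => /(_ i'n j'n us); rewrite !(nth_map 1%g)// -/(g_ _) -/(g_ _) ff eqxx.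
      by move/esym/eqP => e; rewrite e ltnn in ij.
    have [e e0 he] := not_charged nch d0.
    exists (e / 2%:R); first by rewrite divr_gt0.
    move=> _; apply: le_trans (ltW he); apply: (mean_le hm) => w /near_cap.
    by rewrite mulrCA divff// mulr1.
  + move=> [i j] e e' e'0 e'e h ij; apply: le_trans (h ij); apply: (mean_le hm).
    by move=> w [h1 h2]; split; apply: (near_le ha e'e).
  have := @mean_overlap _ _ m hm n (A^~ e) c d (ltW d0).
  have nn : (n * n)%:R * d <= 1.
    by rewrite /d ler_pdivrMr// mul1r ler_nat.
  have hA i : (i < n)%N -> c <= m (A i e).
    by move=> lin; apply: charged_translate => //; exact: Hg.
  move=> /(_ hA) hov.
  have {}hov : n%:R * c <= 1 + (n * n)%:R * d.
    apply: hov => i j /andP[ij jn]; apply: (he (i, j)) => //.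
    by apply/allpairsP; exists (i, j); rewrite !mem_iota !add0n jn (ltn_trans ij jn).
  rewrite -ltnS -(ltr_nat R); apply: le_lt_trans (truncnS_gt _).
  by rewrite ler_pdivlMr//; lra.
- move=> g Hg.
  suff wlog_ (w w' : 'rV[K]_q.+1) l l' :
        (w <= kermx P)%MS -> (w' <= kermx P)%MS -> w != 0 -> w' != 0 ->
        w *m sg g = l *: w -> w' *m sg g = l' *: w' -> a l <= a l'.
    move=> w w' l l' h1 h2 h3 h4 h5 h6; apply/eqP; rewrite eq_le.
    by rewrite (wlog_ w w')//= (wlog_ w' w).
  move=> hw hw' w0 w0' wl wl'; rewrite leNgt; apply/negP => ll.
  have [Q [chQ hQ]] := charged_split (sg_unit Hg) (absval_ge0 ha l') (minv Hg) ch.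
  have kPQ := hproper _ _ chQ.
  have wQ := sub_kermxP (submx_trans hw kPQ).
  have wQ' := sub_kermxP (submx_trans hw' kPQ).
  case: hQ => hQ; last by move: w0; rewrite (hQ _ _ wl ll wQ) eqxx.
  by move: w0'; rewrite (hQ _ _ wl' (lexx _) wQ') eqxx.
Qed.

End Group.
End OneStep.

(** * Derived subgroups and induction along a flag *)

Section DerivedSubgroup.
Variable G : groupType.
Local Open Scope group_scope.

(** As an intersection of subgroups, membership is its own induction principle: it applies to any
    subgroup containing the commutators, such as the elements of [H] that act with determinant 1. *)
Definition dersub (H : set G) : set G := fun g => forall L : set G, subgrp L ->
  (forall x y, H x -> H y -> L (x^-1 * y^-1 * x * y)) -> L g.

Lemma dersub_subgrp H : subgrp (dersub H).
Proof.
split=> [L [l1 _ _] _ //|x y hx hy L sL hL|x hx L sL hL]; have [l1 lM lV] := sL.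
  by apply: lM; [exact: hx|exact: hy].
by apply: lV; exact: hx.
Qed.

Lemma dersub_sub H : subgrp H -> dersub H `<=` H.
Proof.
move=> sH g; apply => // x y Hx Hy; have [h1 hM hV] := sH.
by apply: (hM) => //; apply: (hM) => //; apply: (hM); apply: hV.
Qed.

Lemma comm_dersub (H : set G) x y : H x -> H y -> dersub H (x^-1 * y^-1 * x * y).
Proof. by move=> Hx Hy L _; apply. Qed.

Lemma finidx_sub (H S1 S2 : set G) : subgrp H ->
  (forall g, H g -> S1 g -> S2 g) -> finidx H S1 -> finidx H S2.
Proof.
move=> [h1 hM hV] S12 [s [sH hs]]; exists s; split => // g Hg.
have [h hh hS] := hs _ Hg; exists h => //; apply: S12 => //.
by apply: hM => //; apply: hV; apply: sH.
Qed.

End DerivedSubgroup.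

Section Flag.
Variables (R : realType) (K : closedFieldType) (a : K -> R).
Hypothesis ha : is_absval a.
Variables (G : groupType) (H : set G).
Hypothesis hH : subgrp H.

Lemma absval_eq1 x n : (0 < n)%N -> (a x) ^+ n = 1 -> a x = 1.
Proof.
by move=> n0 /eqP; rewrite pexpr_eq1 ?(absval_ge0 ha)// => /eqP.
Qed.

(** The determinant is, up to sign, the product of the eigenvalues, and here they all have the same
    absolute value. *)
Lemma eigen_det1 k (T : 'M[K]_k) l (c : 'rV[K]_k) :
  \det T = 1 -> c != 0 -> c *m T = l *: c ->
  (forall l' (c' : 'rV[K]_k), c' != 0 -> c' *m T = l' *: c' -> a l' = a l) -> a l = 1.
Proof.
move=> dT c0 cT hT.
have [rs hrs] := closed_field_poly_normal (char_poly T).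
rewrite (monicP (char_poly_monic T)) scale1r in hrs.
have k0 : (0 < k)%N by case: k c c0 {T dT cT hT hrs} => // c; rewrite thinmx0 eqxx.
have hsz : size rs = k.
  by have := size_char_poly T; rewrite hrs size_prod_XsubC => -[].
have rT z : z \in rs -> a z = a l.
  rewrite -root_prod_XsubC -hrs -eigenvalue_root_char.
  by case/eigenvalueP => c' e c'0; apply: hT e.
have := char_poly_det T; rewrite dT mulr1 hrs -horner_coef0 horner_prod.
under eq_bigr do rewrite hornerXsubC sub0r.
move=> /(congr1 a); rewrite (absval_prod ha).
have aN x : a (- x) = a x.
  have : a (-1) = 1.
    by apply: (@absval_eq1 _ 2) => //; rewrite expr2 -(absvalM ha) mulrNN mulr1 (absval1 ha).
  by move=> am; rewrite -mulN1r (absvalM ha) am mul1r.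
rewrite big_seq; under eq_bigr => z zrs do rewrite aN (rT _ zrs).
rewrite -big_seq big_const_seq count_predT iter_mulr_1 hsz => e.
apply: (@absval_eq1 _ k) => //; rewrite e.
elim: (k) => [|n IH]; first by rewrite expr0 (absval1 ha).
by rewrite exprS (absvalM ha) IH mulr1 aN (absval1 ha).
Qed.

(** Induction on the dimension. The subspace [Z] of [charged_orbit] is [H]-stable and each element
    of [H] has eigenvalues of one single size there; on the derived subgroup this size is 1, because
    the determinant of the restriction to [Z] is a character of [H]. An eigenvector outside [Z]
    survives in the quotient by [Z], where the image of the mean satisfies the same hypotheses. The
    hypothesis that proper stable subspaces are null keeps the origin null at every stage. *)
Lemma flag_eigen q (m : set 'rV[K]_q -> R) (sg : G -> 'M[K]_q) :
  is_mean m -> sg 1%g = 1%:M ->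
  (forall x y, H x -> H y -> sg (x * y)%g = sg x *m sg y) ->
  (forall g, H g -> forall E, m ((fun w => w *m sg g) @^-1` E) = m E) ->
  (forall Z : 'M[K]_q, finidx H (fun g => (Z *m sg g <= Z)%MS) ->
     forall g, H g -> (Z *m sg g <= Z)%MS) ->
  (forall Z : 'M[K]_q, (forall g, H g -> (Z *m sg g <= Z)%MS) -> ~~ row_full Z ->
     m [set w | (w <= Z)%MS] = 0) ->
  forall g, dersub H g -> forall (w : 'rV[K]_q) l, w != 0 -> w *m sg g = l *: w ->
    a l = 1.
Proof.
have [H1 HM HV] := hH.
elim/ltn_ind: q m sg => -[_ m sg _ _ _ _ _ _ g _ w l|q IH m sg hm sg1 sgM minv hS hM g Ng w l w0 wl].
  by rewrite thinmx0 eqxx.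
have Hg := dersub_sub hH Ng.
have m0 : m [set 0] = 0.
  have <- : [set w : 'rV[K]_q.+1 | (w <= (0 : 'M[K]_q.+1))%MS] = [set 0].
    by apply/seteqP; split => v /=; rewrite submx0 => /eqP.
  by apply: hM => [h _|]; rewrite ?mul0mx ?sub0mx// /row_full mxrank0.
have [Z [Z0 Zfin Zeig]] := charged_orbit ha hm hH sg1 sgM minv m0.
have Zst := hS _ Zfin.
have [B eqB fB] : exists2 B : 'M[K]_(\rank Z, q.+1), (B :=: Z)%MS & row_free B.
  by exists (row_base Z); [exact: eq_row_base|exact: row_base_free].
pose T h := B *m sg h *m pinvmx B.
have TB h : H h -> T h *m B = B *m sg h.
  by move=> Hh; rewrite mulmxKpV// eqB (eqmxMr _ eqB) Zst.
have BB : B *m pinvmx B = 1%:M by exact: mulmxVp.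
have T1 : T 1%g = 1%:M by rewrite /T sg1 mulmx1.
have TM x y : H x -> H y -> T (x * y)%g = T x *m T y.
  move=> Hx Hy; rewrite [LHS]/T sgM// [X in X *m _]mulmxA -(TB x Hx).
  by rewrite [in RHS]/T -!mulmxA.
have dT : \det (T g) = 1.
  suff : (fun h => H h /\ \det (T h) = 1) g by case.
  have dM x y : H x -> H y -> \det (T (x * y)%g) = \det (T x) * \det (T y).
    by move=> Hx Hy; rewrite TM// det_mulmx.
  have dV x : H x -> \det (T x^-1%g) * \det (T x) = 1.
    by move=> Hx; rewrite -dM ?mulVg ?T1 ?det1//; apply: HV.
  apply: (Ng (fun h => H h /\ \det (T h) = 1)) => [|x y Hx Hy].
    split; first by rewrite T1 det1.
      by move=> x y [Hx dx] [Hy dy]; split; [exact: HM|rewrite dM// dx dy mulr1].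
    move=> x [Hx dx]; split; first exact: HV.
    by have := dV _ Hx; rewrite dx mulr1.
  have HVx := HV _ Hx; have HVy := HV _ Hy.
  have h1 := HM _ _ HVx HVy; have h2 := HM _ _ h1 Hx; have h3 := HM _ _ h2 Hy.
  split=> //; rewrite (dM _ _ h2 Hy) (dM _ _ h1 Hx) (dM _ _ HVx HVy).
  rewrite (mulrAC (\det (T x^-1%g))) (dV x Hx) mul1r; exact: dV.
have [wZ|wZ] := boolP (w <= Z)%MS.
  pose c := w *m pinvmx B.
  have wB : (w <= B)%MS by rewrite eqB.
  have cB : c *m B = w by rewrite mulmxKpV.
  have hc : w *m pinvmx B = c by [].
  clearbody c.
  have BZ (c' : 'rV[K]_(\rank Z)) : (c' *m B <= Z)%MS by rewrite (submx_trans (submxMl _ _))// eqB.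
  have B0 (c' : 'rV[K]_(\rank Z)) : c' != 0 -> c' *m B != 0.
    by move=> c'0; rewrite mulmx_free_eq0.
  apply: (@eigen_det1 _ (T g) l c) => //.
  - by apply: contra_neq w0; rewrite -cB => ->; rewrite mul0mx.
  - by rewrite /T mulmxA (mulmxA c) cB wl -scalemxAl hc.
  - move=> l' c' c'0 e; apply: (Zeig g Hg (c' *m B) w) => //; first exact: B0.
    by rewrite -mulmxA -TB// mulmxA e scalemxAl.
(* [Q] is the quotient map by [Z] in coordinates; below, [Q'] is a section of it, [sg'] the induced
   action and [pb] the preimage of a subspace. *)
have [Q fQ hker] : exists2 Q : 'M[K]_(q.+1, \rank (cokermx Z)), row_full Q &
    forall n (u : 'M[K]_(n, q.+1)), (u <= Z)%MS = (u *m Q == 0).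
  exists (col_base (cokermx Z)); first exact: col_base_full.
  move=> n u; rewrite submxE -[in LHS](mulmx_base (cokermx Z)) mulmxA mulmx_free_eq0//.
  exact: row_base_free.
have [Q' Q'Q] : exists Q', Q' *m Q = 1%:M by exists (pinvmx Q); exact: mulVpmx.
pose sg' h := Q' *m sg h *m Q.
have Qsg h : H h -> sg h *m Q = Q *m sg' h.
  move=> Hh; have : ((1%:M - Q *m Q') *m sg h <= Z)%MS.
    apply: (submx_trans _ (Zst _ Hh)); apply: submxMr; rewrite hker.
    by rewrite mulmxBl mul1mx -mulmxA Q'Q mulmx1 subrr.
  by rewrite hker mulmxBl mulmxBl mul1mx subr_eq0 => /eqP ->; rewrite /sg' !mulmxA.
have rq : (\rank (cokermx Z) < q.+1)%N.
  by rewrite mxrank_coker ltn_subrL /= lt0n mxrank_eq0 Z0.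
pose pb (Z' : 'M[K]_(\rank (cokermx Z))) := kermx (Q *m cokermx Z').
have hpb Z' n (u : 'M[K]_(n, q.+1)) : (u <= pb Z')%MS = (u *m Q <= Z')%MS.
  by rewrite /pb sub_kermx mulmxA -submxE.
have pbst Z' h : H h -> (pb Z' *m sg h <= pb Z')%MS = (Z' *m sg' h <= Z')%MS.
  move=> Hh; apply/idP/idP => hz.
    have h1 : (Z' *m Q' <= pb Z')%MS by rewrite hpb -mulmxA Q'Q mulmx1.
    have := submx_trans (submxMr (sg h) h1) hz.
    by rewrite hpb -mulmxA Qsg// mulmxA -(mulmxA Z') Q'Q mulmx1.
  rewrite hpb -mulmxA Qsg// mulmxA; apply: submx_trans hz; apply: submxMr.
  by rewrite -hpb.
apply: (IH _ rq (fun E => m ((fun w => w *m Q) @^-1` E)) sg' _ _ _ _ _ _ g Ng (w *m Q)).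
- exact: mean_pushforward.
- by rewrite /sg' sg1 mulmx1.
- move=> x y Hx Hy; rewrite {1}/sg' sgM// -!mulmxA Qsg// !mulmxA.
- move=> h Hh E; rewrite -[RHS](minv h Hh); congr m; apply/seteqP.
  by split => v /=; rewrite -!mulmxA Qsg.
- move=> Z' fZ' h Hh; rewrite -pbst//; apply: hS => //.
  by apply: finidx_sub fZ' => // x Hx; rewrite pbst.
- move=> Z' sZ' nf; rewrite -[RHS](hM (pb Z')).
  + by congr m; apply/seteqP; split => v /=; rewrite hpb.
  + by move=> h Hh; rewrite pbst// sZ'.
  + apply: contra nf; rewrite -!sub1mx hpb mul1mx => hQ.
    by rewrite -Q'Q (submx_trans (submxMl _ _)).
- by rewrite -hker.
- by rewrite -mulmxA -Qsg// mulmxA wl -scalemxAl.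
Qed.

End Flag.

(** * Minimal spans and minimal subspaces for a mean on rational vectors *)

Section SubspaceMx.
Variables (F : fieldType) (n : nat).

Lemma subspace_mx (P : set 'rV[F]_n) : P 0 ->
  (forall a u v, P u -> P v -> P (a *: u + v)) ->
  exists B : 'M[F]_n, forall u, P u <-> (u <= B)%MS.
Proof.
move=> P0 PL.
pose Q k := `[< exists B : 'M[F]_n, (forall u : 'rV_n, (u <= B)%MS -> P u) /\ \rank B = k >].
have Q0 : exists k, Q k.
  exists 0%N; apply/asboolP; exists 0; rewrite mxrank0; split=> // u.
  by rewrite submx0 => /eqP ->.
have Qm k : Q k -> (k <= n)%N by move/asboolP => [B [_ <-]]; exact: rank_leq_row.
case: (ex_maxnP Q0 Qm) => k /asboolP[B [hB rB]] hmax.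
exists B => u; split; last exact: hB.
move=> Pu; apply: contrapT => /negP uB.
have lt : (\rank B < \rank (B + u)%MS)%N.
  rewrite ltn_neqAle mxrankS ?addsmxSl// andbT; apply: contra uB => /eqP e.
  have := geq_leqif (mxrank_leqif_sup (addsmxSl B u)).
  by rewrite e leqnn => /esym; apply: submx_trans; exact: addsmxSr.
have : (\rank (B + u)%MS <= k)%N; last by rewrite -rB leqNgt lt.
apply: hmax; apply/asboolP; exists (B + u)%MS; split=> // v /sub_addsmxP[[v1 v2] /= ->].
rewrite (mx11_scalar v2) mul_scalar_mx addrC; apply: PL => //.
by apply: hB; exact: submxMl.
Qed.

End SubspaceMx.

Section FiniteIndex.
Variable G : groupType.
Local Open Scope group_scope.

Lemma finidx_trans (H S : set G) : subgrp H -> finidx setT H -> finidx H S ->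
  finidx setT (fun g => H g /\ S g).
Proof.
move=> [h1 hM hV] [s [_ hs]] [t [tH ht]].
exists [seq k * h | h <- s, k <- t]; split => // g _.
have [h hhs Hg] := hs g I; have [k kt Sg] := ht _ Hg.
exists (k * h); first by apply/allpairsP; exists (h, k).
rewrite invgM mulgA; split=> //; apply: hM => //; apply: hV; exact: tH.
Qed.

End FiniteIndex.

Section RationalMean.
Variables (R : realType) (G : groupType) (r : nat) (rho : G -> 'M[rat]_r).
Variable m : set 'rV[rat]_r -> R.
Hypothesis hm : is_mean m.
Hypothesis m0 : m [set 0] = 0.
Hypothesis rho1 : rho 1%g = 1%:M.
Hypothesis rhoM : forall x y, rho (x * y)%g = rho x *m rho y.
Hypothesis minv : forall g E, m ((fun w => w *m rho g) @^-1` E) = m E.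

Lemma rhoV g : rho g *m rho g^-1%g = 1%:M.
Proof. by rewrite -rhoM mulgV. Qed.
Lemma rhoVr g : rho g^-1%g *m rho g = 1%:M.
Proof. by rewrite -rhoM mulVg. Qed.
Lemma rho_unit g : rho g \in unitmx.
Proof. by have [] := mulmx1_unit (rhoV g). Qed.

Definition spanned (H : set G) (A : 'M[rat]_(r * r)) :=
  [/\ subgrp H, finidx setT H & forall h, H h -> (mxvec (rho h) <= A)%MS].

Lemma spanned_min : exists H A, spanned H A /\
  forall H' A', spanned H' A' -> (\rank A <= \rank A')%N.
Proof.
pose Q k := `[< exists H A, spanned H A /\ \rank A = k >].
have Q0 : exists k, Q k.
  exists (\rank (1%:M : 'M[rat]_(r * r))); apply/asboolP; exists setT, 1%:M; split=> //.
  split => //; last by move=> h _; exact: submx1.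
  by exists [:: 1%g]; split=> // g _; exists 1%g; rewrite ?inE.
case: (ex_minnP Q0) => k /asboolP[H [A [hA <-]]] hmin.
by exists H, A; split=> // H' A' h'; apply: hmin; apply/asboolP; exists H', A'.
Qed.

Section Minimal.
Variables (H : set G) (A : 'M[rat]_(r * r)).
Hypothesis hA : spanned H A.
Hypothesis hmin : forall H' A', spanned H' A' -> (\rank A <= \rank A')%N.

(** The matrices of the finite index subgroup cut out by [P] lie in the part of [A] where [P] holds.
    By minimality of the rank this part is all of [A], so the linear condition holds on the whole of
    [H]. *)
Lemma minimal_stab (P : set 'M[rat]_r) : P 0 ->
  (forall a u v, P u -> P v -> P (a *: u + v)) ->
  subgrp (fun g => H g /\ P (rho g)) -> finidx H (fun g => P (rho g)) ->
  forall h, H h -> P (rho h).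
Proof.
move=> P0 PL sP fP h Hh; have [sH fH AH] := hA.
have [||B hB] := @subspace_mx rat (r * r) (fun u => (u <= A)%MS /\ P (vec_mx u)).
- by rewrite sub0mx linear0.
- move=> a u v [uA Pu] [vA Pv]; rewrite linearP /=; split; last exact: PL.
  by rewrite addmx_sub// scalemx_sub.
have BA : (B <= A)%MS.
  by apply/row_subP => i; have [] := (hB (row i B)).2 (row_sub i B).
have : spanned (fun g => H g /\ P (rho g)) B.
  split=> //; first exact: finidx_trans.
  by move=> g [Hg Pg]; apply/hB; rewrite mxvecK; split=> //; exact: AH.
move/hmin; rewrite (geq_leqif (mxrank_leqif_sup BA)) => AB.
by have [] := (hB (mxvec (rho h))).2 (submx_trans (AH _ Hh) AB); rewrite mxvecK.
Qed.

Lemma stab_subgrp (K : fieldType) (f : {rmorphism rat -> K}) n (Z : 'M[K]_(n, r)) :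
  subgrp (fun g => H g /\ (Z *m map_mx f (rho g) <= Z)%MS).
Proof.
have [[h1 hM hV] _ _] := hA.
split=> [|x y [Hx Zx] [Hy Zy]|x [Hx Zx]].
- by rewrite rho1 map_mx1 mulmx1.
- split; first exact: hM.
  by rewrite rhoM map_mxM mulmxA (submx_trans (submxMr _ Zx)).
- split; first exact: hV.
  have ux g : map_mx f (rho g) \in unitmx by rewrite map_unitmx rho_unit.
  have : (Z <= Z *m map_mx f (rho x))%MS.
    by rewrite -(geq_leqif (mxrank_leqif_sup Zx)) mxrankMfree// row_free_unit.
  move/(submxMr (map_mx f (rho x^-1%g))).
  by rewrite -mulmxA -map_mxM rhoV map_mx1 mulmx1.
Qed.

(** Stability of a subspace over an extension field is still a rational linear condition on the
    matrix, so it passes from finite index to [H]. *)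
Lemma minimal_stabmx (K : fieldType) (f : {rmorphism rat -> K}) n (Z : 'M[K]_(n, r)) :
  finidx H (fun g => (Z *m map_mx f (rho g) <= Z)%MS) ->
  forall h, H h -> (Z *m map_mx f (rho h) <= Z)%MS.
Proof.
apply: (@minimal_stab (fun M => (Z *m map_mx f M <= Z)%MS)); last exact: stab_subgrp.
  by rewrite map_mx0 mulmx0 sub0mx.
move=> a u v hu hv; rewrite map_mxD map_mxZ mulmxDr -scalemxAr.
by rewrite addmx_sub// scalemx_sub.
Qed.

Section Charged.
Variable W : 'M[rat]_r.
Hypothesis W0 : 0 < m [set w | (w <= W)%MS].
Hypothesis Wmin : forall W' : 'M[rat]_r, 0 < m [set w | (w <= W')%MS] ->
  (\rank W <= \rank W')%N.

Lemma mean_translate (W' : 'M[rat]_r) g :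
  m [set w | (w <= W' *m rho g)%MS] = m [set w | (w <= W')%MS].
Proof.
rewrite -(minv g); congr m; apply/seteqP; split=> w /=; last exact: submxMr.
by move/(submxMr (rho g^-1%g)); rewrite -!mulmxA rhoV !mulmx1.
Qed.

(** Distinct translates of [W] meet in smaller rank, hence in a null set by minimality. Since all
    have the mass of [W], their number is at most the inverse of that mass. *)
Lemma charged_orbit_finite (L : set G) : exists s : seq G, (forall h, h \in s -> L h) /\
  forall g, L g -> exists2 h, h \in s & (W *m rho g == W *m rho h)%MS.
Proof.
have [|s [sL hs]] := @finite_range G _ L (fun g => <<W *m rho g>>%MS)
    (Num.truncn ((m [set w | (w <= W)%MS])^-1)); last first.
  exists s; split=> // g Lg; have [h h1 /genmxP h2] := hs _ Lg; exists h => //.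
  by rewrite andbC.
move=> s sL us; set n := size s.
pose c := m [set w | (w <= W)%MS]; have W0c : 0 < c by [].
have rk g : \rank (W *m rho g) = \rank W by rewrite mxrankMfree// row_free_unit rho_unit.
have hAA i : (i < n)%N -> c <= m [set w | (w <= W *m rho (nth 1%g s i))%MS].
  by rewrite mean_translate.
have := @mean_overlap _ _ m hm n _ c 0 (lexx _) hAA.
rewrite mulr0 addr0 => hov.
have {}hov : n%:R * c <= 1.
  apply: hov => i j /andP[ij jn]; have iln := ltn_trans ij jn.
  set gi := nth 1%g s i; set gj := nth 1%g s j.
  rewrite (_ : _ `&` _ = [set w | (w <= (W *m rho gi) :&: (W *m rho gj))%MS]); last first.
    by apply/seteqP; split=> w /=; rewrite sub_capmx => /andP.
  rewrite leNgt; apply/negP => /Wmin; rewrite -(rk gi) => h.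
  have e1 := capmxSl (W *m rho gi) (W *m rho gj).
  have e2 := capmxSr (W *m rho gi) (W *m rho gj).
  have := h; rewrite (geq_leqif (mxrank_leqif_sup e1)) => q1.
  move: h; rewrite rk -(rk gj) (geq_leqif (mxrank_leqif_sup e2)) => q2.
  have ee : <<W *m rho gi>>%MS = <<W *m rho gj>>%MS.
    by apply/genmxP; rewrite (submx_trans q1 e2) (submx_trans q2 e1).
  have := @nth_uniq _ (<<W *m rho 1%g>>)%MS _ i j _ _ us.
  rewrite size_map => /(_ iln jn); rewrite !(nth_map 1%g)// -/gi -/gj ee eqxx.
  by move/esym/eqP => e; rewrite e ltnn in ij.
rewrite -ltnS -(ltr_nat R); apply: le_lt_trans (truncnS_gt _).
by rewrite -[X in _ <= X]mul1r ler_pdivlMr.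
Qed.

Lemma charged_stable h : H h -> (W *m rho h <= W)%MS.
Proof.
have idm (M : 'M[rat]_r) : map_mx idfun M = M by apply/matrixP => i j; rewrite mxE.
move=> Hh; rewrite -[rho h]idm; apply: (@minimal_stabmx rat idfun r W) => //.
have [s [sH hs]] := charged_orbit_finite H.
exists s; split=> // g Hg; have [k ks /andP[/(submxMr (rho k^-1%g)) e _]] := hs _ Hg.
exists k => //; move: e; by rewrite idm rhoM -!mulmxA rhoV mulmx1.
Qed.

Section Eigenvalues.
Variables (K : numClosedFieldType) (a : K -> R).
Hypothesis ha : is_absval a.
Variables (k : nat) (B : 'M[rat]_(k, r)) (B' : 'M[rat]_(r, k)).
Hypothesis eqB : (B :=: W)%MS.
Hypothesis BB' : B *m B' = 1%:M.

Definition restr (g : G) : 'M[rat]_k := B *m rho g *m B'.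

Lemma coordK p (w : 'M[rat]_(p, r)) : (w <= W)%MS -> w *m B' *m B = w.
Proof.
by rewrite -eqB => /submxP[c ->]; rewrite -(mulmxA c) BB' mulmx1.
Qed.

Lemma restr_mul h : H h -> restr h *m B = B *m rho h.
Proof.
by move=> Hh; rewrite /restr coordK// (eqmxMr _ eqB) charged_stable.
Qed.

Lemma restr1 : restr 1%g = 1%:M.
Proof. by rewrite /restr rho1 mulmx1. Qed.

Lemma restrM x y : H x -> H y -> restr (x * y)%g = restr x *m restr y.
Proof.
move=> Hx Hy; rewrite [LHS]/restr rhoM [X in X *m _]mulmxA -(restr_mul Hx).
by rewrite [in RHS]/restr -!mulmxA.
Qed.

(** [flag_eigen] is applied to the mean conditioned to [W] and pushed to K^k by coordinates. The
    rational points of a subspace [Z] of K^k of positive mass form a rational subspace of [W] of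
    positive mass, which is [W] by minimality; as the rational points span K^k, [Z] is
    everything. *)
Lemma restr_eigen g : dersub H g -> forall (w : 'rV[K]_k) l, w != 0 ->
  w *m map_mx ratr (restr g) = l *: w -> a l = 1.
Proof.
have [sH _ _] := hA; have [H1 HM HV] := sH.
have c0 : 0 < m [set w | (w <= W)%MS] by [].
set c := m _ in c0.
have stW h w : H h -> ((w : 'rV_r) <= W)%MS = (w *m rho h <= W)%MS.
  move=> Hh; apply/idP/idP => [hw|/(submxMr (rho h^-1%g)) hw].
    by rewrite (submx_trans (submxMr _ hw))// charged_stable.
  move: hw; rewrite -mulmxA rhoV mulmx1 => hw; apply: (submx_trans hw).
  by apply: charged_stable; exact: HV.
pose B_ := map_mx (ratr : rat -> K) B; pose B'_ := map_mx (ratr : rat -> K) B'.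
have fB : row_free B_ by apply/row_freeP; exists B'_; rewrite -map_mxM BB' map_mx1.
apply: (@flag_eigen R K a ha G H sH k
  (fun E => m [set w | (w <= W)%MS /\ E (map_mx ratr (w *m B'))] / c)
  (fun h => map_mx ratr (restr h)) _ _ _ _ _ _ g).
- have [mge0 mT mU] := hm; split.
  + by move=> E; rewrite divr_ge0// ltW.
  + rewrite (_ : [set w | _] = [set w | (w <= W)%MS]) ?divff ?gt_eqF//.
    by apply/seteqP; split => w /=; tauto.
  + move=> E F EF; rewrite -mulrDl -mU.
      by congr (m _ / c); apply/seteqP; split => w /=; tauto.
    by apply/seteqP; split => // w [[_ h1] [_ h2]];
      have : (E `&` F) (map_mx ratr (w *m B')) by []; rewrite EF.
- by rewrite restr1 map_mx1.
- by move=> x y Hx Hy; rewrite restrM// map_mxM.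
- move=> g' Hg E; rewrite -[in RHS](minv g'); congr (m _ / c).
  apply/seteqP; split=> w /= [hw hE].
    split; first by rewrite -stW.
    move: hE; rewrite -map_mxM; congr (E (map_mx _ _)).
    by rewrite /restr mulmxA (mulmxA (w *m B')) coordK.
  rewrite -stW// in hw; split=> //.
  move: hE; rewrite -map_mxM; congr (E (map_mx _ _)).
  by rewrite /restr mulmxA (mulmxA (w *m B')) coordK.
- have eqst Z h : H h -> (Z *m map_mx ratr (restr h) <= Z)%MS =
      ((Z : 'M[K]_k) *m B_ *m map_mx ratr (rho h) <= Z *m B_)%MS.
    by move=> Hh; rewrite -mulmxA -map_mxM -restr_mul// map_mxM mulmxA submxMfree.
  move=> Z fZ h Hh; rewrite eqst//; apply: minimal_stabmx => //.
  by apply: finidx_sub fZ => // x Hx; rewrite eqst.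
- move=> Z _ nZ; suff -> : m [set w | (w <= W)%MS /\
      [set w0 | (w0 <= Z)%MS] (map_mx ratr (w *m B'))] = 0 by rewrite mul0r.
  have [||W' hW'] := @subspace_mx rat r (fun w => (w <= W)%MS /\
      (map_mx ratr (w *m B') <= Z)%MS).
  + by rewrite sub0mx mul0mx map_mx0 sub0mx.
  + move=> b u v [uW uZ] [vW vZ].
    rewrite mulmxDl -scalemxAl map_mxD map_mxZ !addmx_sub ?scalemx_sub//.
  apply/eqP; rewrite eq_le (mean_ge0 hm) andbT leNgt; apply/negP.
  rewrite (_ : [set w | _] = [set w | (w <= W')%MS]); last first.
    by apply/seteqP; split=> w /=; rewrite hW'.
  move/Wmin; have WW : (W' <= W)%MS.
    by apply/row_subP => i; have [] := (hW' (row i W')).2 (row_sub _ _).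
  rewrite (geq_leqif (mxrank_leqif_sup WW)) => WW'.
  case/negP: nZ; rewrite -sub1mx -(map_mx1 (ratr : rat -> K)) -BB'.
  apply/row_subP => i; rewrite -map_row row_mul.
  apply: ((hW' _).2 _).2; apply: submx_trans WW'.
  by rewrite -eqB row_sub.
Qed.

End Eigenvalues.
End Charged.
End Minimal.
End RationalMean.

(** * A p-adic absolute value on an algebraically closed field *)

Section PadicAbsval.
Variables (K : numFieldType) (p : nat).
Hypothesis pr_p : prime p.
Let P : K := p%:R.

Definition is_subring (O : set K) : Prop :=
  [/\ O 1, forall x y, O x -> O y -> O (x - y) & forall x y, O x -> O y -> O (x * y)].

Lemma P_neq0 : P != 0.
Proof. by rewrite /P pnatr_eq0 -lt0n prime_gt0. Qed.

Lemma maximal_subring : exists O : set K, [/\ is_subring O, ~ O P^-1 &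
  forall O', is_subring O' -> O `<=` O' -> ~ O' P^-1 -> O' `<=` O].
Proof.
(* Zorn also asks for the union of the empty chain, hence the clause that puts [1] in [O] only when
   [O] is nonempty. The integers, where [1 / p] is absent, show afterwards that a maximal [O] is not
   empty. *)
pose Q (O : set K) := [/\ forall x, O x -> O 1, forall x y, O x -> O y -> O (x - y),
  forall x y, O x -> O y -> O (x * y) & ~ O P^-1].
have [F FQ tF|O [hQ Omax]] := @Zorn_bigcup K Q.
  split.
  - by move=> x [X FX Xx]; exists X => //; have [h _ _ _] := FQ _ FX; exact: h Xx.
  - move=> x y [X FX Xx] [Y FY Yy]; have [XY|YX] := tF _ _ FX FY.
      by exists Y => //; have [_ h _ _] := FQ _ FY; apply: h => //; exact: XY.
    by exists X => //; have [_ h _ _] := FQ _ FX; apply: h => //; exact: YX.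
  - move=> x y [X FX Xx] [Y FY Yy]; have [XY|YX] := tF _ _ FX FY.
      by exists Y => //; have [_ _ h _] := FQ _ FY; apply: h => //; exact: XY.
    by exists X => //; have [_ _ h _] := FQ _ FX; apply: h => //; exact: YX.
  - by move=> [X FX Xp]; have [_ _ _] := FQ _ FX.
have [u1 uB uM uP] := hQ.
have intQ : Q [set x | exists z : int, x = z%:~R].
  split.
  - by move=> _ _; exists 1; rewrite rmorph1.
  - by move=> _ _ [x ->] [y ->]; exists (x - y); rewrite rmorphB.
  - by move=> _ _ [x ->] [y ->]; exists (x * y); rewrite rmorphM.
  - move=> [z hz]; have : (p%:Z * z)%:~R = 1 :> K.
      by rewrite rmorphM /= -hz -pmulrn mulfV// P_neq0.
    rewrite -(rmorph1 (intr : int -> K)) => /eqP; rewrite eqr_int => /eqP.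
    move/(congr1 (fun x : int => `|x|%N)); rewrite abszM /= => /eqP.
    by rewrite muln_eq1 => /andP[/eqP p1 _]; have := pr_p; rewrite p1.
have O1' : O 1.
  have [[x Ox]|Oe] := pselect (exists x, O x); first exact: u1 Ox.
  exfalso; apply: (Omax _ _ intQ); split; last by move=> h; apply: Oe; exists 1; apply: h; exists 1; rewrite rmorph1.
  by move=> x Ox; exfalso; apply: Oe; exists x.
exists O; split => // O' [h1 h2 h3] sub nP x O'x; apply: contrapT => Ox.
apply: (Omax O'); last by split.
by split => // h; apply: Ox; apply: h.
Qed.

Section Valuation.
Variable O : set K.
Hypothesis sO : is_subring O.
Hypothesis nOP : ~ O P^-1.
Hypothesis Omax : forall O', is_subring O' -> O `<=` O' -> ~ O' P^-1 -> O' `<=` O.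

Let O1 : O 1. Proof. by case: sO. Qed.
Let OB x y : O x -> O y -> O (x - y). Proof. by case: sO => _ + _; apply. Qed.
Let OM x y : O x -> O y -> O (x * y). Proof. by case: sO => _ _; apply. Qed.
Let O0 : O 0. Proof. by rewrite -(subrr 1); apply: OB. Qed.
Let ON x : O x -> O (- x). Proof. by move=> h; rewrite -sub0r; apply: OB. Qed.
Let OD x y : O x -> O y -> O (x + y).
Proof. by move=> hx hy; rewrite -[y]opprK; apply: OB => //; apply: ON. Qed.
Let OX x n : O x -> O (x ^+ n).
Proof. by move=> hx; elim: n => [|n IH]; rewrite ?expr0// exprS; apply: OM. Qed.
Let Osum (I : Type) (s : seq I) (Q : pred I) F : (forall i, Q i -> O (F i)) -> O (\sum_(i <- s | Q i) F i).
Proof. by move=> h; apply: (big_ind O). Qed.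
Let Onat n : O n%:R.
Proof. by elim: n => [|n IH]; rewrite ?mulr0n// -[n.+1]addn1 natrD; apply: OD. Qed.
Let Oint z : O z%:~R.
Proof. by case: z => n; rewrite ?NegzE ?rmorphN; [exact: Onat|apply: ON; exact: Onat]. Qed.

(* O[x] contains 1/p as soon as x is not in O, by maximality. *)
Lemma adjoin x : ~ O x -> exists n (c : nat -> K), (forall i, O (c i)) /\
  \sum_(i < n) c i * x ^+ i = P^-1.
Proof.
move=> Ox; apply: contrapT => h.
pose O' : set K := [set y | exists q : {poly K}, (forall i, O q`_i) /\ y = q.[x]].
apply: Ox; apply: (Omax (O' := O')).
- split.
  + by exists 1; split=> [i|]; rewrite ?hornerC// coefC; case: ifP.
  + move=> _ _ [q [hq ->]] [q' [hq' ->]]; exists (q - q'); rewrite hornerD hornerN.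
    by split=> // i; rewrite coefB; apply: OB.
  + move=> _ _ [q [hq ->]] [q' [hq' ->]]; exists (q * q'); rewrite hornerM.
    by split=> // i; rewrite coefM; apply: Osum => j _; apply: OM.
- move=> y Oy; exists y%:P; rewrite hornerC; split=> // i.
  by rewrite coefC; case: ifP.
- move=> [q [hq e]]; apply: h; exists (size q), (fun i => q`_i); split=> //.
  by rewrite e horner_coef.
- by exists 'X; rewrite hornerX; split=> // i; rewrite coefX; case: eqP.
Qed.

(** [p] lies in the Jacobson radical of [O]. If the inverse of [y = 1 - p b] were outside [O], then
    [1 / p] would be a polynomial in this inverse of degree less than [n]; multiplying by [y ^+ n],
    which has the form [1 - p d], puts [1 / p - d] into [O]. *)
Lemma unit_1P b : O b -> 1 - P * b != 0 /\ O (1 - P * b)^-1.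
Proof.
move=> Ob; have y0 : 1 - P * b != 0.
  apply/eqP => /subr0_eq e; apply: nOP.
  by rewrite -[P^-1]mulr1 e mulrA mulVf ?P_neq0// mul1r.
split=> //; apply: contrapT => /adjoin[n [c [hc e]]].
set y := 1 - P * b in y0 e.
have Oy : O y by apply: OB => //; apply: OM => //; exact: Onat.
have [d [Od hd]] : exists d, O d /\ y ^+ n = 1 - P * d.
  elim: (n) => [|k [d [Od hd]]]; first by exists 0; rewrite expr0 mulr0 subr0.
  exists (d + b - P * b * d); split.
    apply: OB; first exact: OD.
    by apply: OM => //; apply: OM => //; exact: Onat.
  by rewrite exprS hd /y; ring.
have : O (y ^+ n * P^-1).
  rewrite -e mulr_sumr; apply: Osum => i _; rewrite mulrCA; apply: OM => //.
  have -> : y ^+ n = y ^+ (n - i) * y ^+ i by rewrite -exprD subnK// ltnW.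
  by rewrite exprVn mulfK ?expf_neq0//; exact: OX.
rewrite hd mulrBl mul1r mulrAC mulfV ?P_neq0// mul1r => h.
by apply: nOP; rewrite -[P^-1](subrK d); apply: OD.
Qed.

(** The relation of Chevalley's extension argument: [1] is a polynomial of degree at most [n] in [x]
    with coefficients in the ideal [p O]. It exists for some [n] whenever [x] is not in [O]. *)
Definition relP x n := exists c : nat -> K,
  (forall i, exists2 b, O b & c i = P * b) /\ \sum_(i < n.+1) c i * x ^+ i = 1.

Lemma relP_adjoin x : ~ O x -> exists n, relP x n.
Proof.
case/adjoin => n [c [hc e]]; exists n, (fun i => if (i < n)%N then P * c i else 0).
split=> [i|].
  by case: ifP => _; [exists (c i)|exists 0; rewrite ?mulr0].
rewrite big_ord_recr /= ltnn mul0r addr0.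
under eq_bigr => i _ do rewrite ltn_ord -mulrA.
by rewrite -mulr_sumr e mulfV// P_neq0.
Qed.

Lemma relP_mono x n n' : (n <= n')%N -> relP x n -> relP x n'.
Proof.
move=> nn [c [hc e]]; exists (fun i => if (i < n.+1)%N then c i else 0); split.
  by move=> i; case: ifP => _ //; exists 0; rewrite ?mulr0.
rewrite -(big_mkord xpredT (fun i => (if (i < n.+1)%N then c i else 0) * x ^+ i)).
rewrite (big_cat_nat (n := n.+1))//= [X in _ + X]big1_seq ?addr0; last first.
  by move=> i /andP[_]; rewrite mem_index_iota => /andP[h _]; rewrite ltnNge h mul0r.
rewrite (eq_big_nat _ _ (F2 := fun i => c i * x ^+ i)); last by move=> i /andP[_ ->].
by rewrite big_mkord.
Qed.

(** The relation for [x^-1], solved with the unit [1 - d 0], expresses [x ^+ n.+1] by lower powers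
    of [x]; substituting this in the relation for [x] lowers the degree. *)
Lemma relP_reduce x n : x != 0 -> relP x n.+1 -> relP x^-1 n.+1 -> relP x n.
Proof.
move=> x0 [c [hc ec]] [d [hd ed]].
have [b0 Ob0 hb0] := hd 0%N; have [u0 Ou] := unit_1P Ob0.
set u := 1 - P * b0 in u0 Ou.
exists (fun i => c i + c n.+1 * d (n.+1 - i)%N / u); split.
  move=> i; have [b Ob ->] := hc i; have [b' Ob' ->] := hc n.+1.
  have [b'' Ob'' ->] := hd (n.+1 - i)%N.
  exists (b + b' * (P * b'') / u); last by ring.
  by do ![apply: OD => // | apply: OM => //]; exact: Onat.
under eq_bigr do rewrite mulrDl.
rewrite big_split /= -[RHS]ec [RHS]big_ord_recr /=; congr (_ + _).
apply: (mulfI u0); rewrite mulr_sumr.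
have -> : u * (c n.+1 * x ^+ n.+1) = c n.+1 * x ^+ n.+1 * (1 - d 0%N) by rewrite mulrC /u hb0.
have -> : 1 - d 0%N = \sum_(i < n.+1) d i.+1 * x^-1 ^+ i.+1.
  by rewrite -ed big_ord_recl expr0 mulr1 addrC addKr.
rewrite mulr_sumr [RHS](reindex_inj rev_ord_inj) /=; apply: eq_bigr => i _.
have -> : (n.+1 - i.+1).+1 = (n.+1 - i)%N by rewrite subSS subSn// -ltnS.
have -> : x ^+ n.+1 = x ^+ i * x ^+ (n.+1 - i) by rewrite -exprD subnKC// ltnW.
have xn : x ^+ (n.+1 - i) != 0 by rewrite expf_neq0.
by rewrite exprVn; field; rewrite u0 xn.
Qed.

(** If neither were in [O], relations of a common degree for both could be lowered together down to
    degree 0, which says that [1] is in [p O]. *)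
Lemma valuation x : x != 0 -> O x \/ O x^-1.
Proof.
move=> x0; have [|Ox] := pselect (O x); [by left|right].
apply: contrapT => Ox'.
have [n hn] := relP_adjoin Ox; have [n' hn'] := relP_adjoin Ox'.
have := relP_mono (leq_maxl n n') hn; have := relP_mono (leq_maxr n n') hn'.
elim: (maxn n n') => [|k IH h2 h1].
  move=> _ [c [hc]]; rewrite big_ord1 expr0 mulr1; have [b Ob ->] := hc 0%N => e.
  by apply: nOP; rewrite -[P^-1]mulr1 -e mulrA mulVf ?P_neq0// mul1r.
apply: IH; last exact: relP_reduce.
by apply: relP_reduce; rewrite ?invr_eq0 ?invrK.
Qed.

Definition ounit x := [/\ x != 0, O x & O x^-1].

Lemma ounitM x y : ounit x -> ounit y -> ounit (x * y).
Proof. by move=> [x0 x1 x2] [y0 y1 y2]; split; rewrite ?mulf_neq0// ?invfM; apply: OM. Qed.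
Lemma ounitV x : ounit x -> ounit x^-1.
Proof. by move=> [x0 x1 x2]; split; rewrite ?invr_eq0 ?invrK. Qed.
Lemma ounitX x n : ounit x -> ounit (x ^ n).
Proof.
move=> hx; have h k : ounit (x ^+ k).
  by elim: k => [|k IH]; rewrite ?expr0 ?exprS; [split; rewrite ?oner_eq0 ?invr1|exact: ounitM].
by case: n => k; [exact: h|rewrite NegzE; apply: ounitV; exact: h].
Qed.

Lemma ounit_exp n : ounit (P ^ n) -> n = 0.
Proof.
have h k : ~ O (P ^+ k.+1)^-1.
  move=> h; apply: nOP; rewrite -[P^-1]mul1r -(mulfV (expf_neq0 k P_neq0)) -mulrA -invfM.
  by rewrite -exprSr; apply: OM => //; apply: OX; exact: Onat.
case: n => [[|k]|k] // [_ h1 h2]; first by case: (h k).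
by rewrite NegzE in h1; case: (h k).
Qed.

Lemma ounit_nat a : coprime a p -> ounit a%:R.
Proof.
move=> cop; have a0 : (0 < a)%N by case: a cop => //; rewrite /coprime gcd0n => /eqP p1; have := pr_p; rewrite p1.
case: (egcdnP p a0) => u v; rewrite (eqP cop) => ea _.
have : (u * a)%:R = 1 - P * (- v%:R) :> K.
  by rewrite ea natrD natrM mulrN opprK addrC /P mulrC.
move=> e2; have [n0 Oi] := unit_1P (ON (Onat v)).
split; rewrite ?pnatr_eq0 ?gt_eqF//.
rewrite -e2 natrM in n0 Oi.
have u0 : u%:R != 0 :> K by apply: contra_neq n0 => ->; rewrite mul0r.
have -> : a%:R^-1 = u%:R * (u%:R * a%:R)^-1 :> K by rewrite invfM mulrA mulfV// mul1r.
exact: OM.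
Qed.

Lemma rat_val (q : rat) : q != 0 -> exists k : int, ounit (ratr q * P ^ k).
Proof.
move=> q0; have hn a : (0 < a)%N -> exists k : nat, exists b, ounit b /\ a%:R = b * P ^+ k :> K.
  move=> a0; have [b cop ->] := pfactor_coprime pr_p a0.
  exists (logn p a), b%:R; split; first by apply: ounit_nat; rewrite coprime_sym.
  by rewrite natrM natrX.
have hz (z : int) : z != 0 -> exists k : nat, exists b, ounit b /\ z%:~R = b * P ^+ k :> K.
  move=> z0; have [|k [b [ub e]]] := hn `|z|%N; first by rewrite absz_gt0.
  exists k; exists ((sgz z)%:~R * b); split; last by rewrite -mulrA -e pmulrn -rmorphM /= -intEsg.
  apply: ounitM => //; case: sgzP z0 => // _ _; split; rewrite ?rmorphN ?rmorph1 ?oppr_eq0 ?oner_eq0 ?invrN ?invr1//.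
    exact: ON.
  exact: ON.
have nq0 : numq q != 0 by rewrite numq_eq0.
have [kn [bn [ubn en]]] := hz _ nq0; have [kd [bd [ubd ed]]] := hz _ (denq_neq0 q).
exists (kd%:Z - kn%:Z); have -> : ratr q * P ^ (kd%:Z - kn%:Z) = bn * bd^-1.
  rewrite /ratr en ed expfzDr ?P_neq0// -invr_expz -!exprnP.
  have [bd0 _ _] := ubd; field.
  by rewrite bd0 !expf_neq0 ?P_neq0.
by apply: ounitM => //; exact: ounitV.
Qed.

Definition oideal x := O x /\ ~ ounit x.

Lemma oidealD x y : oideal x -> oideal y -> oideal (x + y).
Proof.
have wlog_ a b : a != 0 -> O (b / a) -> oideal a -> oideal b -> oideal (a + b).
  move=> a0 hba [Oa na] [Ob nb]; split; first exact: OD.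
  move=> [ab0 _ Oi]; apply: na; split=> //.
  have e : 1 + b / a = (a + b) / a by field.
  suff -> : a^-1 = (1 + b / a) * (a + b)^-1 by apply: OM => //; exact: OD.
  by rewrite e; field; rewrite ab0 a0.
move=> hx hy; have [->|x0] := eqVneq x 0; first by rewrite add0r.
have [->|y0] := eqVneq y 0; first by rewrite addr0.
have yx0 : y / x != 0 by rewrite mulf_neq0// invr_eq0.
case: (valuation yx0) => h; first exact: wlog_.
by rewrite addrC; apply: wlog_ => //; rewrite -invf_div.
Qed.

(** Division by a term of largest size gives [1] plus a sum in [O]. If no other term had this size,
    that sum would lie in the ideal of nonunits and could not be [-1]. *)
Lemma dominant_terms n (t : 'I_n -> K) : (exists i, t i != 0) -> \sum_i t i = 0 ->
  exists i j, [/\ i != j, t i != 0, t j != 0 & ounit (t i / t j)].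
Proof.
move=> [i0 ti0] hsum.
have [i [ti hi]] : exists i, t i != 0 /\ forall j, j \in enum 'I_n -> O (t j / t i).
  elim: (enum 'I_n) => [|j s [i [ti hi]]]; first by exists i0.
  have [tj|tj] := eqVneq (t j) 0.
    by exists i; split=> // k; rewrite inE => /orP[/eqP ->|/hi//]; rewrite tj mul0r.
  have tij : t i / t j != 0 by rewrite mulf_neq0// invr_eq0.
  case: (valuation tij) => h.
    exists j; split=> // k; rewrite inE => /orP[/eqP ->|/hi hk]; first by rewrite mulfV.
    have -> : t k / t j = t k / t i * (t i / t j) by field; rewrite tj ti.
    exact: OM.
  exists i; split=> // k; rewrite inE => /orP[/eqP ->|/hi//].
  by rewrite -invf_div.
apply: contrapT => hn.
have hid j : j != i -> oideal (t j / t i).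
  move=> ji; split; first by apply: hi; rewrite mem_enum.
  move=> u; have [u0 _ _] := u.
  apply: hn; exists j, i; split=> //.
  by apply: contra_neq u0 => ->; rewrite mul0r.
have : oideal (\sum_(j | j != i) t j / t i).
  apply: (big_ind oideal) => //; last exact: oidealD.
  by split=> // -[]; rewrite eqxx.
case=> _; apply; have : (\sum_j t j) / t i = 0 by rewrite hsum mul0r.
rewrite mulr_suml (bigD1 i)//= mulfV// => /eqP; rewrite addrC addr_eq0 => /eqP ->.
by split; rewrite ?oppr_eq0 ?oner_eq0 ?invrN ?invr1//; apply: ON.
Qed.

(** Values are rational: [x] has the size of [p] to the power [- k / (n + 1)]. The shift [n.+1]
    keeps the exponent of [x] positive. *)
Definition has_val (x : K) (n : nat) (k : int) := ounit (x ^+ n.+1 * P ^ k).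

Lemma ratr_eq0 (q : rat) : (ratr q == 0 :> K) = (q == 0).
Proof. exact: fmorph_eq0. Qed.

(** Two terms of the algebraic equation of [x] have the same size; comparing [q i * x ^+ i] with
    [q j * x ^+ j] makes the power [i - j] of [x] a unit times a power of [p]. *)
Lemma has_val_ex x (n : nat) (q : nat -> rat) : x != 0 ->
  (exists2 i, (i < n)%N & q i != 0) -> \sum_(i < n) ratr (q i) * x ^+ i = 0 ->
  exists n k, has_val x n k.
Proof.
move=> x0 [i0 i0n qi0] /dominant_terms[|i [j [ij]]].
  exists (Ordinal i0n); by rewrite mulf_neq0 ?expf_neq0// ratr_eq0.
have hnz i' : ratr (q i') * x ^+ i' != 0 -> q i' != 0.
  by apply: contra_neq => ->; rewrite rmorph0 mul0r.
move=> /hnz qi /hnz qj hu.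
have [ki ui] := rat_val qi; have [kj uj] := rat_val qj.
have {hu} : ounit (x ^+ i / x ^+ j * P ^ (kj - ki)).
  have -> : x ^+ i / x ^+ j * P ^ (kj - ki) =
     (ratr (q i) * x ^+ i / (ratr (q j) * x ^+ j)) * (ratr (q j) * P ^ kj) *
     (ratr (q i) * P ^ ki)^-1.
    rewrite expfzDr ?P_neq0// -invr_expz; field.
    by rewrite !ratr_eq0 qi qj !expf_neq0// expfz_neq0// P_neq0.
  by apply: ounitM; [exact: ounitM|exact: ounitV].
move: (kj - ki) => k {ki kj ui uj}.
wlog lt : i j k ij qi qj / (j < i)%N.
  move=> hw hu; have := ij; rewrite neq_ltn => /orP[lt|lt]; last exact: hw hu.
  apply: (hw j i (- k)) => //; first by rewrite eq_sym.
  have -> : x ^+ j / x ^+ i * P ^ (- k) = (x ^+ i / x ^+ j * P ^ k)^-1.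
    by rewrite -invr_expz !invfM invrK (mulrC (x ^+ j)).
  exact: ounitV.
move=> hu; exists (i - j).-1, k; rewrite /has_val prednK ?subn_gt0//.
by move: hu; rewrite -(expfB x lt).
Qed.

Lemma has_val_unique x n k n' k' : x != 0 -> has_val x n k -> has_val x n' k' ->
  k * n'.+1%:Z = k' * n.+1%:Z.
Proof.
move=> x0 /(ounitX n'.+1) h1 /(ounitX n.+1)/ounitV h2; have := ounitM h1 h2.
rewrite !expfzMl -!exprnP -!exprM !exprnP !exprz_exp invfM mulrACA mulnC mulfV ?expf_neq0//.
rewrite mul1r invr_expz -expfzDr ?P_neq0// => /ounit_exp/eqP.
by rewrite subr_eq0 => /eqP.
Qed.

Lemma has_valM x y n k n' k' : has_val x n k -> has_val y n' k' ->
  has_val (x * y) (n.+1 * n'.+1).-1 (k * n'.+1%:Z + k' * n.+1%:Z).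
Proof.
move=> /(ounitX n'.+1) h1 /(ounitX n.+1) h2; have := ounitM h1 h2.
rewrite /has_val prednK ?muln_gt0// !expfzMl -!exprnP -!exprM !exprnP !exprz_exp.
by rewrite -!exprnP exprMn expfzDr ?P_neq0// (mulnC n'.+1) mulrACA.
Qed.

Lemma has_val_in x n k : x != 0 -> has_val x n k -> k <= 0 <-> O x.
Proof.
move=> x0 [_ h1 h2]; split=> [k0|Ox].
  have [//|Oi] := valuation x0.
  have : O (x ^+ n.+1 * P ^ k * P ^ (- k)).
    apply: OM => //; case: k k0 {h1 h2} => [[|k]|k]// _.
    by rewrite NegzE opprK; apply: OX; exact: Onat.
  rewrite -mulrA -expfzDr ?P_neq0// subrr expr0z mulr1 => h.
  rewrite -[x](_ : x ^+ n.+1 * x^-1 ^+ n = x); first by apply: OM => //; apply: OX.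
  by rewrite exprVn exprS mulfK// expf_neq0.
rewrite leNgt; apply/negP; case: k h1 h2 => [[|k]|k]// h1 h2 _; apply: nOP.
have -> : P^-1 = x ^+ n.+1 * P ^+ k * (x ^+ n.+1 * P ^ k.+1)^-1.
  have -> : P ^ k.+1 = P * P ^+ k by rewrite -exprnP exprS.
  by rewrite (mulrCA _ P) invfM mulrCA mulfV ?mulr1// mulf_neq0// expf_neq0// P_neq0.
by apply: OM => //; apply: OM; apply: OX => //; exact: Onat.
Qed.

End Valuation.

(* |x| is exp (k / n) when x ^ n * p ^ k is a unit of the valuation ring. *)
Theorem padic_absval (R : realType) :
  (forall x : K, exists n (q : nat -> rat), (exists2 i, (i < n)%N & q i != 0) /\
     \sum_(i < n) ratr (q i) * x ^+ i = 0) ->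
  exists a : K -> R, [/\ is_absval a, forall x y, a (x + y) <= Num.max (a x) (a y) & a P < 1].
Proof.
move=> halg; have [A0 [sO nOP Omax]] := maximal_subring.
pose V x (nk : nat * int) := has_val A0 x nk.1 nk.2.
have Vex x : x != 0 -> exists nk, V x nk.
  move=> x0; have [n [q [hq e]]] := halg x.
  have [n' [k h]] := has_val_ex sO nOP Omax x0 hq e.
  by exists (n', k).
pose v (nk : nat * int) : R := nk.2%:~R / nk.1.+1%:R.
pose nkx x : nat * int := xget (0%N, 0) [set nk | V x nk].
have nkP x : x != 0 -> V x (nkx x).
  by move=> x0; apply: (@xgetPex _ (0%N, 0) [set nk | V x nk]); exact: Vex.
pose a x : R := if x == 0 then 0 else expR (v (nkx x)).
have vE x nk : x != 0 -> V x nk -> v (nkx x) = v nk.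
  move=> x0 h; have := has_val_unique sO nOP x0 (nkP _ x0) h.
  move/(congr1 (fun z : int => z%:~R : R)); rewrite !rmorphM /= -!pmulrn => e.
  by apply/eqP; rewrite /v eqr_div// e.
have aM x y : a (x * y) = a x * a y.
  rewrite /a mulf_eq0; case: eqVneq => [|x0]; first by rewrite mul0r.
  case: eqVneq => [|y0]; first by rewrite mulr0.
  have xy0 : x * y != 0 by rewrite mulf_neq0.
  rewrite -expRD; congr expR.
  have /(vE (x * y) (_, _) xy0) -> := has_valM sO (nkP _ x0) (nkP _ y0).
  rewrite /v; cbn [fst snd].
  have -> : ((nkx x).1.+1 * (nkx y).1.+1).-1.+1 = ((nkx x).1.+1 * (nkx y).1.+1)%N by rewrite prednK.
  rewrite rmorphD !rmorphM /= -!pmulrn natrM.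
  have hA : (nkx x).1.+1%:R != 0 :> R by rewrite pnatr_eq0.
  have hB : (nkx y).1.+1%:R != 0 :> R by rewrite pnatr_eq0.
  move: ((nkx x).1.+1%:R : R) ((nkx y).1.+1%:R : R) hA hB => A B hA hB.
  by field; rewrite hA hB.
have a_ge0 x : 0 <= a x by rewrite /a; case: ifP => // _; exact: expR_ge0.
have a_eq0 x : (a x == 0) = (x == 0).
  by rewrite /a; case: ifP => [|_]; rewrite ?eqxx// gt_eqF// expR_gt0.
have a_le1 x : a x <= 1 <-> A0 x.
  rewrite /a; case: eqVneq => [->|x0].
    by split=> // _; have [u1 uB _] := sO; rewrite -(subrr 1); exact: uB.
  rewrite -(has_val_in sO nOP Omax x0 (nkP _ x0)) -[X in _ <= X]expR0 ler_expR /v.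
  by rewrite ler_pdivrMr// mul0r lerz0.
have aU x y : a (x + y) <= Num.max (a x) (a y).
  wlog xy : x y / a x <= a y.
    move=> hw; have [h|h] := boolP (a x <= a y); first exact: hw.
    by rewrite addrC maxC; apply: hw; rewrite ltW// ltNge.
  rewrite (le_trans _ (_ : a y <= _))//; last by rewrite le_max lexx orbT.
  have [y0|y0] := eqVneq y 0.
    move: xy; rewrite {1 2}/a y0 eqxx addr0; case: ifP => [/eqP ->|_]; first by rewrite /a eqxx.
    by rewrite leNgt expR_gt0.
  have ay : 0 < a y by rewrite lt0r a_eq0 y0 a_ge0.
  have xd : x + y = y * (x / y + 1) by field.
  rewrite xd aM ler_piMr ?a_ge0//; apply/a_le1.
  have [u1 uB uM] := sO.
  rewrite -[1]opprK; apply: (uB) => //; last by rewrite -sub0r -(subrr 1); apply: (uB) => //; apply: (uB).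
  apply/a_le1; rewrite aM -(ler_pM2r ay) -mulrA -aM mulVf// mul1r.
  suff -> : a 1 = 1 by rewrite mulr1.
  have := aM 1 1; rewrite mulr1 => e; apply: (@mulfI _ (a 1)); rewrite ?a_eq0 ?oner_eq0//.
  by rewrite -e mulr1.
exists a; split=> //.
- split=> // x y; apply: (le_trans (aU _ _)).
  by rewrite ge_max lerDl lerDr !a_ge0.
- have VP : V P (0%N, -1).
    rewrite /V /has_val /= expr1 exprN1 mulfV ?P_neq0//.
    by have [u1 _ _] := sO; split; rewrite ?oner_eq0 ?invr1.
  rewrite /a (negbTE P_neq0) (vE _ _ P_neq0 VP) -[X in _ < X]expR0 ltr_expR /v /=.
  by rewrite divr1 rmorphN rmorph1 oppr_lt0.
Qed.

End PadicAbsval.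

(** * Bounded integral traces *)

Section Idempotent.
Variables (F : numFieldType).

(** In a full rank factorisation [e = C *m D], idempotence cancels to [D *m C = 1], and [C *m D] has
    the same trace. *)
Lemma mxtrace_idem k (e : 'M[F]_k) : e *m e = e -> \tr e = (\rank e)%:R.
Proof.
have [r [re [C [D [CD [C' C'C] [D' DD']]]]]] : exists r, r = \rank e /\
    exists C : 'M[F]_(k, r), exists D : 'M[F]_(r, k), [/\ C *m D = e, exists C', C' *m C = 1%:M & exists D', D *m D' = 1%:M].
  exists (\rank e); split=> //; exists (col_base e), (row_base e); split; first exact: mulmx_base.
    by exists (pinvmx (col_base e)); apply: mulVpmx; exact: col_base_full.
  by exists (pinvmx (row_base e)); apply: mulmxVp; exact: row_base_free.
move=> ee; have DC : D *m C = 1%:M.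
  have K1 (Y : 'M[F]_(r, k)) : C' *m (C *m Y) = Y by rewrite mulmxA C'C mul1mx.
  have K2 (Y : 'M[F]_r) : Y *m D *m D' = Y by rewrite -mulmxA DD' mulmx1.
  move: ee; rewrite -CD -(mulmxA C D) => /(congr1 (fun M => C' *m M *m D')).
  by rewrite !K1 mulmxA K2 DD'.
by rewrite -re -[in LHS]CD mxtrace_mulC DC mxtrace1.
Qed.

(** The projection [e] onto the generalised eigenspace of 1 is a polynomial in [j], and because 1 is
    not 0 it can be taken without constant term, so its trace vanishes. In characteristic 0 an
    idempotent of trace 0 is 0, while [e] fixes [w]. *)
Lemma trace_powers_no_fix k (j : 'M[F]_k.+1) (w : 'rV_k.+1) :
  (forall n, \tr (j ^+ n.+1) = 0) -> w *m j = w -> w = 0.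
Proof.
move=> htr wj; apply/eqP; apply: contraT => w0.
have pN0 : char_poly j != 0 by rewrite monic_neq0// char_poly_monic.
have [a [q]] := multiplicity_XsubC (char_poly j) 1; rewrite pN0 /= => q1 pE.
have p1 : root (char_poly j) 1.
  by rewrite -eigenvalue_root_char; apply/eigenvalueP; exists w; rewrite ?scale1r.
have a0 : (0 < a)%N by case: a pE => // pE; rewrite pE expr0 mulr1 (negbTE q1) in p1.
have cop : coprimep (('X - 1%:P) ^+ a) ('X * q).
  rewrite coprimep_expl// coprimep_sym coprimepMl !coprimep_XsubC q1 andbT.
  by rewrite rootX oner_eq0.
have /Bezout_eq1_coprimepP[[u v] /= uv] := cop.
pose f := v * ('X * q); pose e := horner_mx j f.
have f0 : f`_0 = 0 by rewrite /f mulrCA coefXM.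
have ee : e *m e = e.
  have f2 : f * f = f - (v * 'X * u) * char_poly j.
    rewrite -[X in X - _]mulr1 -uv pE /f; ring.
  have ff : f * f - f = - (v * 'X * u) * char_poly j by rewrite f2; ring.
  have : horner_mx j (f * f - f) = 0 by rewrite ff rmorphM /= Cayley_Hamilton mulr0.
  by rewrite rmorphB rmorphM => /subr0_eq.
have we : w *m e = w.
  rewrite /e (_ : w *m _ = f.[1] *: w); last first.
    have hw n : w *m j ^+ n = w.
      by elim: n => [|n IH]; rewrite ?expr0 ?mulmx1// exprSr -[_ * _]/(_ *m _) mulmxA IH.
    elim/poly_ind: f {f0 e ee} => [|g c IH]; first by rewrite rmorph0 mulmx0 horner0 scale0r.
    rewrite rmorphD rmorphM /= horner_mx_X horner_mx_C mulmxDr mul_mx_scalar.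
    by rewrite -[_ * _]/(_ *m _) mulmxA IH -scalemxAl wj hornerMXaddC mulr1 scalerDl.
  have : (u * ('X - 1%:P) ^+ a + f).[1] = 1 by rewrite uv hornerC.
  by rewrite hornerD hornerM horner_exp hornerXsubC subrr expr0n gtn_eqF// mulr0 add0r => ->; rewrite scale1r.
have tre : \tr e = 0.
  rewrite /e -[f](coefK) poly_def rmorph_sum /= linear_sum /=.
  case: (size f) => [|n]; first by rewrite big_ord0.
  rewrite big_ord_recl f0 scale0r rmorph0 linear0 add0r big1// => i _.
  by rewrite linearZ /= rmorphXn /= horner_mx_X mxtraceZ htr mulr0.
have /eqP : (\rank e)%:R = 0 :> F by rewrite -mxtrace_idem.
rewrite pnatr_eq0 mxrank_eq0 => /eqP e0.
by rewrite e0 mulmx0 in we; rewrite -we eqxx in w0.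
Qed.

End Idempotent.

Section TraceInt.
Variable R : realType.

Lemma trace_roots (K : closedFieldType) k (T : 'M[K]_k) : exists rs : seq K,
  [/\ size rs = k, \tr T = \sum_(z <- rs) z &
      forall z, z \in rs -> exists2 w : 'rV_k, w != 0 & w *m T = z *: w].
Proof.
have [rs hrs] := closed_field_poly_normal (char_poly T).
rewrite (monicP (char_poly_monic T)) scale1r in hrs.
have hsz : size rs = k.
  by have := size_char_poly T; rewrite hrs size_prod_XsubC => -[].
exists rs; split=> //.
  case: k T hrs hsz => [|k] T hrs hsz.
    by rewrite /mxtrace big_ord0 (size0nil hsz) big_nil.
  have := char_poly_trace T (ltn0Sn k); rewrite hrs.
  by have := @coefPn_prod_XsubC _ rs; rewrite hsz => /(_ isT) -> /oppr_inj.
move=> z; rewrite -root_prod_XsubC -hrs -eigenvalue_root_char => /eigenvalueP[w e w0].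
by exists w.
Qed.

Lemma normc_absval : is_absval (@Normc.normc R : R[i] -> R).
Proof.
split.
- by move=> [x y]; exact: sqrtr_ge0.
- move=> x; apply/eqP/eqP => [/Normc.eq0_normc//|->]; exact: Normc.normc0.
- exact: Normc.normcM.
- exact: le_normcD.
Qed.

Lemma normc_int (z : int) : Normc.normc (z%:~R : R[i]) = `|z%:~R : R|.
Proof.
rewrite (_ : z%:~R = real_complex R z%:~R); last by rewrite rmorph_int.
by rewrite /= expr0n /= addr0 sqrtr_sqr.
Qed.

Lemma algC_algebraic (x : algC) : exists n (q : nat -> rat),
  (exists2 i, (i < n)%N & q i != 0) /\ \sum_(i < n) ratr (q i) * x ^+ i = 0.
Proof.
have [p [hp pm] _] := minCpolyP x.
exists (size p), (fun i => p`_i); split.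
  exists (size p).-1; first by rewrite prednK// size_poly_gt0 monic_neq0.
  by rewrite -/(lead_coef p) (monicP pm) oner_eq0.
have := root_minCpoly x; rewrite hp => /rootP; rewrite horner_coef size_map_poly.
by move=> e; rewrite -[RHS]e; apply: eq_bigr => i _; rewrite coef_map.
Qed.

Lemma ultra_int (K : numFieldType) (a : K -> R) : is_absval a ->
  (forall x y, a (x + y) <= Num.max (a x) (a y)) -> forall z : int, a z%:~R <= 1.
Proof.
move=> ha aU; have hn n : a n%:R <= 1.
  elim: n => [|n IH]; first by rewrite (absval0 ha).
  by rewrite -[n.+1]addn1 natrD (le_trans (aU _ _))// ge_max IH (absval1 ha) lexx.
have aN : a (-1) = 1.
  have : a (-1) ^+ 2 == 1 by rewrite expr2 -(absvalM ha) mulrNN mulr1 (absval1 ha).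
  rewrite sqrf_eq1 => /orP[/eqP//|/eqP e]; have := absval_ge0 ha (-1).
  by rewrite e oppr_ge0 ler10.
case=> n; first exact: hn.
by rewrite NegzE rmorphN /= -mulN1r (absvalM ha) aN mul1r; exact: hn.
Qed.

(** If a prime divides the denominator, the denominator has size less than 1, hence so has the
    numerator, and a Bezout relation between them gives 1 a size less than 1. *)
Lemma rat_integral (q : rat) :
  (forall p, prime p -> exists a : algC -> R, [/\ is_absval a,
     forall x y, a (x + y) <= Num.max (a x) (a y), a p%:R < 1 & a (ratr q) <= 1]) ->
  exists z : int, q = z%:~R.
Proof.
move=> h; have [d1|d1] := eqVneq `|denq q|%N 1%N.
  exists (numq q); rewrite -[LHS]divq_num_den.
  by rewrite -[denq q]gez0_abs ?denq_ge0// d1 rmorph1 divr1.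
have dgt : (1 < `|denq q|)%N by rewrite ltn_neqAle eq_sym d1 absz_gt0 denq_neq0.
have [a [ha aU ap aq]] := h _ (pdiv_prime dgt).
have hz := ultra_int ha aU.
have aden : a (denq q)%:~R < 1.
  have [c hc] : exists c, `|denq q|%N = (c * pdiv `|denq q|)%N.
    by exists (`|denq q| %/ pdiv `|denq q|)%N; rewrite divnK ?pdiv_dvd.
  move: (pdiv _) hc ap => pp hc ap.
  rewrite -[denq q]gez0_abs ?denq_ge0// hc PoszM rmorphM /=.
  rewrite (absvalM ha) -[X in _ < X]mulr1 (le_lt_trans (ler_wpM2r (absval_ge0 ha _) (hz _)))//.
  by rewrite !mul1r -pmulrn.
have anum : a (numq q)%:~R < 1.
  have -> : (numq q)%:~R = ratr q * (denq q)%:~R :> algC.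
    by rewrite /ratr divfK// intr_eq0 denq_neq0.
  rewrite (absvalM ha) (le_lt_trans _ aden)// ler_piMl ?(absval_ge0 ha)//.
have [u [v e]] := Bezoutz (numq q) (denq q).
have g1 : gcdz (numq q) (denq q) = 1.
  by apply/eqP; have := coprime_num_den q; rewrite /coprime /gcdz => /eqP ->.
have : a 1 < 1; last by rewrite (absval1 ha) ltxx.
have -> : 1 = u%:~R * (numq q)%:~R + v%:~R * (denq q)%:~R :> algC.
  by rewrite -!rmorphM -rmorphD /= e g1.
apply: (le_lt_trans (aU _ _)); rewrite gt_max !(absvalM ha).
by rewrite !(le_lt_trans (ler_wpM2r (absval_ge0 ha _) (hz _)))// mul1r.
Qed.

(** The hypothesis is used over [algC] with absolute values for which a given prime is small, which
    makes the trace integral, and over [R[i]] with the modulus, which bounds it by the number of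
    eigenvalues. *)
Lemma trace_int k (T : 'M[rat]_k) :
  (forall (K : numClosedFieldType) (a : K -> R), is_absval a ->
     forall (w : 'rV[K]_k) l, w != 0 -> w *m map_mx ratr T = l *: w -> a l = 1) ->
  exists2 z : int, \tr T = z%:~R & (`|z| <= k)%N.
Proof.
move=> hT; have [z hz] : exists z : int, \tr T = z%:~R.
  apply: rat_integral => p pr_p.
  have [a [ha aU ap]] := padic_absval pr_p R algC_algebraic.
  exists a; split=> //; have [rs [_ e hrs]] := trace_roots (map_mx (ratr : rat -> algC) T).
  rewrite -trace_map_mx e.
  have {}hrs z : z \in rs -> a z = 1 by case/hrs => w w0 wz; exact: hT wz.
  elim: rs {e} hrs => [|z rs IH] hrs; first by rewrite big_nil (absval0 ha).
  rewrite big_cons (le_trans (aU _ _))// ge_max hrs ?mem_head//= lexx /=.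
  by apply: IH => x xs; apply: hrs; rewrite inE xs orbT.
exists z => //; have ha := normc_absval.
have [rs [hsz e hrs]] := trace_roots (map_mx (ratr : rat -> R[i]) T).
rewrite -(ler_nat R) natr_absz intr_norm -normc_int.
have -> : z%:~R = \sum_(z <- rs) z :> R[i] by rewrite -e trace_map_mx hz rmorph_int.
apply: (le_trans (absval_sum ha _ _)).
rewrite big_seq (eq_bigr (fun=> 1)); last first.
  by move=> x /hrs[w w0 wx]; exact: (hT _ _ ha _ _ w0 wx).
by rewrite -big_seq big_const_seq count_predT iter_addr_0 hsz.
Qed.

End TraceInt.

(** * Algebras of matrices of trace zero are nilpotent *)

Section NilFlag.
Variables (F : numFieldType) (k : nat) (J : set 'M[F]_k).
Hypothesis J0 : J 0.
Hypothesis JL : forall a x y, J x -> J y -> J (a *: x + y).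
Hypothesis JM : forall x y, J x -> J y -> J (x *m y).
Hypothesis Jtr : forall x, J x -> \tr x = 0.

Lemma nil_no_fix j (w : 'rV[F]_k) : J j -> w *m j = w -> w = 0.
Proof.
case: k J J0 JL JM Jtr j w => [|n] J' J0' JL' JM' Jtr' j w Jj; first by rewrite thinmx0.
apply: trace_powers_no_fix => i; apply: Jtr'; elim: i => [|i IH]; first by rewrite expr1.
by rewrite exprS; exact: JM'.
Qed.

Definition stableJ (T : 'M[F]_k) := forall j, J j -> (T *m j <= T)%MS.

(** [S] is a proper stable subspace of [T] of maximal rank. For a row [t] of [T] outside [S], the
    space [S + t J] is stable. If it is proper, it equals [S], and [t J] lies in [S]. If it is [T],
    then [t = s + t j] with [s] in [S]; since [1 - j] is invertible and maps [S] onto itself, [t]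
    would be in [S]. *)
Lemma nil_descent (T : 'M[F]_k) : stableJ T -> exists S : 'M[F]_k,
  [/\ stableJ S, (S <= T)%MS, T != 0 -> (\rank S < \rank T)%N &
      forall j, J j -> (T *m j <= S)%MS].
Proof.
move=> sT; have [->|T0] := eqVneq T 0.
  by exists 0; split=> // [j _|j _]; rewrite ?eqxx// mul0mx sub0mx.
pose Q n := `[< exists S : 'M[F]_k, [/\ stableJ S, (S <= T)%MS, (\rank S < \rank T)%N & \rank S = n] >].
have Q0 : exists n, Q n.
  exists 0%N; apply/asboolP; exists 0; split; rewrite ?sub0mx ?mxrank0 ?lt0n ?mxrank_eq0//.
  by move=> j _; rewrite mul0mx sub0mx.
have Qm n : Q n -> (n <= k)%N by move/asboolP => [S [_ _ _ <-]]; exact: rank_leq_row.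
case: (ex_maxnP Q0 Qm) => n /asboolP[S [sS ST rS rn]] hmax.
exists S; split=> // j0 Jj0; apply/row_subP => i; rewrite row_mul.
set t := row i T; have tT : (t <= T)%MS by exact: row_sub.
have [tS|tS] := boolP (t <= S)%MS.
  by rewrite (submx_trans (submxMr _ tS))// sS.
have [||S' hS'] := @subspace_mx F k (fun v => exists s j, [/\ (s <= S)%MS, J j & v = s + t *m j]).
- by exists 0, 0; rewrite sub0mx mulmx0 addr0.
- move=> a u v [s [j [sS1 Jj ->]]] [s' [j' [sS1' Jj' ->]]].
  exists (a *: s + s'), (a *: j + j'); split; [by rewrite addmx_sub// scalemx_sub|exact: JL|].
  by rewrite mulmxDr scalerDr -scalemxAr addrACA.
have SS' : (S <= S')%MS.
  apply/row_subP => i'; apply/hS'; exists (row i' S), 0.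
  by rewrite row_sub mulmx0 addr0.
have S'T : (S' <= T)%MS.
  apply/row_subP => i'; have [s [j [sS1 Jj ->]]] := (hS' (row i' S')).2 (row_sub _ _).
  by rewrite addmx_sub// ?(submx_trans sS1)// (submx_trans (submxMr _ tT))// sT.
have sS' : stableJ S'.
  move=> j' Jj'; apply/row_subP => i'; rewrite row_mul.
  have [s [j [sS1 Jj ->]]] := (hS' (row i' S')).2 (row_sub _ _).
  apply/hS'; exists (s *m j'), (j *m j'); split; [|exact: JM|by rewrite mulmxDl mulmxA].
  by rewrite (submx_trans (submxMr _ sS1))// sS.
have [rk|rk] := ltnP (\rank S') (\rank T).
  have : (\rank S' <= \rank S)%N by rewrite rn; apply: hmax; apply/asboolP; exists S'.
  rewrite (geq_leqif (mxrank_leqif_sup SS')); apply: submx_trans.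
  by apply/hS'; exists 0, j0; rewrite sub0mx add0r.
rewrite (geq_leqif (mxrank_leqif_sup S'T)) in rk.
have [s [j [sS1 Jj e]]] := (hS' t).2 (submx_trans tT rk).
have uj : 1%:M - j \in unitmx.
  rewrite -row_free_unit -kermx_eq0; apply/rowV0P => v /sub_kermxP.
  by rewrite mulmxBr mulmx1 => /subr0_eq/esym; exact: nil_no_fix.
have sub : (S *m (1%:M - j) <= S)%MS by rewrite mulmxBr mulmx1 addmx_sub// eqmx_opp sS.
have sub2 : (S <= S *m (1%:M - j))%MS.
  by rewrite -(geq_leqif (mxrank_leqif_sup sub)) mxrankMfree// row_free_unit.
case/negP: tS; have /submxP[c hc] := submx_trans sS1 sub2.
have : t *m (1%:M - j) = (c *m S) *m (1%:M - j).
  by rewrite -mulmxA -hc mulmxBr mulmx1 {1}e addrK.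
by move/(can_inj (mulmxK uj)) => ->; exact: submxMl.
Qed.

Lemma nil_flag : exists T : nat -> 'M[F]_k,
  [/\ T 0%N = 1%:M, forall i, T i.+1 = 0 \/ (\rank (T i.+1) + i.+1 <= k)%N,
      forall i, (T i.+1 <= T i)%MS & forall i j, J j -> (T i *m j <= T i.+1)%MS].
Proof.
pose R1 (T S : 'M[F]_k) := stableJ T -> [/\ stableJ S, (S <= T)%MS, T != 0 -> (\rank S < \rank T)%N &
      forall j, J j -> (T *m j <= S)%MS].
have [f hf] : exists f : 'M[F]_k -> 'M[F]_k, forall T, R1 T (f T).
  exists (fun T => xget 0 [set S | R1 T S]) => T; apply: (@xgetPex _ 0 [set S | R1 T S]).
  have [sT|nT] := pselect (stableJ T); last by exists 0.
  by have [S hS] := nil_descent sT; exists S.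
pose T i := iter i f 1%:M.
have sT i : stableJ (T i).
  elim: i => [|i IH]; first by move=> j _; exact: submx1.
  by have [] := hf _ IH.
exists T; split=> // [i|i|i j]; first last.
- by have [_ _ _ h] := hf _ (sT i); exact: h.
- by have [] := hf _ (sT i).
elim: i => [|i IH].
  have [_ _ h _] := hf _ (sT 0%N); have [e|k0] := eqVneq (T 0%N) 0; last first.
    right; have := h k0; rewrite mxrank1 addn1; exact.
  left; have [_ h2 _ _] := hf _ (sT 0%N); apply/eqP.
  by have h3 : (T 1%N <= T 0%N)%MS by []; rewrite e submx0 in h3.
have [_ h2 h _] := hf _ (sT i.+1); have [e|k0] := eqVneq (T i.+1) 0.
  left; apply/eqP; have h3 : (T i.+2 <= T i.+1)%MS by [].
  by rewrite e submx0 in h3.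
right; case: IH => [e|IH]; first by rewrite e eqxx in k0.
by have lt : (\rank (T i.+2) < \rank (T i.+1))%N := h k0; lia.
Qed.

End NilFlag.

(** * Finitely many integral traces give virtual solvability *)

Section SolvableStep.
Variables (G : groupType) (H : set G) (k : nat) (tau : G -> 'M[rat]_k) (N0 : nat).
Hypothesis sH : subgrp H.
Hypothesis tau1 : tau 1%g = 1%:M.
Hypothesis tauM : forall x y, H x -> H y -> tau (x * y)%g = tau x *m tau y.
Hypothesis htr : forall g, dersub H g -> exists2 z : int, \tr (tau g) = z%:~R & (`|z| <= N0)%N.

Let N := dersub H.
Let NH g : N g -> H g. Proof. exact: dersub_sub. Qed.
Let H1 : H 1%g. Proof. by case: sH. Qed.
Let HM x y : H x -> H y -> H (x * y)%g. Proof. by case: sH => _ + _; apply. Qed.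
Let HV x : H x -> H x^-1%g. Proof. by case: sH => _ _; apply. Qed.
Let N1 : N 1%g. Proof. by case: (dersub_subgrp H). Qed.
Let NM x y : N x -> N y -> N (x * y)%g. Proof. by case: (dersub_subgrp H) => _ + _; apply. Qed.
Let NV x : N x -> N x^-1%g. Proof. by case: (dersub_subgrp H) => _ _; apply. Qed.

Local Opaque dersub.
Ltac inG := solve [repeat first [assumption | apply: (H1) | apply: (HM) | apply: (HV) | apply: (NH) |
  apply: (N1) | apply: (NM) | apply: (NV)]].

Lemma dersub_conj h n : H h -> N n -> N (h * n * h^-1)%g.
Proof.
move=> Hh Nn; have -> : (h * n * h^-1 = (h^-1^-1 * n^-1^-1 * h^-1 * n^-1) * n)%g.
  by rewrite !invgK mulgVK.
apply: NM => //; apply: comm_dersub; first exact: HV.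
exact: HV (NH Nn).
Qed.

Definition same a b := forall n, N n -> \tr (tau a *m tau n) = \tr (tau b *m tau n).

(** The kernel of the action of [N] on its linear span modulo the radical of the trace form. *)
Definition trker g := N g /\ same g 1%g.

Lemma sameP a b : N a -> N b -> same a b -> trker (a * b^-1)%g.
Proof.
move=> Na Nb sab; split; first inG.
move=> n Nn; rewrite tau1 mul1mx tauM; [|inG|inG].
rewrite -mulmxA -tauM; [|inG|inG].
rewrite sab; last inG.
by rewrite -tauM; [rewrite mulVKg|inG|inG].
Qed.

Lemma same_conj h a b : H h -> N a -> N b -> same a b -> same (h * a * h^-1)%g (h * b * h^-1)%g.
Proof.
move=> Hh Na Nb sab n Nn; have Hn := NH Nn.
have Hh' := HV Hh.
have e c : N c -> \tr (tau (h * c * h^-1)%g *m tau n) = \tr (tau c *m tau (h^-1 * n * h)%g).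
  move=> Nc; have Hc := NH Nc; rewrite !tauM; try inG.
  by rewrite -!mulmxA mxtrace_mulC -!mulmxA.
rewrite !e// sab//; have := dersub_conj Hh' Nn; by rewrite invgK.
Qed.

Lemma trker_subgrp : subgrp trker.
Proof.
split=> [|x y [Nx sx] [Ny sy]|x [Nx sx]]; first by split.
  split=> [|n Nn]; first inG.
  rewrite tauM; [|inG|inG]; rewrite -mulmxA -tauM; [|inG|inG]; rewrite sx; last inG.
  by rewrite tau1 mul1mx tauM ?sy ?tau1 ?mul1mx//; inG.
rewrite -[x^-1%g]mul1g; apply: sameP => // n Nn; by rewrite sx.
Qed.

Lemma span_finite : exists l (b : 'I_l -> G), (forall i, N (b i)) /\
  forall g, N g -> (mxvec (tau g) <= \matrix_i mxvec (tau (b i)))%MS.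
Proof.
pose Q n := `[< exists l (b : 'I_l -> G), (forall i, N (b i)) /\
  \rank (\matrix_i mxvec (tau (b i))) = n >].
have Q0 : exists n, Q n.
  exists (\rank (\matrix_(i < 0) mxvec (tau 1%g))); apply/asboolP.
  by exists 0%N, (fun=> 1%g).
have Qm n : Q n -> (n <= k * k)%N by move/asboolP => [l [b [_ <-]]]; exact: rank_leq_col.
case: (ex_maxnP Q0 Qm) => n /asboolP[l [b [Nb rn]]] hmax.
exists l, b; split=> // g Ng; apply: contraT => hg.
set B := \matrix_i _ in rn hg.
pose b' (i : 'I_l.+1) := if unlift ord0 i is Some j then b j else g.
pose B' := \matrix_i mxvec (tau (b' i)).
have gB : (mxvec (tau g) <= B')%MS.
  have -> : mxvec (tau g) = row ord0 B' by rewrite rowK /b' unlift_none.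
  exact: row_sub.
have BB : (B <= B')%MS.
  apply/row_subP => i; have -> : row i B = row (lift ord0 i) B' by rewrite !rowK /b' liftK.
  exact: row_sub.
have : (\rank B' <= n)%N.
  apply: hmax; apply/asboolP; exists l.+1, b'; split=> // i.
  by rewrite /b'; case: unlift.
rewrite -rn (geq_leqif (mxrank_leqif_sup BB)) => B'B.
by case/negP: hg; exact: submx_trans B'B.
Qed.

Section Span.
Variables (l : nat) (b : 'I_l -> G).
Hypothesis Nb : forall i, N (b i).
Hypothesis hb : forall g, N g -> (mxvec (tau g) <= \matrix_i mxvec (tau (b i)))%MS.
Let B := \matrix_i mxvec (tau (b i)).

Lemma span_expand (M : 'M[rat]_k) : (mxvec M <= B)%MS -> exists c : 'I_l -> rat,
  M = \sum_i c i *: tau (b i).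
Proof.
move=> /submxP[c hc]; exists (fun i => c 0 i).
apply: (can_inj mxvecK); rewrite hc mulmx_sum_row linear_sum; apply: eq_bigr => i _.
by rewrite rowK linearZ.
Qed.

Lemma same_span x y : (forall i, \tr (tau x *m tau (b i)) = \tr (tau y *m tau (b i))) -> same x y.
Proof.
move=> h n Nn; have [c ->] := span_expand (hb Nn).
rewrite !mulmx_sumr !linear_sum /=; apply: eq_bigr => i _.
by rewrite -!scalemxAr !mxtraceZ h.
Qed.

(** A trace function is determined by its values on the finite family [b], integers between [- N0]
    and [N0]; the shift by [N0] encodes them in a finite type, so [N] has finitely many classes
    modulo [trker]. *)
Definition color (g : G) : {ffun 'I_l -> 'I_(N0 + N0).+1} :=
  [ffun i => inord `|numq (\tr (tau g *m tau (b i))) + N0%:Z|].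

Lemma color_same x y : N x -> N y -> color x = color y -> same x y.
Proof.
move=> Nx Ny e; apply: same_span => i; move/ffunP/(_ i): e; rewrite !ffunE.
have h g : N g -> exists2 z : int, \tr (tau g *m tau (b i)) = z%:~R & (`|z| <= N0)%N.
  have Nbi := Nb i; move=> Ng; rewrite -tauM; [|inG|inG]; apply: htr; change (N (g * b i)%g); inG.
have [z -> hz] := h _ Nx; have [z' -> hz'] := h _ Ny.
rewrite !numq_int => /(congr1 val) /=; rewrite !inordK; [|lia|lia] => e.
by congr (_%:~R); lia.
Qed.

(** The elements of [H] that act trivially by conjugation on the finite quotient of [N] by [trker].
    Its intersection with [N] is abelian modulo [trker], so that the finite quotient costs a single
    step of the derived series. *)
Definition centr : set G := fun h => H h /\ forall n, N n -> trker (h * n * h^-1 * n^-1)%g.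

Lemma centr_subgrp : subgrp centr.
Proof.
have [t1 tM tV] := trker_subgrp.
split.
- by split=> // n Nn; rewrite mul1g invg1 mulg1 mulgV.
- move=> x y [Hx cx] [Hy cy]; split; first exact: HM.
  move=> n Nn; have Nn' := dersub_conj Hy Nn.
  have := tM _ _ (cx _ Nn') (cy _ Nn); congr trker.
  by rewrite !invgM !invgK !mulgA !(mulgVK, mulgK).
- move=> x [Hx cx]; split; first exact: HV.
  move=> n Nn; have := dersub_conj (HV Hx) Nn; rewrite invgK => Nn'.
  have := tV _ (cx _ Nn'); congr trker.
  by rewrite !invgM !invgK !mulgA !(mulgVK, mulgK, mulgV, mulVg, mul1g).
Qed.

(** [f h] records how conjugation by [h] acts on the finitely many colors; two elements with the
    same record differ by an element of [centr]. *)
Lemma centr_finidx : finidx H centr.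
Proof.
pose rep v := xget 1%g [set n | N n /\ color n = v].
have Nrep v : N (rep v) by rewrite /rep; case: xgetP => // x _ [].
have srep n : N n -> same n (rep (color n)).
  move=> Nn; apply: color_same => //; rewrite /rep.
  case: xgetP => [x _ [_ ->]//|/(_ n)]; by case.
pose f h := [ffun v => color (h * rep v * h^-1)%g].
have [|s [sHH hs]] := @finite_range G _ H f #|{ffun {ffun 'I_l -> 'I_(N0 + N0).+1} -> {ffun 'I_l -> 'I_(N0 + N0).+1}}|.
  by move=> s _ us; rewrite -(size_map f) -(card_uniqP us) max_card.
exists s; split=> // g Hg; have [h hhs e] := hs _ Hg; exists h => //.
have Hh := sHH _ hhs.
have sgh n : N n -> same (g * n * g^-1)%g (h * n * h^-1)%g.
  move=> Nn m Nm; have Nr := Nrep (color n).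
  rewrite (same_conj Hg Nn Nr (srep _ Nn))// (same_conj Hh Nn Nr (srep _ Nn))//.
  apply: color_same => //; try exact: dersub_conj.
  by move/ffunP/(_ (color n)): e; rewrite !ffunE => ->.
split; first inG.
move=> n Nn; have := dersub_conj (HV Hh) Nn; rewrite invgK => Nn'.
have := sameP (dersub_conj Hg Nn') (dersub_conj Hh Nn') (sgh _ Nn').
by rewrite !invgM !invgK !mulgA !(mulgVK, mulgK, mulgV, mulVg, mul1g).
Qed.

(** The radical of the trace form on the span of [tau N]. It is closed under products and traceless,
    so that [nil_flag] applies to it. *)
Definition radical : set 'M[rat]_k := fun x => (mxvec x <= B)%MS /\
  forall n, N n -> \tr (x *m tau n) = 0.

Lemma radical0 : radical 0.
Proof. by split=> [|n _]; rewrite ?linear0 ?sub0mx// mul0mx mxtrace0. Qed.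

Lemma radicalL a x y : radical x -> radical y -> radical (a *: x + y).
Proof.
move=> [xB tx] [yB ty]; split; first by rewrite linearP addmx_sub// scalemx_sub.
by move=> n Nn; rewrite mulmxDl -scalemxAl mxtraceD mxtraceZ tx// ty// mulr0 addr0.
Qed.

Lemma radical_tr x : radical x -> \tr x = 0.
Proof. by move=> [_ /(_ _ N1)]; rewrite tau1 mulmx1. Qed.

Lemma span_mul x n : (mxvec x <= B)%MS -> N n -> (mxvec (x *m tau n) <= B)%MS.
Proof.
move=> /span_expand[c ->] Nn; rewrite mulmx_suml linear_sum summx_sub// => i _.
have Nbi := Nb i; rewrite -scalemxAl linearZ scalemx_sub// -tauM; [|inG|inG].
by apply: hb; inG.
Qed.

Lemma radicalM x y : radical x -> radical y -> radical (x *m y).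
Proof.
move=> rx [yB ty]; have [c ->] := span_expand yB.
rewrite mulmx_sumr; apply: (big_ind radical); first exact: radical0.
  by move=> u v ru rv; rewrite -[u]scale1r; exact: radicalL.
move=> i _; rewrite -scalemxAr -[_ *: _]addr0; apply: radicalL radical0.
have [xB tx] := rx; split; first by apply: span_mul => //; exact: Nb.
by have Nbi := Nb i; move=> n Nn; rewrite -mulmxA -tauM ?tx//; inG.
Qed.

Lemma trker_radical g : trker g -> radical (tau g - 1%:M).
Proof.
move=> [Ng sg]; split.
  by rewrite linearB /= addmx_sub ?hb// eqmx_opp -tau1 hb.
by move=> n Nn; rewrite mulmxBl raddfB /= sg// tau1 subrr.
Qed.

End Span.

(** The chain consists of [centr], its intersection with [N], and the elements of [trker] that move
    the flag [T] down by more and more steps. Commutators in [H] lie in [N], [centr] centralises [N]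
    modulo [trker], and commutators of unipotent elements go deeper into the flag. The flag accounts
    for [k] in [k.+2], the two members before it for the rest. *)
Theorem solvable_step : exists D : nat -> set G,
  [/\ forall i, subgrp (D i), forall i, D i `<=` H, finidx H (D 0%N),
      forall i x y, D i x -> D i y -> D i.+1 (x^-1 * y^-1 * x * y)%g &
      forall n g, (k.+2 <= n)%N -> D n g -> tau g = 1%:M].
Proof.
have [l [b [Nb hb]]] := span_finite.
have [T [T0 Tr TT TJ]] := nil_flag (radical0 b) (radicalL (b := b)) (radicalM Nb hb) (@radical_tr _ b).
pose E i g := trker g /\ forall j, (T j *m (tau g - 1%:M) <= T (j + i).+1)%MS.
have tJ g j : trker g -> (T j *m (tau g - 1%:M) <= T j.+1)%MS.
  by move=> tg; apply: TJ; exact: trker_radical.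
have tst g j : trker g -> (T j *m tau g <= T j)%MS.
  move=> tg; rewrite -[tau g](subrK 1%:M) mulmxDr mulmx1 addmx_sub//.
  exact: submx_trans (tJ _ _ tg) (TT _).
have Tmon i j : (i <= j)%N -> (T j <= T i)%MS.
  by move=> /subnK <-; elim: (j - i)%N => // n IH; rewrite addSn (submx_trans (TT _)).
have [t1 tM tV] := trker_subgrp.
have tH g : trker g -> H g by move=> [/NH].
have sE i : subgrp (E i).
  split.
  - by split=> // j; rewrite tau1 subrr mulmx0 sub0mx.
  - move=> x y [tx hx] [ty hy]; split; first exact: tM.
    move=> j; have -> : tau (x * y)%g - 1%:M = (tau x - 1%:M) *m tau y + (tau y - 1%:M).
      by rewrite tauM; [rewrite mulmxBl mul1mx addrA subrK|exact: tH|exact: tH].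
    rewrite mulmxDr addmx_sub// mulmxA (submx_trans (submxMr _ (hx j)))//.
    exact: tst.
  - move=> x [tx hx]; split; first exact: tV.
    move=> j; have -> : tau x^-1%g - 1%:M = - ((tau x - 1%:M) *m tau x^-1%g).
      by rewrite mulmxBl mul1mx -tauM; [rewrite mulgV tau1 opprB|exact: tH|exact/tH/tV].
    rewrite mulmxN eqmx_opp mulmxA (submx_trans (submxMr _ (hx j)))//.
    by apply: tst; exact: tV.
have [c1 cM cV] := centr_subgrp.
pose D i := if i is i'.+1 then if i' is i''.+1 then E i'' else (fun g => centr g /\ N g) else centr.
exists D; split.
- case=> [|[|i]]; [exact: centr_subgrp| |exact: sE].
  split; first by split.
    by move=> x y [cx Nx] [cy Ny]; split; [exact: cM|exact: NM].
  by move=> x [cx Nx]; split; [exact: cV|exact: NV].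
- by case=> [|[|i]] h; [case|move=> [[]]|move=> [/tH]].
- exact: centr_finidx hb.
- case=> [|[|i]] x y.
  + move=> cx cy; split; last by apply: comm_dersub; [case: cx|case: cy].
    by apply: (cM) => //; apply: (cM) => //; apply: (cM); exact: cV.
  + move=> [cx Nx] [cy Ny]; have tr : trker (x^-1 * y^-1 * x * y)%g.
      by have [_ /(_ _ (NV Ny))] := cV _ cx; rewrite !invgK.
    by split=> // j; rewrite addn0; exact: tJ.
  + move=> [tx hx] [ty hy]; have tx' := tV _ tx; have ty' := tV _ ty.
    have txy' := tM _ _ tx' ty'.
    split; first by apply: (tM) => //; exact: (tM).
    move=> j; pose X := tau x - 1%:M; pose Y := tau y - 1%:M.
    (* Up to a factor that preserves the flag, the commutator differs from 1 by [XY - YX]. Each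
       product moves the flag by [2 (i + 1)] steps, at least the [i + 2] that are required. *)
    have -> : tau (x^-1 * y^-1 * x * y)%g - 1%:M =
        tau (x^-1 * y^-1)%g *m (X *m Y - Y *m X).
      have -> : X *m Y - Y *m X = tau x *m tau y - tau y *m tau x.
        rewrite /X /Y !mulmxBl !mulmxBr !mul1mx !mulmx1.
        set P := tau x *m tau y; set Q := tau y *m tau x.
        by apply/matrixP => p q; rewrite !mxE; ring.
      have txyx := tM _ _ txy' tx.
      have [Hx Hy] := (tH _ tx, tH _ ty).
      rewrite mulmxBr !mulmxA -!tauM; try inG.
      by rewrite mulgVK mulVg tau1.
    rewrite mulmxA (submx_trans (submxMr _ (tst _ j txy')))// mulmxBr addmx_sub ?eqmx_opp//.
      rewrite mulmxA (submx_trans (submxMr _ (hx j)))// (submx_trans (hy _))//.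
      by apply: Tmon; lia.
    rewrite mulmxA (submx_trans (submxMr _ (hy j)))// (submx_trans (hx _))//.
    by apply: Tmon; lia.
- case=> [|[|i]] // g; rewrite !ltnS => ki [_ /(_ 0%N)].
  rewrite T0 mul1mx add0n => h; have : T i.+1 = 0.
    by case: (Tr i) => //; lia.
  by move=> e; move: h; rewrite e submx0 subr_eq0 => /eqP.
Qed.

End SolvableStep.

(** * Solvable chains of subgroups *)

Section FiniteIndexCap.
Variable G : groupType.
Local Open Scope group_scope.

Lemma finidx_cap (H S1 S2 : set G) : subgrp H -> subgrp S1 -> subgrp S2 ->
  finidx H S1 -> finidx H S2 -> finidx H (S1 `&` S2).
Proof.
move=> [h1 hM hV] [a1 aM aV] [b1 bM bV] [s1 [s1H hs1]] [s2 [s2H hs2]].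
pose f1 g := xget 1 [set h | h \in s1 /\ S1 (g * h^-1)].
pose f2 g := xget 1 [set h | h \in s2 /\ S2 (g * h^-1)].
have P1 g : H g -> f1 g \in s1 /\ S1 (g * (f1 g)^-1).
  move=> Hg; apply: (@xgetPex _ 1 [set h | h \in s1 /\ S1 (g * h^-1)]).
  by have [h hh hS] := hs1 _ Hg; exists h.
have P2 g : H g -> f2 g \in s2 /\ S2 (g * (f2 g)^-1).
  move=> Hg; apply: (@xgetPex _ 1 [set h | h \in s2 /\ S2 (g * h^-1)]).
  by have [h hh hS] := hs2 _ Hg; exists h.
have [|s [sH hs]] := @finite_range G _ H (fun g => (f1 g, f2 g)) (size [seq (x, y) | x <- s1, y <- s2]).
  move=> s sH us; rewrite -(size_map (fun g => (f1 g, f2 g))); apply: uniq_leq_size => //.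
  move=> _ /mapP[g gs ->]; have Hg := sH _ gs; apply/allpairsP; exists (f1 g, f2 g).
  by split=> //=; [case: (P1 _ Hg)|case: (P2 _ Hg)].
exists s; split=> // g Hg; have [h hhs [e1 e2]] := hs _ Hg; exists h => //.
have Hh := sH _ hhs; have [_ x1] := P1 _ Hg; have [_ x2] := P1 _ Hh.
have [_ y1] := P2 _ Hg; have [_ y2] := P2 _ Hh.
rewrite e1 in x2; rewrite e2 in y2; split.
  by have := aM _ _ x1 (aV _ x2); rewrite invgM invgK mulgA mulgVK.
by have := bM _ _ y1 (bV _ y2); rewrite invgM invgK mulgA mulgVK.
Qed.

(** Each member contains the commutators of the preceding one, an upper bound for the derived
    series. In this form chains can be intersected, as the finitely many translates of a subspace
    require. *)
Definition solvable_chain (H : set G) (D : nat -> set G) : Prop :=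
  [/\ forall i, subgrp (D i), forall i, D i `<=` H, finidx H (D 0%N) &
      forall i x y, D i x -> D i y -> D i.+1 (x^-1 * y^-1 * x * y)].

Lemma solvable_chain_all (I : eqType) (H : set G) (P : I -> set G) n (s : seq I) : subgrp H ->
  (forall h, h \in s -> exists D, solvable_chain H D /\ D n `<=` P h) ->
  exists D, solvable_chain H D /\ forall h, h \in s -> D n `<=` P h.
Proof.
move=> sH; have [h1 hM hV] := sH; elim: s => [_|h s IH hD].
  exists (fun=> H); split=> //; split; first by [].
  - by move=> _ g.
  - by exists [:: 1]; split=> [h|g Hg]; [rewrite inE => /eqP ->|exists 1; rewrite ?inE// invg1 mulg1].
  - by move=> _ x y Hx Hy; do 3 (apply: (hM) => //); exact: hV.
case: IH => [h' hs|D1 [[s1 i1 f1 c1] d1]]; first by apply: hD; rewrite inE hs orbT.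
have [D2 [[s2 i2 f2 c2] d2]] := hD h (mem_head _ _).
exists (fun i => D1 i `&` D2 i); split.
  split.
  - move=> i; have [a1 aM aV] := s1 i; have [b1 bM bV] := s2 i.
    by split=> // [x y [? ?] [? ?]|x [? ?]]; split; by [exact: aM|exact: bM|exact: aV|exact: bV].
  - by move=> i g [/i1].
  - exact: finidx_cap.
  - by move=> i x y [? ?] [? ?]; split; [exact: c1|exact: c2].
move=> h'; rewrite inE => /orP[/eqP ->|hs] g [g1 g2]; first exact: d2.
exact: d1 g1.
Qed.

End FiniteIndexCap.

(** [H] is chosen independently of [W], so it serves every translate of [W]; a translate has the
    mass and the rank of [W], hence is again of minimal rank. [U] is the sum of the translates,
    which the whole group permutes. *)
Theorem virtually_solvable_subspace (R : realType) (G : groupType) (r : nat)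
    (rho : G -> 'M[rat]_r) (m : set 'rV[rat]_r -> R) :
  is_mean m -> m [set 0] = 0 -> rho 1%g = 1%:M ->
  (forall x y, rho (x * y)%g = rho x *m rho y) ->
  (forall g E, m ((fun w => w *m rho g) @^-1` E) = m E) ->
  exists U : 'M[rat]_r, exists D : nat -> set G, exists n,
    [/\ U != 0, forall g, (U *m rho g <= U)%MS, solvable_chain setT D &
        forall g, D n g -> U *m rho g = U].
Proof.
move=> hm m0 rho1 rhoM minv.
have [H [A [hA hmin]]] := spanned_min rho.
have [sH fH _] := hA.
pose Q k := `[< exists W : 'M[rat]_r, 0 < m [set w | (w <= W)%MS] /\ \rank W = k >].
have Q0 : exists k, Q k.
  exists (\rank (1%:M : 'M[rat]_r)); apply/asboolP; exists 1%:M; split=> //.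
  rewrite (_ : [set w | _] = setT); first by case: hm => _ -> _; exact: ltr01.
  by apply/seteqP; split=> // w _ /=; exact: submx1.
case: (ex_minnP Q0) => k /asboolP[W [W0 rW]] kmin.
have Wmin (W' : 'M[rat]_r) : 0 < m [set w | (w <= W')%MS] -> (\rank W <= \rank W')%N.
  by move=> h; rewrite rW; apply: kmin; apply/asboolP; exists W'.
have Wn0 : W != 0.
  apply/eqP => e; move: W0; rewrite e (_ : [set w | _] = [set 0]) ?m0 ?ltxx//.
  by apply/seteqP; split=> w /=; rewrite submx0 => /eqP.
have [s [_ hs]] := charged_orbit_finite hm rho1 rhoM minv W0 Wmin setT.
have rkW g : \rank (W *m rho g) = \rank W.
  by rewrite mxrankMfree// row_free_unit (rho_unit rho1 rhoM).
have hD h : exists D, solvable_chain H D /\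
    D r.+2 `<=` [set g | W *m rho h *m rho g = W *m rho h].
  pose W' := W *m rho h.
  have W'0 : 0 < m [set w | (w <= W')%MS] by rewrite (mean_translate rho1 rhoM minv).
  have W'min (W'' : 'M[rat]_r) : 0 < m [set w | (w <= W'')%MS] -> (\rank W' <= \rank W'')%N.
    by rewrite /W' rkW; exact: Wmin.
  have [B eqB [B' BB']] : exists2 B : 'M[rat]_(\rank W', r), (B :=: W')%MS &
      exists B', B *m B' = 1%:M.
    exists (row_base W'); first exact: eq_row_base.
    by exists (pinvmx (row_base W')); apply: mulmxVp; exact: row_base_free.
  case: (@solvable_step G H (\rank W') (restr rho B B') r sH) => [|||D [D1 D2 D3 D4 D5]].
  - exact: restr1.
  - exact: (restrM hm rho1 rhoM minv hA hmin W'0 W'min eqB BB').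
  - move=> g Ng; have [|z hz zk] := @trace_int R _ (restr rho B B' g).
      by move=> K a ha; exact: (restr_eigen hm rho1 rhoM minv hA hmin W'0 W'min ha eqB BB' Ng).
    by exists z => //; rewrite (leq_trans zk)// rank_leq_row.
  exists D; split=> // g Dg /=.
  have Hg : H g := D2 _ _ Dg.
  have := D5 r.+2 g _ Dg; rewrite !ltnS rank_leq_row => /(_ isT) tg.
  have BW : B *m rho g = B.
    by rewrite -(restr_mul hm rho1 rhoM minv hA hmin W'0 W'min eqB BB' Hg) tg mul1mx.
  have /submxP[c hc] : (W' <= B)%MS by rewrite eqB.
  by rewrite -/W' hc -mulmxA BW.
have [D [chD dD]] := @solvable_chain_all G G H
  (fun h => [set g | W *m rho h *m rho g = W *m rho h]) r.+2 s sH (fun h _ => hD h).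
have Usub h : h \in s -> (W *m rho h <= \sum_(h <- s) (W *m rho h))%MS.
  by move=> hs'; rewrite (big_rem h)//= addsmxSl.
have sumS (M : 'M[rat]_r) : (forall h, h \in s -> (W *m rho h <= M)%MS) ->
    (\sum_(h <- s) (W *m rho h) <= M)%MS.
  move=> hM; rewrite big_seq; elim/big_rec: _ => [|h X hs' IH]; first by rewrite sub0mx.
  by rewrite addsmx_sub hM.
exists (\sum_(h <- s) (W *m rho h))%MS, D, r.+2; split.
- have [h hs' _] := hs 1%g I; apply: contra_neq Wn0 => e; apply/eqP.
  by have := Usub _ hs'; rewrite e submx0 -mxrank_eq0 rkW mxrank_eq0.
- move=> g; set U := (\sum_(h <- s) _)%MS.
  have : (U <= U *m rho g^-1%g)%MS.
    apply: sumS => h hs'; have [h' h's /andP[e _]] := hs (h * g)%g I.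
    have := submxMr (rho g^-1%g) (submx_trans e (Usub _ h's)).
    by rewrite rhoM -!mulmxA (rhoV rho1 rhoM) !mulmx1.
  by move/(submxMr (rho g)); rewrite -mulmxA (rhoVr rho1 rhoM) mulmx1.
- have [d1 d2 d3 d4] := chD; split=> //.
  have [t [_ ht]] := finidx_trans sH fH d3.
  by exists t; split=> // g _; have [h hh [_ hg]] := ht g I; exists h.
- move=> g Dg; set U := (\sum_(h <- s) _)%MS.
  have : (U <= kermx (rho g - 1%:M))%MS.
    apply: sumS => h hs'; rewrite sub_kermx mulmxBr mulmx1.
    by have := dD _ hs' _ Dg => /= ->; rewrite subrr.
  by rewrite sub_kermx mulmxBr mulmx1 subr_eq0 => /eqP.
Qed.

(** * The Haar integral on a compact group *)

Section Translation.
Variable X : topologicalZmodType.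

Lemma continuous_addl (a : X) : continuous (fun x => a + x).
Proof.
move=> x; apply: (@continuous_comp _ _ _ (fun y => (a, y)) (fun z : X * X => z.1 + z.2)).
  by apply: cvg_pair => //; exact: cvg_cst.
exact: add_continuous.
Qed.

Lemma continuous_subr (a : X) : continuous (fun x => a - x).
Proof.
move=> x; apply: (@continuous_comp _ _ _ -%R (fun y => a + y)).
  exact: opp_continuous.
exact: continuous_addl.
Qed.

Lemma continuous_addr (a : X) : continuous (fun x => x + a).
Proof. by under eq_fun do rewrite addrC; exact: continuous_addl. Qed.

End Translation.

Section BorelMeasurable.
Variables (R : realType) (X : topologicalZmodType).

Lemma borel_open (A : set X) : open A -> measurable (A : set (borel X)).
Proof. by move=> oA; apply: sub_sigma_algebra. Qed.

Lemma continuous_measurable_map (f : X -> X) : continuous f ->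
  measurable_fun setT (f : borel X -> borel X).
Proof.
move=> cf; apply: (@measurability _ _ (borel X) (borel X) setT _ (@open X)) => //.
move=> _ [B oB <-]; rewrite setTI; apply: borel_open.
by move/continuousP: cf; exact.
Qed.

Lemma continuous_measurable (f : X -> R) : continuous f ->
  measurable_fun setT (f : borel X -> R).
Proof.
move=> cf; apply: (measurability _ (RGenOpens.measurableE R)) => //.
move=> _ [B [a [b ->]] <-]; rewrite setTI; apply: borel_open.
by move/continuousP: cf; apply; exact: interval_open.
Qed.

End BorelMeasurable.

Section Integral.
Variables (R : realType) (X : topologicalZmodType).
Variable rho : {measure set (borel X) -> \bar R}.
Hypothesis frho : (rho setT < +oo)%E.

Definition bmf (f : X -> R) : Prop :=
  measurable_fun setT (f : borel X -> R) /\ exists M, forall x, `|f x| <= M.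

Definition Int (f : X -> R) : R := fine (\int[rho]_x (f x)%:E)%E.

Lemma bmf_integrable f : bmf f -> rho.-integrable setT (EFin \o (f : borel X -> R)).
Proof.
move=> [mf [M hM]]; apply: measurable_bounded_integrable => //.
exists M; split; first exact: num_real.
by move=> y My x _; exact: le_trans (hM x) (ltW My).
Qed.

Lemma bmf_cst c : bmf (fun=> c).
Proof. by split; [exact: measurable_cst|exists `|c|]. Qed.

Lemma bmfD f g : bmf f -> bmf g -> bmf (fun x => f x + g x).
Proof.
move=> [mf [M hM]] [mg [N hN]]; split; first exact: measurable_funD.
by exists (M + N) => x; rewrite (le_trans (ler_normD _ _))// lerD.
Qed.

Lemma bmfM f g : bmf f -> bmf g -> bmf (fun x => f x * g x).
Proof.
move=> [mf [M hM]] [mg [N hN]]; split; first exact: measurable_funM.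
by exists (M * N) => x; rewrite normrM ler_pM.
Qed.

Lemma bmfZ c f : bmf f -> bmf (fun x => c * f x).
Proof. by move=> hf; apply: bmfM => //; exact: bmf_cst. Qed.

Lemma bmfN f : bmf f -> bmf (fun x => - f x).
Proof. by move=> /(bmfZ (-1)) h; under eq_fun do rewrite -mulN1r. Qed.

Lemma bmfB f g : bmf f -> bmf g -> bmf (fun x => f x - g x).
Proof. by move=> hf hg; apply: bmfD => //; exact: bmfN. Qed.

Lemma bmf_sum (I : Type) (s : seq I) (F : I -> X -> R) :
  (forall i, bmf (F i)) -> bmf (fun x => \sum_(i <- s) F i x).
Proof.
move=> h; elim: s => [|i s IH].
  by under eq_fun do rewrite big_nil; exact: bmf_cst.
by under eq_fun do rewrite big_cons; exact: bmfD.
Qed.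

Lemma bmf_continuous f : compact [set: X] -> continuous f -> bmf f.
Proof.
move=> cX cf; split; first exact: continuous_measurable.
have /compact_bounded[M [_ hM]] : compact (f @` setT).
  apply: continuous_compact => //; exact: continuous_subspaceT.
exists (M + 1) => x; apply: hM; first by rewrite ltrDl.
by exists x.
Qed.

Lemma bmf_indic (A : set (borel X)) : measurable A -> bmf (\1_A : X -> R).
Proof.
move=> mA; split; first exact: measurable_indic.
exists 1 => x; rewrite indicE; case: (_ \in _); by rewrite ?normr1 ?normr0.
Qed.

Lemma bmf_comp f (phi : X -> X) : continuous phi -> bmf f -> bmf (f \o phi).
Proof.
move=> cp [mf [M hM]]; split; last by exists M => x; exact: hM.
by apply: (measurableT_comp mf); exact: continuous_measurable_map.
Qed.

Lemma IntD f g : bmf f -> bmf g -> Int (fun x => f x + g x) = Int f + Int g.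
Proof.
move=> hf hg; rewrite /Int integralD_EFin//; try exact: bmf_integrable.
by rewrite fineD//; apply: integrable_fin_num => //; exact: bmf_integrable.
Qed.

Lemma IntZ c f : bmf f -> Int (fun x => c * f x) = c * Int f.
Proof.
move=> hf; rewrite /Int; under eq_integral do rewrite EFinM.
rewrite integralZl//; last exact: bmf_integrable.
by rewrite fineM//; apply: integrable_fin_num => //; exact: bmf_integrable.
Qed.

Lemma IntN f : bmf f -> Int (fun x => - f x) = - Int f.
Proof.
by move=> hf; rewrite -mulN1r -IntZ//; congr Int; apply/funext => x; rewrite mulN1r.
Qed.

Lemma IntB f g : bmf f -> bmf g -> Int (fun x => f x - g x) = Int f - Int g.
Proof. by move=> hf hg; rewrite IntD ?IntN//; exact: bmfN. Qed.

Lemma Int_sum (I : Type) (s : seq I) (F : I -> X -> R) : (forall i, bmf (F i)) ->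
  Int (fun x => \sum_(i <- s) F i x) = \sum_(i <- s) Int (F i).
Proof.
move=> h; elim: s => [|i s IH].
  rewrite big_nil; under eq_fun do rewrite big_nil.
  by rewrite /Int integral0.
rewrite big_cons -IH -IntD//; last exact: bmf_sum.
by congr Int; apply/funext => x; rewrite big_cons.
Qed.

Lemma Int_ge0 f : (forall x, 0 <= f x) -> 0 <= Int f.
Proof. by move=> h; apply: fine_ge0; apply: integral_ge0 => x _; rewrite lee_fin. Qed.

Lemma Int_le f g : bmf f -> bmf g -> (forall x, f x <= g x) -> Int f <= Int g.
Proof.
by move=> hf hg h; rewrite -subr_ge0 -IntB//; apply: Int_ge0 => x; rewrite subr_ge0.
Qed.

Lemma Int_cst c : Int (fun=> c) = c * fine (rho setT).
Proof.
rewrite /Int integral_cst//= fineM//.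
by rewrite ge0_fin_numE.
Qed.

Lemma Int_norm f : bmf f -> `|Int f| <= Int (fun x => `|f x|).
Proof.
move=> hf; have hn : bmf (fun x => `|f x|).
  have [mf [M hM]] := hf; split; first exact: measurableT_comp.
  by exists M => x; rewrite normr_id.
rewrite ler_norml -IntN//; apply/andP; split; apply: Int_le => //; try exact: bmfN.
  by move=> x; rewrite lerNl -normrN ler_norm.
by move=> x; exact: ler_norm.
Qed.

Lemma Int_indic (A : set (borel X)) : measurable A -> Int (\1_A : X -> R) = fine (rho A).
Proof. by move=> mA; rewrite /Int integral_indic// setIT. Qed.

Lemma Int_invariant f (phi : X -> X) : continuous phi -> bmf f ->
  (forall A : set (borel X), measurable A -> rho (phi @^-1` A) = rho A) ->
  Int (fun x => f (phi x)) = Int f.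
Proof.
move=> cp hf hrho; rewrite /Int; congr fine.
pose phi' : borel X -> borel X := phi.
have mp : measurable_fun setT phi' by exact: continuous_measurable_map.
have hf' : bmf (f \o phi) by exact: bmf_comp.
have := @integral_pushforward _ _ (borel X) (borel X) R phi' mp rho setT (EFin \o f).
move=> /(_ _ _ measurableT) <-.
- by apply: eq_measure_integral => A mA _; rewrite /= /pushforward hrho.
- by apply/measurable_EFinP; case: hf.
- rewrite preimage_setT.
  exact: (bmf_integrable hf').
Qed.

End Integral.

Section Uniform.
Variables (R : realType) (X : topologicalZmodType).
Hypothesis cX : compact [set: X].

Lemma uniform_continuity (f : X -> R) (e : R) : continuous f -> 0 < e ->
  exists U : set X, [/\ open U, U 0 & forall x u, U u -> `|f (x + u) - f x| < e].
Proof.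
move=> cf e0; have e2 : 0 < e / 2 by rewrite divr_gt0.
have hnc := (compact_near_coveringP _).1 cX.
have hV : nbhs (0 : X) (fun u => [set: X] `<=` (fun x => `|f (x + u) - f x| < e)).
  apply: (hnc X (nbhs (0 : X)) (fun u x => `|f (x + u) - f x| < e)) => x _.
  have h1 : \forall p \near (x, (0 : X)), `|f (p.1 + p.2) - f x| < e / 2.
    have cfa : (f (p.1 + p.2)) @[p --> (x, (0 : X))] --> f x.
      rewrite -[X in _ --> f X]addr0.
      apply: (@continuous_comp _ _ _ (fun p : X * X => p.1 + p.2) f (x, 0)); last exact: cf.
      exact: add_continuous.
    by move/cvgrPdist_lt: cfa => /(_ _ e2); apply: filterS => p; rewrite distrC.
  have h2 : \forall p \near (x, (0 : X)), `|f p.1 - f x| < e / 2.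
    have cfa : (f p.1) @[p --> (x, (0 : X))] --> f x.
      apply: (@continuous_comp _ _ _ (fun p : X * X => p.1) f (x, 0)); last exact: cf.
      exact: cvg_fst.
    by move/cvgrPdist_lt: cfa => /(_ _ e2); apply: filterS => p; rewrite distrC.
  apply: filterS2 h1 h2 => -[y u] /= h3 h4.
  have -> : f (y + u) - f y = (f (y + u) - f x) - (f y - f x) by ring.
  by rewrite (le_lt_trans (ler_normB _ _))// [X in _ < X](splitr e) ltrD.
move: hV; rewrite nbhsE => -[W [oW W0] hW].
by exists W; split => // x u /hW; exact.
Qed.

Lemma translates_cover (U : set X) : open U -> U 0 ->
  exists s : seq X, forall x, exists2 z, z \in s & U (x - z).
Proof.
move=> oU U0; have hnc := (compact_near_coveringP _).1 cX.
pose F := filter_from [set: seq X] (fun s0 => [set s : seq X | forall x, x \in s0 -> x \in s]).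
have FF : Filter F.
  apply: filter_from_filter; first by exists [::].
  move=> s1 s2 _ _; exists (s1 ++ s2) => // s /= h.
  by split => x xs; apply: h; rewrite mem_cat xs ?orbT.
have : F (fun s => [set: X] `<=` (fun x => exists2 z, z \in s & U (x - z))).
  apply: (hnc (seq X) F (fun s x => exists2 z, z \in s & U (x - z))) => x _.
  have h1 : nbhs x (fun y => U (y - x)).
    have : open ((fun y => y - x) @^-1` U).
      by apply: open_comp => // y _; exact: continuous_addr.
    by move=> oV; apply: open_nbhs_nbhs; split => //=; rewrite subrr.
  have h2 : F (fun s => x \in s).
    by exists [:: x] => // s /= h; apply: h; rewrite mem_head.
  exists ((fun y => U (y - x)), (fun s => is_true (x \in s))) => //.
  by move=> [y s] /= [h3 h4]; exists x.
by move=> [s0 _ h]; exists s0 => x; apply: (h s0).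
Qed.

Lemma continuous_bounded (f : X -> R) : continuous f -> exists M, forall x, `|f x| <= M.
Proof. by move=> cf; have [_] := @bmf_continuous R X f cX cf. Qed.

End Uniform.

Section Haar.
Variables (R : realType) (X : topologicalZmodType).
Variable mu : {measure set (borel X) -> \bar R}.
Hypothesis cX : compact [set: X].
Hypothesis mu1 : mu setT = 1%E.
Hypothesis muinv : forall (x : X) (A : set (borel X)), measurable A ->
  mu ((fun y : X => x + y) @^-1` A) = mu A.
Local Notation Int := (Int mu).

Lemma haar_fin : (mu setT < +oo)%E.
Proof. by rewrite mu1 ltry. Qed.
Local Hint Resolve haar_fin : core.

Lemma bmf_cont (f : X -> R) : continuous f -> bmf f.
Proof. exact: bmf_continuous. Qed.

Lemma Int_const (c : R) : Int (fun=> c) = c.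
Proof. by rewrite Int_cst// mu1 mulr1. Qed.

Lemma Int_shift (f : X -> R) z : bmf f -> Int (fun x => f (x + z)) = Int f.
Proof.
move=> hf; rewrite -(@Int_invariant _ _ mu haar_fin f (fun x => z + x))//.
- by under eq_fun do rewrite addrC.
- exact: continuous_addl.
- by move=> A mA; exact: muinv.
Qed.

(** Finitely many translates of the open set where [f] exceeds half of [f a] cover the group. The
    corresponding sum of translates of [f] is bounded below, and its integral is a multiple of that
    of [f]. *)
Lemma Int_gt0 (f : X -> R) a : continuous f -> (forall x, 0 <= f x) -> 0 < f a ->
  0 < Int f.
Proof.
move=> cf f0 fa.
pose U := [set u | f a / 2 < f (a + u)].
have oU : open U.
  have -> : U = (fun u => f (a + u)) @^-1` [set r | f a / 2 < r] by [].
  apply: open_comp; last exact: open_gt.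
  by move=> x _; apply: continuous_comp; [exact: continuous_addl|exact: cf].
have U0 : U 0 by rewrite /U /= addr0; lra.
have [s hs] := translates_cover cX oU U0.
have bs z : bmf (fun x => f (x + (a - z))).
  by apply: (@bmf_comp R X f (fun x => x + (a - z))); [exact: continuous_addr|exact: bmf_cont].
have : f a / 2 <= Int (fun x => \sum_(z <- s) f (x + (a - z))).
  rewrite -[X in X <= _]Int_const; apply: Int_le => //; [exact: bmf_cst|exact: bmf_sum|].
  move=> x; have [z zs /= Uz] := hs x.
  rewrite (big_rem z)//= -[X in X <= _]addr0; apply: lerD; last exact: sumr_ge0.
  by apply: ltW; rewrite addrCA.
rewrite Int_sum//.
under eq_bigr do rewrite (Int_shift _ (bmf_cont cf)).
rewrite big_const_seq iter_addr_0 count_predT => h.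
rewrite lt_neqAle Int_ge0// andbT; apply/negP => /eqP e.
by move: h; rewrite -e mul0rn; lra.
Qed.

Lemma Int_sqr_eq0 (f : X -> R) : continuous f -> Int (fun x => f x ^+ 2) = 0 -> forall x, f x = 0.
Proof.
move=> cf h x; apply/eqP; apply/negPn/negP => fx.
suff : 0 < Int (fun x => f x ^+ 2) by rewrite h ltxx.
apply: (@Int_gt0 _ x).
- move=> y; apply: (@continuous_comp _ _ _ f (fun r : R => r ^+ 2)); first exact: cf.
  exact: exprn_continuous.
- by move=> y; exact: sqr_ge0.
- by rewrite exprn_even_gt0.
Qed.

Definition l2 (f : X -> R) : R := Num.sqrt (Int (fun x => f x ^+ 2)).

Lemma bmf_sqr (f : X -> R) : bmf f -> bmf (fun x => f x ^+ 2).
Proof. by move=> hf; under eq_fun do rewrite expr2; exact: bmfM. Qed.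

Lemma l2_sqr f : l2 f ^+ 2 = Int (fun x => f x ^+ 2).
Proof. by rewrite sqr_sqrtr// Int_ge0// => x; exact: sqr_ge0. Qed.

Lemma l2_ge0 f : 0 <= l2 f.
Proof. exact: sqrtr_ge0. Qed.

Lemma cauchy_schwarz f g : bmf f -> bmf g ->
  `|Int (fun x => f x * g x)| <= l2 f * l2 g.
Proof.
move=> hf hg; set a := Int _.
have key t : 0 <= l2 f ^+ 2 + 2 * t * a + t ^+ 2 * l2 g ^+ 2.
  have hfg := bmfM hf hg; have hf2 := bmf_sqr hf; have hg2 := bmf_sqr hg.
  rewrite !l2_sqr /a -(IntZ haar_fin (2 * t) hfg) -(IntZ haar_fin _ hg2).
  have hfg' := bmfZ (2 * t) hfg; have hg2' := bmfZ (t ^+ 2) hg2.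
  rewrite -(IntD haar_fin hf2 hfg') -(IntD haar_fin (bmfD hf2 hfg') hg2').
  apply: Int_ge0 => x.
  have -> : f x ^+ 2 + 2 * t * (f x * g x) + t ^+ 2 * g x ^+ 2 = (f x + t * g x) ^+ 2.
    by ring.
  exact: sqr_ge0.
have f0 := l2_ge0 f; have g0 := l2_ge0 g.
rewrite -[X in _ <= X]ger0_norm ?mulr_ge0// -ler_sqr ?nnegrE// -!normrX !ger0_norm ?sqr_ge0//.
have [g00|g00] := eqVneq (l2 g) 0.
  rewrite g00 mulr0 expr0n/=; rewrite leNgt; apply/negP => a0.
  have an0 : a != 0 by apply/eqP => e; rewrite e expr0n ltxx in a0.
  (* With [l2 g = 0] the quadratic is affine in [t], and this [t] gives it the value -1. *)
  have := key (- (l2 f ^+ 2 + 1) / (2 * a)); rewrite g00.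
  have -> : l2 f ^+ 2 + 2 * (- (l2 f ^+ 2 + 1) / (2 * a)) * a +
    (- (l2 f ^+ 2 + 1) / (2 * a)) ^+ 2 * 0 ^+ 2 = -1 by field.
  by rewrite lerNr oppr0 ler10.
have gp : 0 < l2 g ^+ 2 by rewrite exprn_even_gt0.
have := key (- a / l2 g ^+ 2).
have -> : l2 f ^+ 2 + 2 * (- a / l2 g ^+ 2) * a + (- a / l2 g ^+ 2) ^+ 2 * l2 g ^+ 2 =
  (l2 f ^+ 2 * l2 g ^+ 2 - a ^+ 2) / l2 g ^+ 2 by field.
by rewrite pmulr_lge0 ?invr_gt0// subr_ge0 exprMn.
Qed.

Lemma l2_le f (M : R) : bmf f -> (forall x, `|f x| <= M) -> l2 f <= M.
Proof.
move=> hf h; have M0 : 0 <= M by exact: le_trans (h 0).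
rewrite -ler_sqr ?nnegrE ?l2_ge0// l2_sqr -[X in _ <= X]Int_const.
apply: Int_le; [exact: haar_fin|exact: bmf_sqr|exact: bmf_cst|].
by move=> x; rewrite -[X in X <= _]ger0_norm ?sqr_ge0// normrX lerXn2r ?nnegrE.
Qed.

Lemma Int_norm_l2 f : bmf f -> `|Int f| <= l2 f.
Proof.
move=> hf; have := cauchy_schwarz hf (bmf_cst X (1 : R)).
rewrite (_ : (fun x => f x * 1) = f); last by apply/funext => x; rewrite mulr1.
move=> h; apply: (le_trans h); rewrite ler_piMr ?l2_ge0//.
by apply: l2_le; [exact: bmf_cst|move=> x; rewrite normr1].
Qed.

End Haar.

Lemma small_norm_eq0 (R : realType) (x c : R) : 0 <= c ->
  (forall e, 0 < e -> `|x| <= e * c) -> x = 0.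
Proof.
move=> c0 h; apply/eqP; rewrite -normr_eq0 eq_le normr_ge0 andbT.
apply/ler_addgt0Pl => e e0; rewrite addr0.
have c1 : 0 < c + 1 by rewrite ltr_wpDl.
apply: (le_trans (h (e / (c + 1)) _)); first by rewrite divr_gt0.
by rewrite -mulrA ler_piMr ?(ltW e0)// mulrC ler_pdivrMr// mul1r lerDl.
Qed.

(** * Convolution operators and the Peter-Weyl theorem *)

Section Convolution.
Variables (R : realType) (X : topologicalZmodType).
Variable mu : {measure set (borel X) -> \bar R}.
Hypothesis cX : compact [set: X].
Hypothesis mu1 : mu setT = 1%E.
Hypothesis muinv : forall (x : X) (A : set (borel X)), measurable A ->
  mu ((fun y : X => x + y) @^-1` A) = mu A.
Local Notation Int := (Int mu).
Local Notation l2 := (l2 mu).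
Let fm := haar_fin mu1.

Lemma continuous_of_equi (f : X -> R) :
  (forall e : R, 0 < e -> exists U : set X,
     [/\ open U, U 0 & forall x u, U u -> `|f (x + u) - f x| <= e]) -> continuous f.
Proof.
move=> h x; apply/cvgrPdist_le => e e0.
have [U [oU U0 hU]] := h e e0.
have : nbhs x (fun y => U (y - x)).
  have : open ((fun y => y - x) @^-1` U).
    by apply: open_comp => // y _; exact: continuous_addr.
  by move=> oV; apply: open_nbhs_nbhs; split => //=; rewrite subrr.
apply: filterS => y Uy; rewrite distrC.
by have := hU x _ Uy; rewrite [x + _]addrC subrK.
Qed.

Definition convol (k g : X -> R) : X -> R := fun x => Int (fun y => k (x - y) * g y).

Lemma bmf_kernel (k : X -> R) x : continuous k -> bmf (fun y => k (x - y)).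
Proof.
move=> ck; apply: (@bmf_comp R X k (fun y => x - y)); first exact: continuous_subr.
exact: bmf_cont.
Qed.

Lemma conv_bound (k g : X -> R) C x : continuous k -> bmf g -> (forall z, `|k z| <= C) ->
  `|convol k g x| <= C * l2 g.
Proof.
move=> ck hg hC; have hk := bmf_kernel x ck.
apply: (le_trans (cauchy_schwarz mu1 hk hg)).
by apply: ler_wpM2r; [exact: l2_ge0|exact: l2_le].
Qed.

(** The neighbourhood [U] is the same for all [g]: this equicontinuity on balls of L2 is the
    compactness of the convolution operator. *)
Lemma conv_equi (k : X -> R) e : continuous k -> 0 < e ->
  exists U : set X, [/\ open U, U 0 & forall x u g, U u -> bmf g ->
    `|convol k g (x + u) - convol k g x| <= e * l2 g].
Proof.
move=> ck e0; have [U [oU U0 hU]] := uniform_continuity cX ck e0.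
exists U; split => // x u g Uu hg; rewrite /convol.
have h1 := bmf_kernel x ck; have h2 := bmf_kernel (x + u) ck.
rewrite -(IntB fm (bmfM h2 hg) (bmfM h1 hg)).
rewrite (_ : (fun y => _ - _) = (fun y => (k (x + u - y) - k (x - y)) * g y)); last first.
  by apply/funext => y; rewrite mulrBl.
apply: (le_trans (cauchy_schwarz mu1 (bmfB h2 h1) hg)).
apply: ler_wpM2r; [exact: l2_ge0|apply: l2_le => //; first exact: bmfB].
by move=> y; apply: ltW; rewrite addrAC hU.
Qed.

Lemma conv_continuous (k g : X -> R) : continuous k -> bmf g -> continuous (convol k g).
Proof.
move=> ck hg; apply: continuous_of_equi => e e0.
have e1 : 0 < e / (l2 g + 1) by rewrite divr_gt0// ltr_wpDl// l2_ge0.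
have [U [oU U0 hU]] := conv_equi ck e1; exists U; split => // x u Uu.
apply: (le_trans (hU x u g Uu hg)).
rewrite mulrAC ler_pdivrMr ?ltr_wpDl// ?l2_ge0//.
by rewrite ler_wpM2l ?(ltW e0)// lerDl.
Qed.

Lemma convD (k g h : X -> R) : continuous k -> bmf g -> bmf h ->
  convol k (fun x => g x + h x) = (fun x => convol k g x + convol k h x).
Proof.
move=> ck hg hh; apply/funext => x; rewrite /convol.
have h1 := bmf_kernel x ck.
rewrite -(IntD fm (bmfM h1 hg) (bmfM h1 hh)); congr (Int _).
by apply/funext => y; rewrite mulrDr.
Qed.

Lemma convZ c (k g : X -> R) : continuous k -> bmf g ->
  convol k (fun x => c * g x) = (fun x => c * convol k g x).
Proof.
move=> ck hg; apply/funext => x; rewrite /convol.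
have h1 := bmf_kernel x ck.
rewrite -(IntZ fm _ (bmfM h1 hg)); congr (Int _).
by apply/funext => y; rewrite mulrCA.
Qed.

Lemma conv_shift (k g : X -> R) z : continuous k -> bmf g ->
  convol k (fun x => g (x + z)) = (fun x => convol k g (x + z)).
Proof.
move=> ck hg; apply/funext => x; rewrite /convol.
have h1 := bmf_kernel (x + z) ck.
rewrite -(Int_shift mu1 muinv z (bmfM h1 hg)); congr (Int _).
by apply/funext => y; rewrite opprD addrACA subrr addr0.
Qed.

(** The Borel sets of the square of [X] may exceed the product of the Borel sets, so Fubini is
    proved for finite sums of product kernels, written as nested case distinctions: with [a] the
    indicator of a set, the new kernel is [b y] on it and [K x y] off it. *)
Inductive separable : (X -> X -> R) -> Prop :=
| separable0 : separable (fun _ _ => 0)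
| separableS a b K : bmf a -> bmf b -> separable K ->
    separable (fun x y => a x * b y + (1 - a x) * K x y).

Lemma separable_fubini K : separable K ->
  (forall x, bmf (K x)) /\ (forall y, bmf (K^~ y)) /\
  forall g h, bmf g -> bmf h ->
    [/\ bmf (fun x => Int (fun y => K x y * g y)),
        bmf (fun y => Int (fun x => K x y * h x)) &
        Int (fun x => h x * Int (fun y => K x y * g y)) =
        Int (fun y => g y * Int (fun x => K x y * h x))].
Proof.
elim=> [|a b {}K ha hb _ [K1 [K2 IH]]].
  have b0 := bmf_cst X (0 : R); split => [x|]; first exact: b0.
  split=> [y|g h hg hh]; first exact: b0.
  have E g0 : Int (fun y => 0 * g0 y) = 0.
    by under [X in Int X]eq_fun do rewrite mul0r; exact: Int_const.
  rewrite !E; split; [exact: b0|exact: b0|].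
  by congr (Int _); apply/funext => x; rewrite !mulr0.
have h1a : bmf (fun x => 1 - a x) by apply: bmfB => //; exact: bmf_cst.
split=> [x|]; first by apply: bmfD; apply: bmfZ.
split=> [y|g h hg hh].
  apply: bmfD; last exact: bmfM.
  by under eq_fun do rewrite mulrC; exact: bmfZ.
have E1 x : Int (fun y => (a x * b y + (1 - a x) * K x y) * g y) =
  a x * Int (fun y => b y * g y) + (1 - a x) * Int (fun y => K x y * g y).
  rewrite -(IntZ fm _ (bmfM hb hg)) -(IntZ fm _ (bmfM (K1 x) hg)).
  rewrite -(IntD fm (bmfZ _ (bmfM hb hg)) (bmfZ _ (bmfM (K1 x) hg))).
  by congr (Int _); apply/funext => y; ring.
have hh' : bmf (fun x => (1 - a x) * h x) by exact: bmfM.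
have E2 y : Int (fun x => (a x * b y + (1 - a x) * K x y) * h x) =
  b y * Int (fun x => a x * h x) + Int (fun x => K x y * ((1 - a x) * h x)).
  rewrite -(IntZ fm _ (bmfM ha hh)).
  rewrite -(IntD fm (bmfZ _ (bmfM ha hh)) (bmfM (K2 y) hh')).
  by congr (Int _); apply/funext => x; ring.
have [B1 B2 B3] := IH g _ hg hh'.
have bc c u : bmf u -> bmf (fun x => u x * c).
  by move=> hu; under eq_fun do rewrite mulrC; exact: bmfZ.
split.
- under eq_fun do rewrite E1; apply: bmfD; [exact: bc|exact: bmfM].
- by under eq_fun do rewrite E2; apply: bmfD; [exact: bc|].
- under [X in Int X]eq_fun do rewrite E1.
  under [X in _ = Int X]eq_fun do rewrite E2.
  set I1 := Int (fun y => b y * g y); set I2 := Int (fun y => a y * h y).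
  transitivity (I1 * I2 + Int (fun x => ((1 - a x) * h x) * Int (fun y => K x y * g y))).
    rewrite {1}/I2 -(IntZ fm _ (bmfM ha hh)).
    rewrite -(IntD fm (bmfZ _ (bmfM ha hh)) (bmfM hh' B1)).
    by congr (Int _); apply/funext => x; ring.
  rewrite B3 mulrC {1}/I1 -(IntZ fm _ (bmfM hb hg)).
  rewrite -(IntD fm (bmfZ _ (bmfM hb hg)) (bmfM hg B2)).
  by congr (Int _); apply/funext => x; ring.
Qed.

(** By uniform continuity [k (x - y)] is close to [k (z - y)] when [x] is close to [z], and finitely
    many [z] suffice. *)
Lemma separable_approx (k : X -> R) e : continuous k -> 0 < e ->
  exists2 K, separable K & forall x y, `|k (x - y) - K x y| <= e.
Proof.
move=> ck e0; have [U [oU U0 hU]] := uniform_continuity cX ck e0.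
have [s hs] := translates_cover cX oU U0.
suff [K hK1 hK2] : exists2 K, separable K &
    forall x y, (exists2 z, z \in s & U (x - z)) -> `|k (x - y) - K x y| <= e.
  by exists K => // x y; exact: hK2.
elim: s {hs} => [|z s [K hK1 hK2]].
  by exists (fun _ _ => 0) => [|x y [z]//]; exact: separable0.
pose a : X -> R := \1_[set x | U (x - z)].
have ha : bmf a.
  apply: bmf_indic; apply: borel_open.
  apply: (@open_comp _ _ (fun x => x - z)) => // x _; exact: continuous_addr.
exists (fun x y => a x * k (z - y) + (1 - a x) * K x y).
  by apply: separableS => //; exact: bmf_kernel.
move=> x y [w]; rewrite inE => ws Uw.
have [Uz|Uz] := pselect (U (x - z)).
  have -> : a x = 1 by rewrite /a indicE mem_set.
  rewrite mul1r subrr mul0r addr0; apply: ltW.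
  by have := hU (z - y) _ Uz; rewrite addrCA addrAC subrr add0r addrC.
have -> : a x = 0 by rewrite /a indicE memNset.
rewrite mul0r add0r subr0 mul1r; apply: hK2.
by case/orP: ws Uw => [/eqP-> //|ws Uw]; exists w.
Qed.

(** The identity is exact for separable kernels, and replacing [k] by one within [e] costs at most
    [e * (l2 g * l2 h)] on each side. *)
Lemma conv_adjoint (k g h : X -> R) : continuous k -> bmf g -> bmf h ->
  Int (fun x => h x * convol k g x) = Int (fun y => g y * convol (fun z => k (- z)) h y).
Proof.
move=> ck hg hh; apply/eqP; rewrite -subr_eq0; apply/eqP.
have ck' : continuous (fun z => k (- z)).
  by move=> z; apply: continuous_comp; [exact: opp_continuous|exact: ck].
have bc1 : bmf (convol k g) by apply: bmf_cont => //; exact: conv_continuous.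
have bc2 : bmf (convol (fun z => k (- z)) h) by apply: bmf_cont => //; exact: conv_continuous.
apply: (@small_norm_eq0 _ _ (2 * (l2 g * l2 h))).
  by rewrite mulr_ge0// mulr_ge0// l2_ge0.
move=> e e0; have [K sK hK] := separable_approx ck e0.
have [K1 [K2 hF]] := separable_fubini sK; have [B1 B2 B3] := hF g h hg hh.
pose Kg x := Int (fun y => K x y * g y); pose Kh y := Int (fun x => K x y * h x).
have D1 x : `|convol k g x - Kg x| <= e * l2 g.
  have hk := bmf_kernel x ck.
  rewrite /convol /Kg -(IntB fm (bmfM hk hg) (bmfM (K1 x) hg)).
  rewrite (_ : (fun y => _ - _) = (fun y => (k (x - y) - K x y) * g y)); last first.
    by apply/funext => y; rewrite mulrBl.
  apply: (le_trans (cauchy_schwarz mu1 (bmfB hk (K1 x)) hg)).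
  apply: ler_wpM2r; first exact: l2_ge0.
  exact: (l2_le mu1 (bmfB hk (K1 x)) (hK x)).
have D2 y : `|convol (fun z => k (- z)) h y - Kh y| <= e * l2 h.
  have hk := bmf_kernel y ck'.
  rewrite /convol /Kh -(IntB fm (bmfM hk hh) (bmfM (K2 y) hh)).
  rewrite (_ : (fun x => _ - _) = (fun x => (k (- (y - x)) - K x y) * h x)); last first.
    by apply/funext => x; rewrite mulrBl.
  apply: (le_trans (cauchy_schwarz mu1 (bmfB hk (K2 y)) hh)).
  apply: ler_wpM2r; first exact: l2_ge0.
  apply: (l2_le mu1 (bmfB hk (K2 y))) => x.
  by rewrite opprB; exact: hK.
have E1 : `|Int (fun x => h x * convol k g x) - Int (fun x => h x * Kg x)| <= e * (l2 g * l2 h).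
  rewrite -(IntB fm (bmfM hh bc1) (bmfM hh B1)).
  rewrite (_ : (fun y => _ - _) = (fun y => h y * (convol k g y - Kg y))); last first.
    by apply/funext => y; rewrite mulrBr.
  have bd := bmfB bc1 B1.
  apply: (le_trans (cauchy_schwarz mu1 hh bd)); rewrite mulrA mulrC.
  by apply: ler_wpM2r; [exact: l2_ge0|exact: l2_le].
have E2 : `|Int (fun x => g x * convol (fun z => k (- z)) h x) - Int (fun x => g x * Kh x)|
    <= e * (l2 g * l2 h).
  rewrite -(IntB fm (bmfM hg bc2) (bmfM hg B2)).
  rewrite (_ : (fun y => _ - _) = (fun y => g y * (convol (fun z => k (- z)) h y - Kh y))); last first.
    by apply/funext => y; rewrite mulrBr.
  have bd := bmfB bc2 B2.
  apply: (le_trans (cauchy_schwarz mu1 hg bd)); rewrite mulrCA.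
  by apply: ler_wpM2l; [exact: l2_ge0|exact: l2_le].
move: E1 E2; rewrite -/Kg -/Kh in B3 *; rewrite B3.
set u := Int _; set v := Int _; set w := Int _ => E1 E2.
have -> : u - w = (u - v) - (w - v) by ring.
apply: (le_trans (ler_normB _ _)).
have -> : e * (2 * (l2 g * l2 h)) = e * (l2 g * l2 h) + e * (l2 g * l2 h) by ring.
apply: lerD; [exact: E1|exact: E2].
Qed.

End Convolution.

(** In a nonzero subspace of minimal rank stable under the family, an eigenspace of one member is
    stable under all by commutation, hence is everything. The family, later all translations, may be
    infinite. *)
Lemma common_eigenvector_family (C : numClosedFieldType) N (I : Type) (A : I -> 'M[C]_N) :
  (0 < N)%N -> (forall i j, A i *m A j = A j *m A i) ->
  exists2 v : 'rV[C]_N, v != 0 & exists c : I -> C, forall i, v *m A i = c i *: v.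
Proof.
move=> N0 hc.
pose Q k := `[< exists W : 'M[C]_N, [/\ W != 0, \rank W = k & forall i, (W *m A i <= W)%MS] >].
have Q0 : exists k, Q k.
  exists (\rank (1%:M : 'M[C]_N)); apply/asboolP; exists 1%:M; split=> //.
    by rewrite -mxrank_eq0 mxrank1 -lt0n.
  by move=> i; exact: submx1.
case: (ex_minnP Q0) => k /asboolP[W [W0 rW WA]] kmin.
exists (nz_row W); first by rewrite nz_row_eq0.
suff h i : exists a, nz_row W *m A i = a *: nz_row W.
  by have [c hcc] := choice h; exists c.
have rk0 : (0 < \rank W)%N by rewrite lt0n mxrank_eq0.
have /submxP[M hM] : (row_base W *m A i <= row_base W)%MS.
  by rewrite (eqmxMr _ (eq_row_base W)) eq_row_base.
have [a /eigenvalueP[w wM w0]] := eigenvalue_closed M rk0.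
have hu : (w *m row_base W) *m A i = a *: (w *m row_base W).
  by rewrite -mulmxA hM mulmxA wM scalemxAl.
have u0 : w *m row_base W != 0 by rewrite mulmx_free_eq0 ?row_base_free.
pose Z := (W :&: eigenspace (A i) a)%MS.
have ZW : (Z <= W)%MS by exact: capmxSl.
have ZE : (Z <= eigenspace (A i) a)%MS by exact: capmxSr.
have Z0 : Z != 0.
  apply/negP => /eqP e.
  have : (w *m row_base W <= Z)%MS.
    rewrite sub_capmx -{1}(eq_row_base W) submxMl /=.
    by apply/eigenspaceP.
  by rewrite e submx0 (negbTE u0).
have Zst j : (Z *m A j <= Z)%MS.
  rewrite sub_capmx (submx_trans (submxMr _ ZW) (WA j)) /=.
  apply/eigenspaceP; rewrite -mulmxA -hc mulmxA (eigenspaceP ZE).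
  by rewrite scalemxAl.
have : (k <= \rank Z)%N by apply: kmin; apply/asboolP; exists Z.
rewrite -rW => hk; have WZ : (W <= Z)%MS by rewrite -(geq_leqif (mxrank_leqif_sup ZW)).
exists a; apply/eigenspaceP; apply: (submx_trans (nz_row_sub W)).
exact: submx_trans WZ ZE.
Qed.

(** * Uniform limits along an ultrafilter *)

Section Ascoli.
Variables (R : realType) (X : topologicalZmodType).
Hypothesis cX : compact [set: X].
Variables (U : set_system nat) (u : nat -> X -> R) (M : R).
Hypothesis UU : UltraFilter U.
Hypothesis uM : forall n x, `|u n x| <= M.
Hypothesis uequi : forall e, 0 < e -> exists V : set X,
  [/\ open V, V 0 & forall n x v, V v -> `|u n (x + v) - u n x| <= e].

Let PU : ProperFilter U. Proof. exact: ultra_proper. Qed.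

Definition ptlim x : R := ulim U (u^~ x).

Lemma ptlimP x e : 0 < e -> U [set n | `|u n x - ptlim x| < e].
Proof. by move=> e0; apply: (@ulimP R _ U UU (u^~ x)) => //; exists M => n. Qed.

Lemma ptlim_equi e : 0 < e -> exists V : set X,
  [/\ open V, V 0 & forall x v, V v -> `|ptlim (x + v) - ptlim x| <= e].
Proof.
move=> e0; have [V [oV V0 hV]] := uequi e0; exists V; split=> // x v Vv.
apply/ler_addgt0Pl => d d0; have d2 : 0 < d / 2 by rewrite divr_gt0.
have [n [/= h1 h2]] := filter_ex (filterI (ptlimP (x + v) d2) (ptlimP x d2)).
have -> : ptlim (x + v) - ptlim x =
  (u n x - ptlim x) - (u n (x + v) - ptlim (x + v)) + (u n (x + v) - u n x) by ring.
apply: (le_trans (ler_normD _ _)); apply: lerD; last exact: hV.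
by rewrite (le_trans (ler_normB _ _))// [X in _ <= X](splitr d) ltW// ltrD.
Qed.

(** Closeness on a finite net is an event of [U], and equicontinuity of the family and of its limit
    spreads it to all of [X]. *)
Lemma ptlim_uniform e : 0 < e -> U [set n | forall x, `|u n x - ptlim x| <= e].
Proof.
move=> e0; have e3 : 0 < e / 3 by rewrite divr_gt0.
have [V [oV V0 hV]] := uequi e3; have [W [oW W0 hW]] := ptlim_equi e3.
have [s hs] := @translates_cover X cX (V `&` W) (openI oV oW) (conj V0 W0).
have hfin : U [set n | forall z, z \in s -> `|u n z - ptlim z| < e / 3].
  elim: s {hs} => [|z s IH]; first by apply: filterS filterT => n _ z.
  apply: filterS (filterI (ptlimP z e3) IH) => n [/= h1 h2] w.
  by rewrite inE => /orP[/eqP-> //|]; exact: h2.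
apply: filterS hfin => n /= hn x; have [z zs [Vz Wz]] := hs x.
have := hV n z _ Vz; have := hW z _ Wz; rewrite [z + _]addrC subrK => h1 h2.
have h3 := hn z zs.
have -> : u n x - ptlim x = (u n x - u n z) - (ptlim x - ptlim z) + (u n z - ptlim z) by ring.
apply: (le_trans (ler_normD _ _)).
have -> : e = e / 3 + e / 3 + e / 3 by field.
by apply: lerD; [apply: (le_trans (ler_normB _ _)); exact: lerD|exact: ltW].
Qed.

End Ascoli.

(** * Continuous functions orthogonal to all characters *)

Section Perp.
Variables (R : realType) (X : topologicalZmodType).
Variable mu : {measure set (borel X) -> \bar R}.
Hypothesis cX : compact [set: X].
Hypothesis mu1 : mu setT = 1%E.
Hypothesis muinv : forall (x : X) (A : set (borel X)), measurable A ->
  mu ((fun y : X => x + y) @^-1` A) = mu A.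
Local Notation Int := (Int mu).
Local Notation l2 := (l2 mu).
Local Notation convol := (convol mu).
Let fm := haar_fin mu1.
Let cb (f : X -> R) : continuous f -> bmf f := @bmf_cont R X cX f.

Definition chRe (chi : X -> R[i]) x : R := complex.Re (chi x).
Definition chIm (chi : X -> R[i]) x : R := complex.Im (chi x).

Lemma chReD chi x y : is_character chi ->
  chRe chi (x + y) = chRe chi x * chRe chi y - chIm chi x * chIm chi y.
Proof.
move=> [_ _ _ h _]; rewrite /chRe h /chIm; by case: (chi x) => a b; case: (chi y).
Qed.

Lemma chImD chi x y : is_character chi ->
  chIm chi (x + y) = chRe chi x * chIm chi y + chIm chi x * chRe chi y.
Proof.
move=> [_ _ _ h _]; rewrite /chIm h /chRe; by case: (chi x) => a b; case: (chi y).
Qed.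

Lemma cont_chRe chi : is_character chi -> continuous (chRe chi).
Proof. by case. Qed.

Lemma cont_chIm chi : is_character chi -> continuous (chIm chi).
Proof. by case. Qed.

(** The space that Peter-Weyl shows to be zero. It is invariant under translations, convolutions and
    uniform limits, so that the spectral argument can be run inside it. *)
Definition perp (g : X -> R) : Prop := continuous g /\
  forall chi, is_character chi ->
    Int (fun x => g x * chRe chi x) = 0 /\ Int (fun x => g x * chIm chi x) = 0.

Lemma continuous_lin (a b : R) (g h : X -> R) : continuous g -> continuous h ->
  continuous (fun x => a * g x + b * h x).
Proof.
by move=> cg ch x; apply: cvgD; apply: cvgM; [exact: cvg_cst|exact: cg|exact: cvg_cst|exact: ch].
Qed.

Lemma Int_lin (a b : R) (g h : X -> R) : bmf g -> bmf h ->
  Int (fun x => a * g x + b * h x) = a * Int g + b * Int h.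
Proof.
by move=> hg hh; rewrite IntD ?IntZ//; exact: bmfZ.
Qed.

Lemma perp_lin a b g h : perp g -> perp h -> perp (fun x => a * g x + b * h x).
Proof.
move=> [cg pg] [ch ph]; split; first exact: continuous_lin.
move=> chi hchi; have [g1 g2] := pg _ hchi; have [h1 h2] := ph _ hchi.
have bg := cb cg; have bh := cb ch.
have b1 := cb (cont_chRe hchi); have b2 := cb (cont_chIm hchi).
split.
- rewrite (_ : (fun x => _) = (fun x => a * (g x * chRe chi x) + b * (h x * chRe chi x))).
    by rewrite Int_lin ?g1 ?h1 ?mulr0 ?addr0//; exact: bmfM.
  by apply/funext => x; ring.
- rewrite (_ : (fun x => _) = (fun x => a * (g x * chIm chi x) + b * (h x * chIm chi x))).
    by rewrite Int_lin ?g2 ?h2 ?mulr0 ?addr0//; exact: bmfM.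
  by apply/funext => x; ring.
Qed.

Lemma continuous_shift (g : X -> R) z : continuous g -> continuous (fun x => g (x + z)).
Proof. by move=> cg x; apply: continuous_comp; [exact: continuous_addr|exact: cg]. Qed.

Lemma perp_shift g z : perp g -> perp (fun x => g (x + z)).
Proof.
move=> [cg pg]; split; first exact: continuous_shift.
move=> chi hchi; have [g1 g2] := pg _ hchi; have bg := cb cg.
have b1 := cb (cont_chRe hchi); have b2 := cb (cont_chIm hchi).
have E h : bmf h -> Int (fun x => g (x + z) * h x) = Int (fun x => g x * h (x - z)).
  move=> bh; rewrite -[RHS](Int_shift mu1 muinv z) ?addrK//.
    by congr (Int _); apply/funext => x; rewrite addrK.
  by apply: bmfM => //; apply: (@bmf_comp R X h (fun x => x - z)) => //; exact: continuous_addr.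
split; rewrite E//.
- rewrite (_ : (fun x => _) = (fun x => chRe chi (- z) * (g x * chRe chi x) +
    (- chIm chi (- z)) * (g x * chIm chi x))).
    by rewrite Int_lin ?g1 ?g2 ?mulr0 ?addr0//; exact: bmfM.
  by apply/funext => x; rewrite chReD//; ring.
- rewrite (_ : (fun x => _) = (fun x => chIm chi (- z) * (g x * chRe chi x) +
    chRe chi (- z) * (g x * chIm chi x))).
    by rewrite Int_lin ?g1 ?g2 ?mulr0 ?addr0//; exact: bmfM.
  by apply/funext => x; rewrite chImD//; ring.
Qed.

(** By the adjoint formula, the coefficients of the convolution at [chi] are combinations of those
    of [g] at [chi]. *)
Lemma perp_conv k g : continuous k -> perp g -> perp (convol k g).
Proof.
move=> ck [cg pg]; have bg := cb cg; have bk := cb ck.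
split; first exact: conv_continuous.
move=> chi hchi; have [g1 g2] := pg _ hchi.
have b1 := cb (cont_chRe hchi); have b2 := cb (cont_chIm hchi).
have E h : bmf h -> Int (fun x => convol k g x * h x) =
    Int (fun y => g y * Int (fun x => k x * h (x + y))).
  move=> bh; under [X in Int X]eq_fun do rewrite mulrC.
  rewrite (conv_adjoint cX mu1 ck bg bh); congr (Int _); apply/funext => y; congr (_ * _); rewrite /convol.
  rewrite -[RHS](Int_shift mu1 muinv (- y)); last first.
    by apply: bmfM => //; apply: (@bmf_comp R X h (fun x => x + y)) => //; exact: continuous_addr.
  by congr (Int _); apply/funext => x; rewrite subrK opprB.
split; rewrite E//.
- rewrite (_ : (fun x => _) = (fun x => Int (fun y => k y * chRe chi y) * (g x * chRe chi x) +
    (- Int (fun y => k y * chIm chi y)) * (g x * chIm chi x))).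
    by rewrite Int_lin ?g1 ?g2 ?mulr0 ?addr0//; exact: bmfM.
  apply/funext => x.
  rewrite (_ : (fun y => _) = (fun y => chRe chi x * (k y * chRe chi y) +
    (- chIm chi x) * (k y * chIm chi y))).
    by rewrite Int_lin; [ring|exact: bmfM|exact: bmfM].
  by apply/funext => y; rewrite chReD//; ring.
- rewrite (_ : (fun x => _) = (fun x => Int (fun y => k y * chIm chi y) * (g x * chRe chi x) +
    Int (fun y => k y * chRe chi y) * (g x * chIm chi x))).
    by rewrite Int_lin ?g1 ?g2 ?mulr0 ?addr0//; exact: bmfM.
  apply/funext => x.
  rewrite (_ : (fun y => _) = (fun y => chIm chi x * (k y * chRe chi y) +
    chRe chi x * (k y * chIm chi y))).
    by rewrite Int_lin; [ring|exact: bmfM|exact: bmfM].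
  by apply/funext => y; rewrite chImD//; ring.
Qed.

Lemma perp_uniform_limit g : continuous g ->
  (forall e, 0 < e -> exists2 h, perp h & forall x, `|h x - g x| <= e) -> perp g.
Proof.
move=> cg hg; split=> // chi hchi; have bg := cb cg.
have b1 := cb (cont_chRe hchi); have b2 := cb (cont_chIm hchi).
have key w : bmf w -> (forall h, perp h -> Int (fun x => h x * w x) = 0) ->
    Int (fun x => g x * w x) = 0.
  move=> bw hw; apply: (@small_norm_eq0 _ _ (l2 w)); first exact: l2_ge0.
  move=> e e0; have [h ph hh] := hg e e0; have bh := cb ph.1.
  rewrite -[X in `|X|]opprK normrN -sub0r -(hw h ph).
  rewrite -(IntB fm (bmfM bh bw) (bmfM bg bw)).
  rewrite (_ : (fun x => _) = (fun x => (h x - g x) * w x)); last first.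
    by apply/funext => x; rewrite mulrBl.
  have bd := bmfB bh bg.
  apply: (le_trans (cauchy_schwarz mu1 bd bw)); apply: ler_wpM2r; first exact: l2_ge0.
  exact: l2_le.
by split; apply: key => // h [_ /(_ _ hchi)[]].
Qed.

End Perp.

(** Meant for [s = l2 (S g)], [t = l2 (T g)] and [ts = l2 (T (S g))], with [S] the adjoint of [T]
    after [T]: Cauchy-Schwarz gives one bound, the norm of [T] the other, and [ts] is eliminated. *)
Lemma sqr_interpolation (R : realFieldType) (L s t ts : R) : 0 <= L -> 0 <= s -> 0 <= t -> 0 <= ts ->
  s ^+ 2 <= t * ts -> ts ^+ 2 <= L * s ^+ 2 -> s ^+ 2 <= L * t ^+ 2.
Proof.
move=> L0 s0 t0 ts0 h h2.
have [e|e] := eqVneq s 0; first by rewrite e expr0n/= mulr_ge0// sqr_ge0.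
have sp : 0 < s ^+ 2 by rewrite exprn_even_gt0.
rewrite -(ler_pM2r sp).
have h3 : s ^+ 2 * s ^+ 2 <= (t * ts) * (t * ts) by apply: ler_pM => //; exact: sqr_ge0.
apply: (le_trans h3).
have -> : (t * ts) * (t * ts) = t ^+ 2 * ts ^+ 2 by ring.
have -> : L * t ^+ 2 * s ^+ 2 = t ^+ 2 * (L * s ^+ 2) by ring.
exact: (ler_wpM2l (sqr_ge0 _) h2).
Qed.

(** The left side is the expanded squared norm of [S g - L g], with [s], [t], [g] the norms of
    [S g], [T g], [g]: an almost maximal vector is almost an eigenvector. *)
Lemma defect_le (R : realFieldType) (L s t g : R) : s ^+ 2 <= L * t ^+ 2 -> g ^+ 2 <= 1 ->
  1 * s ^+ 2 + 1 * (- (2 * L) * t ^+ 2 + L ^+ 2 * g ^+ 2) <= L * (L - t ^+ 2).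
Proof.
move=> h g2; have : L ^+ 2 * g ^+ 2 <= L ^+ 2 by rewrite ler_piMr// sqr_ge0.
move: h; set a := s ^+ 2; set b := t ^+ 2; set c := L ^+ 2 * _.
have -> : L * (L - b) = L ^+ 2 - L * b by ring.
have -> : - (2 * L) * b = - 2 * (L * b) by ring.
set d := L * b; set f := L ^+ 2; lra.
Qed.

(** * An eigenvector of a compact self-adjoint convolution operator *)

Section Spectral.
Variables (R : realType) (X : topologicalZmodType).
Variable mu : {measure set (borel X) -> \bar R}.
Hypothesis cX : compact [set: X].
Hypothesis mu1 : mu setT = 1%E.
Hypothesis muinv : forall (x : X) (A : set (borel X)), measurable A ->
  mu ((fun y : X => x + y) @^-1` A) = mu A.
Local Notation Int := (Int mu).
Local Notation l2 := (l2 mu).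
Local Notation convol := (convol mu).
Local Notation perp := (perp mu).
Let fm := haar_fin mu1.
Let cb (f : X -> R) : continuous f -> bmf f := @bmf_cont R X cX f.

Variable f0 : X -> R.
Hypothesis pf0 : perp f0.
Hypothesis f0_neq0 : Int (fun x => f0 x ^+ 2) != 0.

Let cf0 : continuous f0. Proof. by case: pf0. Qed.
(** The kernel is taken from the function itself: [T f0] at 0 is the squared norm of [f0], so the
    operator does not vanish on [perp]. [T'] is the adjoint of [T], and [S] is self-adjoint and
    positive. *)
Let k := fun x => f0 (- x).
Let ck : continuous k.
Proof. by move=> x; apply: continuous_comp; [exact: opp_continuous|exact: cf0]. Qed.
Let T := convol k.
Let T' := convol f0.
Let S g := T' (T g).

Let C : R := xget 0 [set M | forall x, `|f0 x| <= M].
Let hC x : `|f0 x| <= C.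
Proof.
by move: x; apply: (@xgetPex _ 0 [set M | forall x, `|f0 x| <= M]); exact: continuous_bounded.
Qed.
Let hCk x : `|k x| <= C. Proof. exact: hC. Qed.
Let C0 : 0 <= C. Proof. exact: le_trans (hC 0). Qed.

Let pT g : perp g -> perp (T g). Proof. exact: perp_conv. Qed.
Let pS g : perp g -> perp (S g). Proof. by move=> pg; apply: perp_conv => //; exact: pT. Qed.
Let cT (g : X -> R) : continuous g -> continuous (T g).
Proof. by move=> cg; apply: conv_continuous => //; exact: cb. Qed.
Let cS (g : X -> R) : continuous g -> continuous (S g).
Proof. by move=> cg; apply: conv_continuous => //; apply: cb; exact: cT. Qed.

Let S_lin (a b : R) (g h : X -> R) : continuous g -> continuous h ->
  S (fun x => a * g x + b * h x) = (fun x => a * S g x + b * S h x).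
Proof.
move=> cg ch; have bg := cb cg; have bh := cb ch.
have b1 := cb (cT cg); have b2 := cb (cT ch).
rewrite /S /T convD//; [|exact: bmfZ|exact: bmfZ].
rewrite !convZ// /T' convD//; [|exact: bmfZ|exact: bmfZ].
by rewrite !convZ.
Qed.

Let T_le (g : X -> R) : continuous g -> l2 (T g) <= C * l2 g.
Proof.
move=> cg; apply: (l2_le mu1 (cb (cT cg))) => x.
exact: (conv_bound cX mu1 x ck (cb cg) hCk).
Qed.

Let S_bound (g : X -> R) x : continuous g -> `|S g x| <= C * (C * l2 g).
Proof.
move=> cg; apply: (le_trans (conv_bound cX mu1 x cf0 (cb (cT cg)) hC)).
by rewrite ler_wpM2l// T_le.
Qed.

Let T_adj (g h : X -> R) : continuous g -> continuous h ->
  Int (fun x => h x * T' g x) = Int (fun x => g x * T h x).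
Proof. by move=> cg ch; exact: (conv_adjoint cX mu1 cf0 (cb cg) (cb ch)). Qed.

(** The supremum [L] of [V] is the squared norm of [T] on [perp], that is the top of the spectrum of
    [S] there. *)
Let V : set R := [set r | exists2 g, perp g & l2 g <= 1 /\ r = l2 (T g) ^+ 2].
Let L := sup V.

Let l2Z (a : R) (g : X -> R) : continuous g -> l2 (fun x => a * g x) = `|a| * l2 g.
Proof.
move=> cg; apply/eqP; rewrite -(@eqrXn2 _ 2) ?mulr_ge0 ?l2_ge0// exprMn real_normK ?num_real//.
rewrite !l2_sqr -(IntZ fm _ (bmf_sqr (cb cg))); apply/eqP; congr (Int _).
by apply/funext => x; rewrite exprMn.
Qed.

Let l2f0 : 0 < l2 f0.
Proof.
rewrite lt_neqAle l2_ge0 andbT eq_sym; apply/eqP => e.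
by move/eqP: f0_neq0; apply; rewrite -l2_sqr e expr0n.
Qed.

Let f1 := fun x => (l2 f0)^-1 * f0 x + 0 * f0 x.
Let pf1 : perp f1. Proof. exact: perp_lin. Qed.

Let Vf1 : V (l2 (T f1) ^+ 2).
Proof.
exists f1; rewrite //; split=> //; rewrite /f1.
under eq_fun do rewrite mul0r addr0.
by rewrite l2Z// gtr0_norm ?invr_gt0// mulVf// gt_eqF.
Qed.

Let V_sup : has_sup V.
Proof.
split; first by exists (l2 (T f1) ^+ 2); exact: Vf1.
exists (C ^+ 2) => _ [g pg [g1 ->]]; rewrite ler_sqr ?nnegrE ?l2_ge0//.
by apply: (le_trans (T_le pg.1)); rewrite ler_piMr.
Qed.

Let L0 : 0 < L.
Proof.
have h : l2 (T f1) ^+ 2 <= L by apply: sup_upper_bound.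
apply: lt_le_trans h; rewrite lt_neqAle sqr_ge0 andbT eq_sym; apply/eqP => h.
have := Int_sqr_eq0 cX mu1 muinv (cT pf1.1).
rewrite -l2_sqr => /(_ h 0).
rewrite /T /convol /convol /k.
under [X in Int X]eq_fun do rewrite sub0r opprK /f1 mul0r addr0 mulrCA.
rewrite (IntZ fm _ (bmfM (cb cf0) (cb cf0))).
move/eqP; rewrite mulf_eq0 invr_eq0 gt_eqF//= => /eqP e.
by move/eqP: f0_neq0; apply; rewrite -e; congr (Int _); apply/funext => x; rewrite expr2.
Qed.

Let T_L g : perp g -> l2 (T g) ^+ 2 <= L * l2 g ^+ 2.
Proof.
move=> pg; have cg := pg.1; have [g0|g0] := eqVneq (l2 g) 0.
  have := T_le cg; rewrite g0 mulr0 => h.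
  have -> : l2 (T g) = 0 by apply/eqP; rewrite eq_le h l2_ge0.
  by rewrite !expr0n mulr0.
have gp : 0 < l2 g by rewrite lt_neqAle eq_sym g0 l2_ge0.
pose g' := fun x => (l2 g)^-1 * g x + 0 * g x.
have pg' : perp g' by exact: perp_lin.
have g'E : g' = (fun x => (l2 g)^-1 * g x).
  by apply/funext => x; rewrite /g' mul0r addr0.
have : l2 (T g') ^+ 2 <= L.
  apply: sup_upper_bound; first exact: V_sup.
  exists g' => //; split=> //.
  by rewrite g'E l2Z// gtr0_norm ?invr_gt0// mulVf.
rewrite g'E /T convZ//; last exact: cb.
rewrite l2Z; last exact: cT.
rewrite exprMn real_normK ?num_real// exprVn mulrC ler_pdivrMr ?exprn_gt0//.
Qed.

Let S_L g : perp g -> l2 (S g) ^+ 2 <= L * l2 (T g) ^+ 2.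
Proof.
move=> pg; have cg := pg.1.
have h : l2 (S g) ^+ 2 <= l2 (T g) * l2 (T (S g)).
  rewrite l2_sqr; have -> : (fun x => S g x ^+ 2) = (fun x => S g x * T' (T g) x).
    by apply/funext => x; rewrite expr2.
  rewrite T_adj; [|exact: cT|exact: cS].
  apply: (le_trans (ler_norm _)).
  by apply: (cauchy_schwarz mu1); apply: cb; apply: cT => //; exact: cS.
exact: (sqr_interpolation (ltW L0) (l2_ge0 mu _) (l2_ge0 mu _) (l2_ge0 mu _) h (T_L (pS pg))).
Qed.

Let defect g : perp g -> l2 g <= 1 ->
  l2 (fun x => 1 * S g x + (- L) * g x) ^+ 2 <= L * (L - l2 (T g) ^+ 2).
Proof.
move=> pg g1; have cg := pg.1; have bg := cb cg; have bS := cb (cS cg).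
have e : Int (fun x => S g x * g x) = l2 (T g) ^+ 2.
  under [X in Int X]eq_fun do rewrite mulrC.
  rewrite T_adj//; last exact: cT.
  by rewrite l2_sqr; congr (Int _); apply/funext => x; rewrite expr2.
rewrite l2_sqr (_ : (fun x => _) =
  (fun x => 1 * S g x ^+ 2 + 1 * ((- (2 * L)) * (S g x * g x) + L ^+ 2 * g x ^+ 2))); last first.
  by apply/funext => x; ring.
have b1 := bmf_sqr bS; have b2 := bmfM bS bg; have b3 := bmf_sqr bg.
rewrite (Int_lin mu1 _ _ b1 (bmfD (bmfZ _ b2) (bmfZ _ b3))) (Int_lin mu1 _ _ b2 b3) e -!l2_sqr.
have g2 : l2 g ^+ 2 <= 1 by rewrite expr_le1// l2_ge0.
exact: (defect_le (S_L pg) g2).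
Qed.

(** Along a maximising sequence [g n] the functions [S (g n)] are bounded and equicontinuous, so
    their ultralimit [h] is uniform. The difference of [S (g n)] and [L * g n] tends to 0 by
    [defect], which makes [h] an eigenvector; it is nonzero since the pairing of [S (g n)] with
    [g n] tends to [L]. *)
Lemma eigenfunction : exists2 h, perp h & (exists x, h x != 0) /\ forall x, S h x = L * h x.
Proof.
have hg n : exists g, perp g /\ l2 g <= 1 /\ L - n.+1%:R^-1 < l2 (T g) ^+ 2.
  have n0 : 0 < n.+1%:R^-1 :> R by rewrite invr_gt0.
  have [_ [g pg [g1 ->]] h] := sup_adherent n0 V_sup.
  by exists g.
have [g gP] := choice hg.
have pg n : perp (g n) by case: (gP n).
have cg n : continuous (g n) by case: (pg n).
have g1 n : l2 (g n) <= 1 by case: (gP n) => _ [].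
have [U UU hU] := nat_ultrafilter.
pose u n := S (g n).
have uM n x : `|u n x| <= C * C.
  apply: (le_trans (S_bound x (cg n))); rewrite ler_wpM2l// ler_piMr//.
have l2T n : l2 (T (g n)) <= C by apply: (le_trans (T_le (cg n))); rewrite ler_piMr.
have uequi (e : R) : 0 < e -> exists W : set X,
    [/\ open W, W 0 & forall n x v, W v -> `|u n (x + v) - u n x| <= e].
  move=> e0; have e1 : 0 < e / (C + 1) by rewrite divr_gt0// ltr_wpDl.
  have [W [oW W0 hW]] := conv_equi cX mu1 cf0 e1; exists W; split=> // n x v Wv.
  apply: (le_trans (hW x v (T (g n)) Wv (cb (cT (cg n))))).
  apply: (@le_trans _ _ (e / (C + 1) * C)); first by rewrite ler_wpM2l// ltW.
  by rewrite mulrAC ler_pdivrMr ?ltr_wpDl// ler_wpM2l ?(ltW e0)// lerDl.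
pose h := ptlim U u.
have hunif (e : R) (e0 : 0 < e) : U [set n | forall x, `|u n x - h x| <= e].
  exact: (ptlim_uniform cX UU uM uequi).
have ch : continuous h.
  apply: continuous_of_equi => e e0.
  exact: (ptlim_equi UU uM uequi).
have PU : ProperFilter U by exact: ultra_proper.
have ph : perp h.
  apply: (perp_uniform_limit cX mu1) => // e e0.
  have [n hn] := filter_ex (hunif e e0); exists (u n) => //; exact: pS.
have Tn (e : R) : 0 < e -> U [set n | L - l2 (T (g n)) ^+ 2 <= e].
  move=> e0; apply: hU; near=> n => /=.
  have [_ [_ hn]] := gP n.
  have : n.+1%:R^-1 <= e.
    rewrite -[e]invrK lef_pV2 ?posrE ?invr_gt0//.
    apply: (@le_trans _ _ n%:R); last by rewrite ler_nat.
    by near: n; exact: nbhs_infty_ger.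
  by move=> hle; rewrite lerBlDr -lerBlDl; apply: (le_trans _ (ltW hn)); rewrite lerB.
exists h => //; split.
  apply: contrapT => hn; have h0 x : h x = 0.
    by apply/eqP; apply/negPn/negP => hx; apply: hn; exists x.
  have L4 : 0 < L / 4 by rewrite divr_gt0.
  have [n [/= hn1 hn2]] := filter_ex (filterI (hunif _ L4) (Tn _ L4)).
  have e : Int (fun x => u n x * g n x) = l2 (T (g n)) ^+ 2.
    under [X in Int X]eq_fun do rewrite mulrC.
    rewrite T_adj//; last exact: cT.
    by rewrite l2_sqr; congr (Int _); apply/funext => x; rewrite expr2.
  have : `|Int (fun x => u n x * g n x)| <= L / 4 * 1.
    apply: (le_trans (cauchy_schwarz mu1 (cb (cS (cg n))) (cb (cg n)))).
    apply: ler_pM; [exact: l2_ge0|exact: l2_ge0| |exact: g1].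
    apply: (l2_le mu1 (cb (cS (cg n)))) => x.
    by have := hn1 x; rewrite h0 subr0.
  by rewrite e ger0_norm ?sqr_ge0//; move: hn2 L0; lra.
move=> x; apply/eqP; rewrite -subr_eq0; apply/eqP.
apply: (@small_norm_eq0 _ _ (C * C + C * C + L)).
  by rewrite !addr_ge0 ?mulr_ge0// ltW.
move=> e e0; have e1 : 0 < e ^+ 2 / L by rewrite divr_gt0// exprn_gt0.
have [n [/= hn1 hn2]] := filter_ex (filterI (hunif _ e0) (Tn _ e1)).
pose w := fun x => 1 * u n x + (- L) * g n x.
have cw : continuous w by apply: continuous_lin => //; exact: cS.
have l2w : l2 w <= e.
  rewrite -ler_sqr ?nnegrE ?l2_ge0 ?(ltW e0)//.
  apply: (le_trans (defect (pg n) (g1 n))).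
  by apply: (@le_trans _ _ (L * (e ^+ 2 / L))); [rewrite ler_pM2l|rewrite mulrC divfK// gt_eqF].
pose d := fun x => 1 * h x + (- 1) * u n x.
have cd : continuous d by apply: continuous_lin => //; exact: cS.
have l2d : l2 d <= e.
  apply: (l2_le mu1 (cb cd)) => y; rewrite /d mul1r mulN1r distrC; exact: hn1.
(* As [u n] is [S (g n)], [S w] is [S (u n) - L * u n] and the three terms telescope. Each is small
   because [S] is bounded from L2 to the sup norm. *)
have -> : S h x - L * h x = S d x + S w x + L * (u n x - h x).
  rewrite /d /w (S_lin 1 (-1) ch (cS (cg n))) (S_lin 1 (- L) (cS (cg n)) (cg n)).
  by rewrite -/(u n); ring.
apply: (le_trans (ler_normD _ _)); apply: (@le_trans _ _ (e * (C * C + C * C) + e * L)); last first.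
  by rewrite -mulrDr.
apply: lerD; last by rewrite normrM gtr0_norm// mulrC ler_wpM2r ?(ltW L0).
apply: (le_trans (ler_normD _ _)); rewrite mulrDr.
have hb (v : X -> R) : continuous v -> l2 v <= e -> `|S v x| <= e * (C * C).
  move=> cv lv; apply: (le_trans (S_bound x cv)); rewrite mulrA mulrC.
  by rewrite ler_wpM2r// mulr_ge0.
by apply: lerD; apply: hb.
Unshelve. all: by end_near. Qed.

Definition eigenspace_fun (g : X -> R) : Prop := perp g /\ forall x, S g x = L * g x.

Lemma eigenspace_fun_lin a b g h : eigenspace_fun g -> eigenspace_fun h ->
  eigenspace_fun (fun x => a * g x + b * h x).
Proof.
move=> [pg Sg] [ph Sh]; split; first exact: perp_lin.
by move=> x; rewrite (S_lin _ _ pg.1 ph.1) Sg Sh; ring.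
Qed.

Lemma eigenspace_fun_shift g z : eigenspace_fun g -> eigenspace_fun (fun x => g (x + z)).
Proof.
move=> [pg Sg]; split; first exact: perp_shift.
move=> x; rewrite /S /T conv_shift//; last exact: (cb pg.1).
rewrite /T' conv_shift//; last by apply: cb; apply: cT; exact: pg.1.
exact: Sg.
Qed.

(** The bound on [S g] divided by the eigenvalue. A bound of the sup norm by the L2 norm is what
    forces finite dimension. *)
Lemma eigenspace_fun_bound g x : eigenspace_fun g -> `|g x| <= (C * C / L) * l2 g.
Proof.
move=> [pg Sg]; rewrite mulrAC ler_pdivlMr// -[X in `|g x| * X](gtr0_norm L0) -normrM mulrC -Sg.
by rewrite -mulrA; exact: (S_bound x pg.1).
Qed.

Lemma perp_eigenspace : exists E : (X -> R) -> Prop, exists B : R,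
  [/\ (forall g, E g -> perp g),
      (forall a b g h, E g -> E h -> E (fun x => a * g x + b * h x)),
      (forall g z, E g -> E (fun x => g (x + z))),
      (forall g x, E g -> `|g x| <= B * l2 g) &
      exists g x, E g /\ g x != 0].
Proof.
exists eigenspace_fun, (C * C / L); split.
- by move=> g [].
- exact: eigenspace_fun_lin.
- exact: eigenspace_fun_shift.
- by move=> g x; exact: eigenspace_fun_bound.
- by have [h ph [[x hx] Sh]] := eigenfunction; exists h, x.
Qed.

End Spectral.

(** * A finite-dimensional translation invariant space contains a character *)

Section PeterWeyl.
Variables (R : realType) (X : topologicalZmodType).
Variable mu : {measure set (borel X) -> \bar R}.
Hypothesis cX : compact [set: X].
Hypothesis mu1 : mu setT = 1%E.
Hypothesis muinv : forall (x : X) (A : set (borel X)), measurable A ->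
  mu ((fun y : X => x + y) @^-1` A) = mu A.
Local Notation Int := (Int mu).
Local Notation l2 := (l2 mu).
Local Notation perp := (perp mu).
Let fm := haar_fin mu1.
Let cb (f : X -> R) : continuous f -> bmf f := @bmf_cont R X cX f.

Section Eigen.
Variables (E : (X -> R) -> Prop) (B : R).
Hypothesis Eperp : forall g, E g -> perp g.
Hypothesis Elin : forall a b g h, E g -> E h -> E (fun x => a * g x + b * h x).
Hypothesis Eshift : forall g z, E g -> E (fun x => g (x + z)).
Hypothesis EB : forall g x, E g -> `|g x| <= B * l2 g.
Hypothesis E0 : exists g x, E g /\ g x != 0.

Let bE g : E g -> bmf g. Proof. by move=> /Eperp[/cb]. Qed.

(** Orthonormal families in [E], indexed by [nat] with a bound so that one more member can be
    appended. *)
Definition onf N (gs : nat -> X -> R) : Prop :=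
  (forall i, (i < N)%N -> E (gs i)) /\
  forall i j, (i < N)%N -> (j < N)%N -> Int (fun x => gs i x * gs j x) = (i == j)%:R.

Let lc N (gs : nat -> X -> R) (c : nat -> R) x := \sum_(i < N) c i * gs i x.

Let E_lc N gs c : (forall i, (i < N)%N -> E (gs i)) -> E (lc N gs c).
Proof.
move=> h; rewrite /lc; elim: N h => [|N IH] h.
  have [g [x [Eg _]]] := E0; have := Elin 0 0 Eg Eg.
  by under eq_fun do rewrite !mul0r addr0; under [X in _ -> E X]eq_fun do rewrite big_ord0.
under eq_fun do rewrite big_ord_recr/=.
have p1 : E (fun x => \sum_(i < N) c i * gs i x) by apply: IH => i iN; apply: h; exact: ltnW.
have := Elin 1 (c N) p1 (h N (ltnSn N)).
by under eq_fun do rewrite mul1r.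
Qed.

Let Int_lc N gs c h : (forall i, (i < N)%N -> E (gs i)) -> bmf h ->
  Int (fun x => lc N gs c x * h x) = \sum_(i < N) c i * Int (fun x => gs i x * h x).
Proof.
move=> hE bh; rewrite /lc; elim: N hE => [|N IH] hE.
  rewrite big_ord0; under [X in Int X]eq_fun do rewrite big_ord0 mul0r.
  exact: Int_const.
have hE' i : (i < N)%N -> E (gs i) by move=> iN; apply: hE; exact: ltnW.
rewrite big_ord_recr/= -IH//.
have b1 : bmf (fun x => \sum_(i < N) c i * gs i x).
  by have := bE (@E_lc N gs c hE').
have b2 := bE (hE N (ltnSn N)).
rewrite -(IntZ fm _ (bmfM b2 bh)) -(IntD fm (bmfM b1 bh) (bmfZ _ (bmfM b2 bh))).
by congr (Int _); apply/funext => x; rewrite big_ord_recr/=; ring.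
Qed.

Let lc_coef N gs c j : onf N gs -> (j < N)%N -> Int (fun x => lc N gs c x * gs j x) = c j.
Proof.
move=> [hE ho] jN; rewrite Int_lc//; last exact: bE (hE _ jN).
rewrite (bigD1 (Ordinal jN))//= big1 ?addr0 ?ho ?eqxx ?mulr1// => i ij.
rewrite ho//; case: eqP => [e|]; last by rewrite mulr0.
by case/eqP: ij; exact: val_inj.
Qed.

Let lc_sqr N gs c : onf N gs -> Int (fun x => lc N gs c x ^+ 2) = \sum_(i < N) c i ^+ 2.
Proof.
move=> hon; have [hE ho] := hon.
under [X in Int X]eq_fun do rewrite expr2.
rewrite Int_lc//; last exact: bE (E_lc _ hE).
apply: eq_bigr => i _; rewrite expr2; congr (_ * _).
under [X in Int X]eq_fun do rewrite mulrC.
exact: lc_coef.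
Qed.

(** The combination with coefficients [gs i x] takes at [x] the value of its own squared L2 norm, so
    the sup bound limits the sum of the squares of the [gs i x] by [B ^+ 2]; integrating over [x]
    counts the family. *)
Let onf_bound N gs : onf N gs -> N%:R <= B ^+ 2.
Proof.
move=> hon; have [hE ho] := hon.
have h x : \sum_(i < N) gs i x ^+ 2 <= B ^+ 2.
  pose c i := gs i x; have Ec := E_lc c hE.
  have := EB x Ec; rewrite (_ : lc N gs c x = \sum_(i < N) c i ^+ 2); last first.
    by apply: eq_bigr => i _; rewrite expr2.
  have e : l2 (lc N gs c) ^+ 2 = \sum_(i < N) c i ^+ 2 by rewrite l2_sqr lc_sqr.
  rewrite -/(\sum_(i < N) c i ^+ 2) -e ger0_norm ?sqr_ge0//.
  have l0 := l2_ge0 mu (lc N gs c).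
  have [->|n0] := eqVneq (l2 (lc N gs c)) 0; first by rewrite expr0n/= sqr_ge0.
  have lp : 0 < l2 (lc N gs c) by rewrite lt_neqAle eq_sym n0.
  rewrite [X in X <= _ -> _]expr2 ler_pM2r// => hB.
  by rewrite ler_sqr ?nnegrE// (le_trans l0).
have hb : forall i, (i < N)%N -> bmf (fun x => gs i x ^+ 2) by move=> i iN; apply: bmf_sqr; exact: bE (hE _ iN).
have -> : N%:R = Int (fun x => \sum_(i < N) gs i x ^+ 2).
  rewrite Int_sum//.
    under eq_bigr => i _. 
      under [X in Int X]eq_fun do rewrite expr2.
      rewrite ho// eqxx; over.
    by rewrite big_const_ord iter_addr_0.
  by move=> i; exact: hb.
rewrite -[X in _ <= X](Int_const mu1); apply: Int_le => //; last exact: bmf_cst.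
by apply: bmf_sum => i; exact: hb.
Qed.

Let onf1 : exists gs, onf 1 gs.
Proof.
have [g [x [Eg gx]]] := E0.
have n0 : l2 g != 0.
  apply/eqP => e; have := Int_sqr_eq0 cX mu1 muinv (Eperp Eg).1.
  by rewrite -l2_sqr e expr0n/= => /(_ erefl x) h; rewrite h eqxx in gx.
exists (fun _ x => (l2 g)^-1 * g x + 0 * g x); split=> [i _|i j]; first exact: Elin.
rewrite !ltnS !leqn0 => /eqP-> /eqP->; rewrite eqxx.
have b2 := bmf_sqr (bE Eg).
rewrite (_ : (fun x => _) = (fun x => (l2 g) ^- 2 * g x ^+ 2)).
  by rewrite (IntZ fm _ b2) -l2_sqr mulVf// sqrf_eq0.
by apply/funext => y; rewrite -exprVn; ring.
Qed.

Let onf_max : exists N gs, [/\ (0 < N)%N, onf N gs & forall g, E g ->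
  forall x, g x = \sum_(i < N) Int (fun x => g x * gs i x) * gs i x].
Proof.
pose Q N := `[< exists gs, onf N gs >].
have Q1 : exists N, Q N by exists 1%N; apply/asboolP; exact: onf1.
have Qb N : Q N -> (N <= Num.truncn (B ^+ 2))%N.
  by move=> /asboolP[gs /onf_bound h]; rewrite truncn_ge_nat ?sqr_ge0.
case: (ex_maxnP Q1 Qb) => N /asboolP[gs hon] hmax; exists N, gs.
have [hE ho] := hon.
split=> //; first by apply: hmax; apply/asboolP; exact: onf1.
move=> g Eg; pose c i := Int (fun x => g x * gs i x).
pose v := fun x => 1 * g x + (- 1) * lc N gs c x.
have Ev : E v by apply: Elin => //; exact: E_lc.
have vperp j : (j < N)%N -> Int (fun x => v x * gs j x) = 0.
  move=> jN; have bj := bE (hE _ jN).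
  rewrite (_ : (fun x => _) = (fun x => 1 * (g x * gs j x) + (- 1) * (lc N gs c x * gs j x))).
    rewrite (Int_lin mu1 _ _ (bmfM (bE Eg) bj) (bmfM (bE (E_lc c hE)) bj)) lc_coef//.
    by rewrite /c; ring.
  by apply/funext => x; rewrite /v; ring.
suff v0 : l2 v = 0.
  have := Int_sqr_eq0 cX mu1 muinv (Eperp Ev).1.
  rewrite -l2_sqr v0 expr0n/= => /(_ erefl) h x; have := h x.
  by rewrite /v mul1r mulN1r => /eqP; rewrite subr_eq0 => /eqP.
apply/eqP/negPn/negP => vn0.
have : Q N.+1; last by move=> /hmax; rewrite ltnn.
apply/asboolP; exists (fun i => if (i < N)%N then gs i else fun x => (l2 v)^-1 * v x + 0 * v x).
pose w := fun x => (l2 v)^-1 * v x + 0 * v x.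
have wE : w = fun x => (l2 v)^-1 * v x by apply/funext => x; rewrite /w mul0r addr0.
split=> [i _|i j]; first by case: ifP => [/hE//|_]; exact: Elin.
rewrite !ltnS -/w.
have wj k : (k < N)%N -> Int (fun x => w x * gs k x) = 0.
  move=> kN; rewrite wE; under [X in Int X]eq_fun do rewrite -mulrA.
  by rewrite (IntZ fm _ (bmfM (bE Ev) (bE (hE _ kN)))) vperp// mulr0.
case: (ltnP i N) => iN; case: (ltnP j N) => jN hi hj.
- exact: ho.
- under [X in Int X]eq_fun do rewrite mulrC.
  by rewrite wj//; case: eqP => // e; move: iN; rewrite e ltnNge jN.
- by rewrite wj//; case: eqP => // e; move: jN; rewrite -e ltnNge iN.
have -> : i = j by apply/eqP; rewrite eqn_leq (leq_trans hi)// (leq_trans hj).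
rewrite eqxx wE (_ : (fun x => _) = (fun x => (l2 v) ^- 2 * v x ^+ 2)).
  by rewrite (IntZ fm _ (bmf_sqr (bE Ev))) -l2_sqr mulVf// sqrf_eq0.
by apply/funext => y; rewrite -exprVn; ring.
Qed.

(** Translations act on an orthonormal basis by commuting matrices. A common eigenvector gives [F]
    with [F (x + a) = c a * F x], so [c = F / F 0] is a continuous homomorphism whose real and
    imaginary parts are in [E]. *)
Lemma eigenspace_character : exists2 chi, is_character chi &
  E (chRe chi) /\ E (chIm chi).
Proof.
have [N [gs [N0 hon hspan]]] := onf_max; have [hE ho] := hon.
pose M a : 'M[R]_N := \matrix_(i, j) Int (fun x => gs i (x + a) * gs j x).
have gsM (i : 'I_N) a x : gs i (x + a) = \sum_(j < N) M a i j * gs j x.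
  rewrite (hspan (fun x => gs i (x + a)))//; last exact: Eshift (hE _ (ltn_ord i)).
  by apply: eq_bigr => j _; rewrite mxE.
have indep (c d : 'I_N -> R) : (forall x, \sum_(j < N) c j * gs j x = \sum_(j < N) d j * gs j x) ->
    forall j, c j = d j.
  move=> h j; pose c' i := if insub i is Some j then c j else 0.
  pose d' i := if insub i is Some j then d j else 0.
  have hc (i : 'I_N) : c' i = c i by rewrite /c' valK.
  have hd (i : 'I_N) : d' i = d i by rewrite /d' valK.
  rewrite -hc -hd -(lc_coef c' hon (ltn_ord j)) -(lc_coef d' hon (ltn_ord j)).
  congr (Int _); apply/funext => x; congr (_ * _); rewrite /lc.
  by under eq_bigr do rewrite hc; rewrite h; apply: eq_bigr => i _; rewrite hd.
have MD a b : M a *m M b = M (a + b).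
  apply/matrixP => i; apply: indep => x; rewrite -[RHS]gsM [a + b]addrC addrA gsM.
  transitivity (\sum_(j < N) \sum_(l < N) M a i j * (M b j l * gs l x)).
    rewrite exchange_big; apply: eq_bigr => l _; rewrite mxE big_distrl/=.
    by apply: eq_bigr => j _; rewrite mulrA.
  by apply: eq_bigr => j _; rewrite -big_distrr/= -gsM.
pose Mc a := map_mx (real_complex R) (M a).
have McC a b : Mc a *m Mc b = Mc b *m Mc a by rewrite -!map_mxM !MD addrC.
have [v v0 [c hc]] := common_eigenvector_family N0 McC.
pose F x : R[i] := \sum_(i < N) v 0 i * real_complex R (gs i x).
have FM x a : F (x + a) = c a * F x.
  have := congr1 (fun w : 'rV[R[i]]_N => \sum_(j < N) w 0 j * real_complex R (gs j x)) (hc a).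
  rewrite /F big_distrr/=; under [X in _ = X -> _]eq_bigr do rewrite mxE -mulrA.
  move=> <-; under eq_bigr do rewrite gsM rmorph_sum/= big_distrr/=.
  rewrite exchange_big; apply: eq_bigr => j _; rewrite mxE big_distrl/=.
  by apply: eq_bigr => i _; rewrite -mulrA /Mc [map_mx _ _ i j]mxE -rmorphM.
pose vr i := if insub i is Some j then complex.Re (v 0 j : R[i]) else 0.
pose vi i := if insub i is Some j then complex.Im (v 0 j : R[i]) else 0.
have EP := E_lc vr hE; have EQ := E_lc vi hE.
have FE x : F x = Complex (lc N gs vr x) (lc N gs vi x).
  rewrite /F /lc.
  have hvr (i : 'I_N) : v 0 i = Complex (vr i) (vi i).
    by rewrite /vr /vi valK; case: (v 0 i).
  under eq_bigr do rewrite hvr.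
  elim/big_rec3: _ => [//|i y z t _ ->].
  by apply/eqP; rewrite eq_complex /= !mulr0 subr0 add0r !eqxx.
have F0 : F 0 != 0.
  apply: contraNneq v0 => e; apply/eqP/rowP => j; rewrite mxE.
  have FF x : F x = 0 by rewrite -[x]add0r FM e mulr0.
  have hr x : lc N gs vr x = 0 by have := FF x; rewrite FE => -[].
  have hi x : lc N gs vi x = 0 by have := FF x; rewrite FE => -[].
  have z0 (d : nat -> R) : (forall x, lc N gs d x = 0) -> d j = 0.
    move=> h; rewrite -(lc_coef d hon (ltn_ord j)); under [X in Int X]eq_fun do rewrite h mul0r.
    exact: Int_const.
  have := z0 _ hr; have := z0 _ hi; rewrite /vr /vi valK.
  by case: (v 0 j) => a b /= -> ->.
have cF x : c x = F x / F 0 by have := FM 0 x; rewrite add0r => ->; rewrite mulfK.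
have cD x y : c (x + y) = c x * c y by rewrite cF FM -mulrA -cF mulrC.
have c0 : c 0 = 1 by rewrite cF divff.
pose p := complex.Re (F 0)^-1; pose q := complex.Im (F 0)^-1.
have cRe x : chRe c x = p * lc N gs vr x + (- q) * lc N gs vi x.
  rewrite /chRe cF FE; rewrite /p /q; case: (F 0)^-1 => s t /=; ring.
have cIm x : chIm c x = q * lc N gs vr x + p * lc N gs vi x.
  rewrite /chIm cF FE; rewrite /p /q; case: (F 0)^-1 => s t /=; ring.
have EcRe : E (chRe c) by rewrite (funext cRe); exact: (Elin p (- q) EP EQ).
have EcIm : E (chIm c) by rewrite (funext cIm); exact: (Elin q p EP EQ).
exists c => //; split=> //; first exact: (Eperp EcRe).1.
  exact: (Eperp EcIm).1.
have hn := normc_absval R; have [_ _ nM _] := hn.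
have [M1 hM1] := continuous_bounded cX (Eperp EcRe).1.
have [M2 hM2] := continuous_bounded cX (Eperp EcIm).1.
have cexp n x : c (x *+ n) = c x ^+ n.
  by elim: n => [|n IH]; rewrite ?mulr0n ?expr0// mulrS exprS cD IH.
have nb x : Normc.normc (c x) <= M1 + M2.
  have := hM1 x; have := hM2 x; rewrite /chRe /chIm; case: (c x) => a b /= hb ha.
  have h0 : 0 <= M1 + M2 by rewrite addr_ge0// (le_trans _ ha, le_trans _ hb).
  rewrite -(ger0_norm h0) -sqrtr_sqr ler_wsqrtr//.
  have : a ^+ 2 <= M1 ^+ 2 by rewrite -real_normK ?num_real// ler_sqr ?nnegrE// (le_trans _ ha).
  have : b ^+ 2 <= M2 ^+ 2 by rewrite -real_normK ?num_real// ler_sqr ?nnegrE// (le_trans _ hb).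
  have : 0 <= M1 * M2 by rewrite mulr_ge0// (le_trans _ ha, le_trans _ hb).
  by rewrite sqrrD; move: (a ^+ 2) (b ^+ 2) (M1 ^+ 2) (M2 ^+ 2) (M1 * M2) => *; lra.
have nX n x : Normc.normc (c x) ^+ n = Normc.normc (c (x *+ n)).
  rewrite cexp; elim: n => [|n IH]; first by rewrite !expr0 Normc.normc1.
  by rewrite !exprS nM IH.
(* The powers of [c x] are again values of [c], hence bounded, so the modulus is at most 1; the same
   at [- x] gives equality below. *)
have le1 x : Normc.normc (c x) <= 1.
  rewrite leNgt; apply/negP => /(exprn_unbounded (M1 + M2))[n0 /(_ n0 (leqnn _))].
  by rewrite nX ltNge nb.
move=> x; rewrite [`|_|](_ : _ = real_complex R (Normc.normc (c x)))//.
suff -> : Normc.normc (c x) = 1 by [].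
apply/eqP; rewrite eq_le le1 /=.
have e1 : Normc.normc (c x) * Normc.normc (c (- x)) = 1.
  by rewrite -nM -cD subrr c0 Normc.normc1.
rewrite -e1 ler_piMr// ?le1//; by case: hn => h _ _ _; exact: h.
Qed.

(** The parts of the character found in [E] are orthogonal to all characters, in particular to
    themselves, although the real part is 1 at 0. *)
Lemma eigenspace_contra : False.
Proof.
have [chi hchi [h1 h2]] := eigenspace_character.
have [p1 _] := (Eperp h1).2 _ hchi; have [_ p2] := (Eperp h2).2 _ hchi.
have z1 := Int_sqr_eq0 cX mu1 muinv (Eperp h1).1.
have z2 := Int_sqr_eq0 cX mu1 muinv (Eperp h2).1.
have sq (w : X -> R) : Int (fun x => w x * w x) = 0 -> Int (fun x => w x ^+ 2) = 0.
  by move=> <-; congr (Int _); apply/funext => x; rewrite expr2.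
have [_ _ _ _ c0] := hchi; have := z1 (sq _ p1) 0.
by rewrite /chRe c0 /= => /eqP; rewrite oner_eq0.
Qed.

End Eigen.

Theorem peter_weyl (f : X -> R) : continuous f ->
  (forall chi, is_character chi ->
    Int (fun x => f x * chRe chi x) = 0 /\ Int (fun x => f x * chIm chi x) = 0) ->
  forall x, f x = 0.
Proof.
move=> cf hf; apply: (Int_sqr_eq0 cX mu1 muinv cf).
apply/eqP/negPn/negP => h.
have [E [B [h1 h2 h3 h4 h5]]] := perp_eigenspace cX mu1 muinv (conj cf hf) h.
exact: (@eigenspace_contra E B).
Qed.

End PeterWeyl.

(** * Characters *)

Section Characters.
Variables (R : realType) (X : topologicalZmodType).

Lemma ch0 (chi : X -> R[i]) : is_character chi -> chi 0 = 1. Proof. by case. Qed.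

Lemma chD (chi : X -> R[i]) x y : is_character chi -> chi (x + y) = chi x * chi y.
Proof. by case. Qed.

Lemma ch_norm (chi : X -> R[i]) x : is_character chi -> `|chi x| = 1.
Proof. by case. Qed.

Lemma ch_neq0 (chi : X -> R[i]) x : is_character chi -> chi x != 0.
Proof. by move=> h; rewrite -normr_eq0 ch_norm// oner_eq0. Qed.

Lemma chN (chi : X -> R[i]) x : is_character chi -> chi (- x) = (chi x)^-1.
Proof.
move=> h; apply: (mulIf (ch_neq0 x h)); rewrite mulVf ?ch_neq0//.
by rewrite -chD// addNr ch0.
Qed.

Lemma chB (chi : X -> R[i]) x y : is_character chi -> chi (x - y) = chi x / chi y.
Proof. by move=> h; rewrite chD// chN. Qed.

Lemma ch_sqr (chi : X -> R[i]) x : is_character chi -> chRe chi x ^+ 2 + chIm chi x ^+ 2 = 1.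
Proof.
move=> /ch_norm -/(_ x); rewrite /chRe /chIm; case: (chi x) => a b /= -[h].
by rewrite -[LHS]sqr_sqrtr ?h ?expr1n// addr_ge0 ?sqr_ge0.
Qed.

Lemma ch_eq1 (chi : X -> R[i]) x : is_character chi -> chRe chi x = 1 -> chi x = 1.
Proof.
move=> h e; have := ch_sqr x h; rewrite e expr1n => /eqP.
rewrite addrC -subr_eq0 addrK sqrf_eq0 => /eqP e2.
by move: e e2; rewrite /chRe /chIm; case: (chi x) => a b /= -> ->.
Qed.

Lemma ch_one : is_character (fun _ : X => 1 : R[i]).
Proof.
split => //; [exact: cst_continuous|exact: cst_continuous|by move=> x; rewrite normr1|].
by move=> x y; rewrite mulr1.
Qed.

Lemma ch_mul (chi psi : X -> R[i]) : is_character chi -> is_character psi ->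
  is_character (fun x => chi x * psi x).
Proof.
move=> h k; have [c1 c2 _ _ _] := h; have [d1 d2 _ _ _] := k; split.
- rewrite (_ : (fun x => _) = (fun x => chRe chi x * chRe psi x - chIm chi x * chIm psi x)).
    by move=> x; apply: cvgB; apply: cvgM; [exact: c1|exact: d1|exact: c2|exact: d2].
  by apply/funext => x; rewrite /chRe /chIm; case: (chi x); case: (psi x).
- rewrite (_ : (fun x => _) = (fun x => chRe chi x * chIm psi x + chIm chi x * chRe psi x)).
    by move=> x; apply: cvgD; apply: cvgM; [exact: c1|exact: d2|exact: c2|exact: d1].
  by apply/funext => x; rewrite /chRe /chIm; case: (chi x) => a b; case: (psi x).
- by move=> x; rewrite normrM !ch_norm// mulr1.
- by move=> x y; rewrite !chD// mulrACA.
- by rewrite !ch0// mulr1.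
Qed.

Lemma ch_inv (chi : X -> R[i]) : is_character chi -> is_character (fun x => (chi x)^-1).
Proof.
move=> h; have [c1 c2 _ _ _] := h.
rewrite (_ : (fun x => _) = (fun x => chi (- x))); last by apply/funext => x; rewrite chN.
split.
- by move=> x; apply: (@continuous_comp _ _ _ -%R (chRe chi)); [exact: opp_continuous|exact: c1].
- by move=> x; apply: (@continuous_comp _ _ _ -%R (chIm chi)); [exact: opp_continuous|exact: c2].
- by move=> x; rewrite ch_norm.
- by move=> x y; rewrite opprD chD.
- by rewrite oppr0 ch0.
Qed.

Lemma ch_exp (chi : X -> R[i]) n : is_character chi -> is_character (fun x => chi x ^+ n).
Proof.
move=> h; elim: n => [|n IH].
  by under eq_fun do rewrite expr0; exact: ch_one.
by under eq_fun do rewrite exprS; exact: ch_mul.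
Qed.

Lemma ch_expz (chi : X -> R[i]) (n : int) : is_character chi -> is_character (fun x => chi x ^ n).
Proof. by move=> h; case: n => n; [exact: ch_exp|apply: ch_inv; exact: ch_exp]. Qed.

Lemma ch_prod (I : Type) (s : seq I) (chi : I -> X -> R[i]) : (forall i, is_character (chi i)) ->
  is_character (fun x => \prod_(i <- s) chi i x).
Proof.
move=> h; elim: s => [|i s IH]; first by under eq_fun do rewrite big_nil; exact: ch_one.
by under eq_fun do rewrite big_cons; exact: ch_mul.
Qed.

Lemma ch_comp (chi : X -> R[i]) (th : X -> X) : is_character chi -> continuous th ->
  (forall x y, th (x + y) = th x + th y) -> is_character (fun x => chi (th x)).
Proof.
move=> h ct tD; have [c1 c2 _ _ _] := h; split.
- by move=> x; apply: (@continuous_comp _ _ _ th (chRe chi)); [exact: ct|exact: c1].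
- by move=> x; apply: (@continuous_comp _ _ _ th (chIm chi)); [exact: ct|exact: c2].
- by move=> x; rewrite ch_norm.
- by move=> x y; rewrite tD chD.
- have -> : th 0 = 0 by apply: (addIr (th 0)); rewrite -tD !add0r.
  by rewrite ch0.
Qed.

(** On a connected group the real part of a nontrivial character takes a whole interval of values,
    whereas there are at most [n] roots of unity of order dividing [n]; the points [t k] would give
    [n + 1]. *)
Lemma ch_torsion_free (chi : X -> R[i]) n : connected [set: X] -> is_character chi -> (0 < n)%N ->
  (forall x, chi x ^+ n = 1) -> forall x, chi x = 1.
Proof.
move=> cnX h n0 hn x; apply: ch_eq1 => //; apply/eqP/negPn/negP => hx.
have cR := cont_chRe h.
have hI : is_interval (chRe chi @` setT).
  apply/connected_intervalP; apply: connected_continuous_connected => //.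
  exact: continuous_subspaceT.
have a1 : chRe chi x < 1.
  rewrite lt_neqAle hx -[X in _ <= X]sqrtr1 -(ch_sqr x h).
  apply: (le_trans (ler_norm _)); rewrite -sqrtr_sqr ler_wsqrtr// lerDl sqr_ge0//.
set a := chRe chi x in a1 hx.
pose t k : R := a + (1 - a) * (k%:R / n%:R).
have nR : 0 < n%:R :> R by rewrite ltr0n.
have ht (k : 'I_n.+1) : exists z, chRe chi z = t k.
  suff [z _ <-] : (chRe chi @` setT) (t k) by exists z.
  apply: (hI a 1); [by exists x|by exists 0 => //; rewrite /chRe ch0|].
  have k0 : 0 <= k%:R / n%:R :> R by rewrite divr_ge0.
  have k1 : k%:R / n%:R <= 1 :> R by rewrite ler_pdivrMr// mul1r ler_nat -ltnS.
  rewrite /t lerDl mulr_ge0 ?subr_ge0 ?(ltW a1)//=.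
  by rewrite -lerBrDl ler_piMr// subr_ge0 ltW.
have [z hz] := choice ht.
have inj : injective (fun k : 'I_n.+1 => chi (z k)).
  move=> i j e; have : t i = t j by rewrite -!hz /chRe e.
  move=> /addrI /mulfI; rewrite subr_eq0 eq_sym lt_eqF// => /(_ erefl).
  move=> /mulIf; rewrite invr_eq0 gt_eqF// => /(_ erefl) /eqP.
  by rewrite eqr_nat => /eqP; exact: val_inj.
have := @max_poly_roots R[i] ('X^n - 1) [seq chi (z k) | k <- enum 'I_n.+1].
rewrite size_XnsubC// size_map size_enum_ord ltnn => hm.
suff : false by [].
apply: hm.
- by rewrite -size_poly_gt0 size_XnsubC.
- by apply/allP => _ /mapP[k _ ->]; rewrite rootE !hornerE hn subrr.
- by rewrite map_inj_uniq ?enum_uniq.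
Qed.

End Characters.

(** * Characters separate points from closed subgroups *)

Section Separation.
Variables (R : realType) (X : topologicalZmodType).
Variable mu : {measure set (borel X) -> \bar R}.
Hypothesis hX : hausdorff_space X.
Hypothesis cX : compact [set: X].
Hypothesis mu1 : mu setT = 1%E.
Hypothesis muinv : forall (x : X) (A : set (borel X)), measurable A ->
  mu ((fun y : X => x + y) @^-1` A) = mu A.
Local Notation Int := (Int mu).
Let fm := haar_fin mu1.
Let cb (f : X -> R) : continuous f -> bmf f := @bmf_cont R X cX f.

Definition coef (f : X -> R) (chi : X -> R[i]) : R[i] :=
  Complex (Int (fun x => f x * chRe chi x)) (Int (fun x => f x * chIm chi x)).

Lemma coef_shift f chi z : is_character chi -> bmf f ->
  coef (fun x => f (x + z)) chi = chi (- z) * coef f chi.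
Proof.
move=> h bf; have b1 := cb (cont_chRe h); have b2 := cb (cont_chIm h).
have E w : bmf w -> Int (fun x => f (x + z) * w x) = Int (fun x => f x * w (x - z)).
  move=> bw; rewrite -[RHS](Int_shift mu1 muinv z).
    by congr (Int _); apply/funext => x; rewrite addrK.
  by apply: bmfM => //; apply: (@bmf_comp R X w (fun x => x - z)) => //; exact: continuous_addr.
rewrite /coef !E//.
have -> : chi (- z) = Complex (chRe chi (- z)) (chIm chi (- z)).
  by rewrite /chRe /chIm; case: (chi _).
apply/eqP; rewrite eq_complex /=; apply/andP; split; apply/eqP.
- rewrite (_ : (fun x => _) = (fun x => chRe chi (- z) * (f x * chRe chi x) +
    (- chIm chi (- z)) * (f x * chIm chi x))).
    by rewrite (Int_lin mu1 _ _ (bmfM bf b1) (bmfM bf b2)) mulNr.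
  by apply/funext => x; rewrite chReD//; ring.
- rewrite (_ : (fun x => _) = (fun x => chRe chi (- z) * (f x * chIm chi x) +
    chIm chi (- z) * (f x * chRe chi x))).
    by rewrite (Int_lin mu1 _ _ (bmfM bf b2) (bmfM bf b1)).
  by apply/funext => x; rewrite chImD//; ring.
Qed.

Lemma coefB f g chi : is_character chi -> bmf f -> bmf g ->
  coef (fun x => f x - g x) chi = coef f chi - coef g chi.
Proof.
move=> h bf bg; have b1 := cb (cont_chRe h); have b2 := cb (cont_chIm h).
apply/eqP; rewrite eq_complex /=; apply/andP; split; apply/eqP.
- rewrite -(IntB fm (bmfM bf b1) (bmfM bg b1)); congr (Int _).
  by apply/funext => x; rewrite mulrBl.
- rewrite -(IntB fm (bmfM bf b2) (bmfM bg b2)); congr (Int _).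
  by apply/funext => x; rewrite mulrBl.
Qed.

(** The supremum [h] over [Y] of the translates of a Urysohn function is continuous and
    [Y]-invariant, at least 1 at 0 and at most 0 at [x0]. The difference [f] of [h] and its
    translate by [x0] is nonzero, so by Peter-Weyl it has a nonzero coefficient at some [chi].
    Invariance of [f] makes [chi] trivial on [Y], and the coefficient carries the factor
    [1 - chi (- x0)]. *)
Lemma character_separation (Y : set X) x0 : is_subgroup_set Y -> closed Y -> ~ Y x0 ->
  exists chi : X -> R[i], [/\ is_character chi, forall y, Y y -> chi y = 1 & chi x0 != 1].
Proof.
move=> [Y0 YB] cY nYx.
have YN y : Y y -> Y (- y) by move=> Yy; rewrite -sub0r; apply: YB.
pose F := [set x | Y (x - x0)].
have cF : closed F.
  have -> : F = (fun x => x - x0) @^-1` Y by [].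
  by apply: closed_comp => // z _; exact: continuous_addr.
have c0 : closed [set (0 : X)] by apply: accessible_closed_set1; exact: hausdorff_accessible.
have dis : F `&` [set 0] = set0.
  apply/seteqP; split => // x [/= Fx e]; apply: nYx; move: Fx; rewrite /F /= e sub0r.
  by move/YN; rewrite opprK.
have hsep := normal_separatorP.1 (compact_normal hX cX).
have /(@uniform_separatorP _ R)[k [ck k01 kF k0]] := hsep R _ _ cF c0 dis.
have kFE x : Y (x - x0) -> k x = 0 by move=> h; apply: kF; exists x.
have k0E : k 0 = 1 by apply: k0; exists 0.
have k1 x : 0 <= k x <= 1 by have := k01 (k x); rewrite /= in_itv/=; apply; exists x.
pose V x := [set r | exists2 y, Y y & r = k (x + y)].
have Vsup x : has_sup (V x).
  split; first by exists (k (x + 0)); exists 0.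
  by exists 1 => _ [y _ ->]; case/andP: (k1 (x + y)).
pose h x := sup (V x).
have hY x y : Y y -> h (x + y) = h x.
  move=> Yy; rewrite /h; congr sup; apply/seteqP; split => _ [w Yw ->].
    by exists (y + w); rewrite ?addrA// -[w]opprK; apply: YB => //; exact: YN.
  exists (w - y); first exact: YB.
  by rewrite [w - y]addrC addrA addrK.
have hle x v e : (forall y, `|k (x + v + y) - k (x + y)| <= e) -> h (x + v) <= h x + e.
  move=> he; apply: ge_sup; first by case: (Vsup (x + v)).
  move=> _ [y Yy ->]; have := he y; rewrite ler_norml => /andP[_].
  rewrite lerBlDl => hh; apply: (le_trans hh); rewrite lerD2r.
  by apply: (sup_upper_bound (Vsup x)); exists y.
have ch : continuous h.
  apply: continuous_of_equi => e e0.
  have [U [oU U0 hU]] := uniform_continuity cX ck e0.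
  exists U; split => // x u Uu.
  have hd z y : `|k (z + u + y) - k (z + y)| <= e.
    by rewrite addrAC; apply: ltW; exact: hU.
  have h1 : h x <= h (x + u) + e.
    have := hle (x + u) (- u) e; rewrite addrK; apply=> y.
    by rewrite distrC; exact: hd.
  have h2 : h (x + u) <= h x + e by apply: hle => y; exact: hd.
  by rewrite ler_norml lerBlDl h2 andbT; move: h1; move: (h x) (h (x + u)) => p q; lra.
have h00 : 1 <= h 0 by rewrite -k0E; apply: (sup_upper_bound (Vsup 0)); exists 0; rewrite ?addr0.
have hx0 : h x0 <= 0.
  apply: ge_sup; first by case: (Vsup x0).
  by move=> _ [y Yy ->]; rewrite kFE// addrAC subrr add0r.
pose f x := h x - h (x + x0).
have chx : continuous (fun x => h (x + x0)).
  by move=> x; apply: continuous_comp; [exact: continuous_addr|exact: ch].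
have cf : continuous f.
  by move=> x; apply: cvgB; [exact: ch|exact: chx].
have [hchi|hno] := pselect (exists2 chi : X -> R[i], is_character chi & coef f chi != 0).
  have [chi hc hf] := hchi; exists chi; split => //.
    move=> y Yy; have := coef_shift y hc (cb cf).
    have -> : (fun x => f (x + y)) = f.
      by apply/funext => x; rewrite /f (hY x y Yy) addrAC (hY (x + x0) y Yy).
    move=> /eqP; rewrite -subr_eq0 -[X in X - _]mul1r -mulrBl mulf_eq0 (negbTE hf) orbF.
    by rewrite subr_eq0 chN// eq_sym invr_eq1 => /eqP.
  apply: contra_neq hf => e.
  rewrite /f coefB//; [|exact: cb|exact: cb].
  by rewrite (coef_shift x0 hc (cb ch)) chN// e invr1 mul1r subrr.
have := peter_weyl cX mu1 muinv cf.
have hz chi : is_character chi ->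
    Int (fun x => f x * chRe chi x) = 0 /\ Int (fun x => f x * chIm chi x) = 0.
  move=> hc; have : coef f chi = 0.
    by apply/eqP/negPn/negP => hf; apply: hno; exists chi.
  by move=> [].
move=> /(_ hz 0); rewrite /f add0r; lra.
Qed.

End Separation.

(** * Rational coordinates on the dual group *)

Section RankEmbedding.
Variables (R : realType) (X : topologicalZmodType).
Hypothesis cnX : connected [set: X].
Hypothesis fdX : finite_dimensional R X.

Local Notation char := (@is_character R X).

Let independent r (b : 'I_r -> X -> R[i]) : Prop :=
  (forall i, char (b i)) /\
  forall n : 'I_r -> int, (forall x, \prod_(i < r) b i x ^ n i = 1) -> forall i, n i = 0.

Let max_independent : exists r (b : 'I_r -> X -> R[i]), independent b /\
  forall b' : 'I_r.+1 -> X -> R[i], ~ independent b'.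
Proof.
have [d hd] := fdX.
pose Q r := `[< exists b : 'I_r -> X -> R[i], independent b >].
have Q0 : exists r, Q r.
  exists 0%N; apply/asboolP; exists (fun _ _ => 1); split=> [i|n _ i]; by case: i.
have Qd r : Q r -> (r <= d)%N.
  move=> /asboolP[b [bc bi]]; rewrite leqNgt; apply/negP => dr.
  have [n [[i ni] hn]] := hd (fun i => b (widen_ord dr i)) (fun i => bc _).
  pose n' (i : 'I_r) : int := if insub (val i) is Some j then n j else 0.
  have n'E (j : 'I_d.+1) : n' (widen_ord dr j) = n j by rewrite /n' /= valK.
  suff /bi/(_ (widen_ord dr i)) : forall x, \prod_(i < r) b i x ^ n' i = 1.
    by rewrite n'E => e; rewrite e eqxx in ni.
  move=> x; transitivity (\prod_(i < d.+1) b (widen_ord dr i) x ^ n i); last exact: hn.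
  rewrite (bigID (fun i : 'I_r => (i < d.+1)%N))/= [X in _ * X]big1 ?mulr1.
    rewrite (big_ord_narrow dr); apply: eq_bigr => j _; rewrite n'E//.
  by move=> j /negbTE jd; rewrite /n' insubF.
case: (ex_maxnP Q0 Qd) => r /asboolP[b hb] hmax; exists r, b; split=> // b' hb'.
have : Q r.+1 by apply/asboolP; exists b'.
by move/hmax; rewrite ltnn.
Qed.

Section Basis.
Variables (r : nat) (b : 'I_r -> X -> R[i]).
Hypothesis bi : independent b.
Hypothesis bmax : forall b' : 'I_r.+1 -> X -> R[i], ~ independent b'.

Let bc i : char (b i). Proof. by case: bi. Qed.
Let b0 i x : b i x != 0. Proof. exact: ch_neq0. Qed.

(** Only a nonzero power of [chi] lies in the group generated by the maximal independent family; the
    coordinates are its exponents divided by [n]. *)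
Let coord (chi : X -> R[i]) (w : 'rV[rat]_r) : Prop :=
  exists n : int, n != 0 /\ exists m : 'I_r -> int,
    (forall x, chi x ^ n = \prod_(i < r) b i x ^ m i) /\
    forall i, w 0 i * n%:~R = (m i)%:~R.

Let expz_prod (m : 'I_r -> int) (n : int) x :
  (\prod_(i < r) b i x ^ m i) ^ n = \prod_(i < r) b i x ^ (m i * n).
Proof.
elim/big_rec2: _ => [|i y z _ <-]; first by rewrite exp1rz.
by rewrite expfzMl exprz_exp.
Qed.

Let prod_exp_mul (m m' : 'I_r -> int) x :
  (\prod_(i < r) b i x ^ m i) * (\prod_(i < r) b i x ^ m' i) = \prod_(i < r) b i x ^ (m i + m' i).
Proof. by rewrite -big_split; apply: eq_bigr => i _ /=; rewrite expfzDr. Qed.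

Let coord_ex chi : char chi -> exists w, coord chi w.
Proof.
move=> hc; pose b' (i : 'I_r.+1) := if insub (val i) is Some j then b j else chi.
have b'w (j : 'I_r) : b' (widen_ord (leqnSn r) j) = b j by rewrite /b' /= valK.
have b'm : b' ord_max = chi by rewrite /b' insubF//= ltnn.
have b'c i : char (b' i) by rewrite /b'; case: insubP.
have hni : ~ forall n : 'I_r.+1 -> int,
    (forall x, \prod_(i < r.+1) b' i x ^ n i = 1) -> forall i, n i = 0.
  by move=> hn; exact: (@bmax b' (conj b'c hn)).
move/existsNP: hni => [n /not_implyP[hn /existsNP[i ni]]].
have hn' x : \prod_(j < r) b j x ^ n (widen_ord (leqnSn r) j) * chi x ^ n ord_max = 1.
  rewrite -[RHS](hn x) big_ord_recr/= b'm; congr (_ * _).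
  by apply: eq_bigr => j _; rewrite b'w.
have n0 : n ord_max != 0.
  apply/eqP => e; apply: ni; have [_ bi'] := bi.
  have hz := bi' (fun j => n (widen_ord (leqnSn r) j)).
  case: (unliftP ord_max i) => [j|] ->; last exact: e.
  rewrite (_ : lift _ _ = widen_ord (leqnSn r) j); last by apply: val_inj; rewrite /= /bump leqNgt ltn_ord.
  by apply: hz => x; have := hn' x; rewrite e expr0z mulr1.
exists (\row_i ((- n (widen_ord (leqnSn r) i))%:~R / (n ord_max)%:~R)).
exists (n ord_max); split=> //; exists (fun i => - n (widen_ord (leqnSn r) i)); split=> [x|i'].
  have := hn' x; set p := \prod_(j < r) _ => hp.
  have p0 : p != 0 by apply: contraPneq hp => ->; rewrite mul0r => /eqP; rewrite eq_sym oner_eq0.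
  apply: (mulfI p0); rewrite hp prod_exp_mul big1// => i' _.
  by rewrite addrN expr0z.
by rewrite mxE divfK// intr_eq0.
Qed.

Let coord_uniq chi w w' : coord chi w -> coord chi w' -> w = w'.
Proof.
move=> [n [n0 [m [hm wm]]]] [n' [n'0 [m' [hm' wm']]]].
have [_ bi'] := bi.
have e : forall i, m i * n' + (- m' i * n) = 0.
  apply: bi' => x; rewrite -prod_exp_mul -expz_prod -hm exprz_exp.
  have -> : \prod_(i < r) b i x ^ (- m' i * n) = (chi x ^ (n * n'))^-1.
    rewrite -expz_prod -[LHS]invrK; congr (_^-1); rewrite [n * n']mulrC -exprz_exp hm'.
    rewrite invr_expz -exprz_inv -prodfV; congr (_ ^ _); apply: eq_bigr => i _.
    by rewrite invr_expz opprK.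
  rewrite mulfV// expfz_neq0//; apply/negP => /eqP c0.
  have := hm x; rewrite c0 exp0rz (negbTE n0) => /eqP; rewrite eq_sym => /eqP h0.
  have : \prod_(i < r) b i x ^ m i != 0.
    by apply/prodf_neq0 => i _; rewrite expfz_neq0.
  by rewrite h0 eqxx.
apply/rowP => i; have nR : (n * n')%:~R != 0 :> rat by rewrite intr_eq0 mulf_neq0.
have e1 : w 0 i * (n * n')%:~R = (m i * n')%:~R by rewrite !intrM mulrA wm.
have e2 : w' 0 i * (n * n')%:~R = (m' i * n)%:~R.
  by rewrite [n * n']mulrC !intrM mulrA wm'.
apply: (mulIf nR); rewrite e1 e2.
by congr (_%:~R); apply/eqP; rewrite -subr_eq0 -mulNr e.
Qed.

Definition dual_coord chi : 'rV[rat]_r := xget 0 (coord chi).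

Let iotaP chi : char chi -> coord chi (dual_coord chi).
Proof. by move=> hc; apply: xgetPex; exact: coord_ex. Qed.

Let iotaE chi w : char chi -> coord chi w -> dual_coord chi = w.
Proof. by move=> hc hw; apply: (coord_uniq (iotaP hc) hw). Qed.

Lemma iotaM chi psi : char chi -> char psi -> dual_coord (fun x => chi x * psi x) = dual_coord chi + dual_coord psi.
Proof.
move=> h k; apply: iotaE; first exact: ch_mul.
have [n [n0 [m [hm wm]]]] := iotaP h; have [n' [n'0 [m' [hm' wm']]]] := iotaP k.
exists (n * n'); split; first exact: mulf_neq0.
exists (fun i => m i * n' + m' i * n); split=> [x|i].
  by rewrite -prod_exp_mul -!expz_prod -hm -hm' !exprz_exp expfzMl [n' * n]mulrC.
rewrite mxE mulrDl rmorphD !rmorphM /= -wm -wm'; congr (_ + _); first by rewrite mulrA.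
by rewrite mulrCA mulrC.
Qed.

Lemma iota1 : dual_coord (fun=> 1) = 0.
Proof.
apply: iotaE; first exact: ch_one.
exists 1; split=> //; exists (fun=> 0); split=> [x|i]; last by rewrite mxE mul0r.
by rewrite exp1rz big1.
Qed.

Lemma iotaV chi : char chi -> dual_coord (fun x => (chi x)^-1) = - dual_coord chi.
Proof.
move=> h; apply/eqP; rewrite -addr_eq0 -iotaM//; last exact: ch_inv.
rewrite (_ : (fun x => _) = fun=> 1) ?iota1//.
by apply/funext => x; rewrite mulVf// ch_neq0.
Qed.

(** Equal coordinates make a nonzero power of the quotient trivial, and connectedness of [X]
    excludes torsion. *)
Lemma iota_inj chi psi : char chi -> char psi -> dual_coord chi = dual_coord psi -> chi = psi.
Proof.
move=> h k e; have hk : char (fun x => chi x * (psi x)^-1).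
  by apply: ch_mul; [exact: h|exact: ch_inv].
suff h1 : forall x, chi x * (psi x)^-1 = 1.
  by apply/funext => x; apply: (divIf (ch_neq0 x k)); rewrite h1 divff// ch_neq0.
have [n [n0 [m [hm wm]]]] := iotaP hk.
have m0 i : m i = 0.
  apply/eqP; rewrite -(intr_eq0 rat) -wm (iotaM h (ch_inv k)) (iotaV k).
  by rewrite e subrr mxE mul0r.
have hn x : (chi x * (psi x)^-1) ^ n = 1 by rewrite hm big1// => i _; rewrite m0.
apply: (@ch_torsion_free _ _ _ `|n|%N cnX hk); first by rewrite absz_gt0.
move=> x; case: n n0 hn {hm wm} => n n0 hn; first exact: hn.
have hx : ((chi x * (psi x)^-1) ^+ n.+1)^-1 = 1 by exact: hn.
change ((chi x * (psi x)^-1) ^+ n.+1 = 1).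
by rewrite -[LHS]invrK hx invr1.
Qed.

Lemma iota_exp chi n : char chi -> dual_coord (fun x => chi x ^+ n) = n%:R *: dual_coord chi.
Proof.
move=> h; elim: n => [|n IH].
  by under eq_fun do rewrite expr0; rewrite iota1 scale0r.
under eq_fun do rewrite exprS; rewrite iotaM//; last exact: ch_exp.
by rewrite IH -natr1 scalerDl scale1r addrC.
Qed.

Lemma iota_expz chi (n : int) : char chi -> dual_coord (fun x => chi x ^ n) = n%:~R *: dual_coord chi.
Proof.
move=> h; case: n => n; first exact: iota_exp.
rewrite (_ : (fun x => _) = (fun x => (chi x ^+ n.+1)^-1))//.
by rewrite (iotaV (ch_exp n.+1 h)) iota_exp// NegzE rmorphN scaleNr.
Qed.

Lemma iota_prod (I : Type) (s : seq I) (chi : I -> X -> R[i]) : (forall i, char (chi i)) ->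
  dual_coord (fun x => \prod_(i <- s) chi i x) = \sum_(i <- s) dual_coord (chi i).
Proof.
move=> h; elim: s => [|i s IH].
  by rewrite big_nil; under eq_fun do rewrite big_nil; exact: iota1.
under eq_fun do rewrite big_cons; rewrite big_cons -IH iotaM//; exact: ch_prod.
Qed.

(** The rows of the matrix are the coordinates of the basis characters composed with [th];
    characters are row vectors, so an endomorphism acts on the right. *)
Lemma iota_comp chi th : char chi -> continuous th -> (forall x y, th (x + y) = th x + th y) ->
  dual_coord (fun x => chi (th x)) = dual_coord chi *m \matrix_(i < r) dual_coord (fun x => b i (th x)).
Proof.
move=> h ct tD; have [n [n0 [m [hm wm]]]] := iotaP h.
have nR : n%:~R != 0 :> rat by rewrite intr_eq0.
apply: (scalerI nR); rewrite -iota_expz; last exact: ch_comp.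
have -> : (fun x => chi (th x) ^ n) = (fun x => \prod_(i < r) (b i (th x)) ^ (m i)).
  by apply/funext => x; exact: hm.
rewrite iota_prod; last by move=> i; apply: (@ch_expz _ _ (fun x => b i (th x))); exact: ch_comp.
apply/rowP => j; rewrite summxE mxE mxE big_distrr/=; apply: eq_bigr => i _.
rewrite (iota_expz (m i) (ch_comp (bc i) ct tD)) !mxE -wm; ring.
Qed.

Lemma iota_span w : exists n chi, [/\ (0 < n)%N, char chi & dual_coord chi = n%:R *: w].
Proof.
pose d (i : 'I_r) : nat := absz (denq (w 0 i)).
pose n := (\prod_(i < r) d i)%N.
have n0 : (0 < n)%N by apply: prodn_gt0 => i; rewrite absz_gt0 denq_neq0.
have hm i : exists z : int, n%:R * w 0 i = z%:~R.
  exists ((\prod_(j < r | j != i) d j)%N%:Z * numq (w 0 i)).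
  rewrite /n (bigD1 i)//= natrM intrM -[w 0 i in LHS]divq_num_den.
  rewrite /d pmulrn gez0_abs ?denq_ge0// pmulrn.
  have d0 : (denq (w 0 i))%:~R != 0 :> rat by rewrite intr_eq0 denq_neq0.
  by rewrite [X in X * _ = _]mulrC -mulrA; congr (_ * _); rewrite mulrC divfK.
have [m hm'] := choice hm.
exists n, (fun x => \prod_(i < r) b i x ^ m i); split=> //.
  by apply: ch_prod => i; exact: ch_expz.
apply: iotaE; first by apply: ch_prod => i; exact: ch_expz.
exists 1; split=> //; exists m; split=> [x|i]; first by rewrite expr1z.
by rewrite mxE mulr1 hm'.
Qed.

End Basis.

(** All later arguments use the dual only through these four properties. Its image in Q^r can be a
    proper subgroup, so a vector is reached only up to a positive integer multiple. *)
Theorem rank_embedding : exists r (dual_coord : (X -> R[i]) -> 'rV[rat]_r) (M : (X -> X) -> 'M[rat]_r),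
  [/\ (forall chi psi, char chi -> char psi ->
         dual_coord (fun x => chi x * psi x) = dual_coord chi + dual_coord psi),
      (forall chi psi, char chi -> char psi -> dual_coord chi = dual_coord psi -> chi = psi),
      (forall w, exists n chi, [/\ (0 < n)%N, char chi & dual_coord chi = n%:R *: w]) &
      (forall chi th, char chi -> continuous th -> (forall x y, th (x + y) = th x + th y) ->
         dual_coord (fun x => chi (th x)) = dual_coord chi *m M th)].
Proof.
have [r [b [bi bmax]]] := max_independent.
exists r, (dual_coord b), (fun th => \matrix_(i < r) dual_coord b (fun x => b i (th x))); split.
- exact: iotaM.
- exact: iota_inj.
- exact: iota_span.
- exact: iota_comp.
Qed.

End RankEmbedding.

(** * Square-integrable approximation by trigonometric polynomials *)

Section AbsApprox.
Variable R : realFieldType.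

(** The classical polynomials that increase to the absolute value on [[-1, 1]], by iteration towards
    the square root of [t ^+ 2]. *)
Fixpoint abs_approx n (t : R) : R :=
  if n is n'.+1 then abs_approx n' t + (t ^+ 2 - abs_approx n' t ^+ 2) / 2 else 0.

Lemma abs_approx_bound n t : `|t| <= 1 ->
  [/\ 0 <= abs_approx n t, abs_approx n t <= `|t| &
      `|t| - abs_approx n t <= `|t| * (1 - `|t| / 2) ^+ n].
Proof.
move=> t1; have t0 := normr_ge0 t; elim: n => [|n [h1 h2 h3]] /=.
  by split => //; rewrite subr0 expr0 mulr1.
have e : `|t| - (abs_approx n t + (t ^+ 2 - abs_approx n t ^+ 2) / 2) =
  (`|t| - abs_approx n t) * (1 - (`|t| + abs_approx n t) / 2).
  by rewrite -[t ^+ 2]real_normK ?num_real//; field.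
have h4 : 0 <= 1 - (`|t| + abs_approx n t) / 2 by move: h2 t1; lra.
split.
- rewrite addr_ge0// divr_ge0// subr_ge0 -[t ^+ 2]real_normK ?num_real//.
  by rewrite ler_sqr ?nnegrE.
- by rewrite -subr_ge0 e mulr_ge0// subr_ge0.
- rewrite e exprSr mulrA; apply: ler_pM => //; first by rewrite subr_ge0.
  by move: h1; lra.
Qed.

End AbsApprox.

Lemma small_pow (R : realType) (t e : R) : 0 <= t -> t < 1 -> 0 < e ->
  exists n0 : nat, forall n, (n0 <= n)%N -> t ^+ n < e.
Proof.
move=> t0 t1 e0; have h := @cvg_expr R t; rewrite ger0_norm// in h.
have /cvgrPdist_lt/(_ e e0) := h t1.
case=> n0 _ hn; exists n0 => n nn.
by have := hn n nn; rewrite /= sub0r normrN ger0_norm// exprn_ge0.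
Qed.

Section L2Closure.
Variables (R : realType) (X : topologicalZmodType).
Variable rho : {measure set (borel X) -> \bar R}.
Hypothesis frho : (rho setT < +oo)%E.
Local Notation Int := (Int rho).

Lemma bmfX2 (f : X -> R) : bmf f -> bmf (fun x => f x ^+ 2).
Proof. by move=> hf; under eq_fun do rewrite expr2; exact: bmfM. Qed.

Lemma bmf_lin (a b : R) (f g : X -> R) : bmf f -> bmf g -> bmf (fun x => a * f x + b * g x).
Proof. by move=> hf hg; apply: bmfD; apply: bmfZ. Qed.

Lemma Int_bounded_cvg (g : nat -> X -> R) (f : X -> R) M : (forall n, bmf (g n)) -> bmf f ->
  (forall n x, `|g n x| <= M) -> (forall x, (fun n => g n x) @ \oo --> f x) ->
  (fun n => Int (g n)) @ \oo --> Int f.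
Proof.
move=> bg bf hM hg; rewrite /Int.
have gI (h : X -> R) : bmf h -> (\int[rho]_x (h x)%:E)%E \is a fin_num.
  by move=> bh; apply: integrable_fin_num => //; exact: bmf_integrable.
apply: fine_cvg; rewrite fineK ?gI//.
apply: (@dominated_cvg _ _ _ rho setT measurableT _ _ (fun=> M%:E)) => //.
- by move=> n; apply/measurable_EFinP; case: (bg n).
- by move=> x _; apply: cvg_EFin; [exact: nearW|exact: hg].
- exact: (bmf_integrable frho (bmf_cst X M)).
- by move=> n x _; rewrite lee_fin; exact: hM.
Qed.

Variable P : set (X -> R).
Hypothesis Pbmf : forall p, P p -> bmf p.
Hypothesis Pcst : forall c, P (fun=> c).
Hypothesis Plin : forall a b p q, P p -> P q -> P (fun x => a * p x + b * q x).
Hypothesis Pmul : forall p q, P p -> P q -> P (fun x => p x * q x).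

(** The L2 closure of the algebra [P] among bounded functions. The finite measure [rho] is
    arbitrary, because the sum of the Haar measure and its image under an affine map will be
    needed. *)
Definition l2cl (f : X -> R) : Prop := bmf f /\
  forall e : R, 0 < e -> exists2 p, P p & Int (fun x => (f x - p x) ^+ 2) < e.

Let sq_bmf (f p : X -> R) : bmf f -> bmf p -> bmf (fun x => (f x - p x) ^+ 2).
Proof. by move=> hf hp; apply: bmfX2; exact: bmfB. Qed.

Lemma l2cl_P p : P p -> l2cl p.
Proof.
move=> Pp; split=> [|e e0]; first exact: Pbmf.
exists p => //; rewrite (_ : (fun x => _) = (fun=> 0)) ?Int_cst ?mul0r//.
by apply/funext => x; rewrite subrr expr0n.
Qed.

(** The [+ 1] in the denominators covers vanishing coefficients. *)
Let Int_2le (f g h : X -> R) (a b e : R) : bmf f -> bmf g -> bmf h -> 0 < e -> 0 <= a -> 0 <= b ->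
  Int g < e / (2 * a + 1) -> Int h < e / (2 * b + 1) -> (forall x, f x <= a * g x + b * h x) ->
  Int f < e.
Proof.
move=> bf bg bh e0 a0 b0 hg hh hle.
apply: (@le_lt_trans _ _ (a * Int g + b * Int h)).
  rewrite -!IntZ// -IntD//; [|exact: bmfZ|exact: bmfZ].
  by apply: Int_le => //; exact: bmf_lin.
have key (c t : R) : 0 <= c -> t < e / (2 * c + 1) -> c * t <= e / 2 /\ (c * t < e / 2 \/ c = 0).
  move=> c0 ht; have [->|cn0] := eqVneq c 0.
    by rewrite mul0r; split; [rewrite divr_ge0// ltW|right].
  have cp : 0 < c by rewrite lt_neqAle eq_sym cn0.
  have hct : c * t < e / 2.
    apply: (@lt_trans _ _ (c * (e / (2 * c + 1)))); first by rewrite ltr_pM2l.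
    have p1 : 0 < 2 * c + 1 by rewrite addr_gt0// mulr_gt0.
    rewrite mulrA ltr_pdivrMr// -subr_gt0.
    have -> : e / 2 * (2 * c + 1) - c * e = e / 2 by field.
    by rewrite divr_gt0.
  by split; [exact: ltW|left].
have [h1 h1'] := key a _ a0 hg; have [h2 h2'] := key b _ b0 hh.
case: h1' h2' => [h1'|a00] [h2'|b00].
- by move: h1' h2'; lra.
- by rewrite b00 mul0r; move: h1' e0; lra.
- by rewrite a00 mul0r; move: h2' e0; lra.
- by rewrite a00 b00 !mul0r addr0.
Qed.

Lemma l2cl_lin a b f g : l2cl f -> l2cl g -> l2cl (fun x => a * f x + b * g x).
Proof.
move=> [bf hf] [bg hg]; split=> [|e e0]; first exact: bmf_lin.
have ea (c : R) : 0 < e / (2 * (2 * c ^+ 2) + 1).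
  by rewrite divr_gt0// ltr_wpDl// mulr_ge0// mulr_ge0// sqr_ge0.
have [p Pp hp] := hf _ (ea a); have [q Pq hq] := hg _ (ea b).
exists (fun x => a * p x + b * q x); first exact: Plin.
have bp := Pbmf Pp; have bq := Pbmf Pq.
apply: (Int_2le _ (sq_bmf bf bp) (sq_bmf bg bq) e0 _ _ hp hq).
- by apply: sq_bmf; exact: bmf_lin.
- by rewrite mulr_ge0// sqr_ge0.
- by rewrite mulr_ge0// sqr_ge0.
move=> x; rewrite -subr_ge0.
have -> : 2 * a ^+ 2 * (f x - p x) ^+ 2 + 2 * b ^+ 2 * (g x - q x) ^+ 2 -
  (a * f x + b * g x - (a * p x + b * q x)) ^+ 2 = (a * (f x - p x) - b * (g x - q x)) ^+ 2 by ring.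
exact: sqr_ge0.
Qed.

Lemma l2clM f g : l2cl f -> l2cl g -> l2cl (fun x => f x * g x).
Proof.
move=> [bf hf] [bg hg]; split=> [|e e0]; first exact: bmfM.
have ea (c : R) : 0 < e / (2 * (2 * c ^+ 2) + 1).
  by rewrite divr_gt0// ltr_wpDl// mulr_ge0// mulr_ge0// sqr_ge0.
(* [q] is chosen against the bound of [f], and [p] afterwards against the bound of [q], since
   [f g - p q = f (g - q) + q (f - p)]. *)
have [_ [F hF]] := bf; have [q Pq hq] := hg _ (ea F).
have bq := Pbmf Pq; have [_ [Q hQ]] := bq; have [p Pp hp] := hf _ (ea Q).
exists (fun x => p x * q x); first exact: Pmul.
have bp := Pbmf Pp.
apply: (Int_2le _ (sq_bmf bg bq) (sq_bmf bf bp) e0 _ _ hq hp).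
- by apply: sq_bmf; exact: bmfM.
- by rewrite mulr_ge0// sqr_ge0.
- by rewrite mulr_ge0// sqr_ge0.
have sqle (c M : R) : `|c| <= M -> c ^+ 2 <= M ^+ 2.
  move=> h; rewrite -[c ^+ 2]real_normK ?num_real// ler_sqr ?nnegrE//.
  exact: le_trans h.
move=> x; apply: (@le_trans _ _ (2 * f x ^+ 2 * (g x - q x) ^+ 2 + 2 * q x ^+ 2 * (f x - p x) ^+ 2)).
  rewrite -subr_ge0.
  have -> : 2 * f x ^+ 2 * (g x - q x) ^+ 2 + 2 * q x ^+ 2 * (f x - p x) ^+ 2 -
    (f x * g x - p x * q x) ^+ 2 = (f x * (g x - q x) - q x * (f x - p x)) ^+ 2 by ring.
  exact: sqr_ge0.
by apply: lerD; apply: ler_wpM2r; rewrite ?sqr_ge0// ler_wpM2l// sqle.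
Qed.

Lemma l2cl_lim (g : nat -> X -> R) f M : (forall n, l2cl (g n)) -> bmf f ->
  (forall n x, `|g n x| <= M) -> (forall x, `|f x| <= M) ->
  (forall x (e : R), 0 < e -> exists n0 : nat, forall n, (n0 <= n)%N -> `|f x - g n x| < e) ->
  l2cl f.
Proof.
move=> hg bf hM fM hlim; split=> // e e0.
have bg n : bmf (g n) by case: (hg n).
have hc : (fun n => Int (fun x => (f x - g n x) ^+ 2)) @ \oo --> Int (fun=> 0 : R).
  apply: (@Int_bounded_cvg _ _ ((M + M) ^+ 2)) => //.
  - by move=> n; exact: sq_bmf.
  - exact: bmf_cst.
  - move=> n x; rewrite ger0_norm ?sqr_ge0// -real_normK ?num_real//.
    rewrite ler_sqr ?nnegrE ?normr_ge0//.
      by rewrite (le_trans (ler_normB _ _))// lerD.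
    by rewrite addr_ge0// (le_trans _ (fM 0)).
  - move=> x; apply/cvgrPdist_lt => d d0.
    have d1 : 0 < Num.sqrt d by rewrite sqrtr_gt0.
    have [n0 hn] := hlim x _ d1; exists n0 => // n /= nn.
    rewrite sub0r normrN ger0_norm ?sqr_ge0// -[_ ^+ 2]real_normK ?num_real//.
    rewrite -[X in _ < X]sqr_sqrtr ?(ltW d0)// ltr_sqr ?nnegrE ?sqrtr_ge0//.
    exact: hn.
have e1 : 0 < e / (2 * 2 + 1) by rewrite divr_gt0.
rewrite Int_cst// mul0r in hc.
move/cvgrPdist_lt: hc => /(_ _ e1)[n0 _ /(_ n0 (leqnn _))].
rewrite /= sub0r normrN ger0_norm => [h1|]; last by apply: Int_ge0 => x; exact: sqr_ge0.
have [p Pp hp] := (hg n0).2 _ e1; exists p => //; have bp := Pbmf Pp.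
have two0 : 0 <= 2 :> R by [].
apply: (Int_2le (sq_bmf bf bp) (sq_bmf bf (bg n0)) (sq_bmf (bg n0) bp) e0 two0 two0 h1 hp).
move=> x; rewrite -subr_ge0.
have -> : 2 * (f x - g n0 x) ^+ 2 + 2 * (g n0 x - p x) ^+ 2 - (f x - p x) ^+ 2 =
  ((f x - g n0 x) - (g n0 x - p x)) ^+ 2 by ring.
exact: sqr_ge0.
Qed.

Lemma l2cl_cst c : l2cl (fun=> c).
Proof. exact: l2cl_P. Qed.

Lemma l2clZ a f : l2cl f -> l2cl (fun x => a * f x).
Proof.
move=> h; have := l2cl_lin a 0 h h.
by under eq_fun do rewrite mul0r addr0.
Qed.

Lemma l2clB f g : l2cl f -> l2cl g -> l2cl (fun x => f x - g x).
Proof.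
move=> h k; have := l2cl_lin 1 (-1) h k.
by under eq_fun do rewrite mul1r mulN1r.
Qed.

Lemma l2clD f g : l2cl f -> l2cl g -> l2cl (fun x => f x + g x).
Proof.
move=> h k; have := l2cl_lin 1 1 h k.
by under eq_fun do rewrite !mul1r.
Qed.

Lemma l2cl_bounded f : l2cl f -> exists2 M : R, 0 < M & forall x, `|f x| <= M.
Proof.
move=> [[_ [M hM]] _]; exists (`|M| + 1); first by rewrite ltr_wpDl.
by move=> x; rewrite (le_trans (hM x))// (le_trans (ler_norm M))// lerDl.
Qed.

Lemma l2cl_exp f n : l2cl f -> l2cl (fun x => f x ^+ n).
Proof.
move=> h; elim: n => [|n IH]; first by under eq_fun do rewrite expr0; exact: l2cl_cst.
by under eq_fun do rewrite exprS; exact: l2clM.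
Qed.

Lemma l2cl_abs f : l2cl f -> l2cl (fun x => `|f x|).
Proof.
move=> hf; have [M M0 hM] := l2cl_bounded hf.
pose u x := M^-1 * f x; have hu : l2cl u by exact: l2clZ.
have u1 x : `|u x| <= 1.
  by rewrite normrM gtr0_norm ?invr_gt0// mulrC ler_pdivrMr// mul1r.
suff h : l2cl (fun x => `|u x|).
  rewrite (_ : (fun x => _) = (fun x => M * `|u x|)); first exact: l2clZ.
  by apply/funext => x; rewrite normrM gtr0_norm ?invr_gt0// mulVKf// gt_eqF.
have ha n : l2cl (fun x => abs_approx n (u x)).
  elim: n => [|n IH] /=; first exact: l2cl_cst.
  apply: l2clD => //; under eq_fun do rewrite mulrC; apply: l2clZ.
  by apply: l2clB; exact: l2cl_exp.
apply: (@l2cl_lim (fun n x => abs_approx n (u x)) _ 1) => //.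
- split; last by exists 1 => x; rewrite normr_id.
  by apply: measurableT_comp => //; case: hu => -[].
- move=> n x; have [h1 h2 _] := abs_approx_bound n (u1 x).
  by rewrite ger0_norm// (le_trans h2).
- by move=> x; rewrite normr_id.
- move=> x e e0; have [->|u0] := eqVneq (u x) 0.
    exists 0%N => n _; suff -> : abs_approx n (0 : R) = 0 by rewrite normr0 subrr normr0.
    by elim: n => //= n ->; rewrite expr0n/= subrr mul0r addr0.
  have p0 : 0 < `|u x| by rewrite normr_gt0.
  have q0 : 0 <= 1 - `|u x| / 2 by move: (u1 x); lra.
  have q1 : 1 - `|u x| / 2 < 1 by move: p0; lra.
  have [n0 hn] := small_pow q0 q1 e0; exists n0 => n /hn hn'.
  have [h1 h2 h3] := abs_approx_bound n (u1 x).
  rewrite ger0_norm ?subr_ge0//; apply: (le_lt_trans h3).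
  by apply: le_lt_trans hn'; rewrite ler_piMl// exprn_ge0.
Qed.

(** With [g] the positive part rescaled to [[0, 1]], the indicator is the pointwise limit of
    [1 - (1 - g) ^+ n]. *)
Lemma l2cl_pos f : l2cl f -> l2cl (fun x => ((0 < f x)%R)%:R).
Proof.
move=> hf; have [M M0 hM] := l2cl_bounded hf.
pose g x := (2 * M)^-1 * (f x + `|f x|).
have M2 : 0 < 2 * M by rewrite mulr_gt0.
have hg : l2cl g by apply: l2clZ; apply: l2clD => //; exact: l2cl_abs.
have g0 x : 0 <= g x.
  by rewrite mulr_ge0// ?invr_ge0 ?(ltW M2)// -lerBlDl sub0r -normrN ler_norm.
have g1 x : g x <= 1.
  rewrite /g mulrC ler_pdivrMr// mul1r mulr_natl mulr2n lerD//.
  exact: le_trans (ler_norm _) (hM x).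
apply: (@l2cl_lim (fun n x => 1 - (1 - g x) ^+ n) _ 1) => //.
- move=> n; apply: l2clB; first exact: l2cl_cst.
  by apply: l2cl_exp; apply: l2clB => //; exact: l2cl_cst.
- rewrite (_ : (fun x => _) = \1_[set x | 0 < f x]); last first.
    apply/funext => x; rewrite indicE; case: (boolP (0 < f x)) => h.
      by rewrite mem_set.
    by rewrite memNset//=; apply/negP.
  apply: bmf_indic; have [[mf _] _] := hf.
  have := mf measurableT `]0, +oo[%classic (measurable_itv _).
  by rewrite setTI; congr (measurable _); apply/seteqP; split=> x /=; rewrite in_itv/= andbT.
- move=> n x; have h : 0 <= (1 - g x) ^+ n by rewrite exprn_ge0// subr_ge0.
  have h' : (1 - g x) ^+ n <= 1 by rewrite exprn_ile1// ?subr_ge0// gerBl.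
  by rewrite ger0_norm ?subr_ge0// gerBl.
- by move=> x; case: (0 < f x); rewrite ?normr1 ?normr0.
- move=> x e e0; case: (ltrP 0 (f x)) => hx.
    have gp : 0 < g x by rewrite mulr_gt0 ?invr_gt0// addr_gt0// normr_gt0 gt_eqF.
    have q0 : 0 <= 1 - g x by rewrite subr_ge0.
    have q1 : 1 - g x < 1 by rewrite gtrBl.
    have [n0 hn] := small_pow q0 q1 e0; exists n0 => n /hn hn'.
    by rewrite subKr ger0_norm// exprn_ge0.
  exists 0%N => n _; have -> : g x = 0 by rewrite /g ler0_norm// subrr mulr0.
  by rewrite subr0 expr1n subrr subrr normr0.
Qed.

Definition l2set (A : set (borel X)) : Prop := measurable A /\ l2cl (\1_A : X -> R).

Let indicC (A : set X) : (\1_(~` A) : X -> R) = (fun x => 1 - \1_A x).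
Proof.
apply/funext => x; rewrite !indicE; have [Ax|Ax] := pselect (A x).
  by rewrite (mem_set Ax) memNset ?subrr//; apply.
by rewrite (memNset Ax) mem_set ?subr0.
Qed.

Let indicI (A B : set X) : (\1_(A `&` B) : X -> R) = (fun x => \1_A x * \1_B x).
Proof.
apply/funext => x; rewrite !indicE; have [Ax|Ax] := pselect (A x); last first.
  by rewrite (memNset Ax) mul0r memNset// => -[].
have [Bx|Bx] := pselect (B x); first by rewrite !mem_set ?mulr1.
by rewrite (memNset Bx) mulr0 memNset// => -[].
Qed.

Lemma l2setC A : l2set A -> l2set (~` A).
Proof.
move=> [mA hA]; split; first exact: measurableC.
by rewrite indicC; apply: l2clB => //; exact: l2cl_cst.
Qed.

Lemma l2setI A B : l2set A -> l2set B -> l2set (A `&` B).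
Proof.
move=> [mA hA] [mB hB]; split; first exact: measurableI.
by rewrite indicI; exact: l2clM.
Qed.

Lemma l2setT : l2set setT.
Proof. by split; [exact: measurableT|rewrite indicT; exact: l2cl_cst]. Qed.

Lemma l2set_bigcap (I : Type) (s : seq I) (A : I -> set (borel X)) :
  (forall i, l2set (A i)) -> l2set (\big[setI/setT]_(i <- s) A i).
Proof.
move=> h; elim: s => [|i s IH]; first by rewrite big_nil; exact: l2setT.
by rewrite big_cons; exact: l2setI.
Qed.

Lemma l2set_bigcup (A : nat -> set (borel X)) : (forall n, l2set (A n)) -> l2set (\bigcup_n A n).
Proof.
move=> hA; have mU : measurable (\bigcup_n A n).
  by apply: bigcupT_measurable => n; case: (hA n).
split=> //.
pose B n := ~` (\big[setI/setT]_(i <- iota 0 n) ~` A i).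
have BP n x : B n x <-> exists2 i, (i < n)%N & A i x.
  rewrite /B; split.
    move=> hB; apply: contrapT => hn; apply: hB.
    rewrite -bigcap_seq => i; rewrite /= mem_iota add0n => /andP[_ ni] Ai.
    by apply: hn; exists i.
  by move=> [i ni Ai]; rewrite -bigcap_seq => /(_ i); apply => //; rewrite /= mem_iota.
have hB n : l2set (B n) by apply: l2setC; apply: l2set_bigcap => i; exact: l2setC.
apply: (@l2cl_lim (fun n => \1_(B n)) _ 1).
- by move=> n; case: (hB n).
- exact: bmf_indic.
- by move=> n x; rewrite indicE; case: (_ \in _); rewrite ?normr1 ?normr0.
- by move=> x; rewrite indicE; case: (_ \in _); rewrite ?normr1 ?normr0.
- move=> x e e0; have [[i _ Ai]|hn] := pselect ((\bigcup_n A n) x).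
    exists i.+1 => n ni; rewrite !indicE mem_set; last by exists i.
    by rewrite mem_set ?subrr ?normr0//; apply/BP; exists i.
  exists 0%N => n _; rewrite !indicE (memNset hn) memNset ?subrr ?normr0//.
  by move=> /BP[i _ Ai]; apply: hn; exists i.
Qed.

Lemma l2set_borel : (forall O : set X, open O -> l2set O) ->
  forall A : set (borel X), measurable A -> l2set A.
Proof.
move=> ho; apply: (@smallest_sub _ _ _ (fun A => l2set A)) => //.
split.
- by have := l2setC l2setT; rewrite setCT.
- by move=> A hA; rewrite setTD; exact: l2setC.
- exact: l2set_bigcup.
Qed.

(** After rescaling [f] to [g] in [[0, 1]], [G n] is the average of the indicators of [n + 1] level
    sets, which rounds [g] down to a multiple of [1 / (n + 1)]. *)
Lemma l2cl_bmf f : (forall O : set X, open O -> l2set O) -> bmf f -> l2cl f.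
Proof.
move=> ho bf; have [mf [M hM]] := bf.
pose K := `|M| + 1; have K0 : 0 < K by rewrite ltr_wpDl.
have hK x : `|f x| <= K by rewrite (le_trans (hM x))// (le_trans (ler_norm M))// lerDl.
pose g x := (2 * K)^-1 * (f x + K).
have K2 : 0 < 2 * K by rewrite mulr_gt0.
have g0 x : 0 <= g x.
  rewrite mulr_ge0// ?invr_ge0 ?(ltW K2)// -lerBlDr sub0r.
  by have := hK x; rewrite ler_norml => /andP[].
have g1 x : g x <= 1.
  rewrite /g mulrC ler_pdivrMr// mul1r mulr_natl mulr2n lerD2r.
  exact: le_trans (ler_norm _) (hK x).
have bg : bmf g by apply: bmfZ; apply: bmfD => //; exact: bmf_cst.
suff hg : l2cl g.
  rewrite (_ : f = fun x => 2 * K * g x - K).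
    by apply: l2clB; [exact: l2clZ|exact: l2cl_cst].
  by apply/funext => x; rewrite /g mulVKf ?gt_eqF// addrK.
have hs n k : l2cl (fun x => ((k.+1%:R <= n.+1%:R * g x)%R)%:R).
  rewrite (_ : (fun x => _) = \1_[set x | (k.+1)%:R <= n.+1%:R * g x]); last first.
    apply/funext => x; rewrite indicE; case: (boolP (_ <= _)) => h.
      by rewrite mem_set.
    by rewrite memNset//=; apply/negP.
  apply: (l2set_borel ho _).2.
  have [mg _] := bmfZ n.+1%:R bg.
  have := mg measurableT `[k.+1%:R, +oo[%classic (measurable_itv _).
  by rewrite setTI; congr (measurable _); apply/seteqP; split=> x /=; rewrite in_itv/= andbT.
pose G n x := n.+1%:R^-1 * \sum_(k < n.+1) ((k.+1%:R <= n.+1%:R * g x)%R)%:R : R.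
have GE n x : G n x = n.+1%:R^-1 * (Num.truncn (n.+1%:R * g x))%:R.
  rewrite /G; congr (_ * _); set t := n.+1%:R * g x.
  have t0 : 0 <= t by rewrite mulr_ge0.
  have hT : (Num.truncn t <= n.+1)%N.
    have /andP[hT _] := truncn_itv t0.
    by rewrite -(ler_nat R) (le_trans hT)// /t ler_piMr.
  rewrite -natr_sum; congr (_%:R).
  under eq_bigr do rewrite -truncn_ge_nat//.
  rewrite (eq_bigr (fun k : 'I_n.+1 => if (k < Num.truncn t)%N then 1%N else 0%N)); last first.
    by move=> k _; case: ltnP.
  by rewrite -big_mkcond/= (big_ord_narrow hT)/= sum1_card card_ord.
have inv0 n : 0 < n.+1%:R^-1 :> R by rewrite invr_gt0.
have Gd n x : 0 <= g x - G n x /\ g x - G n x <= n.+1%:R^-1.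
  rewrite GE; have t0 : 0 <= n.+1%:R * g x by rewrite mulr_ge0.
  have /andP[h1 h2] := truncn_itv t0.
  move: h1 h2; rewrite -[(Num.truncn _).+1%:R]natr1; set T := (Num.truncn _)%:R => h1 h2.
  have e : g x - n.+1%:R^-1 * T = n.+1%:R^-1 * (n.+1%:R * g x - T).
    by rewrite mulrBr mulKf// pnatr_eq0.
  rewrite e; split; first by rewrite mulr_ge0 ?(ltW (inv0 _))// subr_ge0.
  by rewrite ler_piMr ?(ltW (inv0 _))// lerBlDl ltW.
apply: (@l2cl_lim G _ 1) => //.
- move=> n; apply: l2clZ.
  suff hm m : l2cl (fun x => \sum_(k < m) ((k.+1%:R <= n.+1%:R * g x)%R)%:R) by exact: hm.
  elim: m => [|m IH]; first by under eq_fun do rewrite big_ord0; exact: l2cl_cst.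
  by under eq_fun do rewrite big_ord_recr/=; apply: l2clD => //; exact: hs.
- move=> n x; have [h _] := Gd n x; rewrite ger0_norm.
    by rewrite (le_trans _ (g1 x))// -subr_ge0.
  by rewrite GE mulr_ge0// ltW.
- by move=> x; rewrite ger0_norm.
- move=> x e e0; exists (Num.truncn e^-1) => n hn; have [h1 h2] := Gd n x.
  rewrite ger0_norm//; apply: (le_lt_trans h2).
  rewrite -[e]invrK ltf_pV2 ?posrE ?invr_gt0//.
  by rewrite -truncn_le_nat.
Qed.

End L2Closure.

Section CompactCover.
Variable X : topologicalType.

Lemma compact_seq_cover (J : eqType) (K : set X) (V : J -> set X) (good : J -> Prop) :
  compact K -> (forall y, K y -> exists j, good j /\ nbhs y (V j)) ->
  exists s : seq J, (forall j, j \in s -> good j) /\ forall y, K y -> exists2 j, j \in s & V j y.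
Proof.
move=> cK h; have hnc := (compact_near_coveringP _).1 cK.
pose F := filter_from [set s : seq J | forall j, j \in s -> good j]
  (fun s0 => [set s : seq J | forall x, x \in s0 -> x \in s]).
have FF : Filter F.
  apply: filter_from_filter; first by exists [::].
  move=> s1 s2 g1 g2; exists (s1 ++ s2) => [j|s /= hs].
    by rewrite mem_cat => /orP[/g1|/g2].
  by split => x xs; apply: hs; rewrite mem_cat xs ?orbT.
have : F (fun s => K `<=` (fun x => exists2 z, z \in s & V z x)).
  apply: (hnc (seq J) F (fun s x => exists2 z, z \in s & V z x)) => x Kx.
  have [j [gj Vj]] := h x Kx.
  exists ((V j), (fun s => is_true (j \in s))) => /=.
    split=> //; exists [:: j] => [i|s hs]; first by rewrite inE => /eqP->.
    by apply: hs; rewrite inE.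
  by move=> [y s] /= [h3 h4]; exists j.
by move=> [s0 g0 hs]; exists s0; split => // x Kx; apply: (hs s0).
Qed.

End CompactCover.

(** * Fourier coefficients of bounded functions *)

Section ComplexIntegral.
Variables (R : realType) (X : topologicalZmodType).
Variable mu : {measure set (borel X) -> \bar R}.
Hypothesis cX : compact [set: X].
Hypothesis mu1 : mu setT = 1%E.
Hypothesis muinv : forall (x : X) (A : set (borel X)), measurable A ->
  mu ((fun y : X => x + y) @^-1` A) = mu A.
Local Notation Int := (Int mu).
Let fm := haar_fin mu1.
Let cb (f : X -> R) : continuous f -> bmf f := @bmf_cont R X cX f.

Definition cbmf (P : X -> R[i]) : Prop :=
  bmf (fun x => complex.Re (P x) : R) /\ bmf (fun x => complex.Im (P x) : R).

Definition cint (P : X -> R[i]) : R[i] :=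
  Complex (Int (fun x => complex.Re (P x))) (Int (fun x => complex.Im (P x))).

(** The squared modulus with values in [R]; the norm of [R[i]] takes its values in [R[i]]. *)
Definition nsq (z : R[i]) : R := complex.Re z ^+ 2 + complex.Im z ^+ 2.

Definition cj (z : R[i]) : R[i] := Complex (complex.Re z) (- complex.Im z).

Lemma nsq_ge0 z : 0 <= nsq z. Proof. by rewrite addr_ge0// sqr_ge0. Qed.

Lemma nsqM z w : nsq (z * w) = nsq z * nsq w.
Proof. by case: z => a b; case: w => c d; rewrite /nsq /=; ring. Qed.

Lemma mul_cj z : z * cj z = real_complex R (nsq z).
Proof. by case: z => a b; apply/eqP; rewrite eq_complex /nsq /=; apply/andP; split; apply/eqP; ring. Qed.

Lemma cjM z w : cj (z * w) = cj z * cj w.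
Proof. by case: z => a b; case: w => c d; apply/eqP; rewrite eq_complex /=; apply/andP; split; apply/eqP; ring. Qed.

Lemma cjD z w : cj (z + w) = cj z + cj w.
Proof. by case: z => a b; case: w => c d; apply/eqP; rewrite eq_complex /=; apply/andP; split; apply/eqP; ring. Qed.

Lemma cj0 : cj 0 = 0.
Proof. by apply/eqP; rewrite eq_complex /= oppr0 !eqxx. Qed.

Lemma ch_nsq chi x : @is_character R X chi -> nsq (chi x) = 1.
Proof. by move=> h; exact: ch_sqr. Qed.

Lemma ch_cj chi x : @is_character R X chi -> cj (chi x) = (chi x)^-1.
Proof.
move=> h; apply: (mulfI (ch_neq0 x h)); rewrite mul_cj ch_nsq// mulfV ?ch_neq0//.
Qed.

Lemma cbmf_ch chi : is_character chi -> cbmf chi.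
Proof. by move=> h; split; apply: cb; [exact: (cont_chRe h)|exact: (cont_chIm h)]. Qed.

Lemma cbmfD P Q : cbmf P -> cbmf Q -> cbmf (fun x => P x + Q x).
Proof.
move=> [p1 p2] [q1 q2]; split.
- rewrite (_ : (fun x => _) = (fun x => complex.Re (P x) + complex.Re (Q x))); first exact: bmfD.
  by apply/funext => x; case: (P x); case: (Q x).
- rewrite (_ : (fun x => _) = (fun x => complex.Im (P x) + complex.Im (Q x))); first exact: bmfD.
  by apply/funext => x; case: (P x); case: (Q x).
Qed.

Lemma cbmfM P Q : cbmf P -> cbmf Q -> cbmf (fun x => P x * Q x).
Proof.
move=> [p1 p2] [q1 q2]; split.
- rewrite (_ : (fun x => _) = (fun x => complex.Re (P x) * complex.Re (Q x) -
    complex.Im (P x) * complex.Im (Q x))); first by apply: bmfB; exact: bmfM.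
  by apply/funext => x; case: (P x); case: (Q x).
- rewrite (_ : (fun x => _) = (fun x => complex.Re (P x) * complex.Im (Q x) +
    complex.Im (P x) * complex.Re (Q x))); first by apply: bmfD; exact: bmfM.
  by apply/funext => x; case: (P x) => a b; case: (Q x).
Qed.

Lemma cbmf_cst c : cbmf (fun=> c).
Proof. by split; exact: bmf_cst. Qed.

Lemma cbmf_cj P : cbmf P -> cbmf (fun x => cj (P x)).
Proof. by move=> [p1 p2]; split => //; exact: bmfN. Qed.

Lemma cbmf_sum (I : Type) (s : seq I) (P : I -> X -> R[i]) : (forall i, cbmf (P i)) ->
  cbmf (fun x => \sum_(i <- s) P i x).
Proof.
move=> h; elim: s => [|i s IH]; first by under eq_fun do rewrite big_nil; exact: cbmf_cst.
by under eq_fun do rewrite big_cons; exact: cbmfD.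
Qed.

Lemma cbmf_comp P (g : X -> X) : continuous g -> cbmf P -> cbmf (fun x => P (g x)).
Proof. by move=> cg [p1 p2]; split; [exact: (bmf_comp cg p1)|exact: (bmf_comp cg p2)]. Qed.

Lemma bmf_nsq P : cbmf P -> bmf (fun x => nsq (P x)).
Proof. by move=> [p1 p2]; apply: bmfD; exact: bmfX2. Qed.

Lemma cintD P Q : cbmf P -> cbmf Q -> cint (fun x => P x + Q x) = cint P + cint Q.
Proof.
move=> [p1 p2] [q1 q2]; apply/eqP; rewrite eq_complex /= -!IntD//.
by apply/andP; split; apply/eqP; congr (Int _); apply/funext => x; case: (P x); case: (Q x).
Qed.

Lemma cintZ c P : cbmf P -> cint (fun x => c * P x) = c * cint P.
Proof.
move=> [p1 p2]; case: c => a b; apply/eqP; rewrite eq_complex /=; apply/andP; split; apply/eqP.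
- rewrite -!IntZ// -IntB//; [|exact: bmfZ|exact: bmfZ].
  by congr (Int _); apply/funext => x; case: (P x).
- rewrite -!IntZ// -IntD//; [|exact: bmfZ|exact: bmfZ].
  by congr (Int _); apply/funext => x; case: (P x).
Qed.

Lemma cint_cst c : cint (fun=> c) = c.
Proof. by rewrite /cint !(Int_const mu1); case: c. Qed.

Lemma cint_sum (I : Type) (s : seq I) (P : I -> X -> R[i]) : (forall i, cbmf (P i)) ->
  cint (fun x => \sum_(i <- s) P i x) = \sum_(i <- s) cint (P i).
Proof.
move=> h; elim: s => [|i s IH].
  rewrite big_nil -[RHS]cint_cst; congr cint; apply/funext => x.
  by rewrite big_nil.
rewrite big_cons -IH -cintD//; last exact: cbmf_sum.
by congr cint; apply/funext => x; rewrite big_cons.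
Qed.

Lemma cint_ch chi z : is_character chi -> chi z != 1 -> cint chi = 0.
Proof.
move=> h hz; have hc := cbmf_ch h.
have e : cint (fun x => chi (x + z)) = cint chi.
  by congr Complex; [exact: (Int_shift mu1 muinv z hc.1)|exact: (Int_shift mu1 muinv z hc.2)].
have : cint (fun x => chi z * chi x) = cint chi.
  by rewrite -e; congr cint; apply/funext => x; rewrite chD// mulrC.
rewrite cintZ// => /eqP; rewrite -subr_eq0 -[X in _ - X]mul1r -mulrBl mulf_eq0 subr_eq0.
by rewrite (negbTE hz) => /eqP.
Qed.

Lemma Int_nsqB P Q : cbmf P -> cbmf Q ->
  Int (fun x => nsq (P x - Q x)) =
  Int (fun x => nsq (P x)) - 2 * complex.Re (cint (fun x => P x * cj (Q x))) +
  Int (fun x => nsq (Q x)).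
Proof.
move=> hP hQ; have [m1 m2] := cbmfM hP (cbmf_cj hQ).
rewrite /= -(IntZ fm 2 m1) -(IntB fm (bmf_nsq hP) (bmfZ 2 m1)).
rewrite -(IntD fm (bmfB (bmf_nsq hP) (bmfZ 2 m1)) (bmf_nsq hQ)); congr (Int _).
by apply/funext => x; rewrite /nsq; case: (P x) => a b; case: (Q x) => c d /=; ring.
Qed.

Lemma Int_nsq_cint P : cbmf P -> Int (fun x => nsq (P x)) = complex.Re (cint (fun x => P x * cj (P x))).
Proof.
by move=> hP; rewrite /cint /=; congr (Int _); apply/funext => x; rewrite mul_cj.
Qed.

Section Orthonormal.
Variables (J : eqType) (e : J -> X -> R[i]) (im : J -> Prop).
Hypothesis e_ch : forall w, is_character (e w).
Hypothesis e_inj : forall w v, im w -> im v -> (forall x, e w x = e v x) -> w = v.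

Definition fcoef (P : X -> R[i]) w : R[i] := cint (fun x => P x * cj (e w x)).
Definition trig (s : seq J) (c : J -> R[i]) x : R[i] := \sum_(w <- s) c w * e w x.

Lemma e_orth w v : im w -> im v -> fcoef (e w) v = (w == v)%:R.
Proof.
move=> iw iv; rewrite /fcoef; have [->|wv] := eqVneq w v.
  rewrite -[RHS](cint_cst 1); congr cint; apply/funext => x.
  by rewrite ch_cj// mulfV// ch_neq0.
have hc : is_character (fun x => e w x * (e v x)^-1) by apply: ch_mul => //; exact: ch_inv.
rewrite (_ : (fun x => _) = (fun x => e w x * (e v x)^-1)); last first.
  by apply/funext => x; rewrite ch_cj.
have [[z hz]|hn] := pselect (exists z, e w z * (e v z)^-1 != 1); first exact: (cint_ch hc hz).
case/eqP: wv; apply: e_inj => // x; apply/eqP/negPn/negP => hx; apply: hn; exists x.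
by apply: contra hx => /eqP h; rewrite -[e w x](divfK (ch_neq0 x (e_ch v))) h mul1r.
Qed.

Lemma cbmf_trig s c : cbmf (trig s c).
Proof.
by apply: cbmf_sum => w; apply: cbmfM; [exact: cbmf_cst|exact: cbmf_ch].
Qed.

Lemma fcoef_trig s c v : uniq s -> (forall w, w \in s -> im w) -> im v ->
  fcoef (trig s c) v = if v \in s then c v else 0.
Proof.
move=> us hs iv; rewrite /fcoef.
have hw w : cbmf (fun x => e w x * cj (e v x)).
  by apply: cbmfM; [exact: cbmf_ch|apply: cbmf_cj; exact: cbmf_ch].
rewrite (_ : (fun x => _) = (fun x => \sum_(w <- s) c w * (e w x * cj (e v x)))); last first.
  by apply/funext => x; rewrite /trig big_distrl/=; apply: eq_bigr => w _; rewrite mulrA.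
rewrite cint_sum; last by move=> w; apply: cbmfM => //; exact: cbmf_cst.
rewrite big_seq (eq_bigr (fun w => if w == v then c v else 0)); last first.
  move=> w ws; rewrite cintZ// -/(fcoef (e w) v) e_orth//; last exact: hs.
  by case: eqP => [->|]; rewrite ?mulr1 ?mulr0.
rewrite -big_seq -big_mkcond/=; case: ifP => vs.
  by rewrite (big_rem v)//= eqxx big1_seq ?addr0// => w; rewrite mem_rem_uniq// inE; case: eqP.
by rewrite big1_seq// => w /andP[/eqP-> vs']; rewrite vs' in vs.
Qed.

Lemma cint_cj_trig P s c : cbmf P ->
  cint (fun x => P x * cj (trig s c x)) = \sum_(w <- s) cj (c w) * fcoef P w.
Proof.
move=> hP; have hw w : cbmf (fun x => P x * cj (e w x)).
  by apply: cbmfM => //; apply: cbmf_cj; exact: cbmf_ch.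
rewrite (_ : (fun x => _) = (fun x => \sum_(w <- s) cj (c w) * (P x * cj (e w x)))).
  rewrite cint_sum; last by move=> w; apply: cbmfM => //; exact: cbmf_cst.
  by apply: eq_bigr => w _; rewrite cintZ.
apply/funext => x; rewrite /trig (big_morph cj cjD cj0) big_distrr/=.
by apply: eq_bigr => w _; rewrite cjM; ring.
Qed.

Lemma parseval s c : uniq s -> (forall w, w \in s -> im w) ->
  Int (fun x => nsq (trig s c x)) = \sum_(w <- s) nsq (c w).
Proof.
move=> us hs; rewrite Int_nsq_cint; last exact: cbmf_trig.
rewrite cint_cj_trig; last exact: cbmf_trig.
transitivity (complex.Re (\sum_(w <- s) real_complex R (nsq (c w)))).
  congr complex.Re; rewrite big_seq [RHS]big_seq; apply: eq_bigr => w ws.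
  by rewrite fcoef_trig ?ws// 1?mulrC ?mul_cj//; exact: hs.
by rewrite -rmorph_sum.
Qed.

Lemma bessel P s : cbmf P -> uniq s -> (forall w, w \in s -> im w) ->
  \sum_(w <- s) nsq (fcoef P w) <= Int (fun x => nsq (P x)).
Proof.
move=> hP us hs; rewrite -subr_ge0.
have := Int_nsqB hP (cbmf_trig s (fcoef P)).
rewrite parseval// cint_cj_trig//.
have -> : complex.Re (\sum_(w <- s) cj (fcoef P w) * fcoef P w) = \sum_(w <- s) nsq (fcoef P w).
  transitivity (complex.Re (\sum_(w <- s) real_complex R (nsq (fcoef P w)))).
    by congr complex.Re; apply: eq_bigr => w _; rewrite mulrC mul_cj.
  by rewrite -rmorph_sum.
set S := \sum_(w <- s) _; move=> h.
have -> : Int (fun x => nsq (P x)) - S = Int (fun x => nsq (P x)) - 2 * S + S by ring.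
by rewrite -h; apply: Int_ge0 => x; exact: nsq_ge0.
Qed.

End Orthonormal.

End ComplexIntegral.

(** * Density of trigonometric polynomials *)

Section Dual.
Variables (R : realType) (X : topologicalZmodType).
Variable mu : {measure set (borel X) -> \bar R}.
Hypothesis hX : hausdorff_space X.
Hypothesis cX : compact [set: X].
Hypothesis mu1 : mu setT = 1%E.
Hypothesis muinv : forall (x : X) (A : set (borel X)), measurable A ->
  mu ((fun y : X => x + y) @^-1` A) = mu A.
Local Notation char := (@is_character R X).
Variables (r : nat) (iota : (X -> R[i]) -> 'rV[rat]_r).
Hypothesis iotaM : forall chi psi, char chi -> char psi ->
  iota (fun x => chi x * psi x) = iota chi + iota psi.
Hypothesis iota_inj : forall chi psi, char chi -> char psi -> iota chi = iota psi -> chi = psi.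
Let cb (f : X -> R) : continuous f -> bmf f := @bmf_cont R X cX f.

Definition dual_im (w : 'rV[rat]_r) : Prop := exists2 chi, char chi & iota chi = w.

(** Outside the image of the dual the default is the trivial character, so that [ech w] is a
    character for every [w]. *)
Definition ech (w : 'rV[rat]_r) : X -> R[i] :=
  xget (fun=> 1) [set chi | char chi /\ iota chi = w].

Lemma ech_char w : char (ech w).
Proof.
rewrite /ech; case: xgetP => [chi _ []//|_]; exact: ch_one.
Qed.

Lemma iota_ech w : dual_im w -> iota (ech w) = w.
Proof.
move=> [chi h1 h2]; have : exists chi, char chi /\ iota chi = w by exists chi.
by move=> /(@xgetPex _ (fun=> 1) [set chi | char chi /\ iota chi = w]) [].
Qed.

Lemma ech_iota chi : char chi -> ech (iota chi) = chi.
Proof.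
move=> h; apply: iota_inj => //; first exact: ech_char.
by apply: iota_ech; exists chi.
Qed.

Lemma dual_im_iota chi : char chi -> dual_im (iota chi).
Proof. by move=> h; exists chi. Qed.

Lemma ech_inj w v : dual_im w -> dual_im v -> (forall x, ech w x = ech v x) -> w = v.
Proof. by move=> iw iv /funext e; rewrite -(iota_ech iw) -(iota_ech iv) e. Qed.

Lemma dual_imD w v : dual_im w -> dual_im v -> dual_im (w + v).
Proof.
move=> iw iv; exists (fun x => ech w x * ech v x).
  by apply: ch_mul; exact: ech_char.
by rewrite iotaM ?iota_ech//; exact: ech_char.
Qed.

Lemma echD w v : dual_im w -> dual_im v -> ech (w + v) = (fun x => ech w x * ech v x).
Proof.
move=> iw iv; have h : char (fun x => ech w x * ech v x) by apply: ch_mul; exact: ech_char.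
rewrite -(ech_iota h); congr ech; rewrite iotaM ?iota_ech//; exact: ech_char.
Qed.

Definition tsum (L : seq (R[i] * 'rV[rat]_r)) x : R[i] := \sum_(q <- L) q.1 * ech q.2 x.
Definition tlist (L : seq (R[i] * 'rV[rat]_r)) : Prop := forall q, q \in L -> dual_im q.2.

Definition trigpoly (p : X -> R) : Prop :=
  exists2 L, tlist L & forall x, real_complex R (p x) = tsum L x.

Lemma cbmf_tsum L : cbmf (tsum L).
Proof.
by apply: cbmf_sum => q; apply: cbmfM; [exact: cbmf_cst|apply: cbmf_ch => //; exact: ech_char].
Qed.

Lemma trigpoly_bmf p : trigpoly p -> bmf p.
Proof.
move=> [L _ h]; have [h1 _] := cbmf_tsum L.
by rewrite (_ : p = fun x => complex.Re (tsum L x))//; apply/funext => x; rewrite -h.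
Qed.

Lemma tlist_cat L K : tlist L -> tlist K -> tlist (L ++ K).
Proof. by move=> h k q; rewrite mem_cat => /orP[/h|/k]. Qed.

Lemma tlist_scale c L : tlist L -> tlist [seq (c * q.1, q.2) | q <- L].
Proof. by move=> h q /mapP[q' /h hq ->]. Qed.

Lemma tsum_cat L K x : tsum (L ++ K) x = tsum L x + tsum K x.
Proof. exact: big_cat. Qed.

Lemma tsum_scale c L x : tsum [seq (c * q.1, q.2) | q <- L] x = c * tsum L x.
Proof. by rewrite /tsum big_map big_distrr/=; apply: eq_bigr => q _; rewrite mulrA. Qed.

Lemma iota_one : iota (fun=> 1) = 0.
Proof.
have h := ch_one R X; have := iotaM h h; under eq_fun do rewrite mulr1.
by move=> /eqP; rewrite -subr_eq0 opprD addrA subrr sub0r oppr_eq0 => /eqP.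
Qed.

Lemma ech0 : ech 0 = fun=> 1.
Proof. by rewrite -iota_one ech_iota//; exact: ch_one. Qed.

Lemma trigpoly_cst c : trigpoly (fun=> c).
Proof.
exists [:: (real_complex R c, 0)] => [q|x].
  by rewrite inE => /eqP-> /=; rewrite -iota_one; apply: dual_im_iota; exact: ch_one.
by rewrite /tsum big_seq1 ech0 mulr1.
Qed.

Lemma trigpoly_lin a b p q : trigpoly p -> trigpoly q -> trigpoly (fun x => a * p x + b * q x).
Proof.
move=> [L hL pL] [K hK pK].
exists ([seq (real_complex R a * q.1, q.2) | q <- L] ++ [seq (real_complex R b * q.1, q.2) | q <- K]).
  by apply: tlist_cat; exact: tlist_scale.
by move=> x; rewrite tsum_cat !tsum_scale -pL -pK rmorphD !rmorphM.
Qed.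

Lemma trigpoly_mul p q : trigpoly p -> trigpoly q -> trigpoly (fun x => p x * q x).
Proof.
move=> [L hL pL] [K hK pK].
exists [seq (a.1 * b.1, a.2 + b.2) | a <- L, b <- K].
  by move=> _ /allpairsP[[a b] /= [/hL ha /hK hb ->]]; exact: dual_imD.
move=> x; rewrite rmorphM/= pL pK /tsum big_allpairs_dep/= big_distrl/=.
rewrite [LHS]big_seq [RHS]big_seq; apply: eq_bigr => a aL.
rewrite big_distrr/= [LHS]big_seq [RHS]big_seq; apply: eq_bigr => b bK.
by rewrite echD; [ring|exact: hL|exact: hK].
Qed.

Lemma cj_ech_im w : dual_im w -> exists2 v, dual_im v & ech v = (fun x => cj (ech w x)).
Proof.
move=> iw; have h := ch_inv (ech_char w); exists (iota (fun x => (ech w x)^-1)).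
  exact: dual_im_iota.
by rewrite ech_iota//; apply/funext => x; rewrite ch_cj//; exact: ech_char.
Qed.

Lemma trigpoly_Re w : dual_im w -> trigpoly (chRe (ech w)).
Proof.
move=> iw; have [v iv hv] := cj_ech_im iw.
exists [:: (2^-1, w); (2^-1, v)] => [q|x].
  by rewrite !inE => /orP[/eqP->|/eqP->].
rewrite /tsum big_cons big_seq1 /= hv -mulrDr /chRe.
have two : (2 : R[i]) != 0 by rewrite pnatr_eq0.
apply: (mulfI two); rewrite mulVKf//; case: (ech w x) => a b.
apply/eqP; rewrite eq_complex /cj /=; apply/andP; split; apply/eqP; ring.
Qed.

Lemma trigpoly_Im w : dual_im w -> trigpoly (chIm (ech w)).
Proof.
move=> iw; have [v iv hv] := cj_ech_im iw.
pose I : R[i] := Complex 0 1.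
exists [:: (- I / 2, w); (I / 2, v)] => [q|x].
  by rewrite !inE => /orP[/eqP->|/eqP->].
rewrite /tsum big_cons big_seq1 /= hv /chIm.
have two : (2 : R[i]) != 0 by rewrite pnatr_eq0.
have -> : - I / 2 * ech w x + I / 2 * cj (ech w x) = (- I * ech w x + I * cj (ech w x)) / 2.
  by rewrite mulrDl; congr (_ + _); ring.
apply: (mulIf two); rewrite divfK//; case: (ech w x) => a b.
apply/eqP; rewrite eq_complex /cj /=; apply/andP; split; apply/eqP; ring.
Qed.

Section OpenSets.
Variable rho : {measure set (borel X) -> \bar R}.
Hypothesis frho : (rho setT < +oo)%E.
Local Notation l2set := (l2set rho trigpoly).
Local Notation l2cl := (l2cl rho trigpoly).
Let Tlin := trigpoly_lin.

(** A vector of coordinates, a sign, a choice between real and imaginary part, and a rational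
    threshold: countably many half-spaces. *)
Let index := ('rV[rat]_r * (bool * bool) * rat)%type.
Let hfun (j : index) x : R :=
  (if j.1.2.1 then 1 else -1) * (if j.1.2.2 then chRe (ech j.1.1) x else chIm (ech j.1.1) x).
Let hset (j : index) : set X := [set x | ratr j.2 < hfun j x].

Let hfun_cont j : continuous (hfun j).
Proof.
rewrite /hfun => x; apply: cvgM; first exact: cvg_cst.
by case: j.1.2.2; [apply: cont_chRe|apply: cont_chIm]; exact: ech_char.
Qed.

Let hset_open j : open (hset j).
Proof.
have -> : hset j = hfun j @^-1` [set t | ratr j.2 < t] by [].
by apply: open_comp; [move=> x _; exact: hfun_cont|exact: open_gt].
Qed.

Let hset_l2 j : dual_im j.1.1 -> l2set (hset j).
Proof.
move=> iw; split; first exact: borel_open.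
have -> : (\1_(hset j) : X -> R) = (fun x => ((0 < hfun j x - ratr j.2)%R)%:R).
  apply/funext => x; rewrite indicE subr_gt0.
  case: (boolP (_ < _)) => h; first by rewrite mem_set.
  by rewrite memNset// => h'; move/negP: h; apply.
apply: (l2cl_pos frho trigpoly_bmf trigpoly_cst trigpoly_lin trigpoly_mul).
apply: (l2clB frho trigpoly_bmf trigpoly_lin).
  apply: (l2clZ frho trigpoly_bmf trigpoly_lin); apply: l2cl_P => //; first exact: trigpoly_bmf.
  by case: j.1.2.2; [exact: trigpoly_Re|exact: trigpoly_Im].
exact: (l2cl_cst frho trigpoly_bmf trigpoly_cst).
Qed.

Let separate x y : x <> y -> exists j, dual_im j.1.1 /\ hset j x /\ hfun j y < ratr j.2.
Proof.
move=> xy; have sg0 : is_subgroup_set [set (0 : X)].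
  by split=> // a b /= -> ->; rewrite subrr.
have c0 : closed [set (0 : X)] by apply: accessible_closed_set1; exact: hausdorff_accessible.
have nxy : ~ [set (0 : X)] (x - y) by move=> /eqP; rewrite subr_eq0 => /eqP.
have [chi [hc _ hxy]] := character_separation hX cX mu1 muinv sg0 c0 nxy.
pose w := iota chi; have iw : dual_im w by exact: dual_im_iota.
have ew : ech w = chi by exact: ech_iota.
have hne : chi x != chi y.
  by apply: contra hxy => /eqP e; rewrite chB// e divff// ch_neq0.
have [b hb] : exists b : bool, (if b then chRe chi x else chIm chi x) !=
    (if b then chRe chi y else chIm chi y).
  have [e|ne] := eqVneq (chRe chi x) (chRe chi y); last by exists true.
  exists false; apply: contra hne => /eqP e'; move: e e'; rewrite /chRe /chIm.
  by case: (chi x) => a1 b1; case: (chi y) => a2 b2 /= -> ->.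
have [s hs] : exists s : bool, hfun (w, (s, b), 0) y < hfun (w, (s, b), 0) x.
  rewrite /hfun /= ew; case: (ltgtP (if b then chRe chi y else chIm chi y)
    (if b then chRe chi x else chIm chi x)) => h.
  - by exists true; rewrite !mul1r.
  - by exists false; rewrite !mulN1r ltrN2.
  - by rewrite h eqxx in hb.
have [q] := rat_in_itvoo hs; rewrite in_itv/= => /andP[h1 h2].
by exists (w, (s, b), q).
Qed.

(** The complement of [O] is compact and characters separate points, so finitely many half-spaces
    around a point of [O] have their intersection inside [O]. Finite lists of indices are countable,
    whence a countable union of finite intersections, enumerated by [pickle]. *)
Let open_l2set (O : set X) : open O -> l2set O.
Proof.
move=> oO; pose good (s : seq index) := (forall j, j \in s -> dual_im j.1.1) /\
  (forall x, (forall j, j \in s -> hset j x) -> O x).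
pose dec (n : nat) : option (seq index) := unpickle n.
have decK (s : seq index) : dec (pickle s) = Some s by exact: pickleK.
pose A n : set X := if `[< exists2 s, good s & dec n = Some s >]
  then (if dec n is Some s then [set x | forall j : index, j \in s -> hset j x] else set0)
  else set0.
have -> : O = \bigcup_n A n.
  apply/seteqP; split=> x; last first.
    move=> [n _]; rewrite /A; case: asboolP => // -[s gs ->] /= hx; exact: gs.2.
  move=> Ox; have cO : compact (~` O).
    by apply: (@subclosed_compact _ _ [set: X]) => //; rewrite closedC.
  case: (@compact_seq_cover X index (~` O) (fun j => [set y | hfun j y < ratr j.2])
    (fun j => dual_im j.1.1 /\ hset j x) cO) => [y Oy|s [gs hs]].
    have [j [h1 [h2 h3]]] : exists j, dual_im j.1.1 /\ hset j x /\ hfun j y < ratr j.2.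
    by apply: separate => e; apply: Oy; rewrite -e.
  exists j; split=> //.
  have oV : open [set y | hfun j y < ratr j.2].
    have -> : [set y | hfun j y < ratr j.2] = hfun j @^-1` [set t | t < ratr j.2] by [].
    by apply: open_comp; [move=> z _; exact: hfun_cont|exact: open_lt].
  by apply: open_nbhs_nbhs.
    exists (pickle s) => //; rewrite /A; case: asboolP => [_|hn].
      by rewrite decK => j js; case: (gs j js).
    apply: hn; exists s; last by rewrite decK.
    split=> [j js|z hz]; first by case: (gs j js).
    apply: contrapT => Oz; have [j js /= hj] := hs z Oz.
    by have := hz j js; rewrite /hset /= ltNge (ltW hj).
apply: (l2set_bigcup frho trigpoly_bmf trigpoly_cst trigpoly_lin trigpoly_mul) => n.
have l0 : l2set set0.
  by rewrite -setCT; apply: (l2setC frho trigpoly_bmf trigpoly_cst trigpoly_lin);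
    exact: (l2setT frho trigpoly_bmf trigpoly_cst).
rewrite /A; case: asboolP => [[s [gs _] ->]|_]; last exact: l0.
elim: s gs => [|j s IH] gs.
  rewrite (_ : [set x | _] = setT); first exact: (l2setT frho trigpoly_bmf trigpoly_cst).
  by apply/seteqP; split.
rewrite (_ : [set x | _] = hset j `&` [set x | forall j : index, j \in s -> hset j x]).
  apply: (l2setI frho trigpoly_bmf trigpoly_mul).
    by apply: hset_l2; apply: gs; rewrite mem_head.
  by apply: IH => i si; apply: gs; rewrite inE si orbT.
apply/seteqP; split=> x /=.
  by move=> h; split=> [|i si]; apply: h; rewrite inE ?eqxx ?si ?orbT.
by move=> [h1 h2] i; rewrite inE => /orP[/eqP->|/h2].
Qed.

Lemma trigpoly_dense f (e : R) : bmf f -> 0 < e ->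
  exists2 p, trigpoly p & Int rho (fun x => (f x - p x) ^+ 2) < e.
Proof.
move=> bf e0; have [_ h] := l2cl_bmf frho trigpoly_bmf trigpoly_cst trigpoly_lin trigpoly_mul
  open_l2set bf.
exact: h.
Qed.

End OpenSets.

End Dual.

(** * Invariance of the Haar measure under affine maps *)

Section PushSum.
Variables (R : realType) (X : topologicalZmodType).
Variable mu : {measure set (borel X) -> \bar R}.
Hypothesis fmu : (mu setT < +oo)%E.
Variables (g : borel X -> borel X) (mg : measurable_fun setT g).

Definition push_meas : {measure set (borel X) -> \bar R} :=
  measure_function_pushforward__canonical__measure_function_Measure mu mg.
(** An L2 approximation of [f] for this measure approximates [f] and [f \o g] for [mu] at the same
    time. *)
Definition push_sum : {measure set (borel X) -> \bar R} := measure_add mu push_meas.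

Lemma push_meas_fin : (push_meas setT < +oo)%E.
Proof. by rewrite /push_meas /= /pushforward preimage_setT. Qed.

Lemma push_sum_fin : (push_sum setT < +oo)%E.
Proof.
have -> : push_sum setT = (mu setT + push_meas setT)%E by exact: measure_addE.
by rewrite lte_add_pinfty// push_meas_fin.
Qed.

Lemma Int_push (f : X -> R) : bmf f -> bmf (f \o g) ->
  Int push_meas f = Int mu (fun x => f (g x)).
Proof.
move=> bf bfg; rewrite /Int; congr fine.
have := @integral_pushforward _ _ (borel X) (borel X) R g mg mu setT (EFin \o f).
move=> /(_ _ _ measurableT) => ->.
- by rewrite preimage_setT.
- by apply/measurable_EFinP; case: bf.
- rewrite preimage_setT; exact: (bmf_integrable fmu bfg).
Qed.

Lemma Int_push_sum (f : X -> R) : bmf f -> bmf (f \o g) ->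
  Int push_sum f = Int mu f + Int mu (fun x => f (g x)).
Proof.
move=> bf bfg; rewrite -Int_push// /Int /push_sum.
have i1 := bmf_integrable fmu bf; have i2 := bmf_integrable push_meas_fin bf.
rewrite integral_measure_add// fineD//; exact: integrable_fin_num.
Qed.

End PushSum.

Section AffineInvariance.
Variables (R : realType) (X : topologicalZmodType).
Variable mu : {measure set (borel X) -> \bar R}.
Hypothesis hX : hausdorff_space X.
Hypothesis cX : compact [set: X].
Hypothesis mu1 : mu setT = 1%E.
Hypothesis muinv : forall (x : X) (A : set (borel X)), measurable A ->
  mu ((fun y : X => x + y) @^-1` A) = mu A.
Local Notation char := (@is_character R X).
Variables (r : nat) (iota : (X -> R[i]) -> 'rV[rat]_r).
Hypothesis iotaM : forall chi psi, char chi -> char psi ->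
  iota (fun x => chi x * psi x) = iota chi + iota psi.
Hypothesis iota_inj : forall chi psi, char chi -> char psi -> iota chi = iota psi -> chi = psi.
Local Notation Int := (Int mu).
Let fm := haar_fin mu1.

Variables (x0 : X) (th : X -> X).
Hypothesis ath : is_automorphism th.
Let g x := x0 + th x.

Let thD : forall x y, th (x + y) = th x + th y. Proof. by case: ath. Qed.
Let thc : continuous th. Proof. by case: ath. Qed.

Lemma affine_continuous : continuous g.
Proof.
by move=> x; apply: (@continuous_comp _ _ _ th (fun y => x0 + y)); [exact: thc|exact: continuous_addl].
Qed.

(** For a nontrivial character both sides vanish, since composition with a surjective map keeps it
    nontrivial. *)
Lemma cint_ch_affine chi : char chi -> cint mu (fun x => chi (g x)) = cint mu chi.
Proof.
move=> h; have h' := ch_comp h thc thD.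
rewrite (_ : (fun x => _) = (fun x => chi x0 * chi (th x))); last first.
  by apply/funext => x; rewrite /g chD.
rewrite (cintZ mu1 _ (cbmf_ch cX h')).
have [[z hz]|hn] := pselect (exists z, chi z != 1); last first.
  have c1 x : chi x = 1.
    by apply/eqP/negPn/negP => hx; apply: hn; exists x.
  by rewrite c1 mul1r; congr cint; apply/funext => x; rewrite !c1.
have [_ _ [th' [_ thK _]]] := ath.
rewrite (cint_ch cX mu1 muinv h hz) (@cint_ch _ _ _ cX mu1 muinv _ (th' z) h') ?mulr0//.
by rewrite thK.
Qed.

Lemma cint_tsum_affine L : cint mu (fun x => tsum iota L (g x)) = cint mu (tsum iota L).
Proof.
have hb q : cbmf (fun x => q.1 * ech iota q.2 x).
  by apply: cbmfM; [exact: cbmf_cst|apply: cbmf_ch => //; exact: ech_char].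
have hbg q : cbmf (fun x => q.1 * ech iota q.2 (g x)).
  exact: (cbmf_comp affine_continuous (hb q)).
rewrite /tsum (cint_sum mu1 L hb) (cint_sum mu1 L hbg).
apply: eq_bigr => q _.
have hc := cbmf_ch cX (ech_char iota q.2).
rewrite (cintZ mu1 _ hc) (cintZ mu1 _ (cbmf_comp affine_continuous hc)).
by rewrite cint_ch_affine//; exact: ech_char.
Qed.

Lemma Int_trigpoly_affine p : trigpoly iota p -> Int (fun x => p (g x)) = Int p.
Proof.
move=> [L _ hp]; have := cint_tsum_affine L.
have -> : tsum iota L = fun x => real_complex R (p x) by apply/funext => x; rewrite hp.
by rewrite /cint => -[].
Qed.

(** The identity holds on trigonometric polynomials, and one that is close to [f] for the sum of
    [mu] and its image carries it over to [f]. *)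
Lemma Int_affine f : bmf f -> Int (fun x => f (g x)) = Int f.
Proof.
move=> bf; have cg := affine_continuous.
apply/eqP; rewrite -subr_eq0; apply/eqP; apply: (@small_norm_eq0 _ _ 2) => // e e0.
have mg : measurable_fun setT (g : borel X -> borel X) by exact: continuous_measurable_map.
have e2 : 0 < e ^+ 2 by rewrite exprn_gt0.
have [p Pp hp] := trigpoly_dense hX cX mu1 muinv iotaM iota_inj (push_sum_fin fm mg) bf e2.
have bp := trigpoly_bmf cX Pp.
have bd := bmfB bf bp; have bd2 := bmf_sqr bd.
have bg (h : X -> R) : bmf h -> bmf (fun x => h (g x)) by move=> bh; exact: (bmf_comp cg bh).
rewrite (Int_push_sum fm mg bd2 (bg _ bd2)) in hp.
have n1 : 0 <= Int (fun x => (f x - p x) ^+ 2) by apply: Int_ge0 => x; exact: sqr_ge0.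
have n2 : 0 <= Int (fun x => (f (g x) - p (g x)) ^+ 2) by apply: Int_ge0 => x; exact: sqr_ge0.
have hl (h : X -> R) : Int (fun x => h x ^+ 2) <= e ^+ 2 -> l2 mu h <= e.
  by move=> hh; rewrite -ler_sqr ?nnegrE ?l2_ge0 ?(ltW e0)// l2_sqr.
have l1 : l2 mu (fun x => f x - p x) <= e by apply: hl; move: hp n1 n2; lra.
have l2' : l2 mu (fun x => f (g x) - p (g x)) <= e.
  apply: hl; move: hp n1 n2; set a := Int _; set b := Int _; clearbody a b; lra.
have -> : Int (fun x => f (g x)) - Int f =
    Int (fun x => f (g x) - p (g x)) - Int (fun x => f x - p x).
  rewrite (IntB fm (bg _ bf) (bg _ bp)) (IntB fm bf bp) (Int_trigpoly_affine Pp); ring.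
apply: (le_trans (ler_normB _ _)); rewrite mulrC mulr_natl mulr2n; apply: lerD.
- exact: (le_trans (Int_norm_l2 mu1 (bg _ bd)) l2').
- exact: (le_trans (Int_norm_l2 mu1 bd) l1).
Qed.

Lemma mu_affine (A : set (borel X)) : measurable A -> mu (g @^-1` A) = mu A.
Proof.
move=> mA; have cg := affine_continuous.
have mg : measurable_fun setT (g : borel X -> borel X) by exact: continuous_measurable_map.
have mA' : measurable (g @^-1` A : set (borel X)) by rewrite -[_ @^-1` _]setTI; exact: mg.
have fin (B : set (borel X)) : measurable B -> mu B \is a fin_num.
  by move=> mB; rewrite ge0_fin_numE// (le_lt_trans _ fm)// le_measure// inE.
have := Int_affine (bmf_indic R mA); rewrite (Int_indic mu mA).
have -> : (fun x => \1_A (g x) : R) = \1_(g @^-1` A).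
  by apply/funext => x; rewrite !indicE; congr (_%:R); apply/idP/idP; rewrite !inE.
by rewrite (Int_indic mu mA') => h; rewrite -(fineK (fin _ mA')) -(fineK (fin _ mA)) h.
Qed.

End AffineInvariance.

(** * From almost invariant vectors to an invariant mean *)

Section NsqIneq.
Variable R : realType.

Lemma nsq_ineq (a b : R[i]) (t : R) : 0 < t ->
  nsq a <= (1 + t) * nsq b + (1 + t^-1) * nsq (a - b).
Proof.
move=> t0; case: a => a1 a2; case: b => b1 b2; rewrite /nsq /=.
have sq (x y : R) : x ^+ 2 <= (1 + t) * y ^+ 2 + (1 + t^-1) * (x - y) ^+ 2.
  rewrite -subr_ge0.
  have -> : (1 + t) * y ^+ 2 + (1 + t^-1) * (x - y) ^+ 2 - x ^+ 2 =
    t^-1 * (t * y - (x - y)) ^+ 2 by field; rewrite gt_eqF.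
  by rewrite mulr_ge0 ?invr_ge0 ?(ltW t0)// sqr_ge0.
by rewrite !mulrDr addrACA; apply: lerD; exact: sq.
Qed.

Lemma nsq_triangle (a b c : R[i]) : nsq (a + b + c) <= 3 * (nsq a + nsq b + nsq c).
Proof.
case: a => a1 a2; case: b => b1 b2; case: c => c1 c2; rewrite /nsq /=.
have sq (x y z : R) : (x + y + z) ^+ 2 <= 3 * (x ^+ 2 + y ^+ 2 + z ^+ 2).
  rewrite -subr_ge0.
  have -> : 3 * (x ^+ 2 + y ^+ 2 + z ^+ 2) - (x + y + z) ^+ 2 =
    (x - y) ^+ 2 + (y - z) ^+ 2 + (x - z) ^+ 2 by ring.
  by rewrite !addr_ge0// sqr_ge0.
have -> : 3 * (a1 ^+ 2 + a2 ^+ 2 + (b1 ^+ 2 + b2 ^+ 2) + (c1 ^+ 2 + c2 ^+ 2)) =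
  3 * (a1 ^+ 2 + b1 ^+ 2 + c1 ^+ 2) + 3 * (a2 ^+ 2 + b2 ^+ 2 + c2 ^+ 2) by ring.
by apply: lerD; exact: sq.
Qed.

End NsqIneq.

Section MassTransport.
Variables (R : realType) (X : topologicalZmodType).
Variable mu : {measure set (borel X) -> \bar R}.
Hypothesis hX : hausdorff_space X.
Hypothesis cX : compact [set: X].
Hypothesis mu1 : mu setT = 1%E.
Hypothesis muinv : forall (x : X) (A : set (borel X)), measurable A ->
  mu ((fun y : X => x + y) @^-1` A) = mu A.
Local Notation char := (@is_character R X).
Variables (r : nat) (iota : (X -> R[i]) -> 'rV[rat]_r) (M : (X -> X) -> 'M[rat]_r).
Hypothesis iotaM : forall chi psi, char chi -> char psi ->
  iota (fun x => chi x * psi x) = iota chi + iota psi.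
Hypothesis iota_inj : forall chi psi, char chi -> char psi -> iota chi = iota psi -> chi = psi.
Hypothesis iota_comp : forall chi th, char chi -> continuous th ->
  (forall x y, th (x + y) = th x + th y) -> iota (fun x => chi (th x)) = iota chi *m M th.
Local Notation Int := (Int mu).
Local Notation im := (dual_im iota).
Local Notation e := (ech iota).
Let fm := haar_fin mu1.

(** The finite measure on the dual given by the squared moduli of the coefficients of a
    trigonometric polynomial. *)
Definition mass (s : seq 'rV[rat]_r) (c : 'rV[rat]_r -> R[i]) (E : set 'rV[rat]_r) : R :=
  \sum_(w <- s | `[< E w >]) nsq (c w).

Lemma mass_ge0 s c E : 0 <= mass s c E.
Proof. by apply: sumr_ge0 => w _; exact: nsq_ge0. Qed.

Lemma massU s c E F : E `&` F = set0 -> mass s c (E `|` F) = mass s c E + mass s c F.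
Proof.
move=> EF; rewrite /mass [X in X + _]big_mkcond [X in _ + X]big_mkcond -big_split big_mkcond/=.
apply: eq_bigr => w _; case: (asboolP (E w)) => Ew; case: (asboolP (F w)) => Fw.
- by have : set0 w by rewrite -EF.
- by rewrite addr0 asboolT//; left.
- by rewrite add0r asboolT//; right.
- by rewrite addr0 asboolF// => -[].
Qed.

Lemma mass_setT s c : mass s c setT = \sum_(w <- s) nsq (c w).
Proof. by apply: eq_bigl => w; rewrite asboolT. Qed.

Lemma mass_le s c E : mass s c E <= mass s c setT.
Proof.
rewrite mass_setT /mass big_mkcond/=; apply: ler_sum => w _.
by case: ifP => // _; exact: nsq_ge0.
Qed.

Let emorph w : im w -> char (e w). Proof. by move=> _; exact: ech_char. Qed.

Lemma ech_comp w th : im w -> continuous th -> (forall x y, th (x + y) = th x + th y) ->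
  im (w *m M th) /\ e (w *m M th) = (fun x => e w (th x)).
Proof.
move=> iw tc tD; have hc : char (fun x => e w (th x)) by apply: ch_comp => //; exact: ech_char.
have hw : iota (fun x => e w (th x)) = w *m M th.
  by rewrite iota_comp ?iota_ech//; exact: ech_char.
by split; rewrite -hw; [exact: dual_im_iota|exact: ech_iota].
Qed.

(** The coefficient of [P \o g] at [w *m M th] is [c w] up to a factor of modulus 1, so the left
    side is a partial sum of squared coefficients of [P \o g]. These are compared with those of [P]
    by [nsq_ineq], and Bessel's inequality for the difference bounds the error. *)
Lemma mass_transport s c (x0 : X) th E (t : R) : uniq s -> (forall w, w \in s -> im w) ->
  is_automorphism th -> 0 < t ->
  mass s c ((fun w => w *m M th) @^-1` E) <= (1 + t) * mass s c E +
    (1 + t^-1) * Int (fun x => nsq (trig e s c (x0 + th x) - trig e s c x)).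
Proof.
move=> us hs ath t0; have [thD thc [th' [_ thK _]]] := ath.
pose g x := x0 + th x; have gc : continuous g by exact: affine_continuous.
pose P := trig e s c; have bP : cbmf P by apply: cbmf_trig => // w; exact: ech_char.
have bPg : cbmf (fun x => P (g x)) by exact: cbmf_comp.
have bm1 : cbmf (fun x => - 1 * P x) by apply: cbmfM => //; exact: cbmf_cst.
have bD : cbmf (fun x => P (g x) - P x).
  by under eq_fun do rewrite -mulN1r; exact: cbmfD.
have ech' := ech_char iota.
have bcj w : cbmf (fun x => cj (e w x)) by apply: cbmf_cj; exact: cbmf_ch.
pose psi (w : 'rV[rat]_r) : 'rV[rat]_r := w *m M th.
have psiP w : im w -> im (psi w) /\ e (psi w) = (fun x => e w (th x)).
  by move=> iw; exact: ech_comp.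
have psi_inj w v : im w -> im v -> psi w = psi v -> w = v.
  move=> iw iv h; apply: (ech_inj iw iv) => x.
  have := congr1 (fun u => e u (th' x)) h.
  by rewrite (psiP w iw).2 (psiP v iv).2 thK.
have coefP w : w \in s -> nsq (c w) = nsq (fcoef mu e (fun x => P (g x)) (psi w)).
  move=> ws; have iw := hs _ ws; rewrite /fcoef (psiP w iw).2.
  have -> : (fun x => P (g x) * cj (e w (th x))) =
      (fun x => e w x0 * (P (g x) * cj (e w (g x)))).
    apply/funext => x.
    rewrite [e w (g x)](chD x0 (th x) (ech' w)) cjM [RHS]mulrCA; congr (_ * _).
    by rewrite mulrA mul_cj (ch_nsq x0 (ech' w)) mul1r.
  have bq : cbmf (fun x => P x * cj (e w x)) by exact: cbmfM.
  rewrite (cintZ mu1 _ (cbmf_comp gc bq)) nsqM (ch_nsq x0 (ech' w)) mul1r.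
  have -> : cint mu (fun x => P (g x) * cj (e w (g x))) = fcoef mu e P w.
    rewrite /fcoef /cint; congr Complex.
      exact: (Int_affine hX cX mu1 muinv iotaM iota_inj x0 ath bq.1).
    exact: (Int_affine hX cX mu1 muinv iotaM iota_inj x0 ath bq.2).
  rewrite (fcoef_trig cX mu1 muinv ech' (@ech_inj _ _ _ _))//.
  by rewrite ws.
have coefD v : fcoef mu e (fun x => P (g x) - P x) v =
    fcoef mu e (fun x => P (g x)) v - fcoef mu e P v.
  rewrite /fcoef; have b1 := cbmfM bPg (bcj v); have b2 := cbmfM bP (bcj v).
  rewrite -[X in _ - X]mul1r -mulNr -(cintZ mu1 _ b2) -(cintD mu1 b1); last first.
    by apply: cbmfM => //; exact: cbmf_cst.
  by congr cint; apply/funext => x; ring.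
pose s' := [seq psi w | w <- s & `[< E (psi w) >]].
have us' : uniq s'.
  rewrite map_inj_in_uniq ?filter_uniq// => w v.
  by rewrite !mem_filter => /andP[_ ws] /andP[_ vs]; apply: psi_inj; exact: hs.
have hs' v : v \in s' -> im v.
  by move=> /mapP[w]; rewrite mem_filter => /andP[_ /hs iw] ->; case: (psiP w iw).
have -> : mass s c ((fun w => w *m M th) @^-1` E) =
    \sum_(v <- s') nsq (fcoef mu e (fun x => P (g x)) v).
  rewrite /s' big_map big_filter /mass big_seq_cond [RHS]big_seq_cond.
  by apply: eq_bigr => w /andP[ws _]; exact: coefP.
apply: (@le_trans _ _ (\sum_(v <- s') ((1 + t) * nsq (fcoef mu e P v) +
    (1 + t^-1) * nsq (fcoef mu e (fun x => P (g x) - P x) v)))).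
  by apply: ler_sum => v _; rewrite coefD; exact: nsq_ineq.
rewrite big_split/= -!mulr_sumr; apply: lerD; last first.
  apply: ler_wpM2l; first by rewrite addr_ge0// invr_ge0 ltW.
  exact: (bessel cX mu1 muinv ech' (@ech_inj _ _ _ _)).
apply: ler_wpM2l; first by rewrite addr_ge0// ltW.
rewrite big_seq (eq_bigr (fun v => if v \in s then nsq (c v) else 0)); last first.
  move=> v vs'; rewrite (fcoef_trig cX mu1 muinv ech' (@ech_inj _ _ _ _))//; last exact: hs'.
  by case: ifP => // _; rewrite /nsq /= expr0n/= addr0.
rewrite -big_seq -big_mkcond/= -big_filter /mass -[X in _ <= X]big_filter.
rewrite (perm_big [seq v <- [seq w <- s | `[< E w >]] | v \in s']).
  rewrite big_filter; apply: (@le_trans _ _ (\sum_(v <- [seq w <- s | `[< E w >]])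
    (if v \in s' then nsq (c v) else 0))); first by rewrite -big_mkcond.
  by apply: ler_sum => v _; case: ifP => // _; exact: nsq_ge0.
apply: uniq_perm; rewrite ?filter_uniq// => v; rewrite !mem_filter.
case vs' : (v \in s'); last by rewrite andbF.
rewrite andbT; case vs : (v \in s); last by rewrite andbF.
by move: vs' => /mapP[w]; rewrite mem_filter => /andP[h _] ->; rewrite h.
Qed.

Lemma tsum_trig L : tlist iota L -> exists s c, [/\ uniq s, forall w, w \in s -> im w &
  tsum iota L = trig e s c].
Proof.
move=> hL; exists (undup [seq q.2 | q <- L]), (fun w => \sum_(q <- L | q.2 == w) q.1).
split; first exact: undup_uniq.
  by move=> w; rewrite mem_undup => /mapP[q /hL hq ->].
apply/funext => x; rewrite /trig /tsum.
under [RHS]eq_bigr do rewrite big_mkcond big_distrl/=.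
rewrite exchange_big/= big_seq [RHS]big_seq; apply: eq_bigr => q qL.
have hq : q.2 \in undup [seq q.2 | q <- L] by rewrite mem_undup; exact: map_f.
rewrite (big_rem q.2)//= eqxx big1_seq ?addr0// => w /andP[_].
rewrite mem_rem_uniq ?undup_uniq// inE eq_sym => /andP[/negbTE-> _].
by rewrite mul0r.
Qed.

End MassTransport.

Lemma normr_le_1Dsqr (R : realFieldType) (a : R) : `|a| <= 1 + a ^+ 2.
Proof.
have := sqr_ge0 (`|a| - 1); rewrite sqrrB real_normK ?num_real//.
by move: (a ^+ 2) (`|a|) (normr_ge0 a) => b c; lra.
Qed.

Section SquareIntegrable.
Variables (R : realType) (X : topologicalZmodType).
Variable mu : {measure set (borel X) -> \bar R}.
Hypothesis mu1 : mu setT = 1%E.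
Let fm := haar_fin mu1.
Implicit Types (f g h u : borel X -> R).

(** The vectors of [no_spectral_gap] may be unbounded, so their integrals stay in the extended
    reals; [Int] is kept for bounded functions. *)
Definition EJ h : \bar R := (\int[mu]_x (h x)%:E)%E.

Lemma EJE h : EJ h = (\int[mu]_x (h x)%:E)%E. Proof. by []. Qed.

Lemma EJ_bmf (f : X -> R) : bmf f -> EJ f = (Int mu f)%:E.
Proof.
by move=> bf; rewrite /EJ /Int fineK//; apply: integrable_fin_num => //; exact: bmf_integrable.
Qed.

Lemma EJ_ge0 h : (forall x, 0 <= h x) -> (0 <= EJ h)%E.
Proof. by move=> h0; apply: integral_ge0 => x _; rewrite lee_fin. Qed.

Lemma EJ_le f g : measurable_fun setT f -> measurable_fun setT g -> (forall x, 0 <= f x) ->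
  (forall x, f x <= g x) -> (EJ f <= EJ g)%E.
Proof.
move=> mf mg f0 fg; apply: ge0_le_integral => //.
- by move=> x _; rewrite lee_fin.
- exact/measurable_EFinP.
- exact/measurable_EFinP.
- by move=> x _; rewrite lee_fin.
Qed.

Lemma EJ_lin (a b : R) f g : measurable_fun setT f -> measurable_fun setT g ->
  (forall x, 0 <= f x) -> (forall x, 0 <= g x) -> 0 <= a -> 0 <= b ->
  EJ (fun x => a * f x + b * g x)%R = (a%:E * EJ f + b%:E * EJ g)%E.
Proof.
move=> mf mg f0 g0 a0 b0; rewrite /EJ.
rewrite -!ge0_integralZl//; try (by move=> x _; rewrite lee_fin); try exact/measurable_EFinP.
rewrite -ge0_integralD//.
- by move=> x _; rewrite -EFinM lee_fin mulr_ge0.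
- by apply/measurable_EFinP; apply: measurable_funM => //; exact: measurable_cst.
- by move=> x _; rewrite -EFinM lee_fin mulr_ge0.
- by apply/measurable_EFinP; apply: measurable_funM => //; exact: measurable_cst.
Qed.

Lemma l2_trunc u (e : R) : measurable_fun setT u -> (EJ (fun x => u x ^+ 2)%R < +oo)%E -> 0 < e ->
  exists2 b, bmf b & (EJ (fun x => (u x - b x) ^+ 2)%R < e%:E)%E.
Proof.
move=> mu' hu e0.
pose S k := [set x : borel X | `|u x| <= k%:R].
have mS k : measurable (S k).
  have mn : measurable_fun setT (fun x => `|u x|) by exact: measurableT_comp.
  have := mn measurableT `]-oo, k%:R]%classic (measurable_itv _).
  by rewrite setTI; congr (measurable _); apply/seteqP; split=> x; rewrite /S /= in_itv.
pose b k (x : X) : R := u x * \1_(S k) x.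
have bE k x : b k x = if `|u x| <= k%:R then u x else 0.
  rewrite /b indicE; case: ifP => h; first by rewrite mem_set ?mulr1.
  by rewrite memNset ?mulr0// => h'; rewrite /S /= h in h'.
have mb k : measurable_fun setT (b k : borel X -> R).
  by apply: measurable_funM => //; apply: measurable_indic; exact: mS.
have bb k : bmf (b k).
  split; first exact: mb; exists k%:R => x; rewrite bE.
  by case: ifP => // _; rewrite normr0.
have msq k : measurable_fun setT (fun x => (u x - b k x) ^+ 2).
  by apply: measurable_funX; exact: measurable_funB.
have mu2 : measurable_fun setT (fun x => u x ^+ 2) by exact: measurable_funX.
have le2 k x : (u x - b k x) ^+ 2 <= u x ^+ 2.
  by rewrite bE; case: ifP => _; [rewrite subrr expr0n/= sqr_ge0|rewrite subr0].
have iu : mu.-integrable setT (fun x => (u x ^+ 2)%:E).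
  apply/integrableP; split; first exact/measurable_EFinP.
  apply: le_lt_trans hu; rewrite /EJ le_eqVlt; apply/orP; left; apply/eqP.
  by apply: eq_integral => x _; rewrite /= ger0_norm// sqr_ge0.
have hc : (\int[mu]_x ((u x - b k x) ^+ 2)%:E)%E @[k --> \oo] --> (\int[mu]_x 0%:E)%E.
  apply: (@dominated_cvg _ _ _ mu setT measurableT _ _ (fun x => (u x ^+ 2)%:E)) => //.
  - by move=> k; exact/measurable_EFinP.
  - move=> x _; apply: cvg_near_cst; exists (Num.truncn `|u x|).+1 => // k /= hk.
    rewrite bE ifT ?subrr ?expr0n//.
    by rewrite (le_trans (ltW (truncnS_gt _)))// ler_nat.
  - by move=> k x _; rewrite /= ger0_norm ?sqr_ge0// lee_fin.
rewrite integral0 in hc.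
have : \forall k \near \oo, (EJ (fun x => (u x - b k x) ^+ 2)%R < e%:E)%E.
  move/fine_cvgP: hc => [hfin /cvgrPdist_lt/(_ _ e0)]; apply: filterS2 hfin => k hk.
  rewrite /= sub0r normrN => h; rewrite /EJ -(fineK hk) lte_fin.
  exact: le_lt_trans (ler_norm _) h.
by move=> [k _ /(_ k (leqnn k)) hk]; exists (b k).
Qed.

Lemma EJ_sq_le3 f g h : measurable_fun setT f -> measurable_fun setT g -> measurable_fun setT h ->
  (EJ (fun x => (f x - h x) ^+ 2)%R <=
   2%:E * EJ (fun x => (f x - g x) ^+ 2)%R + 2%:E * EJ (fun x => (g x - h x) ^+ 2)%R)%E.
Proof.
move=> mf mg mh.
have m1 : measurable_fun setT (fun x => (f x - g x) ^+ 2) by apply: measurable_funX; exact: measurable_funB.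
have m2 : measurable_fun setT (fun x => (g x - h x) ^+ 2) by apply: measurable_funX; exact: measurable_funB.
have m3 : measurable_fun setT (fun x => (f x - h x) ^+ 2) by apply: measurable_funX; exact: measurable_funB.
rewrite -EJ_lin//; try (by move=> x; exact: sqr_ge0).
apply: EJ_le => //.
- by apply: measurable_funD; apply: measurable_funM => //; exact: measurable_cst.
- by move=> x; exact: sqr_ge0.
move=> x; rewrite -subr_ge0.
have -> : 2 * (f x - g x) ^+ 2 + 2 * (g x - h x) ^+ 2 - (f x - h x) ^+ 2 =
  ((f x - g x) - (g x - h x)) ^+ 2 by ring.
exact: sqr_ge0.
Qed.

Lemma EJ_sqr_integrable u : measurable_fun setT u -> (EJ (fun x => u x ^+ 2)%R < +oo)%E ->
  mu.-integrable setT (EFin \o u).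
Proof.
move=> mu' hu; apply/integrableP; split; first exact/measurable_EFinP.
apply: (@le_lt_trans _ _ (EJ (fun x => 1 * 1 + 1 * u x ^+ 2)%R)).
  apply: (@EJ_le (fun x => `|u x|)) => //.
  - exact: measurableT_comp.
  - apply: measurable_funD; first exact: measurable_cst.
    by apply: measurable_funM; [exact: measurable_cst|exact: measurable_funX].
  - by move=> x; rewrite !mul1r normr_le_1Dsqr.
have m2 : measurable_fun setT (fun x => u x ^+ 2) by exact: measurable_funX.
rewrite (@EJ_lin 1 1 (fun=> 1))//; [|by move=> x; exact: sqr_ge0].
by rewrite !mul1e lte_add_pinfty// (EJ_bmf (bmf_cst X 1)) ltry.
Qed.

End SquareIntegrable.

Lemma small_inv (R : realType) (c e : R) : 0 < e -> exists n0 : nat, forall n, (n0 <= n)%N ->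
  c * n.+1%:R^-1 < e.
Proof.
move=> e0; exists (Num.truncn (`|c| / e)) => n hn.
have n0 : 0 < n.+1%:R :> R by rewrite ltr0n.
rewrite ltr_pdivrMr// mulrC -ltr_pdivrMr//; apply: (@le_lt_trans _ _ (`|c| / e)).
  by rewrite ler_pM2r ?invr_gt0// ler_norm.
by rewrite -truncn_le_nat.
Qed.

Lemma quarter_sum (R : realFieldType) (a c e : R) : a < e / 4 -> c < e / 4 -> 2 * a + 2 * c < e.
Proof. by move=> *; lra. Qed.

(** A pointwise bound whose integral over a probability space compares two means through the L2
    distance. *)
Lemma young_shift (R : realFieldType) (t a b : R) : 0 < t ->
  b <= a + (t + t^-1 * (a - b) ^+ 2).
Proof.
move=> t0; rewrite -subr_ge0.
have -> : a + (t + t^-1 * (a - b) ^+ 2) - b =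
  t^-1 * ((t + (a - b) / 2) ^+ 2 + 3 / 4 * (a - b) ^+ 2) by field; rewrite gt_eqF.
by rewrite mulr_ge0 ?invr_ge0 ?(ltW t0)// addr_ge0 ?sqr_ge0// mulr_ge0 ?sqr_ge0// divr_ge0.
Qed.

Lemma mass_one_arith (R : realFieldType) (a b e : R) : a < e / 2 -> 1 <= b + e / 14 * b + a ->
  b <= 1 + e / 14 + a -> e / 14 * b <= e / 14 * 6 -> 0 < e -> - e < b - 1 < e.
Proof. by move=> h1 h2 h3 h4 h5; apply/andP; split; move: h2 h4; set z := e / 14 * b; lra. Qed.

Lemma sq_small_arith (R : realFieldType) (w e a b : R) : 0 < w -> w <= 1 -> w <= e / 4 ->
  `|a| <= w -> `|b| <= w -> a ^+ 2 + b ^+ 2 < e.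
Proof.
move=> w0 w1 we ha hb.
have sq (x : R) : `|x| <= w -> x ^+ 2 <= w.
  move=> hx; rewrite -[x ^+ 2]real_normK ?num_real//.
  apply: (@le_trans _ _ (w * w)); first by rewrite expr2 ler_pM.
  by rewrite ler_piMr// ltW.
by move: (sq a ha) (sq b hb); lra.
Qed.

Lemma step_arith (R : realFieldType) (e x : R) : e / 2 * x <= e / 2 * 1 ->
  (1 + e / 2) * x + e / 2 <= e + x.
Proof. by rewrite mulrDl; move: (e / 2 * x) => z; lra. Qed.

Lemma gap_arith (R : realFieldType) (b d : R) : 0 < b -> 12 * d < b / 2 ->
  3 * (2 * d + b / 12) + 3 * (2 * d) < b.
Proof. by move=> *; lra. Qed.

Section MatrixOfAutomorphism.
Variables (R : realType) (X : topologicalZmodType).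
Local Notation char := (@is_character R X).
Variables (r : nat) (iota : (X -> R[i]) -> 'rV[rat]_r) (M : (X -> X) -> 'M[rat]_r).
Hypothesis iota_span : forall w, exists n chi, [/\ (0 < n)%N, char chi & iota chi = n%:R *: w].
Hypothesis iota_comp : forall chi th, char chi -> continuous th ->
  (forall x y, th (x + y) = th x + th y) -> iota (fun x => chi (th x)) = iota chi *m M th.

Lemma iota_span_eq (A B : 'M[rat]_r) : (forall chi, char chi -> iota chi *m A = iota chi *m B) -> A = B.
Proof.
move=> h; apply/row_matrixP => i; rewrite !rowE.
have [n [chi [n0 hc hw]]] := iota_span (delta_mx 0 i).
have nR : n%:R != 0 :> rat by rewrite pnatr_eq0 -lt0n.
by apply: (scalerI nR); rewrite !scalemxAl -hw; exact: h.
Qed.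

Lemma mx_comp th1 th2 : continuous th1 -> (forall x y, th1 (x + y) = th1 x + th1 y) ->
  continuous th2 -> (forall x y, th2 (x + y) = th2 x + th2 y) ->
  M (fun x => th1 (th2 x)) = M th1 *m M th2.
Proof.
move=> c1 d1 c2 d2; apply: iota_span_eq => chi hc.
rewrite mulmxA -iota_comp//; last by move=> x y; rewrite d2 d1.
  by rewrite -iota_comp// -iota_comp//; exact: (ch_comp hc c1 d1).
by move=> x; apply: continuous_comp; [exact: c2|exact: c1].
Qed.

Lemma mx_id : M id = 1%:M.
Proof.
have ci : continuous (id : X -> X) by move=> x; exact: cvg_id.
by apply: iota_span_eq => chi hc; rewrite mulmx1 -(iota_comp hc ci).
Qed.

End MatrixOfAutomorphism.

(** * The mean defined by almost invariant vectors *)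

Section GapMean.
Variables (R : realType) (X : topologicalZmodType).
Variable mu : {measure set (borel X) -> \bar R}.
Hypothesis hX : hausdorff_space X.
Hypothesis cX : compact [set: X].
Hypothesis mu1 : mu setT = 1%E.
Hypothesis muinv : forall (x : X) (A : set (borel X)), measurable A ->
  mu ((fun y : X => x + y) @^-1` A) = mu A.
Local Notation char := (@is_character R X).
Variables (r : nat) (iota : (X -> R[i]) -> 'rV[rat]_r) (M : (X -> X) -> 'M[rat]_r).
Hypothesis iotaM : forall chi psi, char chi -> char psi ->
  iota (fun x => chi x * psi x) = iota chi + iota psi.
Hypothesis iota_inj : forall chi psi, char chi -> char psi -> iota chi = iota psi -> chi = psi.
Hypothesis iota_span : forall w, exists n chi, [/\ (0 < n)%N, char chi & iota chi = n%:R *: w].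
Hypothesis iota_comp : forall chi th, char chi -> continuous th ->
  (forall x y, th (x + y) = th x + th y) -> iota (fun x => chi (th x)) = iota chi *m M th.
Local Notation Int := (Int mu).
Local Notation EJ := (EJ mu).
Let fm := haar_fin mu1.

Lemma p_a_affine (x0 : X) th : is_automorphism th -> p_a (fun x => x0 + th x) = th.
Proof.
move=> [tD _ _]; apply/funext => x; rewrite /p_a.
have -> : th 0 = 0 by apply: (addIr (th 0)); rewrite -tD !add0r.
by rewrite addr0 addrAC subrr add0r.
Qed.

Lemma EJ_affine (h : X -> X) (w : borel X -> R) : is_affine h -> measurable_fun setT w ->
  (forall x, 0 <= w x) -> EJ (fun x => w (h x)) = EJ w.
Proof.
move=> [x0 [th [ath ->]]] mw w0; pose g : borel X -> borel X := fun x => x0 + th x.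
have mg : measurable_fun setT g by apply: continuous_measurable_map; exact: affine_continuous.
have := @ge0_integral_pushforward _ _ (borel X) (borel X) R g mg mu setT (EFin \o w).
move=> /(_ measurableT) hp; rewrite !EJE; transitivity (\int[pushforward mu g]_x (w x)%:E)%E.
  rewrite hp ?preimage_setT//; first exact/measurable_EFinP.
  by move=> x _; rewrite /= lee_fin.
apply: eq_measure_integral => A mA _; rewrite /= /pushforward.
exact: (mu_affine hX cX mu1 muinv iotaM iota_inj x0 ath mA).
Qed.

Lemma l2_trig (u : borel X -> R) (e : R) : measurable_fun setT u ->
  (EJ (fun x => (u x ^+ 2)%R) < +oo)%E -> 0 < e ->
  exists2 p, trigpoly iota p & (EJ (fun x => ((u x - p x) ^+ 2)%R) < e%:E)%E.
Proof.
move=> mu' hu e0; have e4 : 0 < e / 4 by rewrite divr_gt0.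
have [b bb hb] := l2_trunc mu' hu e4.
have [p Pp hp] := trigpoly_dense hX cX mu1 muinv iotaM iota_inj fm bb e4.
exists p => //; have bp := trigpoly_bmf cX Pp.
apply: (le_lt_trans (EJ_sq_le3 mu mu' bb.1 bp.1)).
rewrite [X in (_ + _ * X)%E](EJ_bmf mu1 (bmf_sqr (bmfB bb bp))).
have hfin : EJ (fun x => ((u x - b x) ^+ 2)%R) \is a fin_num.
  rewrite ge0_fin_numE; first by apply: lt_trans hb _; rewrite ltry.
  by apply: EJ_ge0 => x; exact: sqr_ge0.
move: hb; rewrite -(fineK hfin) lte_fin => hb.
rewrite -!EFinM -EFinD lte_fin.
exact: quarter_sum hb hp.
Qed.

(** The integral of [young_shift], where [z] has mean 0; [t] is left free, to be balanced against
    the error [e]. *)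
Lemma mean_approx_le (z : borel X -> R) (y : X -> R) (e t : R) : measurable_fun setT z ->
  bmf y -> (EJ (fun x => (z x ^+ 2)%R) < +oo)%E -> (\int[mu]_x (z x)%:E = 0)%E ->
  (EJ (fun x => ((z x - y x) ^+ 2)%R) < e%:E)%E -> 0 < t -> Int y <= t + t^-1 * e.
Proof.
move=> mz by_ zfin z0 hd t0; have [my _] := by_.
have iz := EJ_sqr_integrable mu1 mz zfin.
have msq : measurable_fun setT (fun x => (z x - y x) ^+ 2).
  by apply: measurable_funX; exact: measurable_funB.
have sqf : (EJ (fun x => ((z x - y x) ^+ 2)%R) < +oo)%E.
  by apply: lt_trans hd _; rewrite ltry.
have isq : mu.-integrable setT (EFin \o (fun x => (z x - y x) ^+ 2)).
  apply/integrableP; split; first exact/measurable_EFinP.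
  apply: le_lt_trans sqf; rewrite EJE le_eqVlt; apply/orP; left; apply/eqP.
  by apply: eq_integral => x _; rewrite /= ger0_norm// sqr_ge0.
have ic : mu.-integrable setT (EFin \o (fun=> t)) by exact: (bmf_integrable fm (bmf_cst X t)).
have isq' : mu.-integrable setT (fun x => t^-1%:E * ((z x - y x) ^+ 2)%:E)%E.
  exact: integrableZl.
have iy := bmf_integrable fm by_.
have -> : Int y = fine (EJ y) by [].
rewrite -lee_fin fineK; last exact: integrable_fin_num.
apply: (@le_trans _ _ (\int[mu]_x ((z x)%:E + (t%:E + t^-1%:E * ((z x - y x) ^+ 2)%:E)))%E).
  apply: le_integral => //.
    by apply: integrableD => //; exact: integrableD.
  move=> x _; rewrite -EFinM -!EFinD lee_fin.
  exact: young_shift.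
rewrite integralD//; last exact: integrableD.
rewrite z0 add0e integralD//= integralZl//.
rewrite [X in (X + _ <= _)%E](_ : _ = t%:E); last first.
  by have := EJ_bmf mu1 (bmf_cst X t); rewrite (Int_const mu1).
rewrite [X in (_ <= X)%E]EFinD; apply: leeD => //; rewrite EFinM.
apply: lee_wpmul2l; last exact: ltW.
by rewrite lee_fin invr_ge0 ltW.
Qed.

Lemma mean_approx (z : borel X -> R) (y : X -> R) (e t : R) : measurable_fun setT z ->
  bmf y -> (EJ (fun x => (z x ^+ 2)%R) < +oo)%E -> (\int[mu]_x (z x)%:E = 0)%E ->
  (EJ (fun x => ((z x - y x) ^+ 2)%R) < e%:E)%E -> 0 < t -> `|Int y| <= t + t^-1 * e.
Proof.
move=> mz by_ zfin z0 hd t0; have iz := EJ_sqr_integrable mu1 mz zfin.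
rewrite ler_norml; apply/andP; split; last exact: mean_approx_le zfin z0 hd t0.
rewrite lerNl -(IntN fm by_).
apply: (@mean_approx_le (fun x => - 1 * z x)) => //.
- by apply: measurable_funM => //; exact: measurable_cst.
- exact: bmfN.
- by rewrite (_ : (fun x => _) = (fun x => z x ^+ 2))//; apply/funext => x; rewrite mulN1r sqrrN.
- under eq_integral do rewrite EFinM.
  by rewrite integralZl// z0 mule0.
- rewrite (_ : (fun x => _) = (fun x => (z x - y x) ^+ 2))//.
  by apply/funext => x; rewrite mulN1r -opprD sqrrN.
Qed.

Section AlmostInvariant.
Variables (G : set (X -> X)) (u v : nat -> borel X -> R).
Hypothesis Ggrp : is_group G.
Hypothesis Gaff : G `<=` @is_affine X.
Hypothesis muv : forall n, measurable_fun setT (u n) /\ measurable_fun setT (v n).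
Hypothesis norm1 : forall n, EJ (fun x => (u n x ^+ 2 + v n x ^+ 2)%R) = 1%E.
Hypothesis mean0 : forall n, (\int[mu]_x ((u n x)%:E) = 0)%E /\ (\int[mu]_x ((v n x)%:E) = 0)%E.
Hypothesis almost_inv : forall g g', G g -> G g' -> g \o g' = id -> g' \o g = id ->
  (fun n => EJ (fun x => ((u n (g' x) - u n x) ^+ 2 + (v n (g' x) - v n x) ^+ 2)%R)) @ \oo --> 0%E.

Let mu2 n : measurable_fun setT (fun x => u n x ^+ 2).
Proof. by apply: measurable_funX; case: (muv n). Qed.
Let mv2 n : measurable_fun setT (fun x => v n x ^+ 2).
Proof. by apply: measurable_funX; case: (muv n). Qed.

Let fin_u n : (EJ (fun x => (u n x ^+ 2)%R) < +oo)%E.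
Proof.
apply: (@le_lt_trans _ _ 1%E); last by rewrite ltry.
rewrite -(norm1 n); apply: EJ_le => //.
- by apply: measurable_funD.
- by move=> x; exact: sqr_ge0.
- by move=> x; rewrite lerDl sqr_ge0.
Qed.

Let fin_v n : (EJ (fun x => (v n x ^+ 2)%R) < +oo)%E.
Proof.
apply: (@le_lt_trans _ _ 1%E); last by rewrite ltry.
rewrite -(norm1 n); apply: EJ_le => //.
- by apply: measurable_funD.
- by move=> x; exact: sqr_ge0.
- by move=> x; rewrite lerDr sqr_ge0.
Qed.

Let d n : R := n.+1%:R^-1.
Let d0 n : 0 < d n. Proof. by rewrite invr_gt0. Qed.

Let approx_ex : exists (s : nat -> seq 'rV[rat]_r) (c : nat -> 'rV[rat]_r -> R[i]) (p q : nat -> X -> R),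
  forall n, [/\ uniq (s n), (forall w, w \in s n -> dual_im iota w),
    (forall x, Complex (p n x) (q n x) = trig (ech iota) (s n) (c n) x) &
    (EJ (fun x => ((u n x - p n x) ^+ 2)%R) < (d n)%:E)%E /\
    (EJ (fun x => ((v n x - q n x) ^+ 2)%R) < (d n)%:E)%E].
Proof.
suff h n : exists t : seq 'rV[rat]_r * ('rV[rat]_r -> R[i]) * (X -> R) * (X -> R),
    [/\ uniq t.1.1.1, (forall w, w \in t.1.1.1 -> dual_im iota w),
    (forall x, Complex (t.1.2 x) (t.2 x) = trig (ech iota) t.1.1.1 t.1.1.2 x) &
    (EJ (fun x => ((u n x - t.1.2 x) ^+ 2)%R) < (d n)%:E)%E /\
    (EJ (fun x => ((v n x - t.2 x) ^+ 2)%R) < (d n)%:E)%E].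
  have [t ht] := choice h; exists (fun n => (t n).1.1.1), (fun n => (t n).1.1.2).
  by exists (fun n => (t n).1.2), (fun n => (t n).2).
have [m1 m2] := muv n.
have [p [L hL hp] dp] := l2_trig m1 (fin_u n) (d0 n).
have [q [K hK hq] dq] := l2_trig m2 (fin_v n) (d0 n).
pose I : R[i] := Complex 0 1.
have hLK : tlist iota (L ++ [seq (I * a.1, a.2) | a <- K]) by apply: tlist_cat => //; exact: tlist_scale.
have [s [c [us hs hsc]]] := tsum_trig hLK.
exists (s, c, p, q); split=> //= x; rewrite -hsc tsum_cat tsum_scale -hp -hq.
by apply/eqP; rewrite eq_complex /=; apply/andP; split; apply/eqP; ring.
Qed.

(** [m E] is the ultralimit of the mass that the approximants [P n] put on [E]. The total mass comes
    from the norms, the mass at 0 is the squared modulus of the mean of [P n] and tends to 0, and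
    [mass_transport] gives one inequality of invariance. *)
Lemma almost_invariant_mean : exists m : set 'rV[rat]_r -> R, [/\ is_mean m, m [set 0] = 0 &
  forall h, G h -> forall E, m ((fun w => w *m M (p_a h)) @^-1` E) = m E].
Proof.
have [s [c [p [q H]]]] := approx_ex.
pose P n x : R[i] := Complex (p n x) (q n x).
have PE n : P n = trig (ech iota) (s n) (c n) by have [_ _ hx _] := H n; apply/funext => x; exact: hx.
have ech' := ech_char iota.
have bP n : cbmf (P n) by rewrite PE; apply: cbmf_trig.
have mp n : measurable_fun setT (p n : borel X -> R) by case: (bP n) => -[].
have mq n : measurable_fun setT (q n : borel X -> R) by case: (bP n) => _ [].
pose N n := Int (fun x => nsq (P n x)).
have N0 n : 0 <= N n by apply: Int_ge0 => x; exact: nsq_ge0.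
have EJN n : EJ (fun x => nsq (P n x)) = (N n)%:E by rewrite EJ_bmf//; exact: bmf_nsq.
have mnsq (a b : borel X -> R) : measurable_fun setT a -> measurable_fun setT b ->
    measurable_fun setT (fun x => a x ^+ 2 + b x ^+ 2).
  by move=> ma mb; apply: measurable_funD; exact: measurable_funX.
have sq0 (a b : R) : 0 <= a ^+ 2 + b ^+ 2 by rewrite addr_ge0// sqr_ge0.
have W n : (EJ (fun x => ((u n x - p n x) ^+ 2 + (v n x - q n x) ^+ 2)%R) <= (2 * d n)%:E)%E.
  have [_ _ _ [w1 w2]] := H n; have [m1 m2] := muv n.
  have := @EJ_lin R X mu 1 1 (fun x => (u n x - p n x) ^+ 2) (fun x => (v n x - q n x) ^+ 2).
  rewrite !mul1e => hl; under [X in (EJ X <= _)%E]eq_fun do rewrite -[X in X + _]mul1r -[X in _ + X]mul1r.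
  rewrite hl//; try (by move=> x; exact: sqr_ge0).
  - by rewrite mulr_natl mulr2n EFinD; apply: leeD; exact: ltW.
  - by apply: measurable_funX; exact: measurable_funB.
  - by apply: measurable_funX; exact: measurable_funB.
have EJc (a b : R) (A B C : borel X -> R) : measurable_fun setT A -> measurable_fun setT B ->
    measurable_fun setT C -> (forall x, 0 <= A x) -> (forall x, 0 <= B x) ->
    (forall x, 0 <= C x) -> 0 <= a -> 0 <= b -> (forall x, A x <= a * B x + b * C x) ->
    (EJ A <= a%:E * EJ B + b%:E * EJ C)%E.
  move=> mA mB mC A0 B0 C0 a0 b0 h; rewrite -EJ_lin//; apply: EJ_le => //.
  by apply: measurable_funD; apply: measurable_funM => //; exact: measurable_cst.
have mP n : measurable_fun setT (fun x : borel X => nsq (P n x)) by case: (bmf_nsq (bP n)).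
have mF n : measurable_fun setT (fun x => u n x ^+ 2 + v n x ^+ 2) by exact: measurable_funD.
have mW n : measurable_fun setT (fun x => (u n x - p n x) ^+ 2 + (v n x - q n x) ^+ 2).
  by have [m1 m2] := muv n; apply: mnsq; exact: measurable_funB.
have t1 (t : R) : 0 < t -> 0 <= 1 + t by move=> t0; rewrite addr_ge0// ltW.
have tV (t : R) : 0 < t -> 0 <= 1 + t^-1 by move=> t0; rewrite addr_ge0// invr_ge0 ltW.
have I1 n t : 0 < t -> N n <= (1 + t) + (1 + t^-1) * (2 * d n).
  move=> t0; rewrite -lee_fin -EJN.
  apply: (le_trans (EJc (1 + t) (1 + t^-1) _ _ _ (mP n) (mF n) (mW n) _ _ _ _ _ _)) => //.
  - by move=> x; exact: nsq_ge0.
  - exact: t1.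
  - exact: tV.
  - move=> x; have := nsq_ineq (P n x) (Complex (u n x) (v n x)) t0.
    by rewrite /nsq /= -[p n x - u n x]opprB -[q n x - v n x]opprB !sqrrN.
  rewrite norm1 mule1 [X in (_ <= X)%E]EFinD; apply: leeD => //; rewrite EFinM.
  apply: lee_wpmul2l; last exact: W.
  by rewrite lee_fin tV.
have I2 n t : 0 < t -> 1 <= (1 + t) * N n + (1 + t^-1) * (2 * d n).
  move=> t0; rewrite -lee_fin -(norm1 n).
  apply: (le_trans (EJc (1 + t) (1 + t^-1) _ _ _ (mF n) (mP n) (mW n) _ _ _ _ _ _)) => //.
  - by move=> x; exact: nsq_ge0.
  - exact: t1.
  - exact: tV.
  - by move=> x; exact: (nsq_ineq (Complex (u n x) (v n x)) (P n x) t0).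
  rewrite EJN [X in (_ <= X)%E]EFinD; apply: leeD; first by rewrite -EFinM.
  rewrite EFinM; apply: lee_wpmul2l; last exact: W.
  by rewrite lee_fin tV.
have d1 n : d n <= 1 by rewrite invf_le1// ler1n.
(* The bound [I1] at [t = 1] is [2 + 4 * d n], and [d n] is at most 1. *)
have N6 n : N n <= 6.
  apply: (le_trans (I1 n 1 ltr01)); rewrite invr1; move: (d1 n); move: (d n) => z hz.
  by rewrite (_ : 6 = 1 + 1 + (1 + 1) * (2 * 1)) ?lerD2l ?ler_pM2l//; ring.
have [U UU hU] := nat_ultrafilter.
have PU : ProperFilter U by exact: ultra_proper.
have ev (Q : nat -> Prop) : (exists n0 : nat, forall n, (n0 <= n)%N -> Q n) -> U Q.
  by move=> [n0 hn]; apply: hU; exists n0.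
pose f E n := mass (s n) (c n) E.
have inj := @ech_inj R X r iota.
have fT n : f setT n = N n.
  have [us hs _ _] := H n.
  by rewrite /f mass_setT /N PE (parseval cX mu1 muinv ech' inj).
have f6 E n : `|f E n| <= 6.
  by rewrite ger0_norm ?mass_ge0// (le_trans (mass_le _ _ _))// -/(f setT n) fT.
have fb E : bounded_family (f E) by exists 6.
pose m E := ulim U (f E).
have m0 E : 0 <= m E by apply: (ulim_ge0 UU) => // n; exact: mass_ge0.
have mT : m setT = 1.
  (* With 14, the relative loss [e / 14] on a mass bounded by 6 stays below [e / 2], the other half
     being left to the L2 error. *)
  apply: ulim_unique => e e0; have t0 : 0 < e / 14 by rewrite divr_gt0.
  have e2 : 0 < e / 2 by rewrite divr_gt0.
  apply: ev; have [n0 hn] := small_inv ((1 + (e / 14)^-1) * 2) e2; exists n0 => n nn.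
  have h := hn n nn; rewrite /= fT.
  have := I1 n _ t0; have := I2 n _ t0; rewrite mulrA; move: h; rewrite -/(d n).
  move: (_ * _ * d n) (N n) (N6 n) => a b b6 ha h1 h2.
  rewrite ltr_norml; move: (ler_wpM2l (ltW t0) b6) => h3.
  by rewrite mulrDl mul1r in h1; exact: mass_one_arith ha h1 h2 h3 e0.
have mU E F : E `&` F = set0 -> m (E `|` F) = m E + m F.
  move=> EF; rewrite /m -(ulimD UU)//; congr ulim; apply/funext => n; exact: massU.
exists m; split; first by split.
- apply: ulim_unique => e e0; apply: ev.
  pose w : R := Num.min 1 (e / 4).
  have w0 : 0 < w by rewrite lt_min ltr01 divr_gt0.
  have w2 : 0 < w / 2 by rewrite divr_gt0.
  have [n0 hn] := small_inv (w / 2)^-1 w2; exists n0 => n nn.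
  have h := hn n nn; rewrite -/(d n) in h; rewrite /= subr0.
  have [us hs _ [h1 h2]] := H n; have [mu_ mv_] := muv n; have [z1 z2] := mean0 n.
  have b1 := (bP n).1; have b2 := (bP n).2.
  have a1 : `|Int (p n)| <= w.
    apply: (le_trans (mean_approx mu_ b1 (fin_u n) z1 h1 w2)).
    by rewrite [X in _ <= X](splitr w) lerD2l ltW.
  have a2 : `|Int (q n)| <= w.
    apply: (le_trans (mean_approx mv_ b2 (fin_v n) z2 h2 w2)).
    by rewrite [X in _ <= X](splitr w) lerD2l ltW.
  rewrite ger0_norm ?mass_ge0//; apply: (@le_lt_trans _ _ (nsq (cint mu (P n)))).
    have fc w' : fcoef mu (ech iota) (P n) w' = fcoef mu (ech iota) (trig (ech iota) (s n) (c n)) w'.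
      by rewrite PE.
    rewrite /f /mass big_seq_cond (eq_bigl (fun w' => (w' \in s n) && (w' == 0))); last first.
      by move=> w'; congr (_ && _); apply/asboolP/eqP.
    rewrite -big_seq_cond -big_filter.
    case: (boolP (0 \in s n)) => h0; last first.
      rewrite big1_seq ?nsq_ge0// => w' /andP[_]; rewrite mem_filter => /andP[/eqP-> hw].
      by rewrite hw in h0.
    rewrite filter_pred1_uniq// big_seq1.
    have := fcoef_trig cX mu1 muinv ech' inj (c n) us hs (hs _ h0).
    rewrite h0 -fc => <-; rewrite /fcoef (ech0 iotaM iota_inj).
    rewrite (_ : (fun x => _) = P n)//; apply/funext => x.
    by apply/eqP; rewrite eq_complex /=; apply/andP; split; apply/eqP; ring.
  rewrite /nsq /cint /=.
  have hw1 : w <= 1 by rewrite ge_min lexx.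
  have hwe : w <= e / 4 by rewrite ge_min lexx orbT.
  exact: sq_small_arith w0 hw1 hwe a1 a2.
- have half h : G h -> forall E, m ((fun w => w *m M (p_a h)) @^-1` E) <= m E.
    move=> Gh E; have [x0 [th [ath hE]]] := Gaff Gh.
    have ph : p_a h = th by rewrite hE p_a_affine.
    have [_ _ /(_ _ Gh)[h' Gh' [hh' h'h]]] := Ggrp.
    pose B n := Int (fun x => nsq (P n (h x) - P n x)).
    have Bsmall (b : R) : 0 < b -> U [set n | B n < b].
      move=> b0; have Ah : is_affine h by exact: Gaff.
      have ch : continuous h by rewrite hE; exact: affine_continuous.
      have mh : measurable_fun setT (h : borel X -> borel X) by exact: continuous_measurable_map.
      have muh n : measurable_fun setT (fun x : borel X => u n (h x)).
        by apply: (measurableT_comp _ mh); case: (muv n).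
      have mvh n : measurable_fun setT (fun x : borel X => v n (h x)).
        by apply: (measurableT_comp _ mh); case: (muv n).
      pose Wn n := fun x : borel X => (u n x - p n x) ^+ 2 + (v n x - q n x) ^+ 2.
      pose Dn n := fun x : borel X => (u n (h x) - u n x) ^+ 2 + (v n (h x) - v n x) ^+ 2.
      have mD n : measurable_fun setT (Dn n).
        by have [m1 m2] := muv n; apply: mnsq; exact: measurable_funB.
      have mWh n : measurable_fun setT (fun x : borel X => Wn n (h x)).
        by apply: (measurableT_comp _ mh); exact: mW.
      have bPh n : cbmf (fun x => P n (h x) - P n x).
        rewrite (_ : (fun x => _) = (fun x => P n (h x) + (- 1) * P n x)); last first.
          by apply/funext => x; rewrite mulN1r.
        by apply: cbmfD; [exact: cbmf_comp|apply: cbmfM => //; exact: cbmf_cst].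
      have b12 : 0 < b / 12 by rewrite divr_gt0.
      have b2 : 0 < b / 2 by rewrite divr_gt0.
      have evD : U [set n | (EJ (Dn n) < (b / 12)%:E)%E].
        have /fine_cvgP[hfin /cvgrPdist_lt/(_ _ b12) hd] := almost_inv Gh' Gh h'h hh'.
        apply: (hU); apply: filterS2 hfin hd => n hk.
        rewrite /= sub0r normrN => hd; rewrite -(fineK hk) lte_fin.
        exact: le_lt_trans (ler_norm _) hd.
      have evd : U [set n | 12 * d n < b / 2] by apply: ev; exact: small_inv.
      apply: filterS (filterI evD evd) => n [/= h1 h2].
      have mA : measurable_fun setT (fun x : borel X => nsq (P n (h x) - P n x)).
        by case: (bmf_nsq (bPh n)).
      have W0 x : 0 <= Wn n x by exact: sq0.
      have D0 x : 0 <= Dn n x by exact: sq0.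
      have mS : measurable_fun setT (fun x : borel X => Wn n (h x) + Dn n x) by exact: measurable_funD.
      have three : 0 <= 3 :> R by [].
      have S0 x : 0 <= Wn n (h x) + Dn n x by rewrite addr_ge0.
      (* [P n \o h] and [P n] are compared through the given vector and its composition with [h];
         since [h] preserves [mu], the first error has the same integral as the last. *)
      have k1 := EJc 3 3 _ _ _ mA mS (mW n) (fun x => nsq_ge0 _) S0 W0 three three.
      have k2 := EJc 1 1 _ _ _ mS (mWh n) (mD n) S0 (fun x => W0 (h x)) D0 ler01 ler01.
      have kk : (EJ (fun x : borel X => (Wn n (h x) + Dn n x)%R) <= (2 * d n + b / 12)%:E)%E.
        apply: (le_trans (k2 _)); first by move=> x; rewrite !mul1r.
        rewrite !mul1e EFinD; apply: leeD; last exact: ltW.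
        by rewrite (EJ_affine Ah (mW n) W0); exact: W.
      have : ((B n)%:E <= (3 * (2 * d n + b / 12) + 3 * (2 * d n))%:E)%E.
        rewrite /B -(EJ_bmf mu1 (bmf_nsq (bPh n))); apply: (le_trans (k1 _)).
          move=> x; have := nsq_triangle (P n (h x) - Complex (u n (h x)) (v n (h x)))
            (Complex (u n (h x)) (v n (h x)) - Complex (u n x) (v n x)) (Complex (u n x) (v n x) - P n x).
          have tel (z0 z1 z2 z3 : R[i]) : z0 - z1 + (z1 - z2) + (z2 - z3) = z0 - z3 by ring.
          rewrite tel -mulrDr.
          by rewrite /nsq /Wn /Dn /= -[p n _ - u n _]opprB -[q n _ - v n _]opprB !sqrrN.
        rewrite [X in (_ <= X)%E]EFinD; apply: leeD; rewrite [X in (_ <= X)%E]EFinM;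
          by apply: lee_wpmul2l => //; exact: W.
      rewrite lee_fin => hB; apply: (le_lt_trans hB).
      exact: gap_arith b0 h2.
    have step (t b : R) : 0 < t -> 0 < b -> m ((fun w => w *m M th) @^-1` E) <= (1 + t) * m E + b.
      move=> t0 b0; rewrite -(ulimZ UU (1 + t) (fb E)).
      rewrite -[X in _ <= _ + X](ulim_cst UU b) -(ulimD UU); last 2 first.
      - by exists ((1 + t) * 6) => n; rewrite normrM (ger0_norm (t1 _ t0)) ler_wpM2l ?t1.
      - by exists `|b|.
      have bt : 0 < b / (1 + t^-1) by rewrite divr_gt0// ltr_pwDl// invr_ge0 ltW.
      apply: (ulim_le UU); [exact: fb| |].
        exists ((1 + t) * 6 + `|b|) => n; rewrite (le_trans (ler_normD _ _))// lerD2r.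
        by rewrite normrM (ger0_norm (t1 _ t0)) ler_wpM2l ?t1.
      apply: filterS (Bsmall _ bt) => n /= hB; have [us hs _ _] := H n.
      have := mass_transport hX cX mu1 muinv iotaM iota_inj iota_comp (c n) x0 E us hs ath t0.
      rewrite -PE; move=> hm; apply: (le_trans hm); rewrite lerD2l.
      rewrite ltr_pdivlMr ?ltr_pwDl ?invr_ge0 ?(ltW t0)// in hB.
      by rewrite mulrC ltW//; move: hB; rewrite /B hE.
    rewrite ph; apply/ler_addgt0Pl => e e0.
    have e2 : 0 < e / 2 by rewrite divr_gt0.
    have mE1 : m E <= 1.
      rewrite -mT; apply: (ulim_le UU); [exact: fb|exact: fb|].
      by apply: filterS filterT => n _; exact: mass_le.
    apply: (le_trans (step _ _ e2 e2)).
    by move: (ler_wpM2l (ltW e2) mE1) => h1; exact: step_arith h1.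
  move=> h Gh E; apply/eqP; rewrite eq_le half//=.
  have [x0 [th [ath hE]]] := Gaff Gh.
  have [_ _ /(_ _ Gh)[h' Gh' [hh' h'h]]] := Ggrp.
  have [x0' [th' [ath' h'E]]] := Gaff Gh'.
  have ph : p_a h = th by rewrite hE p_a_affine.
  have ph' : p_a h' = th' by rewrite h'E p_a_affine.
  (* The reverse inequality is [half] for the inverse of [h], applied to the preimage of [E] under
     [h]. *)
  have := half h' Gh' ((fun w => w *m M (p_a h)) @^-1` E); congr (m _ <= _).
  have [tD tc _] := ath; have [tD' tc' _] := ath'.
  have thK x : th' (th x) = x.
    have e1 y : th y = h y - h 0 by rewrite -ph.
    have e2 y : th' y = h' y - h' 0 by rewrite -ph'.
    have e3 y : h' (h y) = y by exact: (congr1 (fun k => k y) h'h).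
    have tB a b : th' (a - b) = th' a - th' b.
      by apply/eqP; rewrite -subr_eq opprK -tD' subrK.
    by rewrite e1 tB !e2 !e3 opprB addrA subrK subr0.
  apply/seteqP; split=> w /=; rewrite ph ph' -mulmxA -(mx_comp iota_span iota_comp)//.
    by rewrite (_ : (fun x => _) = id) ?(mx_id iota_span iota_comp) ?mulmx1//; exact: funext.
  by rewrite (_ : (fun x => _) = id) ?(mx_id iota_span iota_comp) ?mulmx1//; exact: funext.
Qed.

End AlmostInvariant.

End GapMean.

(** * Subsolenoids from means *)

Section FunctionGroup.
Variables (T : choiceType) (G : set (T -> T)).
Hypothesis hG : is_group G.

(** The proof of [is_group] is a parameter of the type, so that the group structure can be attached
    to the type itself. *)
Definition fun_group (_ : is_group G) : Type := {g : T -> T | G g}.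
HB.instance Definition _ := gen_eqMixin (fun_group hG).
HB.instance Definition _ := gen_choiceMixin (fun_group hG).

Definition ginv (g : T -> T) : T -> T :=
  xget (fun x : T => x) [set g' | G g' /\ g \o g' = id /\ g' \o g = id].

Lemma ginvP g : G g -> [/\ G (ginv g), g \o ginv g = id & ginv g \o g = id].
Proof.
move=> Gg; have : exists g', G g' /\ g \o g' = id /\ g' \o g = id.
  by have [_ _ /(_ _ Gg)[g' h1 h2]] := hG; exists g'.
by move=> /(@xgetPex _ (fun x : T => x) [set g' | G g' /\ g \o g' = id /\ g' \o g = id]) [? []].
Qed.

Let G1 : G id. Proof. by case: hG. Qed.
Let GM a b : G a -> G b -> G (a \o b). Proof. by case: hG => _ h _; exact: h. Qed.

Lemma ginvK g x : G g -> ginv g (g x) = x.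
Proof. by move=> /ginvP[_ _ h]; exact: (congr1 (fun k => k x) h). Qed.
Lemma ginvKV g x : G g -> g (ginv g x) = x.
Proof. by move=> /ginvP[_ h _]; exact: (congr1 (fun k => k x) h). Qed.
Lemma ginvG g : G g -> G (ginv g). Proof. by case/ginvP. Qed.

Lemma ginv_unique g g' : G g -> g \o g' = id -> g' = ginv g.
Proof.
move=> Gg h; apply/funext => x; rewrite -[g' x](ginvK _ Gg); congr ginv.
exact: (congr1 (fun k => k x) h).
Qed.

Let fg_one : fun_group hG := exist _ id G1.
Let fg_mul (a b : fun_group hG) : fun_group hG :=
  exist _ (sval a \o sval b) (GM (svalP a) (svalP b)).
Let fg_inv (a : fun_group hG) : fun_group hG := exist _ (ginv (sval a)) (ginvG (svalP a)).

Let fg_eq (a b : fun_group hG) : sval a = sval b -> a = b.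
Proof. by move: a b => [a Ga] [b Gb] /= e; subst b; congr exist; exact: Prop_irrelevance. Qed.

Let fg_mulA : associative fg_mul. Proof. by move=> a b c; exact: fg_eq. Qed.
Let fg_mul1 : left_id fg_one fg_mul. Proof. by move=> a; exact: fg_eq. Qed.
Let fg_1mul : right_id fg_one fg_mul. Proof. by move=> a; exact: fg_eq. Qed.
Let fg_mulV : left_inverse fg_one fg_inv fg_mul.
Proof. by move=> a; apply: fg_eq; have [_ _ h] := ginvP (svalP a). Qed.
Let fg_Vmul : right_inverse fg_one fg_inv fg_mul.
Proof. by move=> a; apply: fg_eq; have [_ h _] := ginvP (svalP a). Qed.

HB.instance Definition _ := isGroup.Build (fun_group hG) fg_mulA fg_mul1 fg_1mul fg_mulV fg_Vmul.

Definition fun_elt g (Gg : G g) : fun_group hG := exist _ g Gg.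

Lemma val_fg1 : sval (1%g : fun_group hG) = id. Proof. by []. Qed.
Lemma val_fgM (a b : fun_group hG) : sval (a * b)%g = sval a \o sval b. Proof. by []. Qed.

End FunctionGroup.

Section AffineFacts.
Variable X : topologicalZmodType.

Lemma p_aD (g : X -> X) x y : is_affine g -> p_a g (x + y) = p_a g x + p_a g y.
Proof. by move=> [x0 [th [ath ->]]]; rewrite p_a_affine//; case: ath => ->. Qed.

Lemma p_a_cont (g : X -> X) : is_affine g -> continuous (p_a g).
Proof. by move=> [x0 [th [ath ->]]]; rewrite p_a_affine//; case: ath. Qed.

Lemma p_aB (g : X -> X) x y : is_affine g -> p_a g (x - y) = g x - g y.
Proof.
move=> ag; have h : p_a g (x - y) + p_a g y = p_a g x by rewrite -p_aD// subrK.
by rewrite -[LHS](addrK (p_a g y)) h /p_a opprB addrA subrK.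
Qed.

Lemma p_a0 (g : X -> X) : p_a g 0 = 0. Proof. by rewrite /p_a subrr. Qed.

Lemma p_a_comp (g h : X -> X) : is_affine g -> p_a (g \o h) = p_a g \o p_a h.
Proof. by move=> ag; apply/funext => x; rewrite /= {1}/p_a /= -p_aB. Qed.

Lemma p_a_id : p_a (id : X -> X) = id.
Proof. by apply/funext => x; rewrite /p_a subr0. Qed.

End AffineFacts.

(** * The image of Gamma in the affine group of X/Y *)

Section Congruence.
Variables (X : topologicalZmodType) (Gamma : set (X -> X)) (Y : set X).
Hypothesis hG : is_group Gamma.
Hypothesis Gaff : Gamma `<=` @is_affine X.
Hypothesis Ysg : is_subgroup_set Y.
Hypothesis Yinv : forall g, Gamma g -> p_a g @` Y `<=` Y.

Lemma sgN x : Y x -> Y (- x).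
Proof. by move=> Yx; rewrite -sub0r; case: Ysg => Y0 YB; exact: YB. Qed.
Lemma sgD x y : Y x -> Y y -> Y (x + y).
Proof. by move=> Yx Yy; rewrite -[y]opprK; case: Ysg => Y0 YB; apply: YB => //; exact: sgN. Qed.
Lemma sg0 : Y 0. Proof. by case: Ysg. Qed.

(** For elements of [Gamma], equality of the induced maps of X/Y; the quotient group itself is never
    formed. *)
Definition cong (g h : X -> X) : Prop := forall x, Y (g x - h x).

Lemma cong_refl g : cong g g. Proof. by move=> x; rewrite subrr; exact: sg0. Qed.
Lemma cong_sym g h : cong g h -> cong h g.
Proof. by move=> c x; rewrite -opprB; exact: sgN. Qed.
Lemma cong_trans h g k : cong g h -> cong h k -> cong g k.
Proof.
by move=> c1 c2 x; have := sgD (c1 x) (c2 x); rewrite addrA subrK.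
Qed.
Lemma cong_compr g h k : cong g h -> cong (g \o k) (h \o k).
Proof. by move=> c x; exact: c. Qed.
Lemma cong_compl g h k : Gamma k -> cong g h -> cong (k \o g) (k \o h).
Proof.
move=> Gk c x /=; rewrite -p_aB; last exact: Gaff.
by apply: (Yinv Gk); exists (g x - h x).
Qed.
Lemma cong_comp g h g' h' : Gamma g -> cong g h -> cong g' h' -> cong (g \o g') (h \o h').
Proof. by move=> Gg c c'; apply: (cong_trans (cong_compl Gg c')); exact: cong_compr. Qed.
Lemma cong_inv a d a' d' : Gamma d' -> cong a d -> a \o a' = id -> d' \o d = id -> cong a' d'.
Proof.
move=> Gd' c aa dd; apply: cong_sym.
have -> : d' = d' \o (a \o a') by rewrite aa.
have {2}-> : a' = d' \o (d \o a') by rewrite compA dd.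
by apply: cong_compl => //; exact: cong_compr.
Qed.

Local Notation N := (kernel_on_quotient Gamma Y).

Let GG := fun_group hG.
Let GM a b : Gamma a -> Gamma b -> Gamma (a \o b). Proof. by case: hG => _ h _; exact: h. Qed.
Let G1 : Gamma id. Proof. by case: hG. Qed.

(** The saturation of [D] by the kernel: the derived series is taken in [Gamma], and its terms are
    controlled only up to [cong]. *)
Definition csat (D : set GG) : set (X -> X) :=
  [set g | Gamma g /\ exists2 d : GG, D d & cong g (sval d)].

Lemma csat_subgroup D : subgrp D -> is_subgroup Gamma (csat D).
Proof.
move=> [D1 DM DV]; split.
- by move=> g [].
- by split=> //; exists 1%g => //; exact: cong_refl.
- move=> a b [Ga [d Dd ca]] [Gb [e De cb]]; split; first exact: GM.
  by exists (d * e)%g; [exact: DM|rewrite val_fgM; exact: cong_comp].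
- move=> a a' [Ga [d Dd ca]] Ga' aa; split=> //; exists (d^-1)%g; first exact: DV.
  have [_ _ h] := ginvP hG (svalP d).
  by apply: (cong_inv _ ca aa h); exact: ginvG (svalP d).
Qed.

Lemma kernel_subgroup : is_subgroup Gamma N.
Proof.
split.
- by move=> g [].
- by split=> //; exact: cong_refl.
- move=> a b [Ga ca] [Gb cb]; split; first exact: GM.
  exact: (@cong_comp a id b id).
- move=> a a' [Ga ca] Ga' aa; split=> //.
  exact: (@cong_inv a id a' id).
Qed.

Lemma derived_csat (D : nat -> set GG) H' : solvable_chain setT D -> H' `<=` csat (D 0%N) ->
  forall i, derived_series Gamma H' i `<=` csat (D i).
Proof.
move=> [Dsg _ _ Dc] H0; elim=> [//|i IH] /= g hg; apply: hg; split; first exact: csat_subgroup.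
move=> c [a [b [a' [b' [[Sa Sb] [Ga' Gb'] aa bb ->]]]]].
have [Ga [d Dd ca]] := IH _ Sa; have [Gb [e De cb]] := IH _ Sb.
split; first by do 3 apply: GM => //.
exists (d^-1 * e^-1 * d * e)%g; first exact: Dc.
have [_ _ hd] := ginvP hG (svalP d); have [_ _ he] := ginvP hG (svalP e).
have ca' : cong a' (ginv Gamma (sval d)) by apply: (cong_inv _ ca aa hd); exact: ginvG (svalP d).
have cb' : cong b' (ginv Gamma (sval e)) by apply: (cong_inv _ cb bb he); exact: ginvG (svalP e).
apply: cong_comp => //; first by do 2 apply: GM => //.
apply: cong_comp => //; first exact: GM.
exact: cong_comp.
Qed.

(** The hypothesis on [D n] concerns linear parts, so [D n] acts on X/Y by translations. These
    commute, at the price of one more derived subgroup, whence [n.+1]. *)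
Lemma virtually_solvable_of_chain (D : nat -> set GG) n : solvable_chain setT D ->
  (forall d, D n d -> forall x, Y (p_a (sval d) x - x)) ->
  quotient_virtually_solvable Gamma N.
Proof.
move=> hD hn; have [Dsg _ [s [_ hs]] Dc] := hD.
have [D1 DM DV] := Dsg 0%N.
exists (csat (D 0%N)); split.
- exact: csat_subgroup.
- by move=> g [Gg cg]; split=> //; exists 1%g.
(* The chain comes with right cosets while left cosets are required, hence the inverses. *)
- exists [set sval (h^-1)%g | h in [set` s]]; split.
  + by apply: finite_image; exact: finite_seq.
  + by move=> _ [h _ <-]; exact: (svalP (h^-1)%g).
  + move=> g Gg; pose gg : GG := fun_elt hG Gg.
    have [h hsh hD0] := hs (gg^-1)%g I.
    exists (sval (h^-1)%g); first by exists h.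
    exists (sval (h * gg)%g).
      split; first exact: (svalP (h * gg)%g).
      by exists (h * gg)%g; [have := DV _ hD0; rewrite invgM !invgK|exact: cong_refl].
    by rewrite -val_fgM mulgA mulVg mul1g.
exists n.+1 => g /= hg; apply: hg; split; first exact: kernel_subgroup.
have hsat := derived_csat hD (fun g h => h) (i := n).
have htr a : csat (D n) a -> exists a0, cong a (fun x => a0 + x).
  move=> [Ga [d Dd ca]]; exists (sval d 0) => x.
  have := sgD (ca x) (hn d Dd x); rewrite /p_a.
  by rewrite opprD !addrA subrK.
move=> c [a [b [a' [b' [[Sa Sb] [Ga' Gb'] aa bb ->]]]]].
have Ca := hsat _ Sa; have Cb := hsat _ Sb; have [Ga _] := Ca; have [Gb _] := Cb.
have [a0 ha] := htr _ Ca; have [b0 hb] := htr _ Cb.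
split; first by do 3 apply: GM => //.
have inv_tr k k' k0 : Gamma k' -> k \o k' = id -> cong k (fun x => k0 + x) ->
    cong k' (fun x => - k0 + x).
  move=> Gk' kk ck x; have := sgN (ck (k' x)).
  have -> : k (k' x) = x by exact: (congr1 (fun f => f x) kk).
  by rewrite opprB opprD opprK addrA [k' x + _]addrC.
have ha' := inv_tr _ _ _ Ga' aa ha; have hb' := inv_tr _ _ _ Gb' bb hb.
move=> x; rewrite /=.
have h1 := hb x; have h2 := ha (b x); have h3 := hb' (a (b x)); have h4 := ha' (b' (a (b x))).
have := sgD (sgD (sgD h4 h3) h2) h1.
move: (b x) => y1; move: (a y1) => y2; move: (b' y2) => y3; move: (a' y3) => y4.
suff -> : y4 - (- a0 + y3) + (y3 - (- b0 + y2)) + (y2 - (a0 + y1)) + (y1 - (b0 + x)) = y4 - x by [].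
rewrite !opprD !opprK.
(* The twelve terms are regrouped so that all but [y4] and [- x] cancel in pairs. *)
rewrite (AC ((1*(1*1))*(1*(1*1))*(1*(1*1))*(1*(1*1))) ((1*12)*((2*8)*(3*4)*(5*11)*(6*7)*(9*10))))/=.
by rewrite !subrr !addNr !addr0.
Qed.

End Congruence.

(** * Annihilators, and means from amenable quotients *)

Section Duality.
Variables (R : realType) (X : topologicalZmodType) (Gamma : set (X -> X)).
Hypothesis hG : is_group Gamma.
Hypothesis Gaff : Gamma `<=` @is_affine X.
Local Notation char := (@is_character R X).
Variables (r : nat) (iota : (X -> R[i]) -> 'rV[rat]_r) (M : (X -> X) -> 'M[rat]_r).
Hypothesis iotaM : forall chi psi, char chi -> char psi ->
  iota (fun x => chi x * psi x) = iota chi + iota psi.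
Hypothesis iota_inj : forall chi psi, char chi -> char psi -> iota chi = iota psi -> chi = psi.
Hypothesis iota_span : forall w, exists n chi, [/\ (0 < n)%N, char chi & iota chi = n%:R *: w].
Hypothesis iota_comp : forall chi th, char chi -> continuous th ->
  (forall x y, th (x + y) = th x + th y) -> iota (fun x => chi (th x)) = iota chi *m M th.

Let hc g : Gamma g -> continuous (p_a g). Proof. by move=> /Gaff; exact: p_a_cont. Qed.
Let hD g : Gamma g -> forall x y, p_a g (x + y) = p_a g x + p_a g y.
Proof. by move=> /Gaff ag x y; exact: p_aD. Qed.

Definition annihilator (U : 'M[rat]_r) : set X :=
  [set x | forall chi, char chi -> (iota chi <= U)%MS -> chi x = 1].

(** A subsolenoid has to be connected and an annihilator need not be. Connected sets through 0 that
    map into the annihilator land in this component, which is how all its properties are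
    obtained. *)
Definition ann_component U : set X := connected_component (annihilator U) 0.

Lemma annihilator_closed U : closed (annihilator U).
Proof.
have -> : annihilator U = \bigcap_(chi in [set chi | char chi /\ (iota chi <= U)%MS])
    ((chRe chi) @^-1` [set (1 : R)]).
  apply/seteqP; split => x /= h.
    by move=> chi [c l]; rewrite /= /chRe (h chi c l).
  by move=> chi c l; apply: ch_eq1 => //; exact: (h chi (conj c l)).
apply: closed_bigI => chi [c _]; apply: closed_comp; last exact: closed_eq.
by move=> x _; exact: cont_chRe.
Qed.

Lemma annihilator_subgroup U : is_subgroup_set (annihilator U).
Proof.
split; first by move=> chi c _; exact: ch0.
by move=> x y hx hy chi c l; rewrite chB// (hx _ c l) (hy _ c l) divr1.
Qed.

Lemma component_image U (B : set X) (f : X -> X) : connected B -> continuous f ->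
  f @` B `<=` annihilator U -> (f @` B) 0 -> f @` B `<=` ann_component U.
Proof.
move=> cB cf h h0; apply: connected_component_max => //.
apply: connected_continuous_connected => //.
exact: continuous_subspaceT.
Qed.

Lemma ann_component0 U : ann_component U 0.
Proof. by apply: connected_component_refl; case: (annihilator_subgroup U). Qed.

Lemma ann_component_subsolenoid U : subsolenoid (ann_component U).
Proof.
split; last 2 first.
- exact/component_closed/annihilator_closed.
- exact: component_connected.
split; first exact: ann_component0.
move=> x y hx hy; apply: (@component_image U (ann_component U) (fun u => u - y)).
- exact: component_connected.
- exact: continuous_addr.
- move=> _ [u hu <-]; have [_ h] := annihilator_subgroup U.
  by apply: h; apply: connected_component_sub; eassumption.
- by exists y => //; rewrite subrr.
- by exists x.
Qed.

Lemma ann_component_invariant U g : Gamma g -> (U *m M (p_a g) <= U)%MS ->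
  p_a g @` ann_component U `<=` ann_component U.
Proof.
move=> Gg hU; apply: component_image.
- exact: component_connected.
- exact: hc.
- move=> _ [u /connected_component_sub hu <-] chi c l.
  apply: (hu (fun x => chi (p_a g x))); first by apply: ch_comp => //; [exact: hc|exact: hD].
  rewrite iota_comp//; [|exact: hc|exact: hD].
  by apply: submx_trans hU; exact: submxMr.
- by exists 0; [exact: ann_component0|rewrite p_a0].
Qed.

(** A multiple of a nonzero row of [U] is the coordinate vector of a nontrivial character, which
    would be trivial on all of [X]. *)
Lemma ann_component_proper U : U != 0 -> ann_component U <> setT.
Proof.
move=> U0 hT; have hA x : annihilator U x.
  by apply: (@connected_component_sub _ _ 0); rewrite -/(ann_component U) hT.
have [i hi] : exists i, row i U != 0.
  apply: contrapT => /forallNP h; move/negP: U0; apply; apply/eqP/row_matrixP => i.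
  by rewrite row0; apply/eqP; have /negP := h i; rewrite negbK.
have [n [chi [n0 c e]]] := iota_span (row i U).
have chi1 : chi = (fun=> 1).
  apply/funext => x; apply: (hA x chi c); rewrite e.
  by apply: submx_trans (row_sub i U); exact: scalemx_sub.
move: e; rewrite chi1 (iota_one iotaM) => /esym/eqP; rewrite scaler_eq0 (negPf hi) orbF.
by rewrite pnatr_eq0 => /eqP n1; move: n0; rewrite n1.
Qed.

(** Characters with coordinates in [U] are invariant under [p_a g], so [p_a g x - x] stays in the
    annihilator. As [X] is connected, its continuous image through 0 stays in the component. *)
Lemma ann_component_fixed U g : connected [set: X] -> Gamma g -> U *m M (p_a g) = U ->
  forall x, ann_component U (p_a g x - x).
Proof.
move=> cnX Gg hU x.
apply: (@component_image U setT (fun x => p_a g x - x)) => //.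
- move=> u; apply: (@continuous_comp _ _ _ (fun v => (p_a g v, v)) (fun z : X * X => z.1 - z.2)).
    by apply: cvg_pair => //; exact: hc.
  exact: sub_continuous.
- move=> _ [y _ <-] chi c l.
  have e : (fun x => chi (p_a g x)) = chi.
    apply: iota_inj => //; first by apply: ch_comp => //; [exact: hc|exact: hD].
    rewrite (iota_comp c (hc Gg) (hD Gg)).
    by move: l => /submxP[q ->]; rewrite -mulmxA hU.
  have ey : chi (p_a g y) = chi y := congr1 (fun f => f y) e.
  by rewrite chB// ey divff// ch_neq0.
- by exists 0 => //; rewrite p_a0 subrr.
Qed.

Lemma mx_pa_comp g h : Gamma g -> Gamma h -> M (p_a (g \o h)) = M (p_a g) *m M (p_a h).
Proof.
move=> Gg Gh; rewrite p_a_comp; last exact: Gaff.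
by rewrite (@mx_comp R X r iota M iota_span iota_comp)//;
  [exact: hc|exact: hD|exact: hc|exact: hD].
Qed.

Lemma mean_virtually_solvable (m : set 'rV[rat]_r -> R) : connected [set: X] ->
  is_mean m -> m [set 0] = 0 ->
  (forall h, Gamma h -> forall E, m ((fun w => w *m M (p_a h)) @^-1` E) = m E) ->
  exists Y : set X, [/\ subsolenoid Y, Y <> setT, (forall g, Gamma g -> p_a g @` Y `<=` Y) &
          quotient_virtually_solvable Gamma (kernel_on_quotient Gamma Y)].
Proof.
move=> cnX mm m0 minv; pose rho (g : fun_group hG) := M (p_a (sval g)).
have rho1 : rho 1%g = 1%:M.
  by rewrite /rho val_fg1 p_a_id; exact: (@mx_id R X r iota M iota_span iota_comp).
have rhoM x y : rho (x * y)%g = rho x *m rho y.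
  by rewrite /rho val_fgM mx_pa_comp//; exact: svalP.
have [U [D [n [U0 hU hD' hfix]]]] := virtually_solvable_subspace mm m0 rho1 rhoM
  (fun g E => minv _ (svalP g) E).
have inv g : Gamma g -> p_a g @` ann_component U `<=` ann_component U.
  by move=> Gg; apply: ann_component_invariant => //; exact: (hU (fun_elt hG Gg)).
exists (ann_component U); split => //.
- exact: ann_component_subsolenoid.
- exact: ann_component_proper.
- have [sg _ _] := ann_component_subsolenoid U.
  apply: (@virtually_solvable_of_chain X Gamma (ann_component U) hG Gaff sg inv D n hD').
  move=> d Dd x; apply: ann_component_fixed => //; [exact: svalP|exact: (hfix d)].
Qed.

Section AmenableQuotient.
Variables (Y : set X) (chi0 : X -> R[i]) (x0 : X).
Hypothesis Ysg : is_subgroup_set Y.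
Hypothesis Yinv : forall g, Gamma g -> p_a g @` Y `<=` Y.
Hypothesis c0 : char chi0.
Hypothesis chiY : forall y, Y y -> chi0 y = 1.
Hypothesis chix0 : chi0 x0 != 1.
Local Notation N := (kernel_on_quotient Gamma Y).

(** The inverse makes [orb] constant on the left cosets of the kernel, as is required of the
    functions to which the mean applies. *)
Let orb (g : X -> X) : X -> R[i] := fun x => chi0 (p_a (ginv Gamma g) x).
Let phi (E : set 'rV[rat]_r) (g : X -> X) : R := (`[< E (iota (orb g)) >])%:R.

Let G1 : Gamma id. Proof. by case: hG. Qed.
Let GM a b : Gamma a -> Gamma b -> Gamma (a \o b). Proof. by case: hG => _ h _; exact: h. Qed.

Lemma ginv_comp g h : Gamma g -> Gamma h -> ginv Gamma (g \o h) = ginv Gamma h \o ginv Gamma g.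
Proof.
move=> Gg Gh; apply/esym/ginv_unique => //; first exact: GM.
by apply/funext => x /=; rewrite !(ginvKV hG).
Qed.

Lemma kernel_ginv e : N e -> N (ginv Gamma e).
Proof.
move=> [Ge he]; have [_ _ _ h] := kernel_subgroup hG Gaff Ysg Yinv.
by have [Gi e1 _] := ginvP hG Ge; apply: (h e).
Qed.

Lemma character_kernel k y : N k -> chi0 (p_a k y) = chi0 y.
Proof.
move=> [Gk hk]; have : Y (p_a k y - y).
  rewrite /p_a addrAC; case: Ysg => _ YB; apply: YB; first exact: hk.
  by have := hk 0; rewrite subr0.
by move=> /chiY; rewrite chB// => /divr1_eq.
Qed.

Let orb_right g e : Gamma g -> N e -> orb (g \o e) = orb g.
Proof.
move=> Gg Ne; have [Ge _] := Ne; apply/funext => x.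
rewrite /orb ginv_comp// p_a_comp /=; last by apply: Gaff; exact: ginvG.
by apply: character_kernel; exact: kernel_ginv.
Qed.

Let orb_char g : Gamma g -> char (orb g).
Proof. by move=> Gg; apply: ch_comp => //; [apply: hc|apply: hD]; exact: ginvG. Qed.

Let orb_neq g : Gamma g -> iota (orb g) <> 0.
Proof.
move=> Gg h; move/negP: chix0; apply; apply/eqP.
have : orb g = (fun=> 1).
  by apply: iota_inj; [exact: orb_char|exact: ch_one|rewrite h (iota_one iotaM)].
move=> /(congr1 (fun f => f (p_a g x0))); rewrite /orb.
have -> : p_a (ginv Gamma g) (p_a g x0) = x0.
  have [Gi _ e] := ginvP hG Gg.
  have := p_a_comp g (Gaff Gi); rewrite e p_a_id => /(congr1 (fun f => f x0)).
  by move=> /esym.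
by [].
Qed.

Let orb_left g h : Gamma g -> Gamma h ->
  iota (orb g) *m M (p_a h) = iota (orb (ginv Gamma h \o g)).
Proof.
move=> Gg Gh; rewrite -iota_comp; [|exact: orb_char|exact: hc|exact: hD].
suff -> : (fun x => orb g (p_a h x)) = orb (ginv Gamma h \o g) by [].
apply/funext => x; rewrite /orb (ginv_comp (ginvG hG Gh) Gg).
rewrite (p_a_comp (ginv Gamma (ginv Gamma h)) (Gaff (ginvG hG Gg))).
have [_ _ e] := ginvP hG Gh.
by rewrite -(ginv_unique hG (ginvG hG Gh) e).
Qed.

Lemma amenable_quotient_mean : quotient_amenable R Gamma N ->
  exists m : set 'rV[rat]_r -> R, [/\ is_mean m, m [set 0] = 0 &
    forall h, Gamma h -> forall E, m ((fun w => w *m M (p_a h)) @^-1` E) = m E].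
Proof.
set B := fun phi : (X -> X) -> R =>
    (exists M : R, forall g, Gamma g -> `|phi g| <= M) /\
    (forall g e, Gamma g -> N e -> phi (g \o e) = phi g).
move=> [M0 [M0lin M0pos M01 M0inv]].
have Bphi E : B (phi E).
  split; last by move=> g e Gg Ne; rewrite /phi orb_right.
  by exists 1 => g _; rewrite /phi; case: `[<_>]; rewrite ?normr1 ?normr0.
have B0 : B (fun=> 0) by split=> //; exists 0 => g _; rewrite normr0.
have M00 : M0 (fun=> 0) = 0.
  have := M0lin 1 _ _ B0 B0; rewrite mulr0 addr0 mul1r.
  by move=> /eqP; rewrite -subr_eq0 opprD addNKr oppr_eq0 => /eqP.
have Blin a f f' : B f -> B f' -> B (fun g => a * f g + f' g).
  move=> [[b hb] i1] [[b' hb'] i2]; split.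
    exists (`|a| * b + b') => g Gg; apply: le_trans (ler_normD _ _) _.
    by rewrite normrM lerD//; [rewrite ler_wpM2l// hb|exact: hb'].
  by move=> g e Gg Ne; rewrite i1// i2.
(* The mean takes functions of all maps of [X] as arguments; positivity shows that only their values
   on [Gamma] count. *)
have M0eq f f' : B f -> B f' -> (forall g, Gamma g -> f g = f' g) -> M0 f = M0 f'.
  move=> Bf Bf' h.
  have le p q : B p -> B q -> (forall g, Gamma g -> p g = q g) -> M0 p <= M0 q.
    move=> Bp Bq e; have := M0lin (-1) _ _ Bp Bq; rewrite mulN1r.
    have := M0pos _ (Blin (-1) _ _ Bp Bq).
    set z := M0 _ => hz ez; rewrite -subr_ge0 addrC -ez; apply: hz => g Gg.
    by rewrite e// mulN1r addNr.
  by apply/eqP; rewrite eq_le !le// => g Gg; rewrite h.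
exists (fun E => M0 (phi E)); split.
- split.
  + by move=> E; apply: M0pos => [|g _]; [exact: Bphi|exact: ler0n].
  + rewrite -[RHS]M01; congr M0; apply/funext => g; rewrite /phi.
    by have -> : `[<[set: 'rV[rat]_r] (iota (orb g))>] = true by exact/asboolP.
  + move=> E F EF; rewrite -[M0 (phi E)]mul1r -(M0lin 1 _ _ (Bphi E) (Bphi F)); congr M0; apply/funext => g.
    rewrite mul1r /phi; set w := iota _.
    have : ~ (E w /\ F w) by move=> h; have : (E `&` F) w by []; rewrite EF.
    by case: (asboolP (E w)); case: (asboolP (F w)); case: (asboolP ((E `|` F) w)) => //=;
      rewrite ?addr0 ?add0r// => h1 h2 h3 h4; exfalso; tauto.
- rewrite -[RHS]M00; apply: M0eq => // g Gg; rewrite /phi.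
  by case: asboolP => // /orb_neq; case.
- move=> h Gh E; have Gi := ginvG hG Gh.
  rewrite -(M0inv _ (phi E) Gi (Bphi E)); apply: M0eq => //.
    have [[b hb] i1] := Bphi E; split.
      by exists b => g Gg; apply: hb; exact: GM.
    by move=> g e Gg Ne; rewrite compA i1//; exact: GM.
  by move=> g Gg; rewrite /phi /= orb_left.
Qed.

End AmenableQuotient.
End Duality.

(** * Almost invariant finite sequences *)

Section Reiter.
Variables (R : realType) (G : groupType) (N : set G).
Local Open Scope ring_scope.

Definition right_inv (phi : G -> R) : Prop := forall g e, N e -> phi (g * e)%g = phi g.

(** A finite sequence of elements of [G], repetitions allowed, stands for its image in G/N. The l1
    distance to its translate is measured by pairing with bounded functions constant on cosets, so
    nothing has to be counted in the quotient. *)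
Definition almost_inv (eps : R) (h : G) (s : seq G) : Prop :=
  forall (phi : G -> R) (b : R), right_inv phi -> (forall g, `|phi g| <= b) ->
    `|\sum_(g <- s) phi (h * g)%g - \sum_(g <- s) phi g| <= eps * b * (size s)%:R.

Definition folner (Q : seq G) : Prop := forall eps : R, 0 < eps ->
  exists s : seq G, s <> [::] /\ forall h, h \in Q -> almost_inv eps h s.

Lemma right_inv_left phi k : right_inv phi -> right_inv (fun g => phi (k * g)%g).
Proof. by move=> h g e Ne; rewrite mulgA (h _ _ Ne). Qed.

Lemma almost_inv_le (e d : R) h s : e <= d -> almost_inv e h s -> almost_inv d h s.
Proof.
move=> ed hs phi b ri hb; apply: le_trans (hs _ _ ri hb) _.
have b0 : 0 <= b := le_trans (normr_ge0 _) (hb 1%g).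
by rewrite ler_wpM2r// ler_wpM2r.
Qed.

Lemma folner_trivial (Q : seq G) : (forall h, h \in Q -> N h) -> folner Q.
Proof.
move=> hQ eps e0; exists [:: 1%g]; split => // h /hQ Nh phi b ri hb.
have b0 : 0 <= b := le_trans (normr_ge0 _) (hb 1%g).
rewrite !big_seq1 mulg1 -[h]mul1g ri// subrr normr0 mulr1 mulr_ge0// ltW//.
Qed.

Lemma sum_norm_le (I : eqType) (s : seq I) (F : I -> R) c :
  (forall i, i \in s -> `|F i| <= c) -> `|\sum_(i <- s) F i| <= c * (size s)%:R.
Proof.
move=> h; apply: le_trans (ler_norm_sum _ _ _) _.
rewrite big_seq; apply: le_trans (ler_sum _ h) _.
by rewrite -big_seq big_const_seq count_predT iter_addr_0 mulr_natr.
Qed.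

(* Add the elements of [F] one at a time: if [s] works for the other elements and
   for enough commutators, then the products [f ^ v * t] with [v < m] and [t] in [s] work
   for [f] by telescoping, and for [h] because [h * f ^ v = f ^ v * h * c] with [c] a commutator. *)
Lemma folner_commutators (D D' : set G) : subgrp D -> D' `<=` D ->
  (forall x y, D x -> D y -> D' (x^-1 * y^-1 * x * y)%g) ->
  (forall F, (forall h, h \in F -> D' h) -> folner F) ->
  forall F, (forall h, h \in F -> D h) -> folner F.
Proof.
move=> [D1 DM DV] sub comm base F hF.
suff : forall F', (forall h, h \in F' -> D' h) -> folner (F ++ F').
  by move=> /(_ [::]); rewrite cats0; apply.
elim: F hF => [_ F' hF'|f F IH hF F' hF' eps e0]; first exact: base.
have Df : D f by apply: hF; exact: mem_head.
have DF h : h \in F ++ F' -> D h.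
  rewrite mem_cat => /orP[hh|/hF' /sub//].
  by apply: hF; rewrite inE hh orbT.
(* For [f], telescoping leaves two sums of size at most [b * n], to be compared with
   [eps * b * (m * n)]: hence [m] at least [2 / eps]. *)
pose m := (Num.truncn (2 / eps)).+1.
have hm : 2 <= eps * m%:R.
  by rewrite mulrC -ler_pdivrMr// ltW// /m -truncn_le_nat.
pose C := [seq (h^-1 * (f ^+ v)^-1 * h * f ^+ v)%g | h <- F ++ F', v <- iota 0 m].
have DX v : D (f ^+ v)%g.
  by elim: v => [|v Dv]; [rewrite expg0|rewrite expgS; exact: DM].
have [|||s [s0 hs]] := IH _ (F' ++ C) _ (eps / 2).
- by move=> h hh; apply: hF; rewrite inE hh orbT.
- move=> h; rewrite mem_cat => /orP[/hF'//|/allpairsP[[k v] [/= hk _ ->]]].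
  by apply: comm => //; exact: DF.
- by rewrite divr_gt0.
exists [seq (f ^+ v * t)%g | v <- iota 0 m, t <- s]; split.
  by move=> /(congr1 size); rewrite size_allpairs size_iota /m mulSn; case: (s) s0.
move=> h hh phi b ri hb.
have b0 : 0 <= b := le_trans (normr_ge0 _) (hb 1%g).
rewrite size_allpairs size_iota !big_allpairs_dep natrM.
set n : R := (size s)%:R; have n0 : 0 <= n by exact: ler0n.
have [hf|hhF] : h = f \/ h \in F ++ F'.
  by move: hh; rewrite cat_cons inE => /orP[/eqP|]; [left|right].
- subst h; pose S v := \sum_(t <- s) phi (f ^+ v * t)%g.
  have SE v : \sum_(t <- s) phi (f * (f ^+ v * t))%g = S v.+1.
    by rewrite /S; apply: eq_bigr => t _; rewrite mulgA -expgS.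
  under eq_bigr do rewrite SE.
  rewrite -sumrB -/(index_iota 0 m).
  have -> : \sum_(v <- iota 0 m) (S v.+1 - \sum_(t <- s) phi (f ^+ v * t)%g) = S m - S 0%N.
    by rewrite -[m in LHS]subn0 -(@telescope_sumr _ 0 m S).
  have SB v : `|S v| <= b * n by apply: sum_norm_le => t _; exact: hb.
  apply: le_trans (ler_normB _ _) _; apply: le_trans (lerD (SB _) (SB _)) _.
  have e1 : eps * b * (m%:R * n) = b * n * (eps * m%:R) by ring.
  rewrite e1; apply: (@le_trans _ _ (b * n * 2)); last by rewrite ler_wpM2l// mulr_ge0.
  by rewrite mulr_natr mulr2n.
- rewrite -sumrB.
  have hm' : eps * b * (m%:R * n) = (eps * b * n) * (size (iota 0 m))%:R by rewrite size_iota; ring.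
  rewrite hm'; apply: sum_norm_le => v hv.
  set c := (h^-1 * (f ^+ v)^-1 * h * f ^+ v)%g.
  have e t : (h * (f ^+ v * t) = f ^+ v * h * (c * t))%g.
    by rewrite /c !mulgA -[(f ^+ v * h * h^-1)%g]mulgA mulgV mulg1 mulgV mul1g.
  under eq_bigr do rewrite e.
  have hc : c \in F ++ (F' ++ C).
    by rewrite !mem_cat; apply/orP; right; apply/orP; right; apply/allpairsP; exists (h, v).
  have hh' : h \in F ++ (F' ++ C) by rewrite catA mem_cat hhF.
  have i1 := hs _ hc _ b (right_inv_left (f ^+ v * h)%g ri) (fun g => hb _).
  have i2 := hs _ hh' _ b (right_inv_left (f ^+ v)%g ri) (fun g => hb _).
  have e2 : \sum_(t <- s) phi (f ^+ v * (h * t))%g = \sum_(t <- s) phi (f ^+ v * h * t)%g.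
    by apply: eq_bigr => t _; rewrite mulgA.
  rewrite e2 in i2.
  apply: le_trans (ler_distD _ _ _) _.
  apply: le_trans (lerD i1 i2) _.
  rewrite -/n; have -> : eps / 2 * b * n + eps / 2 * b * n = eps * b * n by field.
  exact: lexx.
Qed.

Lemma folner_chain n (D : nat -> set G) : (forall i, subgrp (D i)) ->
  (forall i, D i.+1 `<=` D i) ->
  (forall i x y, D i x -> D i y -> D i.+1 (x^-1 * y^-1 * x * y)%g) ->
  D n `<=` N -> forall F, (forall h, h \in F -> D 0%N h) -> folner F.
Proof.
elim: n D => [|n IH] D sg sub comm DN F hF.
  by apply: folner_trivial => h /hF; exact: DN.
apply: (folner_commutators (sg 0%N) (sub 0%N) (comm 0%N)) => // F' hF'.
exact: (IH _ (fun i => sg i.+1) (fun i => sub i.+1) (fun i => comm i.+1) DN F' hF').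
Qed.

(** Induction from [H]: [T] is a transversal whose cosets are permuted by left multiplication, and
    [f * k = rep (f * k) * c] with [c] in [H]. If [s] is almost invariant under these finitely many
    [c], the products of [T] with [s] are almost invariant under [f]. *)
Lemma folner_finite_index (H : set G) (L : seq G) : subgrp H ->
  (forall g, exists2 k, k \in L & H (k^-1 * g)%g) ->
  (forall F, (forall h, h \in F -> H h) -> folner F) -> forall F, folner F.
Proof.
move=> [H1 HM HV] hL base F eps e0.
pose rep g := nth 1%g L (find (fun k => `[< H (k^-1 * g)%g >]) L).
have repP g : H ((rep g)^-1 * g)%g.
  apply/asboolP; apply: (@nth_find _ 1%g (fun k => `[< H (k^-1 * g)%g >])).
  by have [k kL hk] := hL g; apply/hasP; exists k => //; exact/asboolP.
have repE g g' : H (g^-1 * g')%g -> rep g = rep g'.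
  move=> h; rewrite /rep; congr nth; apply: eq_find => k; apply/asboolP/asboolP => hk.
    by have := HM _ _ hk h; rewrite mulgA -[(_ * g * g^-1)%g]mulgA mulgV mulg1.
  have := HM _ _ hk (HV _ h).
  by rewrite invgM invgK mulgA -[(_ * g' * g'^-1)%g]mulgA mulgV mulg1.
have repK g : rep (rep g) = rep g by apply: repE.
have repL g : rep g \in L.
  rewrite mem_nth// -has_find; have [k kL hk] := hL g.
  by apply/hasP; exists k => //; exact/asboolP.
pose T := undup [seq rep k | k <- L].
have TP k : k \in T -> rep k = k by rewrite mem_undup => /mapP[l _ ->].
have repT g : rep g \in T.
  by rewrite mem_undup; apply/mapP; exists (rep g) => //; rewrite repK.
pose C := [seq ((rep (f * k))^-1 * (f * k))%g | f <- F, k <- T].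
have [|s [s0 hs]] := base C _ eps e0.
  by move=> h /allpairsP[[f k] [_ _ ->]]; exact: repP.
exists [seq (k * t)%g | k <- T, t <- s]; split.
  have := repT 1%g; case: (T) => // a l _ /(congr1 size).
  by rewrite size_allpairs /= mulSn; case: (s) s0.
move=> f hf phi b ri hb.
rewrite size_allpairs !big_allpairs_dep natrM.
have inj : {in T &, injective (fun k => rep (f * k)%g)}.
  move=> k k' kT k'T /= e; rewrite -(TP _ kT) -(TP _ k'T); apply: repE.
  have := HM _ _ (HV _ (repP (f * k)%g)) (repP (f * k')%g); rewrite -e.
  rewrite invgM invgK mulgA -[(_ * rep _ * _)%g]mulgA mulgV mulg1.
  by rewrite invgM -mulgA mulKg.
have pT : perm_eq [seq rep (f * k)%g | k <- T] T.
  have uT : uniq T by exact: undup_uniq.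
  have uT' : uniq [seq rep (f * k)%g | k <- T] by rewrite map_inj_in_uniq.
  have sT : {subset [seq rep (f * k)%g | k <- T] <= T} by move=> _ /mapP[k _ ->].
  have [|_ e] := uniq_min_size uT' sT; first by rewrite size_map.
  exact: uniq_perm.
have e2 : \sum_(k <- T) \sum_(t <- s) phi (k * t)%g =
    \sum_(k <- T) \sum_(t <- s) phi (rep (f * k) * t)%g.
  by rewrite -(perm_big _ pT)/= big_map.
rewrite e2 -sumrB.
have -> : eps * b * ((size T)%:R * (size s)%:R) = (eps * b * (size s)%:R) * (size T)%:R by ring.
apply: sum_norm_le => k kT.
set c := ((rep (f * k))^-1 * (f * k))%g.
have e t : (f * (k * t) = rep (f * k) * (c * t))%g.
  by rewrite /c !mulgA mulgV mul1g.
under eq_bigr do rewrite e.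
have hc : c \in C by apply/allpairsP; exists (f, k).
exact: hs _ hc _ b (right_inv_left _ ri) (fun g => hb _).
Qed.

(** Countability allows one sequence for all elements: the [n]th member handles the first [n] terms
    of the enumeration with error [1 / (n + 1)]. *)
Lemma folner_sequence (f : nat -> G) : (forall g, exists n, f n = g) ->
  (forall F, folner F) -> exists s : nat -> seq G, (forall n, s n <> [::]) /\
  forall h (eps : R), 0 < eps -> exists n0 : nat, forall n, (n0 <= n)%N -> almost_inv eps h (s n).
Proof.
move=> fs hF.
have : forall n, exists s : seq G, s <> [::] /\ forall h, h \in [seq f i | i <- iota 0 n] ->
    almost_inv n.+1%:R^-1 h s.
  by move=> n; apply: hF; rewrite invr_gt0 ltr0n.
move=> /choice[s hs]; exists s; split; first by move=> n; case: (hs n).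
move=> h eps e0; have [i <-] := fs h.
exists (maxn i.+1 (Num.truncn eps^-1)) => n; rewrite geq_max => /andP[hi hn].
have [_ /(_ (f i))] := hs n; move=> /(_ _)/almost_inv_le; apply.
  rewrite -[eps]invrK lef_pV2 ?posrE ?invr_gt0 ?ltr0n//.
  by rewrite ltW// -truncn_le_nat.
by apply: map_f; rewrite mem_iota add0n.
Qed.

End Reiter.

(** * From virtual solvability to an invariant mean on the quotient *)

Section DerivedSeries.
Variables (T : choiceType) (Gamma : set (T -> T)).
Hypothesis hG : is_group Gamma.
Let GM a b : Gamma a -> Gamma b -> Gamma (a \o b). Proof. by case: hG => _ h _; exact: h. Qed.
Let G1 : Gamma id. Proof. by case: hG. Qed.
Let GG := fun_group hG.

Lemma derived_subgroup_sub H : is_subgroup Gamma H -> derived_subgroup Gamma H `<=` H.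
Proof.
move=> [HG H1 HM HV] g; apply; split => //.
move=> c [a [b [a' [b' [[Ha Hb] [Ga' Gb'] aa bb ->]]]]].
have Ha' := HV _ _ Ha Ga' aa; have Hb' := HV _ _ Hb Gb' bb.
by apply: (HM) => //; apply: (HM) => //; exact: HM.
Qed.

Lemma derived_subgroup_subgroup H : is_subgroup Gamma H -> is_subgroup Gamma (derived_subgroup Gamma H).
Proof.
move=> sH; have [HG _ _ _] := sH; split.
- exact: subset_trans (derived_subgroup_sub sH) HG.
- by move=> K [[]].
- by move=> a b ha hb K hK; have [[_ _ KM _] _] := hK; apply: KM; [exact: ha|exact: hb].
- move=> a a' ha Ga' aa K hK; have [[_ _ _ KV] _] := hK.
  by apply: (KV a) => //; exact: ha.
Qed.

Lemma derived_series_subgroup H n : is_subgroup Gamma H -> is_subgroup Gamma (derived_series Gamma H n).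
Proof. by move=> sH; elim: n => [//|n IH]; exact: derived_subgroup_subgroup. Qed.

Lemma subgrp_val K : is_subgroup Gamma K -> subgrp [set g : GG | K (sval g)].
Proof.
move=> [_ K1 KM KV]; split => //=.
- by move=> x y; exact: KM.
- move=> x hx; have [Gi e _] := ginvP hG (svalP x).
  exact: KV hx Gi e.
Qed.

Lemma fun_group_eq (a b : GG) : sval a = sval b -> a = b.
Proof. by move: a b => [a Ga] [b Gb] /= e; subst b; congr exist; exact: Prop_irrelevance. Qed.

Lemma fun_group_enum : countable Gamma -> exists f : nat -> GG, forall g, exists n, f n = g.
Proof.
move=> /countable_injP[e einj].
exists (fun n => xget 1%g [set g : GG | e (sval g) = n]) => g; exists (e (sval g)).
have : exists g' : GG, e (sval g') = e (sval g) by exists g.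
move=> /(@xgetPex _ (1%g : GG) [set g' : GG | e (sval g') = e (sval g)]) /= h.
by apply: fun_group_eq; apply: einj; rewrite ?inE//; exact: svalP.
Qed.

Variable (R : realType).
Lemma virtually_solvable_folner N : quotient_virtually_solvable Gamma N ->
  forall F : seq GG, folner R [set g : GG | N (sval g)] F.
Proof.
move=> [H [sH NH [F [finF FG hF]] [n hn]]].
have /finite_seqP[L0 L0F] := finF.
pose L := [seq xget (1%g : GG) [set g : GG | sval g = k] | k <- L0].
apply: (folner_finite_index (L := L) (subgrp_val sH)).
  move=> g; have [k Fk [h Hh e]] := hF _ (svalP g).
  exists (xget (1%g : GG) [set g : GG | sval g = k]).
    by apply: map_f; move: Fk; rewrite L0F.
  have : exists g' : GG, sval g' = k by exists (fun_elt hG (FG _ Fk)).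
  move=> /(@xgetPex _ (1%g : GG) [set g' : GG | sval g' = k]) /= hk.
  rewrite hk e.
  have [_ _ e2] := ginvP hG (FG _ Fk).
  by rewrite compA e2.
apply: (@folner_chain R GG [set g : GG | N (sval g)] n
  (fun i => [set g : GG | derived_series Gamma H i (sval g)])).
- by move=> i; apply: subgrp_val; exact: derived_series_subgroup.
- by move=> i g /= hg; apply: derived_subgroup_sub hg; exact: derived_series_subgroup.
- move=> i x y /= hx hy K [sK hK]; apply: hK.
  have [Gx e1 _] := ginvP hG (svalP x); have [Gy e2 _] := ginvP hG (svalP y).
  by exists (sval x), (sval y), (ginv Gamma (sval x)), (ginv Gamma (sval y)).
- by move=> g /hn.
Qed.

Lemma folner_amenable N (s : nat -> seq GG) : (forall n, s n <> [::]) ->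
  (forall h (eps : R), 0 < eps -> exists n0 : nat, forall n, (n0 <= n)%N ->
     almost_inv [set g : GG | N (sval g)] eps h (s n)) ->
  (forall e, N e -> Gamma e) ->
  quotient_amenable R Gamma N.
Proof.
move=> s0 hs NG B.
have [U UU hU] := nat_ultrafilter.
pose avg (phi : (T -> T) -> R) n : R := (size (s n))%:R^-1 * \sum_(g <- s n) phi (sval g).
have sz n : 0 < (size (s n))%:R :> R.
  by rewrite ltr0n lt0n; apply/negP => /eqP/size0nil; exact: s0.
have avg_le phi (b : R) n : (forall g, Gamma g -> `|phi g| <= b) -> `|avg phi n| <= b.
  move=> hb; rewrite normrM normfV (gtr0_norm (sz n)).
  rewrite mulrC ler_pdivrMr//.
  by apply: sum_norm_le => g _; apply: hb; exact: svalP.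
have bavg phi : B phi -> bounded_family (avg phi).
  by move=> [[b hb] _]; exists b => n; exact: avg_le.
have Bshift h phi : Gamma h -> B phi -> B (fun g => phi (h \o g)).
  move=> Gh [[b hb] ri]; split; first by exists b => g Gg; apply: hb; exact: GM.
  by move=> g e Gg Ne; rewrite compA; apply: ri => //; exact: GM.
exists (fun phi => ulim U (avg phi)); split.
- move=> a phi psi Bphi Bpsi.
  rewrite -ulimZ; [|exact: bavg]; rewrite -ulimD; [|by have [M hM] := bavg _ Bphi;
    exists (`|a| * M) => n; rewrite normrM ler_wpM2l|exact: bavg].
  congr ulim; apply/funext => n; rewrite /avg big_split/= -mulr_sumr mulrDr.
  by rewrite mulrCA.
- move=> phi Bphi pos; apply: ulim_ge0; first exact: bavg.
  move=> n; apply: mulr_ge0; first by rewrite invr_ge0 ltW// sz.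
  by apply: sumr_ge0 => g _; apply: pos; exact: svalP.
- transitivity (ulim U (fun=> 1 : R)); last exact: ulim_cst.
  congr ulim; apply/funext => n.
  by rewrite /avg big_const_seq count_predT iter_addr_0 mulVf// gt_eqF.
- move=> h phi Gh Bphi; have B2 := Bshift _ _ Gh Bphi.
  have bN : bounded_family (fun n => -1 * avg phi n).
    by have [b hb] := bavg _ Bphi; exists b => n; rewrite mulN1r normrN.
  apply/eqP; rewrite -subr_eq0 -mulN1r -ulimZ; last exact: bavg.
  rewrite -ulimD//; last exact: bavg.
  apply/eqP; apply: ulim_unique => e e0; apply: hU.
  have [[b hb] ri] := Bphi.
  have b1 : 0 < `|b| + 1 by rewrite ltr_pwDr.
  have [n0 hn0] := hs (fun_elt hG Gh) (e / (2 * (`|b| + 1))) (divr_gt0 e0 (mulr_gt0 (ltr0Sn _ _) b1)).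
  exists n0 => // n /= hn; rewrite subr0 mulN1r /avg -mulrBr normrM normfV (gtr0_norm (sz n)).
  rewrite mulrC ltr_pdivrMr//.
  have := hn0 n hn (fun g => phi (sval g)) (`|b| + 1) _ _.
  move=> /(_ _ _)/le_lt_trans; apply.
  + by move=> g k Nk; rewrite val_fgM; apply: ri => //; exact: svalP.
  + move=> g; apply: le_trans (hb _ (svalP g)) _.
    by apply: le_trans (ler_norm b) _; rewrite lerDl.
  + rewrite ltr_pM2r//; have -> : e / (2 * (`|b| + 1)) * (`|b| + 1) = e / 2.
      by field; rewrite gt_eqF.
    by rewrite ltr_pdivrMr// mulr_natr mulr2n ltrDl.
Qed.

End DerivedSeries.

(** Converts L1 almost invariance of a sum of indicators into L2 almost invariance of its square
    root. *)
Lemma sqrt_diff_sqr (R : realType) (a b : R) : 0 <= a -> 0 <= b ->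
  (Num.sqrt a - Num.sqrt b) ^+ 2 <= `|a - b|.
Proof.
move=> a0 b0; rewrite -{2}(sqr_sqrtr a0) -{2}(sqr_sqrtr b0) subr_sqr normrM.
rewrite -real_normK ?num_real// expr2 ler_wpM2l//.
have := sqrtr_ge0 a; have := sqrtr_ge0 b; move: (Num.sqrt a) (Num.sqrt b) => x y y0 x0.
by rewrite (ger0_norm (addr_ge0 x0 y0)) ler_norml; apply/andP; split; lra.
Qed.

(** The sum of indicators takes natural values, so the integral of its square root is at most that
    of the sum; this keeps the square root far from constant. *)
Lemma sqrt_nat_le (R : realType) (n : nat) : Num.sqrt (n%:R : R) <= n%:R.
Proof.
case: n => [|n]; first by rewrite sqrtr0.
rewrite -[leRHS]ger0_norm// -sqrtr_sqr ler_sqrt ?sqr_ge0// expr2 ler_peMl//.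
by rewrite ler1n.
Qed.

Lemma quarter_arith (R : realFieldType) (a t : R) : 0 <= a -> a <= t -> t <= 1 / 4 ->
  3 / 4 * t <= t - a ^+ 2.
Proof.
move=> a0 at_ t4; have : a * a <= t * (1 / 4) by rewrite ler_pM// (le_trans at_).
by rewrite -expr2; lra.
Qed.

(** * Almost invariant vectors *)

Section SmallSets.
Variables (R : realType) (X : topologicalZmodType).
Variable mu : {measure set (borel X) -> \bar R}.
Hypothesis cX : compact [set: X].
Hypothesis mu1 : mu setT = 1%E.
Hypothesis muinv : forall (x : X) (A : set (borel X)), measurable A ->
  mu ((fun y : X => x + y) @^-1` A) = mu A.
Local Notation Int := (Int mu).
Let fm := haar_fin mu1.
Variable chi : X -> R[i].
Hypothesis hc : is_character chi.

Definition nbhd_ker (n : nat) : set X := [set x | 1 - n.+1%:R^-1 < chRe chi x].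

Lemma nbhd_ker_open n : open (nbhd_ker n).
Proof.
have -> : nbhd_ker n = chRe chi @^-1` [set y | 1 - n.+1%:R^-1 < y] by [].
by apply: open_comp; [move=> x _; exact: cont_chRe|exact: open_gt].
Qed.

Lemma nbhd_ker_measurable n : measurable (nbhd_ker n : set (borel X)).
Proof. by apply: borel_open; exact: nbhd_ker_open. Qed.

Lemma nbhd_ker_gt0 n : 0 < Int (\1_(nbhd_ker n) : X -> R).
Proof.
have mB := nbhd_ker_measurable n; have bB := bmf_indic R mB.
have B0 : nbhd_ker n 0 by rewrite /nbhd_ker /= /chRe (ch0 hc) /= ltrBlDr ltrDl invr_gt0 ltr0n.
have [s hs] := translates_cover cX (nbhd_ker_open n) B0.
have bsh z : bmf (fun x => \1_(nbhd_ker n) (x - z) : R).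
  by apply: (@bmf_comp _ _ (\1_(nbhd_ker n)) (fun x => x - z)) => //; exact: continuous_addr.
have : Int (fun=> 1) <= Int (fun x => \sum_(z <- s) \1_(nbhd_ker n) (x - z)).
  apply: (Int_le fm); [exact: bmf_cst|exact: bmf_sum|move=> x].
  have [z zs hz] := hs x; rewrite (big_rem z)//= indicE mem_set// lerDl.
  by apply: sumr_ge0 => w _; rewrite indicE ler0n.
rewrite (Int_const mu1) (Int_sum fm)//.
under eq_bigr => z _ do rewrite (Int_shift mu1 muinv)//.
rewrite big_const_seq count_predT iter_addr_0 => h.
rewrite lt_neqAle Int_ge0 ?andbT; last by move=> x; rewrite indicE ler0n.
by apply/eqP => e; move: h; rewrite -e mul0rn ler10.
Qed.

Hypothesis cnX : connected [set: X].
Variable x1 : X.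
Hypothesis nontriv : chi x1 != 1.

Let K : set X := [set x | chi x = 1].

Lemma nbhd_ker_cap : \bigcap_n nbhd_ker n = K.
Proof.
apply/seteqP; split => [x hx|x hx n _]; last first.
  by rewrite /nbhd_ker /= /chRe hx /= ltrBlDr ltrDl invr_gt0 ltr0n.
apply: ch_eq1 => //; apply/eqP; rewrite eq_le; apply/andP; split.
  have := ch_sqr x hc; have := sqr_ge0 (chIm chi x).
  rewrite -(@expr_le1 _ 2) => [|//|]; last first.
    by have := hx 0%N I; rewrite /nbhd_ker /= invr1 subrr => /ltW.
  by move: (chRe chi x ^+ 2) (chIm chi x ^+ 2) => a b; lra.
apply/ler_addgt0Pl => e e0.
have := hx (Num.truncn e^-1) I; rewrite /nbhd_ker /= => h.
rewrite -lerBlDl; apply: le_trans (ltW h); rewrite lerD2l lerN2.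
rewrite -[leRHS]invrK lef_pV2 ?posrE ?invr_gt0 ?ltr0n//.
by rewrite ltW// -truncn_le_nat.
Qed.

Lemma ker_measurable : measurable (K : set (borel X)).
Proof.
rewrite -nbhd_ker_cap; apply: bigcap_measurable => // n _; exact: nbhd_ker_measurable.
Qed.

Lemma chMn x i : chi (x *+ i) = chi x ^+ i.
Proof. by elim: i => [|i IH]; rewrite ?mulr0n ?expr0 ?(ch0 hc)// mulrS exprS (chD _ _ hc) IH. Qed.

(* Some [x] has [chi x] of order larger than [k], and then the translates of the
   kernel by [x *+ i] with [i < k] are disjoint. *)
Lemma ker_null : Int (\1_K : X -> R) = 0.
Proof.
have mK := ker_measurable; have bK := bmf_indic R mK.
set t := Int _; have t0 : 0 <= t by apply: Int_ge0 => x; rewrite indicE ler0n.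
suff h k : t * k%:R <= 1.
  apply/eqP; rewrite eq_le t0 andbT leNgt; apply/negP => t1.
  have := h (Num.truncn t^-1).+1; apply/negP; rewrite -ltNge mulrC -ltr_pdivrMr// div1r.
  by rewrite -truncn_le_nat.
have [x hx] : exists x, chi x ^+ k`! != 1.
  apply: contrapT => /forallNP hn; move/negP: nontriv; apply; apply/eqP.
  apply: (@ch_torsion_free _ _ chi k`!) => //; first exact: fact_gt0.
  by move=> x; apply/eqP; have /negP := hn x; rewrite negbK.
have bsh z : bmf (fun y => \1_K (y + z) : R).
  by apply: (@bmf_comp _ _ (\1_K) (fun y => y + z)) => //; exact: continuous_addr.
have : Int (fun y => \sum_(i < k) \1_K (y + x *+ i)) <= Int (fun=> 1).
  apply: (Int_le fm); [by apply: bmf_sum => i; exact: bsh|exact: bmf_cst|move=> y].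
  have [[i hi]|hn] := pselect (exists i : 'I_k, K (y + x *+ i)); last first.
    rewrite big1// => i _; rewrite indicE memNset// => h; apply: hn; by exists i.
  rewrite (bigD1 i)//= indicE mem_set// big1 ?addr0// => j ji.
  rewrite indicE memNset// => hj.
  wlog ij : i j hi hj ji / (i < j)%N => [H|].
    case: (ltngtP i j) => [|h|/val_inj e]; first exact: H.
      by apply: (H j i) => //; rewrite eq_sym.
    by move: ji; rewrite e eqxx.
  move/negP: hx; apply.
  have e : chi x ^+ (j - i) = 1.
    have hi' : chi (y + x *+ i) = 1 := hi.
    have : chi (y + x *+ j) = 1 := hj.
    by rewrite -{1}(subnK (ltnW ij)) mulrnDr addrCA (chD _ _ hc) hi' mulr1 chMn.
  have d : (j - i %| k`!)%N.
    apply: dvdn_fact; rewrite subn_gt0 ij/=.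
    by apply: leq_trans (leq_subr _ _) _; exact: ltnW.
  by rewrite -(divnK d) mulnC exprM e expr1n.
rewrite (Int_const mu1) (Int_sum fm)//.
under eq_bigr => i _ do rewrite (Int_shift mu1 muinv)//.
by rewrite sumr_const card_ord mulr_natr.
Qed.

(** Continuity of the measure from above: the sets decrease to the kernel of [chi], which is
    null. *)
Lemma small_nbhd_ker e : 0 < e -> exists n, Int (\1_(nbhd_ker n) : X -> R) <= e.
Proof.
move=> e0; have mK := ker_measurable.
have : mu \o (nbhd_ker : nat -> set (borel X)) @ \oo --> mu (\bigcap_n nbhd_ker n).
  apply: nonincreasing_cvg_mu.
  - apply: le_lt_trans fm; apply: le_measure; rewrite ?inE//; exact: nbhd_ker_measurable.
  - exact: nbhd_ker_measurable.
  - by rewrite nbhd_ker_cap.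
  - move=> m n mn; apply/subsetPset => x; rewrite /nbhd_ker /=; apply: le_lt_trans.
    by rewrite lerD2l lerN2 lef_pV2 ?posrE ?ltr0n// ler_nat ltnS.
rewrite nbhd_ker_cap.
have fin A : measurable A -> mu A \is a fin_num.
  by move=> mA; rewrite ge0_fin_numE//; apply: le_lt_trans fm; apply: le_measure; rewrite ?inE.
have -> : mu K = (0 : R)%:E.
  by rewrite -(fineK (fin _ mK)) -Int_indic// ker_null.
move=> /fine_cvgP[_ /cvgrPdist_lt /(_ e e0)[n0 _ hn]].
exists n0; have := hn n0 (leqnn n0); rewrite /= sub0r normrN => h.
rewrite Int_indic; last exact: nbhd_ker_measurable.
exact: le_trans (ler_norm _) (ltW h).
Qed.

End SmallSets.

(** * Almost invariant unit vectors from almost invariant sequences *)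

Section Gap.
Variables (R : realType) (X : topologicalZmodType).
Variable mu : {measure set (borel X) -> \bar R}.
Hypothesis cX : compact [set: X].
Hypothesis mu1 : mu setT = 1%E.
Hypothesis muinv : forall (x : X) (A : set (borel X)), measurable A ->
  mu ((fun y : X => x + y) @^-1` A) = mu A.
Local Notation Int := (Int mu).
Let fm := haar_fin mu1.
Variables (G : groupType) (N : set G) (alpha : G -> X -> X).
Hypothesis alpha1 : forall x, alpha 1%g x = x.
Hypothesis alphaM : forall g h x, alpha (g * h)%g x = alpha g (alpha h x).
Hypothesis alpha_cont : forall g, continuous (alpha g).
Hypothesis alpha_int : forall g f, bmf f -> Int (fun x => f (alpha g x)) = Int f.

Section Orbit.
Variable B : set X.
Hypothesis mB : measurable (B : set (borel X)).
Hypothesis BN : forall e x, N e -> B (alpha e x) <-> B x.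
Variable s : seq G.
Hypothesis s0 : s <> [::].
Local Notation beta := (Int (\1_B : X -> R)).
Local Notation sigma := ((size s)%:R * beta).
Hypothesis beta0 : 0 < beta.
Hypothesis small : sigma <= 1 / 4.

Let bB : bmf (\1_B : X -> R) := bmf_indic R mB.

Lemma bmf_act g f : bmf f -> bmf (fun x => f (alpha g x) : R).
Proof. by move=> bf; apply: (@bmf_comp _ _ f (alpha g)) => //; exact: alpha_cont. Qed.

Definition orbit_sum (x : X) : R := \sum_(g <- s) \1_B (alpha g^-1 x).
Definition orbit_sqrt (x : X) : R := Num.sqrt (orbit_sum x).

Lemma orbit_sum_bmf : bmf orbit_sum.
Proof. by apply: bmf_sum => g; exact: bmf_act. Qed.

Lemma orbit_sum_ge0 x : 0 <= orbit_sum x.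
Proof. by apply: sumr_ge0 => g _; rewrite indicE ler0n. Qed.

Lemma orbit_sum_nat x : exists n : nat, orbit_sum x = n%:R.
Proof.
rewrite /orbit_sum; elim: s => [|g t [n e]]; first by exists 0%N; rewrite big_nil.
by rewrite big_cons e indicE; exists ((alpha g^-1 x \in B) + n)%N; rewrite natrD.
Qed.

Lemma Int_orbit_sum : Int orbit_sum = sigma.
Proof.
rewrite (Int_sum fm); last by move=> g; exact: bmf_act.
under eq_bigr => g _ do rewrite alpha_int//.
by rewrite big_const_seq count_predT iter_addr_0 mulr_natl.
Qed.

Lemma bmf_sqrt (f : X -> R) : bmf f -> bmf (fun x => Num.sqrt (f x)).
Proof.
move=> [mf [M hM]]; split.
  apply: (measurableT_comp _ mf); apply: continuous_measurable_fun; exact: sqrt_continuous.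
exists (Num.sqrt M) => x; rewrite ger0_norm ?sqrtr_ge0//.
by apply: ler_wsqrtr; apply: le_trans (hM x); exact: ler_norm.
Qed.

Lemma orbit_sqrt_bmf : bmf orbit_sqrt.
Proof. exact/bmf_sqrt/orbit_sum_bmf. Qed.

Lemma orbit_sqrt_sqr x : orbit_sqrt x ^+ 2 = orbit_sum x.
Proof. by rewrite sqr_sqrtr// orbit_sum_ge0. Qed.

Lemma bmf_norm (f : X -> R) : bmf f -> bmf (fun x => `|f x|).
Proof.
move=> [mf [M hM]]; split; last by exists M => x; rewrite normr_id.
exact: measurableT_comp.
Qed.

(* By duality with the sign of the difference, the L1 norm is a difference of two
   averages over [s] of the function [g |-> Int (psi * \1_(g B))], which is bounded
   by the measure of [B]. *)
Lemma orbit_sum_shift h : almost_inv N h.2 h.1^-1%g s ->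
  Int (fun x => `|orbit_sum (alpha h.1 x) - orbit_sum x|) <= h.2 * sigma.
Proof.
case: h => h eps /= hs.
pose w x := orbit_sum (alpha h x) - orbit_sum x.
have bw : bmf w by apply: bmfB; [apply: bmf_act|]; exact: orbit_sum_bmf.
pose A : set X := [set x | 0 < w x].
have mA : measurable (A : set (borel X)).
  have -> : A = w @^-1` `]0, +oo[ by apply/seteqP; split => x; rewrite /A /= in_itv/= andbT.
  by have [mw _] := bw; rewrite -[_ @^-1` _]setTI; exact: mw.
pose psi (x : X) : R := 2 * \1_A x - 1.
have bpsi : bmf psi by apply: bmfB; [apply: bmfZ; exact: bmf_indic|exact: bmf_cst].
have psi1 x : `|psi x| <= 1.
  rewrite /psi indicE; case: (_ \in _); rewrite ?mulr1 ?mulr0 ?sub0r ?normrN ?normr1//.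
  by rewrite (_ : 2 - 1 = 1) ?normr1//; ring.
have e1 x : `|w x| = psi x * w x.
  rewrite /psi indicE; have [hx|hx] := ltP 0 (w x).
    by rewrite mem_set// gtr0_norm// mulr1; ring.
  by rewrite memNset; [rewrite ler0_norm// mulr0; ring|rewrite /A /=; apply/negP; rewrite -leNgt].
pose Psi g := Int (fun x => psi x * \1_B (alpha g^-1 x)).
have bg g : bmf (fun x => psi x * \1_B (alpha g^-1 x)).
  by apply: bmfM => //; exact: bmf_act.
have -> : Int (fun x => `|w x|) = \sum_(g <- s) Psi (h^-1 * g)%g - \sum_(g <- s) Psi g.
  rewrite -!(Int_sum fm)//.
  rewrite -(IntB fm); [|exact: bmf_sum|exact: bmf_sum].
  congr Int; apply/funext => x; rewrite e1 -!mulr_sumr -mulrBr /w /orbit_sum.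
  congr (_ * (_ - _)); apply: eq_bigr => g _.
  by rewrite invgM invgK alphaM.
apply: le_trans (ler_norm _) _.
have -> : eps * sigma = eps * beta * (size s)%:R by ring.
apply: hs.
  move=> g e Ne; congr Int; apply/funext => x; congr (_ * _); rewrite !indicE; congr (_%:R).
  have E : alpha g^-1%g x = alpha e (alpha (g * e)^-1%g x).
    by rewrite -alphaM invgM mulgA mulgV mul1g.
  rewrite E; congr nat_of_bool; apply/idP/idP; rewrite !inE => hx; exact/(BN _ Ne).
move=> g; apply: le_trans (Int_norm fm (bg g)) _.
rewrite -(alpha_int g^-1%g bB); apply: (Int_le fm); [exact: bmf_norm|exact: bmf_act|].
move=> x; rewrite normrM indicE; case: (_ \in _); rewrite ?normr0 ?mulr0// normr1 mulr1.
exact: psi1.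
Qed.

Let a := Int orbit_sqrt.
Let V := sigma - a ^+ 2.

(** The mean [a] of the square root is at most [sigma], and [sigma <= 1 / 4] gives
    [a ^+ 2 <= sigma / 4]. *)
Lemma orbit_var_ge : 3 / 4 * sigma <= V.
Proof.
apply: quarter_arith => //; first by apply: Int_ge0 => x; exact: sqrtr_ge0.
rewrite -Int_orbit_sum; apply: (Int_le fm); [exact: orbit_sqrt_bmf|exact: orbit_sum_bmf|].
by move=> x; rewrite /orbit_sqrt; have [n ->] := orbit_sum_nat x; exact: sqrt_nat_le.
Qed.

Lemma sigma_gt0 : 0 < sigma.
Proof. by rewrite mulr_gt0// ltr0n lt0n; apply/negP => /eqP/size0nil; exact: s0. Qed.

Let V0 : 0 < V.
Proof. by apply: lt_le_trans orbit_var_ge; rewrite mulr_gt0// ?sigma_gt0//; lra. Qed.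

Definition gap_fun (x : X) : R := (Num.sqrt V)^-1 * (orbit_sqrt x - a).

Lemma gap_fun_bmf : bmf gap_fun.
Proof. by apply: bmfZ; apply: bmfB; [exact: orbit_sqrt_bmf|exact: bmf_cst]. Qed.

Lemma gap_fun_mean : Int gap_fun = 0.
Proof.
have b1 := orbit_sqrt_bmf; have b2 := @bmf_cst _ X a.
rewrite (IntZ fm); last exact: bmfB.
by rewrite (IntB fm)// (Int_const mu1) subrr mulr0.
Qed.

Lemma gap_fun_norm : Int (fun x => gap_fun x ^+ 2) = 1.
Proof.
have b1 := orbit_sqrt_bmf; have b2 := @bmf_cst _ X a.
have e x : gap_fun x ^+ 2 = V^-1 * (orbit_sum x - (2 * a * orbit_sqrt x - a ^+ 2)).
  rewrite /gap_fun exprMn exprVn sqr_sqrtr ?ltW// -orbit_sqrt_sqr; congr (_ * _); ring.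
under eq_fun do rewrite e.
have b3 : bmf (fun x => 2 * a * orbit_sqrt x) by exact: bmfZ.
have b4 := @bmf_cst _ X (a ^+ 2).
have b5 := orbit_sum_bmf.
rewrite (IntZ fm); last by apply: bmfB => //; exact: bmfB.
rewrite (IntB fm)//; last exact: bmfB.
rewrite (IntB fm)// (IntZ fm)// (Int_const mu1) Int_orbit_sum -/a.
have -> : sigma - (2 * a * a - a ^+ 2) = V by rewrite /V; ring.
by rewrite mulVf// gt_eqF.
Qed.

(** Before normalisation the squared distance is at most [eps * sigma]; division by the variance, at
    least [3 / 4 * sigma], gives the constant. *)
Lemma gap_fun_shift h eps : almost_inv N eps h^-1%g s ->
  Int (fun x => (gap_fun (alpha h x) - gap_fun x) ^+ 2) <= 4 / 3 * eps.
Proof.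
move=> hs; have b1 := orbit_sqrt_bmf; have b2 := bmf_act h b1.
have e x : (gap_fun (alpha h x) - gap_fun x) ^+ 2 =
    V^-1 * (orbit_sqrt (alpha h x) - orbit_sqrt x) ^+ 2.
  by rewrite /gap_fun -mulrBr exprMn exprVn sqr_sqrtr ?ltW//; congr (_ * _); ring.
under eq_fun do rewrite e.
have b3 := bmf_sqr (bmfB b2 b1).
rewrite (IntZ fm)//.
have h1 : Int (fun x => (orbit_sqrt (alpha h x) - orbit_sqrt x) ^+ 2) <= eps * sigma.
  apply: le_trans (orbit_sum_shift (h := (h, eps)) hs).
  apply: (Int_le fm) => //.
    by apply: bmf_norm; apply: bmfB; [apply: bmf_act|]; exact: orbit_sum_bmf.
  by move=> x; apply: sqrt_diff_sqr; exact: orbit_sum_ge0.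
rewrite mulrC ler_pdivrMr//.
have i0 : 0 <= Int (fun x => (orbit_sqrt (alpha h x) - orbit_sqrt x) ^+ 2).
  by apply: Int_ge0 => x; exact: sqr_ge0.
have eps0 : 0 <= eps.
  by have := le_trans i0 h1; rewrite pmulr_lge0// sigma_gt0.
apply: le_trans h1 _.
have := ler_wpM2l eps0 orbit_var_ge; set p := sigma; move: (V) => v; move: p => p.
have -> : eps * (3 / 4 * p) = 3 / 4 * (eps * p) by ring.
have -> : 4 / 3 * eps * v = 4 / 3 * (eps * v) by ring.
by lra.
Qed.

End Orbit.

Variable chi : X -> R[i].
Hypothesis hc : is_character chi.
Hypothesis chiN : forall e x, N e -> chi (alpha e x) = chi x.
Hypothesis cnX : connected [set: X].
Variable x1 : X.
Hypothesis nontriv : chi x1 != 1.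
Variable s : nat -> seq G.
Hypothesis s0 : forall n, s n <> [::].
Hypothesis hs : forall h (eps : R), 0 < eps -> exists n0 : nat, forall n, (n0 <= n)%N ->
  almost_inv N eps h (s n).

(** The action [alpha] is a parameter, so that the same group and the same sequences serve [Gamma]
    and its linear parts. The set [B n] is chosen small after [s n], to meet the bound [1 / 4]; the
    vectors are real. *)
Lemma folner_no_gap (P : set (X -> X)) : (forall k, P k -> exists g, k = alpha g) ->
  no_spectral_gap mu P.
Proof.
move=> hP.
have : forall n, exists k, (size (s n))%:R * Int (\1_(nbhd_ker chi k) : X -> R) <= 1 / 4.
  move=> n; have sz : 0 < (size (s n))%:R :> R.
    by rewrite ltr0n lt0n; apply/negP => /eqP/size0nil; exact: s0.
  have [|k hk] := @small_nbhd_ker _ _ mu mu1 muinv chi hc cnX x1 nontriv (1 / 4 / (size (s n))%:R).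
    by rewrite divr_gt0.
  by exists k; rewrite mulrC -ler_pdivlMr.
move=> /choice[k hk].
pose B n := nbhd_ker chi (k n).
have mB n : measurable (B n : set (borel X)) by exact: nbhd_ker_measurable.
have B0 n : 0 < Int (\1_(B n) : X -> R) by exact: (nbhd_ker_gt0 cX mu1 muinv hc).
have BN n e x : N e -> B n (alpha e x) <-> B n x.
  by move=> Ne; rewrite /B /nbhd_ker /= /chRe chiN.
pose u n : X -> R := gap_fun (B n) (s n).
have bu n : bmf (u n) by exact: gap_fun_bmf.
exists u, (fun _ _ => 0); split.
- by move=> n; split; [case: (bu n)|exact: measurable_cst].
- move=> n; under eq_integral do rewrite expr0n/= addr0.
  rewrite -/(EJ mu (fun x => (u n x ^+ 2)%R)) (EJ_bmf mu1); last exact: bmf_sqr.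
  by rewrite /u gap_fun_norm.
- move=> n; split; last by rewrite integral0.
  by rewrite -/(EJ mu (u n)) (EJ_bmf mu1)// /u gap_fun_mean.
- move=> g g' Pg Pg' _ _; have [h ->] := hP _ Pg'.
  have bd n : bmf (fun x => (u n (alpha h x) - u n x) ^+ 2).
    by apply: bmf_sqr; apply: bmfB => //; exact: bmf_act.
  have e n : (\int[mu]_x ((u n (alpha h x) - u n x) ^+ 2 + (0 - 0) ^+ 2)%:E)%E =
      (Int (fun x => (u n (alpha h x) - u n x) ^+ 2))%:E.
    under eq_integral do rewrite subrr expr0n/= addr0.
    by rewrite -(EJ_bmf mu1).
  under eq_fun do rewrite e.
  apply: cvg_EFin; first by near=> n.
  apply/cvgrPdist_lt => d d0.
  have [n0 hn0] := hs h^-1%g (divr_gt0 d0 (ltr0Sn R 1)).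
  exists n0 => // n /= hn; rewrite sub0r normrN ger0_norm; last by apply: Int_ge0 => x; exact: sqr_ge0.
  apply: le_lt_trans (gap_fun_shift (mB n) (BN n) (@s0 n) (B0 n) (hk n) (hn0 n hn)) _.
  by lra.
Unshelve. all: by end_near.
Qed.

End Gap.

(** * Linear parts, and the consequences of a virtually solvable quotient *)

Section LinearParts.
Variables (X : topologicalZmodType) (Gamma : set (X -> X)).
Hypothesis hG : is_group Gamma.
Hypothesis Gaff : Gamma `<=` @is_affine X.

Lemma p_a_aff (g : X -> X) : is_affine g -> is_affine (p_a g).
Proof.
move=> [x0 [th [ath ->]]]; rewrite p_a_affine//; exists 0, th; split => //.
by apply/funext => x; rewrite add0r.
Qed.

Lemma p_a_idem (g : X -> X) : is_affine g -> p_a (p_a g) = p_a g.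
Proof. by move=> ag; apply/funext => x; rewrite {1}/p_a p_a0 subr0. Qed.

Lemma linear_parts_group : is_group [set p_a g | g in Gamma].
Proof.
have [G1 GM GV] := hG; split.
- by exists id => //; rewrite p_a_id.
- move=> _ _ [a Ga <-] [b Gb <-]; exists (a \o b); first exact: GM.
  by rewrite p_a_comp//; exact: Gaff.
- move=> _ [a Ga <-]; have [a' Ga' [e1 e2]] := GV _ Ga; exists (p_a a'); first by exists a'.
  by rewrite -!p_a_comp ?e1 ?e2 ?p_a_id//; exact: Gaff.
Qed.

Lemma linear_parts_affine : [set p_a g | g in Gamma] `<=` @is_affine X.
Proof. by move=> _ [g Gg <-]; apply: p_a_aff; exact: Gaff. Qed.

End LinearParts.

Section VirtuallySolvableQuotient.
Variables (R : realType) (X : topologicalZmodType).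
Variable mu : {measure set (borel X) -> \bar R}.
Variable Gamma : set (X -> X).
Hypothesis hX : hausdorff_space X.
Hypothesis cX : compact [set: X].
Hypothesis cnX : connected [set: X].
Hypothesis fdX : finite_dimensional R X.
Hypothesis mu1 : mu setT = 1%E.
Hypothesis muinv : forall (x : X) (A : set (borel X)), measurable A ->
  mu ((fun y : X => x + y) @^-1` A) = mu A.
Hypothesis hG : is_group Gamma.
Hypothesis Gaff : Gamma `<=` @is_affine X.
Hypothesis cG : countable Gamma.
Variable Y : set X.
Hypothesis sY : subsolenoid Y.
Hypothesis YT : Y <> setT.
Hypothesis Yinv : forall g, Gamma g -> p_a g @` Y `<=` Y.
Local Notation N := (kernel_on_quotient Gamma Y).
Hypothesis vs : quotient_virtually_solvable Gamma N.
Let GG := fun_group hG.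
Let sg : is_subgroup_set Y. Proof. by case: sY. Qed.

Lemma separating_character : exists chi : X -> R[i],
  [/\ is_character chi, forall y, Y y -> chi y = 1 & exists x0, chi x0 != 1].
Proof.
have [x0 hx0] : exists x0, ~ Y x0.
  apply: contrapT => /forallNP h; apply: YT; apply/seteqP; split => // x _.
  by have := h x; rewrite notK.
have [_ cY _] := sY.
have [chi [h1 h2 h3]] := character_separation hX cX mu1 muinv sg cY hx0.
by exists chi; split => //; exists x0.
Qed.

Let seq_ex : exists s : nat -> seq GG, (forall n, s n <> [::]) /\
  forall h (eps : R), 0 < eps -> exists n0 : nat, forall n, (n0 <= n)%N ->
    almost_inv [set g : GG | N (sval g)] eps h (s n).
Proof.
have [f hf] := fun_group_enum hG cG.
by apply: (folner_sequence hf) => F; exact: virtually_solvable_folner.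
Qed.

Lemma virtually_solvable_amenable : quotient_amenable R Gamma N.
Proof.
have [s [s0 hs]] := seq_ex.
by apply: (folner_amenable s0 hs) => e [].
Qed.

Lemma affine_int (g : X -> X) (f : X -> R) : is_affine g -> bmf f -> Int mu (fun x => f (g x)) = Int mu f.
Proof.
move=> [x0 [th [ath ->]]] bf.
have [r [iota [M [iotaM iota_inj iota_span iota_comp]]]] := rank_embedding cnX fdX.
exact: (Int_affine hX cX mu1 muinv iotaM iota_inj x0 ath bf).
Qed.

Lemma affine_cont (g : X -> X) : is_affine g -> continuous g.
Proof. by move=> [x0 [th [ath ->]]]; exact: affine_continuous. Qed.

Lemma virtually_solvable_no_gap : no_spectral_gap mu Gamma.
Proof.
have [s [s0 hs]] := seq_ex; have [chi [hc chiY [x0 hx0]]] := separating_character.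
have aff (g : GG) : is_affine (sval g) by apply: Gaff; exact: svalP.
apply: (@folner_no_gap R X mu cX mu1 muinv GG [set g : GG | N (sval g)] (fun g => sval g)
  _ _ _ chi hc _ cnX x0 hx0 s s0 hs).
- by [].
- by move=> g; exact: affine_cont.
- by move=> g f; exact: affine_int.
- move=> e x [Ge he]; have := chiY _ (he x).
  by rewrite chB// => /divr1_eq.
- by move=> k Gk; exists (fun_elt hG Gk).
Qed.

(** If an affine map is trivial on X/Y, so is its linear part; the sequences built for [Gamma]
    modulo the kernel therefore apply to the linear action as they stand. *)
Lemma virtually_solvable_no_gap_linear : no_spectral_gap mu [set p_a g | g in Gamma].
Proof.
have [s [s0 hs]] := seq_ex; have [chi [hc chiY [x0 hx0]]] := separating_character.
have aff (g : GG) : is_affine (p_a (sval g)) by apply: p_a_aff; apply: Gaff; exact: svalP.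
apply: (@folner_no_gap R X mu cX mu1 muinv GG [set g : GG | N (sval g)] (fun g => p_a (sval g))
  _ _ _ chi hc _ cnX x0 hx0 s s0 hs).
- move=> g h x; rewrite val_fgM p_a_comp//; apply: Gaff; exact: svalP.
- by move=> g; exact: affine_cont.
- by move=> g f; exact: affine_int.
- by move=> e x Ne; exact: (character_kernel sg hc chiY x Ne).
- by move=> _ [k Gk <-]; exists (fun_elt hG Gk).
Qed.

End VirtuallySolvableQuotient.

Theorem theorem1 (R : realType) (X : topologicalZmodType)
    (mu : {measure set (borel X) -> \bar R})
    (Gamma : set (X -> X)) :
  solenoid R X ->
  (* mu is the normalized Haar measure of X *)
  mu setT = 1%E ->
  (forall (x : X) (A : set (borel X)), measurable A ->
     mu ((fun y : X => x + y) @^-1` A) = mu A) ->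
  (* Gamma is a countable subgroup of Aff(X) *)
  countable Gamma -> is_group Gamma -> Gamma `<=` (@is_affine X) ->
  let pG := [set p_a g | g in Gamma] in
  let iii := exists Y : set X,
      [/\ subsolenoid Y, Y <> setT,
          (forall g, Gamma g -> p_a g @` Y `<=` Y) &
          quotient_amenable R Gamma (kernel_on_quotient Gamma Y)] in
  let iv := exists Y : set X,
      [/\ subsolenoid Y, Y <> setT,
          (forall g, Gamma g -> p_a g @` Y `<=` Y) &
          quotient_virtually_solvable Gamma (kernel_on_quotient Gamma Y)] in
  [/\ (no_spectral_gap mu Gamma <-> no_spectral_gap mu pG),
      (no_spectral_gap mu pG <-> iii) &
      (iii <-> iv)].
Proof.
move=> [hX cX cnX fdX] mu1 muinv cG hG Gaff pG iii iv.
have [r [iota [M [iotaM iota_inj iota_span iota_comp]]]] := rank_embedding cnX fdX.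
pose mean := exists m : set 'rV[rat]_r -> R, [/\ is_mean m, m [set 0] = 0 &
  forall h, Gamma h -> forall E, m ((fun w => w *m M (p_a h)) @^-1` E) = m E].
have i_mean : no_spectral_gap mu Gamma -> mean.
  move=> [u [v [muv n1 m0 ai]]].
  exact: (almost_invariant_mean hX cX mu1 muinv iotaM iota_inj iota_span iota_comp
    hG Gaff muv n1 m0 ai).
have ii_mean : no_spectral_gap mu pG -> mean.
  move=> [u [v [muv n1 m0 ai]]].
  have [m [h1 h2 h3]] := almost_invariant_mean hX cX mu1 muinv iotaM iota_inj iota_span iota_comp
    (linear_parts_group hG Gaff) (linear_parts_affine Gaff) muv n1 m0 ai.
  (* [p_a] is idempotent, so invariance for the group of linear parts is the invariance asked for
     [Gamma]. *)
  exists m; split => // h Gh E; rewrite -(p_a_idem (Gaff _ Gh)).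
  by apply: h3; exists h.
have iii_mean : iii -> mean.
  move=> [Y [sY YT Yinv am]].
  have [chi [hc chiY [x0 hx0]]] := separating_character hX cX mu1 muinv sY YT.
  have [sg _ _] := sY.
  exact: (amenable_quotient_mean hG Gaff iotaM iota_inj iota_comp sg Yinv hc chiY hx0 am).
have mean_iv : mean -> iv.
  move=> [m [h1 h2 h3]].
  exact: (mean_virtually_solvable hG Gaff iotaM iota_inj iota_span iota_comp cnX h1 h2 h3).
have iv_i : iv -> no_spectral_gap mu Gamma.
  by move=> [Y [sY YT Yinv vs]]; exact: (virtually_solvable_no_gap hX cX cnX fdX mu1 muinv hG Gaff cG sY).
have iv_ii : iv -> no_spectral_gap mu pG.
  by move=> [Y [sY YT Yinv vs]]; exact: (virtually_solvable_no_gap_linear hX cX cnX fdX mu1 muinv hG Gaff cG sY).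
have iv_iii : iv -> iii.
  by move=> [Y [sY YT Yinv vs]]; exists Y; split => //; exact: (virtually_solvable_amenable R hG).
split; split.
- by move=> /i_mean/mean_iv/iv_ii.
- by move=> /ii_mean/mean_iv/iv_i.
- by move=> /ii_mean/mean_iv/iv_iii.
- by move=> /iii_mean/mean_iv/iv_ii.
- by move=> /iii_mean/mean_iv.
- exact: iv_iii.
Qed.
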